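(* Write $m=\prod_{i=1}^sP_i$, where $P_i=p_i^{\nu_i}$ with distinct primes $p_i$ and exponents $\nu_i\ge1$. Let $\Phi^{0,\rm III}_{2,m}$ be an element of the class $\mathcal C_m$ (defined in the context) having optimal growth and with all Fourier coefficients of discriminant $\Delta=0$ equal to zero. Then for any $\varepsilon_i\in\{\pm1\}$ with $\varepsilon_1\cdots\varepsilon_s=1$ and any $r$ with $r^2\equiv1\pmod{4m}$ we have $$C\Bigl(\Phi^{0,\rm III}_{2,m}\,\Big|\,\prod_{i=1}^s(1+\varepsilon_iW_{P_i});\,-1,\,r\Bigr)=\frac{\pm1}{12}\prod_{i=1}^s\begin{cases} p_i+\varepsilon_i & \text{if }\nu_i=1, \\ {p_i}^{\nu_i}-{p_i}^{\nu_i-2} & \text{if }\nu_i\ge2, \end{cases}$$ where the sign is the product of the $\varepsilon_i$ over all $i$ for which $r\equiv-1\pmod{2P_i}$. In particular, for $M>1$ with $\mu(M)=1$ and for the functions $\mathcal Q_M=\frac12\Phi_{2,M}\,|\,\prod_{p\mid M}(1-W_p)$ (with $\Phi_{2,M}\in\Phi^{\rm stand}_{2,M}+\widetilde J_{2,M}$), chosen to have optimal growth, the Fourier coefficients with non-positive discriminant are given by $$C(\mathcal Q_M;\Delta,r)=\begin{cases} 0 & \text{if }\Delta=0, \\ \pm\dfrac{\phi(M)}{24} & \text{if }\Delta=-1, \end{cases}$$ where $\phi$ is Euler's totient function and in the second line $r^2\equiv1\pmod{4M}$ and the sign is $\mu\bigl(\gcd(\tfrac{r+1}2,M)\bigr)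$.
   Context: Notation: $\tau\in\mathbb H$, $z\in\mathbb C$, $q=e^{2\pi i\tau}$, $y=e^{2\pi iz}$; $\mu$ is the Möbius function. Elliptic and Jacobi forms. A weakly holomorphic elliptic form of index $m\ge1$ is a holomorphic function $\varphi$ on $\mathbb H\times\mathbb C$ with $\varphi(\tau,z+\lambda\tau+\mu)=e^{-2\pi im(\lambda^2\tau+2\lambda z)}\varphi(\tau,z)$ for all $\lambda,\mu\in\mathbb Z$ and with a Fourier expansion $\sum_{n,r\in\mathbb Z,\ n\ge n_0}c(n,r)q^ny^r$. Then $c(n,r)=C(\varphi;4mn-r^2,r)$, where $C(\varphi;\Delta,r)$ (defined for $\Delta\equiv-r^2\bmod4m$) depends only on $\Delta$ (the discriminant) and on $r$ modulo $2m$. It is weak if $c(n,r)=0$ for $n<0$, and has optimal growth if $C(\varphi;\Delta,r)=0$ for all $\Delta<-1$. $\widetilde J_{2,m}$ is the space of weak Jacobi forms of weight 2: weak elliptic forms of index $m$ that also satisfy $\varphi\bigl(\frac{a\tau+b}{c\tau+d},\frac z{c\tau+d}\bigr)=(c\tau+d)^2e^{2\pi imcz^2/(c\tau+d)}\varphi(\tau,z)$ for all $\begin{pmatrix} a & b \\ c & d \end{pmatrix}\in SL(2,\mathbb Z)$. Involutions: for $m=m_1m_2$ with $(m_1,m_2)=1$, $W_{m_1}$ acts on weakly holomorphic elliptic forms of index $m$ by $C(\varphi|W_{m_1};\Delta,\ell)=C(\varphi;\Delta,\ell^* )$, where $\ell^*\equiv-\ell\pmod{2m_1}$ and $\ell^*\equiv\ell\pmod{2m_2}$.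 The functions $\Phi$. Let $A(\tau,z)=(y-2+y^{-1})\prod_{n\ge1}\frac{(1-q^ny)^2(1-q^ny^{-1})^2}{(1-q^n)^4}$ and $B=-\frac3{\pi^2}\wp A$, with $\wp(\tau,z)$ the Weierstrass function of the lattice $\mathbb Z\tau+\mathbb Z$. Put $$\mathcal A_{2,m}(\tau,z)=\sum_{s\in\mathbb Z}\frac{q^{ms^2+s}y^{2ms+1}}{(1-q^sy)^2},\qquad \Phi^{\rm stand}_{2,m}=\frac{B^{m+1}}{12^{m+1}A}-\mathcal A_{2,m},$$ which extends to a weak elliptic form of index $m$, and $$\mathcal C_m=\Bigl\{\sum_{d\ge1,\ d^2\mid m}\mu(d)\,\Phi^{\rm stand}_{2,m/d^2}(\tau,dz)+\psi(\tau,z)\ :\ \psi\in\widetilde J_{2,m}\Bigr\}.$$ (Elements of $\mathcal C_m$ of optimal growth with vanishing $\Delta=0$ coefficients exist.) *)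

(* Defs.v *)
From mathcomp Require Import all_boot all_order all_algebra.
From mathcomp Require Import complex.
From mathcomp Require Import all_classical all_reals all_analysis.
From mathcomp.analysis.showcase Require Import summability.

Set Implicit Arguments.
Unset Strict Implicit.
Unset Printing Implicit Defensive.

Import Order.TTheory GRing.Theory Num.Theory.
Import numFieldNormedType.Exports.

Local Open Scope classical_set_scope.
Local Open Scope ring_scope.

(* The complex numbers R[i] are viewed as an abstract numClosedFieldType so that
   their topology is the one of a normed space over themselves: in particular
   [differentiable] below means complex differentiable (the concrete type R[i]
   carries a left module structure over R instead). *)
Definition cplx (R : realType) : numClosedFieldType := R[i].

Definition mobius (n : nat) : int :=
  if all (fun p => logn p n == 1%N) (primes n) then (-1) ^+ size (primes n)
  else 0.

Section JacobiForms.
Variable R : realType.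
Local Notation C := (cplx R).
Implicit Types (phi : C -> C -> C) (tau z : C).

Definition cexp (z : C) : C :=
  Complex (expR (complex.Re z) * cos (complex.Im z))
          (expR (complex.Re z) * sin (complex.Im z)).

Definition cpi : C := Complex pi 0.

Definition ee (z : C) : C := cexp (2 * cpi * 'i * z).

(* A form is a function C -> C -> C of which only the values at tau in the
   upper half-plane matter. *)
Definition upper_half_plane : set C := [set tau | 0 < 'Im tau].

Definition holomorphic2 phi : Prop :=
  forall tau z, upper_half_plane tau ->
    differentiable (fun w : C * C => phi w.1 w.2) (tau, z).

Definition elliptic_law (m : nat) phi : Prop :=
  forall tau z (lam mu : int), upper_half_plane tau ->
    phi tau (z + lam%:~R * tau + mu%:~R) =
    ee (- (m%:R * (lam%:~R ^+ 2 * tau + 2 * lam%:~R * z))) * phi tau z.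

(* [c] is the family of Fourier coefficients c(n, r), (n, r) : int * int; the
   double series converges unconditionally, i.e. along the filter [totally] of
   finite sets of indices. *)
Definition fourier_expansion phi (c : int * int -> C) : Prop :=
  (exists n0 : int, forall n r : int, n < n0 -> c (n, r) = 0) /\
  (forall tau z, upper_half_plane tau ->
     partial_sum (fun nr : int * int => c nr * ee tau ^ nr.1 * ee z ^ nr.2)
       @ totally --> phi tau z).

Definition wh_elliptic_form (m : nat) phi : Prop :=
  [/\ (0 < m)%N, holomorphic2 phi, elliptic_law m phi
    & exists c, fourier_expansion phi c].

(* Fourier coefficients are unique; the zero family is used as a default value
   when there is no Fourier expansion. *)
Definition fourier_coef phi : int * int -> C :=
  xget (fun=> 0) [set c | fourier_expansion phi c].

Definition admissible (m : nat) (Delta r : int) : Prop :=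
  (Delta = - r ^+ 2 %[mod (4 * m)%:Z])%Z.

(* C(phi; Delta, r) = c(n, r) where 4mn - r^2 = Delta; only meaningful for
   [admissible m Delta r]. *)
Definition disc_coef (m : nat) phi (Delta r : int) : C :=
  fourier_coef phi (((Delta + r ^+ 2) %/ (4 * m)%:Z)%Z, r).

Definition weak_elliptic_form (m : nat) phi : Prop :=
  wh_elliptic_form m phi /\
  forall n r : int, n < 0 -> fourier_coef phi (n, r) = 0.

Definition optimal_growth (m : nat) phi : Prop :=
  forall Delta r : int, admissible m Delta r -> Delta < -1 ->
    disc_coef m phi Delta r = 0.

Definition modular_law (k m : nat) phi : Prop :=
  forall (a b c d : int) tau z, a * d - b * c = 1 -> upper_half_plane tau ->
    phi ((a%:~R * tau + b%:~R) / (c%:~R * tau + d%:~R))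
        (z / (c%:~R * tau + d%:~R)) =
    (c%:~R * tau + d%:~R) ^+ k *
    ee (m%:R * c%:~R * z ^+ 2 / (c%:~R * tau + d%:~R)) * phi tau z.

Definition weak_jacobi_form (k m : nat) phi : Prop :=
  weak_elliptic_form m phi /\ modular_law k m phi.

(* For m = m1 * m2 with m1, m2 coprime, an integer r* with r* = - r mod 2 m1
   and r* = r mod 2 m2; it is unique modulo 2 m. *)
Definition star (m1 m2 : nat) (r : int) : int :=
  xget 0 [set s : int | (s = - r %[mod (2 * m1)%:Z])%Z /\
                        (s = r %[mod (2 * m2)%:Z])%Z].

(* phi | W_{m1} in index m, for m1 an exact divisor of m: the function whose
   Fourier coefficient c(n, r) is C(phi; 4mn - r^2, r* ). *)
Definition involW (m m1 : nat) phi : C -> C -> C := fun tau z =>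
  summability.sum (fun nr : int * int =>
    disc_coef m phi ((4 * m)%:Z * nr.1 - nr.2 ^+ 2) (star m1 (m %/ m1) nr.2)
    * ee tau ^ nr.1 * ee z ^ nr.2 : C).

(* phi | (1 + eps W_{m1}) *)
Definition one_plus_W (m m1 : nat) (eps : int) phi : C -> C -> C :=
  fun tau z => phi tau z + eps%:~R * involW m m1 phi tau z.

Definition formA (tau z : C) : C :=
  let q := ee tau in let y := ee z in
  (y - 2 + y^-1) *
  lim ((\prod_(1 <= n < N.+1)
         ((1 - q ^+ n * y) ^+ 2 * (1 - q ^+ n * y^-1) ^+ 2 / (1 - q ^+ n) ^+ 4))
       @[N --> \oo]).

Definition wp (tau z : C) : C :=
  (z ^+ 2)^-1 +
  summability.sum (fun ab : int * int =>
    if ab == (0, 0) then 0 : C else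
    let w := ab.1%:~R * tau + ab.2%:~R in ((z - w) ^+ 2)^-1 - (w ^+ 2)^-1).

Definition formB (tau z : C) : C := - (3 / cpi ^+ 2) * wp tau z * formA tau z.

Definition appell_lerch (m : nat) (tau z : C) : C :=
  let q := ee tau in let y := ee z in
  summability.sum (fun s : int =>
    q ^ (m%:Z * s ^+ 2 + s) * y ^ (2 * m%:Z * s + 1) / (1 - q ^ s * y) ^+ 2 : C).

(* The defining formula makes sense for z outside Z tau + Z, where the
   singularities are removable: the limit over w --> z, w != z, is the formula
   itself off the lattice and its extension on it. *)
Definition phi_stand (m : nat) (tau z : C) : C :=
  lim ((formB tau w ^+ m.+1 / (12 ^+ m.+1 * formA tau w) - appell_lerch m tau w)
       @[w --> z^']).

Definition classC (m : nat) phi : Prop :=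
  exists psi, weak_jacobi_form 2 m psi /\
    forall tau z, upper_half_plane tau ->
      phi tau z =
      \sum_(1 <= d < m.+1 | (d ^ 2 %| m)%N)
         (mobius d)%:~R * phi_stand (m %/ d ^ 2) tau (d%:R * z)
      + psi tau z.

Definition class_stand (m : nat) phi : Prop :=
  exists psi, weak_jacobi_form 2 m psi /\
    forall tau z, upper_half_plane tau ->
      phi tau z = phi_stand m tau z + psi tau z.

(* phi | prod_i (1 + eps_i W_{P_i}), the (commuting) factors being applied in
   increasing order of i. *)
Definition prod_one_plus_W (m s : nat) (P : 'I_s -> nat) (eps : 'I_s -> int)
    phi : C -> C -> C :=
  foldl (fun f i => one_plus_W m (P i) (eps i) f) phi (enum 'I_s).

(* Q_M = 1/2 Phi | prod_{p | M} (1 - W_p) *)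
Definition formQ (M : nat) phi : C -> C -> C := fun tau z =>
  2^-1 * foldl (fun f p => one_plus_W M p (-1) f) phi (primes M) tau z.

End JacobiForms.

(* Main.v *)
Require Import Defs.
From mathcomp Require Import all_boot all_order all_algebra.
From mathcomp Require Import complex finmap.
From mathcomp Require Import all_classical all_reals all_analysis.
From mathcomp.analysis.showcase Require Import summability.
From mathcomp Require Import ring lra zify.

(** Write c for the coefficients of an element Phi of the class, and let F be the
coefficients of its image under the product of the 1 + eps_i W_{P_i}, of which
F is an eigenvector: W_{P_i} F = eps_i F.  Since W_n only permutes the residues
r mod 2m, F vanishes for Delta < -1 and for Delta = 0, its values at Delta = -1
are all equal to F(0,1) up to the stated sign, and the constant term at z = 0,
a0(F) = sum_r F(0,r), is 2 F(0,1).

On the other hand W_n has an analytic description as an average of translates of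
the function by n-torsion points.  For a weak Jacobi form of weight 2 the value
f(t) of phi | W_n at z = 0 satisfies f(-1/t) = t^2 f(t), and for the standard
form Phi_m there is an additional anomaly kappa t coming from the Appell-Lerch
sum.  A convergent q-series f with f(-1/t) = t^2 f(t) + kappa t has constant term
kappa pi i / 6: integrate from i to the cube root of unity.  Hence a0(W_n psi) = 0
and a0(W_n Phi_m) = (n + m/n)/12 for every exact divisor n of m.  The summand
Phi_{m/d^2}(tau, d z) reduces to index m/d^2 with n/(n,d)^2 in place of n, so the
expansion of the product of the 1 + eps_i W_{P_i} gives
  a0(F) = 1/6 sum_{d^2 | m} mu(d) prod_i (eps_i + P_i/(P_i,d)^2),
and the sum over d factors over the primes.

That Phi_m has a Fourier expansion at all is read off the identity
B^(m+1) / (12^(m+1) A) = (wp/(2 pi i)^2)^(m+1) A^m, where wp/(2 pi i)^2 and A are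
series and products in v(z + s tau), with v = y/(1-y)^2; the modular behaviour of
wp and A at z follows from absolutely convergent lattice sums and products.
All limits are elementary: uniqueness of Fourier coefficients is proved by
averaging over torsion points, and the sine product and the partial fraction
expansion of v by iterating the duplication formula. *)

Set Implicit Arguments.
Unset Strict Implicit.
Unset Printing Implicit Defensive.

Import Order.TTheory GRing.Theory Num.Theory.
Import numFieldNormedType.Exports.

Local Open Scope classical_set_scope.
Local Open Scope ring_scope.

(** * Complex modulus and unconditional sums *)

(** The anomaly is the trace of a double pole. [psim] is W^(m+1) A^m with W = wp/(2 pi i)^2 of
    weight 2 and A of weight -2 and index 1, so it has weight exactly 2 and index m; but its image
    under W_n has polar part 1/(n (2 pi i z)^2) at z = 0. Multiplied by the automorphy factor e^(2
    pi i m z^2/t), this pole feeds kappa t, with kappa = m/(2 pi i n), into the z^0 coefficient.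
    Hence [weight_two] is applied to the z^0 Laurent coefficient of W_n psi_m; its constant term
    m/(12 n) is then corrected by that of the Appell-Lerch part, a sum of v over n-torsion points.

    The answer (n + m/n)/12 is a sum of two multiplicative functions of n. Each turns the expanded
    product of the 1 + eps_i W_{P_i} into an Euler product, and the two products agree because the
    eps_i multiply to 1. In the sum over d, a prime with nu_i >= 2 contributes (eps_i + P_i) -
    (eps_i + P_i/p_i^2), which is why eps_i disappears there. *)

Section Modulus.
Variable R : realType.
Local Notation C := (cplx R).
Implicit Types (x y z : C) (a b e : R).

(** The norm of [C] as an element of the real field, which brings estimates within reach of [lra]
    and [nra]; the library norm takes its values in [C] itself. *)
Definition nrm (x : C) : R := ComplexField.Normc.normc (x : R[i]).

Definition ofR (a : R) : C := Complex a 0.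

Lemma normE x : `|x| = ofR (nrm x).
Proof. by []. Qed.

Lemma nrm_ge0 x : 0 <= nrm x.
Proof. by case: x => a b; exact: sqrtr_ge0. Qed.

Lemma nrm0 : nrm 0 = 0. Proof. exact: ComplexField.Normc.normc0. Qed.

Lemma nrm1 : nrm 1 = 1. Proof. exact: ComplexField.Normc.normc1. Qed.

Lemma nrmM x y : nrm (x * y) = nrm x * nrm y.
Proof. exact: ComplexField.Normc.normcM. Qed.

Lemma nrmV x : nrm x^-1 = (nrm x)^-1.
Proof. exact: ComplexField.Normc.normcV. Qed.

Lemma nrmN x : nrm (- x) = nrm x.
Proof. exact: normcN. Qed.

Lemma nrmB x y : nrm (x - y) = nrm (y - x).
Proof. by rewrite -nrmN opprB. Qed.

Lemma ler_nrmD x y : nrm (x + y) <= nrm x + nrm y.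
Proof. exact: le_normcD. Qed.

Lemma ler_nrmB x y : nrm (x - y) <= nrm x + nrm y.
Proof. by rewrite (le_trans (ler_nrmD _ _))// nrmN. Qed.

Lemma nrm_eq0 x : (nrm x == 0) = (x == 0).
Proof.
by apply/eqP/eqP => [/ComplexField.Normc.eq0_normc|->]//; rewrite nrm0.
Qed.

Lemma nrm_gt0 x : (0 < nrm x) = (x != 0).
Proof. by rewrite lt_neqAle nrm_ge0 andbT eq_sym nrm_eq0. Qed.

Lemma nrmX x n : nrm (x ^+ n) = nrm x ^+ n.
Proof. by elim: n => [|n ih]; rewrite ?expr0 ?nrm1// !exprS nrmM ih. Qed.

Lemma nrm_sum (I : Type) (r : seq I) (P : pred I) (F : I -> C) :
  nrm (\sum_(i <- r | P i) F i) <= \sum_(i <- r | P i) nrm (F i).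
Proof.
elim/big_rec2: _ => [|i y x _ le]; first by rewrite nrm0.
by rewrite (le_trans (ler_nrmD _ _))// lerD2l.
Qed.

Lemma nrm_distl x y : nrm x - nrm y <= nrm (x - y).
Proof. by rewrite lerBlDr -{1}(subrK y x) ler_nrmD. Qed.

Lemma ofRD : {morph ofR : a b / a + b}.
Proof. by move=> a b; apply/eqP; rewrite eq_complex /= addr0 !eqxx. Qed.

Lemma ofRM : {morph ofR : a b / a * b}.
Proof.
by move=> a b; apply/eqP; rewrite eq_complex /= !mul0r mulr0 subr0 addr0 !eqxx.
Qed.

Lemma ofR0 : ofR 0 = 0. Proof. by []. Qed.

Lemma ofRN a : ofR (- a) = - ofR a.
Proof. by apply/eqP; rewrite eq_complex /= oppr0 !eqxx. Qed.

Lemma ofRV a : ofR a^-1 = (ofR a)^-1.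
Proof.
have [->|a0] := eqVneq a 0; first by rewrite invr0 ofR0 invr0.
have a0' : ofR a != 0 by rewrite eq_complex /= (negbTE a0).
by apply: (mulfI a0'); rewrite -ofRM divff// divff.
Qed.

Lemma ofRX a n : ofR (a ^+ n) = ofR a ^+ n.
Proof. by elim: n => [|n ih]; rewrite ?expr0// !exprS ofRM ih. Qed.

Lemma ofRn n : ofR n%:R = n%:R.
Proof. by elim: n => [|n ih]; rewrite // -addn1 !natrD ofRD ih. Qed.

Lemma ofRz (n : int) : ofR n%:~R = n%:~R.
Proof. by case: n => n; rewrite ?NegzE ?mulrNz ?ofRN -?pmulrn ofRn. Qed.

Lemma nrm_ofR a : nrm (ofR a) = `|a|.
Proof. by rewrite /nrm /= expr0n /= addr0 sqrtr_sqr. Qed.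

Lemma nrm_nat n : nrm n%:R = n%:R.
Proof. by rewrite -ofRn nrm_ofR normr_nat. Qed.

Lemma nrm_int (n : int) : nrm n%:~R = `|n%:~R|.
Proof. by rewrite -ofRz nrm_ofR. Qed.

Definition re (x : C) : R := complex.Re (x : R[i]).

Definition im (x : C) : R := complex.Im (x : R[i]).

Lemma reD x y : re (x + y) = re x + re y. Proof. by case: x y => ? ? []. Qed.

Lemma imD x y : im (x + y) = im x + im y. Proof. by case: x y => ? ? []. Qed.

Lemma reN x : re (- x) = - re x. Proof. by case: x. Qed.

Lemma imN x : im (- x) = - im x. Proof. by case: x. Qed.

Lemma reM x y : re (x * y) = re x * re y - im x * im y.
Proof. by case: x y => ? ? []. Qed.

Lemma imM x y : im (x * y) = re x * im y + im x * re y.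
Proof. by case: x y => a b [c d]/=; rewrite /im/=. Qed.

Lemma re_ofR a : re (ofR a) = a. Proof. by []. Qed.

Lemma im_ofR a : im (ofR a) = 0. Proof. by []. Qed.

Lemma ofR_imag : 'i = Complex 0 1 :> C.
Proof. by rewrite -complexiE. Qed.

Lemma re_i : re 'i = 0. Proof. by rewrite ofR_imag. Qed.

Lemma im_i : im 'i = 1. Proof. by rewrite ofR_imag. Qed.

Lemma reim x : x = ofR (re x) + 'i * ofR (im x).
Proof.
apply/eqP; rewrite ofR_imag; case: x => a b.
by rewrite eq_complex /re /im /= !mul0r mulr0 mul1r subrr addr0 !add0r !eqxx.
Qed.

Lemma eq_reim x y : re x = re y -> im x = im y -> x = y.
Proof. by move=> h1 h2; rewrite (reim x) (reim y) h1 h2. Qed.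

Lemma nrm_sqr x : nrm x ^+ 2 = re x ^+ 2 + im x ^+ 2.
Proof. by case: x => a b; rewrite /nrm /= sqr_sqrtr// addr_ge0// sqr_ge0. Qed.

Lemma re_le_nrm x : `|re x| <= nrm x.
Proof.
rewrite -(ler_pXn2r (n := 2))// ?nnegrE ?nrm_ge0// real_normK ?num_real//.
by rewrite nrm_sqr lerDl sqr_ge0.
Qed.

Lemma im_le_nrm x : `|im x| <= nrm x.
Proof.
rewrite -(ler_pXn2r (n := 2))// ?nnegrE ?nrm_ge0// real_normK ?num_real//.
by rewrite nrm_sqr lerDr sqr_ge0.
Qed.

Lemma nrm_i : nrm 'i = 1.
Proof.
by apply/eqP; rewrite -(eqrXn2 (n := 2))// ?nrm_ge0// nrm_sqr re_i im_i expr0n add0r.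
Qed.

Lemma nrm_le_reim x : nrm x <= `|re x| + `|im x|.
Proof.
by rewrite {1}(reim x) (le_trans (ler_nrmD _ _))// nrmM nrm_i mul1r !nrm_ofR.
Qed.

Lemma re_sum (I : Type) (r : seq I) (P : pred I) (F : I -> C) :
  re (\sum_(i <- r | P i) F i) = \sum_(i <- r | P i) re (F i).
Proof. exact: (big_morph re reD). Qed.

Lemma im_sum (I : Type) (r : seq I) (P : pred I) (F : I -> C) :
  im (\sum_(i <- r | P i) F i) = \sum_(i <- r | P i) im (F i).
Proof. exact: (big_morph im imD). Qed.

Lemma ofR_sum (I : Type) (r : seq I) (P : pred I) (F : I -> R) :
  ofR (\sum_(i <- r | P i) F i) = \sum_(i <- r | P i) ofR (F i).
Proof. exact: (big_morph ofR ofRD). Qed.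

(** In the order of [C] only real numbers are positive, so an epsilon in [C] and an epsilon in [R]
    carry the same information. *)
Lemma cvg_nrmP (T : Type) (F : set_system T) (FF : Filter F) (u : T -> C) l :
  u @ F --> l <-> forall e, 0 < e -> \forall t \near F, nrm (u t - l) < e.
Proof.
split => [/cvgrPdist_lt h e e0|h].
  have /h : 0 < ofR e by rewrite ltcE/= eqxx.
  by apply: filterS => t; rewrite normE ltcE/= eqxx/= nrmB.
apply/cvgrPdist_lt => e; rewrite ltcE/= => /andP[/eqP ei e0].
have := h _ e0; apply: filterS => t ht.
by rewrite normE ltcE/= ei eqxx/= nrmB.
Qed.

Lemma nearC x (P : C -> Prop) :
  (\forall w \near x, P w) <-> exists2 d : R, 0 < d & forall w, nrm (w - x) < d -> P w.
Proof.
split=> [/nbhs_ballP[d /=]|[d d0 h]].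
  rewrite ltcE/= => /andP[/eqP di d0] h.
  exists (re d) => // w wd; apply: h; rewrite -ball_normE /= normE ltcE/= di eqxx/=.
  by rewrite nrmB.
apply/nbhs_ballP; exists (ofR d); first by rewrite /= ltcE/= eqxx.
by move=> w; rewrite -ball_normE /= normE ltcE/= eqxx/= => hw; apply: h; rewrite nrmB.
Qed.

Lemma nearC' x (P : C -> Prop) :
  (\forall w \near x^', P w) <->
  exists2 d : R, 0 < d & forall w, nrm (w - x) < d -> w != x -> P w.
Proof.
rewrite near_withinE; apply: iff_trans (nearC _ _) _.
by split=> -[d d0 h]; exists d => // w wd wx; apply: h.
Qed.

Lemma upperP (t : C) : upper_half_plane t <-> 0 < im t.
Proof. by rewrite /upper_half_plane /= -complexIm ltcE/= eqxx. Qed.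

Lemma re_nat n : re n%:R = n%:R.
Proof. by rewrite -ofRn. Qed.

Lemma im_nat n : im n%:R = 0.
Proof. by rewrite -ofRn. Qed.

Lemma re_int (n : int) : re n%:~R = n%:~R.
Proof. by rewrite -ofRz. Qed.

Lemma im_int (n : int) : im n%:~R = 0.
Proof. by rewrite -ofRz. Qed.

End Modulus.
Arguments nrm : simpl never.
Arguments re : simpl never.
Arguments im : simpl never.
Arguments ofR : simpl never.
Arguments ee : simpl never.
Arguments cexp : simpl never.
Arguments Defs.formA : simpl never.
Arguments Defs.wp : simpl never.

(** * Unconditional sums over arbitrary index types *)

Section Sums.
Variable R : realType.
Local Notation C := (cplx R).

(** The explicit value [M], and not mere summability, is carried along because dominated convergence
    and the estimates for products refer to it. *)
Definition bsum (I : choiceType) (g : I -> R) (M : R) :=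
  forall J : {fset I}, \sum_(i <- J) g i <= M.

Definition asummable (I : choiceType) (f : I -> C) :=
  exists M, bsum (fun i => nrm (f i)) M.

Definition hasSum (I : choiceType) (f : I -> C) (l : C) :=
  forall e : R, 0 < e -> exists J0 : {fset I}, forall J : {fset I},
    (J0 `<=` J)%fset -> nrm (\sum_(i <- J) f i - l) < e.

Definition tsum (I : choiceType) (f : I -> C) : C := xget 0 [set l | hasSum f l].

Lemma fsum_le (I : choiceType) (g : I -> R) (A B : {fset I}) :
  (forall i, 0 <= g i) -> (A `<=` B)%fset -> \sum_(i <- A) g i <= \sum_(i <- B) g i.
Proof.
move=> g0 AB; rewrite (big_fsetID _ (mem A) B) /=.
rewrite (_ : [fset x in B | x \in A]%fset = A); first by rewrite lerDl sumr_ge0.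
apply/fsetP => i; rewrite !inE andbC; case: (boolP (i \in A)) => //= /(fsubsetP AB).
by move->.
Qed.

Lemma fsumD (T : nmodType) (I : choiceType) (g : I -> T) (A B : {fset I}) :
  (A `<=` B)%fset ->
  \sum_(i <- B) g i = \sum_(i <- A) g i + \sum_(i <- (B `\` A)%fset) g i.
Proof.
move=> AB; rewrite (big_fsetID _ (mem A) B) /=; congr (_ + _).
  congr (\sum_(i <- _) g i); congr (enum_fset _); apply/fsetP => i.
  rewrite !inE andbC; case: (boolP (i \in A)) => //= /(fsubsetP AB).
  by move->.
congr (\sum_(i <- _) g i); congr (enum_fset _); apply/fsetP => i.
by rewrite !inE andbC.
Qed.

Lemma bsum_ge0 (I : choiceType) (g : I -> R) M : bsum g M -> 0 <= M.
Proof. by move=> /(_ fset0); rewrite big_seq_fset0. Qed.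

Lemma bsum_le (I : choiceType) (g h : I -> R) M :
  (forall i, g i <= h i) -> bsum h M -> bsum g M.
Proof. by move=> gh hM J; apply: le_trans (hM J); apply: ler_sum. Qed.

Lemma bsum_leM (I : choiceType) (g : I -> R) M N :
  M <= N -> bsum g M -> bsum g N.
Proof. by move=> gh hM J; apply: le_trans gh. Qed.

Lemma bsumD (I : choiceType) (g h : I -> R) M N :
  bsum g M -> bsum h N -> bsum (fun i => g i + h i) (M + N).
Proof. by move=> gM hN J; rewrite big_split lerD. Qed.

Lemma bsumZ (I : choiceType) (g : I -> R) M a : 0 <= a ->
  bsum g M -> bsum (fun i => a * g i) (a * M).
Proof. by move=> a0 gM J; rewrite -mulr_sumr ler_wpM2l. Qed.

Lemma bsum_inj (I K : choiceType) (h : K -> I) (g : I -> R) M :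
  injective h -> bsum g M -> bsum (g \o h) M.
Proof.
move=> hi gM J; have := gM [fset h k | k in J]%fset; rewrite big_imfset//= => x y _ _.
exact: hi.
Qed.

Lemma bsum_fiber (I K : choiceType) (p : I -> K) (g : I -> R) (G : K -> R) M :
  (forall k (J : {fset I}), (forall i, i \in J -> p i = k) -> \sum_(i <- J) g i <= G k) ->
  bsum G M -> bsum g M.
Proof.
move=> gG GM J; rewrite (partition_big_imfset _ p)/=.
apply: le_trans (GM [fset p x | x in J]%fset); apply: ler_sum => k _.
rewrite big_fset_condE /=; apply: gG => i.
by rewrite !inE /= => /andP[_ /eqP].
Qed.

Lemma bsum_pair (I K : choiceType) (g : I * K -> R) (G : I -> R) M :
  (forall i, bsum (fun k => g (i, k)) (G i)) -> bsum G M -> bsum g M.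
Proof.
move=> gG; apply: (bsum_fiber (p := fst)) => k J hJ.
have := gG k [fset x.2 | x in J]%fset; rewrite big_imfset/=; last first.
  by move=> [a b] [c d] /hJ/= -> /hJ/= -> ->.
by apply: le_trans; rewrite big_seq [leRHS]big_seq; apply: ler_sum => -[a b] /hJ/= ->.
Qed.

Lemma hasSum_unique (I : choiceType) (f : I -> C) l l' :
  hasSum f l -> hasSum f l' -> l = l'.
Proof.
move=> h h'; apply/eqP; rewrite -subr_eq0 -nrm_eq0; apply: contraT => n0.
have e0 : 0 < nrm (l - l') / 2.
  by rewrite divr_gt0// lt_neqAle eq_sym n0 nrm_ge0.
have [J hJ] := h _ e0; have [J' hJ'] := h' _ e0.
have := hJ _ (fsubsetUl J J'); have := hJ' _ (fsubsetUr J J').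
set S := \sum_(i <- _) _ => h1 h2.
have : nrm (l - l') <= nrm (S - l') + nrm (S - l).
  by rewrite (_ : l - l' = (S - l') - (S - l)) ?ler_nrmB//; ring.
lra.
Qed.

Lemma hasSum_tsum (I : choiceType) (f : I -> C) l : hasSum f l -> tsum f = l.
Proof.
by move=> h; apply: xget_unique => // y hy; exact: hasSum_unique hy h.
Qed.

Lemma eq_hasSum (I : choiceType) (f g : I -> C) l :
  f =1 g -> hasSum f l -> hasSum g l.
Proof. by move=> /funext ->. Qed.

Lemma hasSumD (I : choiceType) (f g : I -> C) l k :
  hasSum f l -> hasSum g k -> hasSum (fun i => f i + g i) (l + k).
Proof.
move=> h h' e e0; have e2 : 0 < e / 2 by rewrite divr_gt0.
have [J hJ] := h _ e2; have [J' hJ'] := h' _ e2.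
exists (J `|` J')%fset => K JK; rewrite big_split /=.
have h1 := hJ _ (fsubset_trans (fsubsetUl _ _) JK).
have h2 := hJ' _ (fsubset_trans (fsubsetUr _ _) JK).
rewrite opprD addrACA (le_lt_trans (ler_nrmD _ _))//; lra.
Qed.

Lemma hasSum0 (I : choiceType) : hasSum (fun _ : I => 0) 0.
Proof.
by move=> e e0; exists fset0 => J _; rewrite big1// subrr nrm0.
Qed.

Lemma hasSumZ (I : choiceType) (f : I -> C) l a :
  hasSum f l -> hasSum (fun i => a * f i) (a * l).
Proof.
move=> h e e0; have a0 : 0 < nrm a + 1 by rewrite ltr_wpDl// nrm_ge0.
have [J hJ] := h _ (divr_gt0 e0 a0).
exists J => K /hJ; rewrite -mulr_sumr -mulrBr nrmM ltr_pdivlMr// => h'.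
have := nrm_ge0 (\sum_(i <- K) f i - l); nra.
Qed.

Lemma hasSumZr (I : choiceType) (f : I -> C) l a :
  hasSum f l -> hasSum (fun i => f i * a) (l * a).
Proof.
by move=> /(hasSumZ a); rewrite mulrC; apply: eq_hasSum => i; rewrite mulrC.
Qed.

Lemma hasSumN (I : choiceType) (f : I -> C) l :
  hasSum f l -> hasSum (fun i => - f i) (- l).
Proof.
by move=> /(hasSumZ (-1)); rewrite mulN1r; apply: eq_hasSum => i; rewrite mulN1r.
Qed.

Lemma hasSumB (I : choiceType) (f g : I -> C) l k :
  hasSum f l -> hasSum g k -> hasSum (fun i => f i - g i) (l - k).
Proof. by move=> h /hasSumN; apply: hasSumD. Qed.

Lemma hasSum_big (I : choiceType) (T : Type) (r : seq T) (P : pred T)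
    (f : T -> I -> C) (l : T -> C) :
  (forall t, P t -> hasSum (f t) (l t)) ->
  hasSum (fun i => \sum_(t <- r | P t) f t i) (\sum_(t <- r | P t) l t).
Proof.
move=> h; elim: r => [|t r ih].
  by rewrite big_nil; apply: eq_hasSum (hasSum0 I) => i; rewrite big_nil.
rewrite big_cons; case: ifP => Pt.
  by apply: eq_hasSum (hasSumD (h t Pt) ih) => i; rewrite big_cons Pt.
by apply: eq_hasSum ih => i; rewrite big_cons Pt.
Qed.

Lemma hasSum_support (I : choiceType) (f : I -> C) (J : {fset I}) :
  (forall i, i \notin J -> f i = 0) -> hasSum f (\sum_(i <- J) f i).
Proof.
move=> h e e0; exists J => K JK.
rewrite -(big_fset_incl _ JK) ?subrr ?nrm0//.
by move=> i _; exact: h.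
Qed.

Lemma hasSum_fin (I : finType) (f : I -> C) : hasSum f (\sum_i f i).
Proof.
have := @hasSum_support I f [fset x | x in I]%fset.
rewrite big_imfset//= big_enum; apply => i; rewrite mem_imfset//= inE.
Qed.

(** The sum is the supremum of the finite partial sums. *)
Lemma bsum_hasSum (I : choiceType) (g : I -> R) M :
  (forall i, 0 <= g i) -> bsum g M ->
  exists s, [/\ bsum g s, s <= M & hasSum (fun i => ofR (g i)) (ofR s)].
Proof.
move=> g0 gM; pose E := [set x | exists J : {fset I}, x = \sum_(i <- J) g i].
have hE : has_sup E.
  split; first by exists (\sum_(i <- fset0) g i); exists fset0.
  by exists M => _ [J ->]; exact: gM.
exists (sup E); split.
- by move=> J; apply: sup_upper_bound => //; exists J.
- by apply: ge_sup; [case: hE|move=> _ [J ->]; exact: gM].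
move=> e e0; have [_ [J ->] hJ] := sup_adherent e0 hE.
exists J => K JK; rewrite -ofR_sum -ofRN -ofRD nrm_ofR.
have h1 := fsum_le g0 JK.
have h2 : \sum_(i <- K) g i <= sup E by apply: sup_upper_bound => //; exists K.
rewrite ler0_norm ?subr_le0// opprB; lra.
Qed.

Lemma asummable_le (I : choiceType) (f : I -> C) (g : I -> R) M :
  (forall i, nrm (f i) <= g i) -> bsum g M -> asummable f.
Proof. by move=> fg gM; exists M; apply: bsum_le gM. Qed.

(** Reduction to nonnegative families: real and imaginary part, then the positive and negative part
    of each. *)
Lemma asummable_ex (I : choiceType) (f : I -> C) :
  asummable f -> exists l, hasSum f l.
Proof.
move=> [M fM].
have key (g : I -> R) : (forall i, `|g i| <= nrm (f i)) ->
    exists l, hasSum (fun i => ofR (g i)) l.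
  move=> gf.
  have [s [_ _ hs]] : exists s, [/\ bsum (fun i => Num.max (g i) 0) s, s <= M &
      hasSum (fun i => ofR (Num.max (g i) 0)) (ofR s)].
    apply: bsum_hasSum => [i|]; first by rewrite le_max lexx orbT.
    apply: bsum_le fM => i; rewrite ge_max nrm_ge0 andbT.
    exact: le_trans (ler_norm _) (gf i).
  have [t [_ _ ht]] : exists s, [/\ bsum (fun i => Num.max (- g i) 0) s, s <= M &
      hasSum (fun i => ofR (Num.max (- g i) 0)) (ofR s)].
    apply: bsum_hasSum => [i|]; first by rewrite le_max lexx orbT.
    apply: bsum_le fM => i; rewrite ge_max nrm_ge0 andbT.
    by apply: le_trans (ler_norm _) _; rewrite normrN.
  exists (ofR s - ofR t); apply: eq_hasSum (hasSumB hs ht) => i.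
  rewrite -ofRN -ofRD; congr (ofR _).
  by case: (leP (g i) 0) => h; case: (leP (- g i) 0) => h'; lra.
have [a ha] := key (fun i => re (f i)) (fun i => re_le_nrm _).
have [b hb] := key (fun i => im (f i)) (fun i => im_le_nrm _).
exists (a + 'i * b); apply: eq_hasSum (hasSumD ha (hasSumZ 'i hb)) => i.
by rewrite -reim.
Qed.

Lemma tsumP (I : choiceType) (f : I -> C) : asummable f -> hasSum f (tsum f).
Proof. by move=> /asummable_ex[l h]; rewrite (hasSum_tsum h). Qed.

(** Unconditional convergence is absolute in finite dimension. Finite sums away from [J0] have
    modulus at most 2; restricting them to the indices where the real part has one sign bounds the
    sum of its absolute values by 2 + 2, and the imaginary part adds another 4. *)
Lemma hasSum_asummable (I : choiceType) (f : I -> C) l :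
  hasSum f l -> asummable f.
Proof.
move=> /(_ 1 ltr01)[J0 h].
have h2 (K : {fset I}) : (forall i, i \in K -> i \notin J0) ->
    nrm (\sum_(i <- K) f i) <= 2.
  move=> hK; have := h _ (fsubset_refl _); have := h _ (fsubsetUl J0 K).
  rewrite (fsumD f (fsubsetUl J0 K)).
  rewrite (_ : ((J0 `|` K) `\` J0)%fset = K); last first.
    apply/fsetP => i; rewrite !inE; case: (boolP (i \in K)) => [/hK ->|_]; first by rewrite orbT.
    by rewrite orbF andNb.
  set x := \sum_(i <- J0) _; set y := \sum_(i <- K) _ => h1 h2.
  have := ler_nrmB (x + y - l) (x - l).
  rewrite (_ : x + y - l - (x - l) = y); first by lra.
  ring.
have h3 (g : I -> R) (K : {fset I}) :
    (forall L : {fset I}, `|\sum_(i <- L) g i| <= nrm (\sum_(i <- L) f i)) ->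
    (forall i, i \in K -> i \notin J0) -> \sum_(i <- K) `|g i| <= 4.
  move=> gf hK; rewrite (big_fsetID _ (fun i => 0 <= g i))/=.
  have a1 : \sum_(i <- [fset x in K | 0 <= g x]%fset) `|g i| <= 2.
    rewrite (_ : \sum_(i <- _) _ = \sum_(i <- [fset x in K | 0 <= g x]%fset) g i).
      apply: le_trans (ler_norm _) _; apply: le_trans (gf _) (h2 _ _) => i.
      by rewrite !inE => /andP[/hK].
    rewrite big_seq [RHS]big_seq; apply: eq_bigr => i.
    by rewrite !inE /= => /andP[_ /ger0_norm].
  have a2 : \sum_(i <- [fset x in K | ~~ (0 <= g x)]%fset) `|g i| <= 2.
    rewrite (_ : \sum_(i <- _) _ = - \sum_(i <- [fset x in K | ~~ (0 <= g x)]%fset) g i).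
      apply: le_trans (ler_norm _) _; rewrite normrN.
      apply: le_trans (gf _) (h2 _ _) => i.
      by rewrite !inE => /andP[/hK].
    rewrite big_seq -sumrN [RHS]big_seq; apply: eq_bigr => i.
    by rewrite !inE /= -ltNge => /andP[_ /ltr0_norm].
  lra.
exists (\sum_(i <- J0) nrm (f i) + 8) => J.
rewrite (big_fsetID _ (mem J0))/= lerD//.
  apply: fsum_le => [i|]; first exact: nrm_ge0.
  by apply/fsubsetP => i; rewrite !inE => /andP[].
set K := [fset x in J | _]%fset.
have hK i : i \in K -> i \notin J0 by rewrite !inE => /andP[].
apply: (@le_trans _ _ (\sum_(i <- K) (`|re (f i)| + `|im (f i)|))).
  by apply: ler_sum => i _; exact: nrm_le_reim.
rewrite big_split /=.
have a1 : \sum_(i <- K) `|re (f i)| <= 4.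
  by apply: h3 hK => L; rewrite -re_sum re_le_nrm.
have a2 : \sum_(i <- K) `|im (f i)| <= 4.
  by apply: h3 hK => L; rewrite -im_sum im_le_nrm.
lra.
Qed.

Lemma hasSum_nrm_le (I : choiceType) (f : I -> C) l M :
  bsum (fun i => nrm (f i)) M -> hasSum f l -> nrm l <= M.
Proof.
move=> fM h; apply/ler_addgt0Pr => e e0; have [J hJ] := h _ e0.
have := hJ _ (fsubset_refl _); set S := \sum_(i <- J) f i => hS.
have : nrm S <= M by apply: le_trans (nrm_sum _ _ _) (fM J).
have := ler_nrmB S (S - l); rewrite (_ : S - (S - l) = l); first lra.
ring.
Qed.

Lemma fset_preim (I K : choiceType) (h : K -> I) (J : {fset I}) :
  injective h -> exists L : {fset K}, forall k, (k \in L) = (h k \in J).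
Proof.
move=> hi.
pose g i := xget None [set k | if k is Some k' then h k' = i else False].
have gK k : g (h k) = Some k by apply: xget_unique => // -[k'|]//= /hi ->.
exists [fset k in pmap g J]%fset => k.
rewrite inE/= mem_pmap; apply/mapP/idP => [[i iJ /esym]|kJ].
  by rewrite /g; case: xgetP => // -[k'|]//= _ e1 [<-]; rewrite e1.
by exists (h k); rewrite // gK.
Qed.

Lemma hasSum_inj (I K : choiceType) (h : K -> I) (f : I -> C) l :
  injective h -> (forall i, (forall k, h k <> i) -> f i = 0) ->
  hasSum f l <-> hasSum (f \o h) l.
Proof.
move=> hi f0.
have im_sum (L : {fset K}) :
    \sum_(k <- L) (f \o h) k = \sum_(i <- [fset h k | k in L]%fset) f i.
  by rewrite big_imfset//= => ? ? _ _; exact: hi.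
split=> hl e e0; have [J0 hJ] := hl _ e0; last first.
  exists [fset h k | k in J0]%fset => J sub; have [L hL] := fset_preim J hi.
  have := hJ L; rewrite im_sum (big_fset_incl _ (B := J))//.
  - apply; apply/fsubsetP => k kJ; rewrite hL; apply: (fsubsetP sub).
    by rewrite in_imfset.
  - by apply/fsubsetP => i /imfsetP[k /=]; rewrite hL => + ->.
  move=> i iJ /imfsetP iL; apply: f0 => k hk; apply: iL; exists k => //=.
  by rewrite hL hk.
have [B hB] := fset_preim J0 hi.
exists B => J BJ; rewrite im_sum.
have := hJ _ (fsubsetUl J0 [fset h k | k in J]%fset).
rewrite -(big_fset_incl _ (fsubsetUr J0 _))// => i iJ /imfsetP iL.
apply: f0 => k hk; apply: (iL); exists k => //=; apply: (fsubsetP BJ); rewrite hB.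
move: iJ; rewrite inE hk => /orP[//|/imfsetP[k' /= k'J e1]].
by case: iL; exists k'.
Qed.

Lemma hasSum_bij (I K : choiceType) (h : K -> I) (f : I -> C) l :
  bijective h -> hasSum f l <-> hasSum (f \o h) l.
Proof.
move=> [g hg gh]; apply: hasSum_inj; first exact: can_inj hg.
by move=> i /(_ (g i)); rewrite gh.
Qed.

Lemma bsum_support (I : choiceType) (g : I -> R) (J : {fset I}) :
  (forall i, 0 <= g i) -> bsum (fun i => if i \in J then g i else 0) (\sum_(i <- J) g i).
Proof.
move=> g0 K; rewrite -big_mkcond big_fset_condE /=.
by apply: fsum_le => //; apply/fsubsetP => i; rewrite !inE => /andP[].
Qed.

Lemma bsum_tail (I : choiceType) (g : I -> R) M e :
  (forall i, 0 <= g i) -> bsum g M -> 0 < e ->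
  exists J0 : {fset I}, bsum (fun i => if i \in J0 then 0 else g i) e.
Proof.
move=> g0 gM e0; have [s [gs _ /(_ _ e0)[J0 hJ]]] := bsum_hasSum g0 gM.
exists J0 => K; have := hJ _ (fsubset_refl _); have := gs (J0 `|` K)%fset.
rewrite (fsumD g (fsubsetUl J0 K)) -ofR_sum -ofRN -ofRD nrm_ofR => h1 h2.
rewrite (_ : \sum_(i <- K) _ = \sum_(i <- ((J0 `|` K) `\` J0)%fset) g i).
  move: h2; rewrite ltr_norml => /andP[h2 _]; lra.
rewrite (eq_bigr (fun i => if i \notin J0 then g i else 0)); last first.
  by move=> i _; case: (i \in J0).
rewrite -big_mkcond big_fset_condE /=; congr (\sum_(i <- _) g i).
congr (enum_fset _); apply/fsetP => i; rewrite !inE.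
by case: (i \in J0); rewrite /= ?andbF ?andbT.
Qed.

Lemma sum_delta (T : nmodType) (K : choiceType) (J : {fset K}) (k0 : K) (a : T) :
  \sum_(k <- J) (if k0 == k then a else 0) = if k0 \in J then a else 0.
Proof.
case: ifP => k0J.
  rewrite (big_fsetD1 k0)//= eqxx big1_seq ?addr0// => k /=.
  by rewrite !inE eq_sym => /andP[/negbTE ->].
rewrite big1_seq// => k /= kJ; case: eqP => // e.
by rewrite e kJ in k0J.
Qed.

(** The partial sum over a finite set [J] of fibres differs from [l] only by the terms with p i
    outside [J]. As soon as [J] contains the image of [J0], these indices lie outside [J0], where
    the absolute sum is at most e / 2. *)
Lemma hasSum_fiberE (I K : choiceType) (p : I -> K) (f : I -> C) (g : K -> C) l :
  (forall k, hasSum (fun i => if p i == k then f i else 0) (g k)) ->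
  hasSum f l -> hasSum g l.
Proof.
move=> hg hf; have [M fM] := hasSum_asummable hf.
move=> e e0; have e2 : 0 < e / 2 by rewrite divr_gt0.
have [J0 hJ0] := bsum_tail (fun i => nrm_ge0 (f i)) fM e2.
exists [fset p i | i in J0]%fset => J J0J.
have h1 : hasSum (fun i => (if p i \in J then f i else 0) - f i) (\sum_(k <- J) g k - l).
  apply: hasSumB hf; have := hasSum_big J (P := predT) (fun k _ => hg k).
  by apply: eq_hasSum => i; rewrite sum_delta.
apply: (@le_lt_trans _ _ (e / 2)); last by lra.
apply: hasSum_nrm_le h1; apply: bsum_le hJ0 => i.
case: ifP => piJ; first by rewrite subrr nrm0; case: ifP => //; rewrite nrm_ge0.
rewrite sub0r nrmN; case: ifP => // iJ.
by rewrite (fsubsetP J0J) in piJ; rewrite ?in_imfset.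
Qed.

Lemma asummable_mask (I : choiceType) (f : I -> C) (P : pred I) :
  asummable f -> asummable (fun i => if P i then f i else 0).
Proof.
move=> [M fM]; apply: asummable_le fM => i; case: ifP => // _.
by rewrite nrm0 nrm_ge0.
Qed.

Lemma hasSum_pair (I K : choiceType) (f : I * K -> C) (g : I -> C) l :
  (forall i, hasSum (fun k => f (i, k)) (g i)) -> hasSum f l -> hasSum g l.
Proof.
move=> hg; apply: (hasSum_fiberE (p := fst)) => i.
apply/(hasSum_inj (h := fun k => (i, k))) => [k k' []//|[a b] hab|].
  by case: eqP => //= ai; case: (hab b); rewrite -ai.
by apply: eq_hasSum (hg i) => k; rewrite /= eqxx.
Qed.

Lemma hasSumM (I K : choiceType) (f : I -> C) (g : K -> C) l k :
  hasSum f l -> hasSum g k -> hasSum (fun x : I * K => f x.1 * g x.2) (l * k).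
Proof.
move=> hf hg; have [M fM] := hasSum_asummable hf; have [N gN] := hasSum_asummable hg.
have /asummable_ex[s hs] : asummable (fun x : I * K => f x.1 * g x.2).
  exists (N * M).
  apply: (bsum_pair (G := fun i => N * nrm (f i))) => [i J|]; last first.
    by apply: bsumZ => //; exact: bsum_ge0 gN.
  rewrite (eq_bigr (fun k => nrm (f i) * nrm (g k))) => [|k' _]; last by rewrite nrmM.
  by rewrite -mulr_sumr mulrC ler_wpM2r// nrm_ge0.
have := hasSum_pair (fun i => hasSumZ (f i) hg) hs => h.
by rewrite (hasSum_unique (hasSumZr k hf) h).
Qed.

Lemma near_all (T : Type) (F : set_system T) (FF : Filter F) (I : eqType)
    (s : seq I) (P : I -> T -> Prop) :
  (forall i, \forall t \near F, P i t) -> \forall t \near F, forall i, i \in s -> P i t.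
Proof.
move=> h; elim: s => [|i s ih]; first by apply: nearW.
apply: filterS (filterI (h i) ih) => t [hi hs] j.
by rewrite inE => /orP[/eqP ->|/hs].
Qed.

(** Dominated convergence along an arbitrary filter, so that one statement serves limits in k and
    limits in z. The bound passes to the limit [f0], all but e / 4 of the majorant sits on a finite
    set [J0], and there finitely many limits are handled together. *)
Lemma tannery (T : Type) (F : set_system T) (FF : ProperFilter F) (I : choiceType)
    (f : T -> I -> C) (f0 : I -> C) (g : I -> R) M :
  bsum g M -> (\forall t \near F, forall i, nrm (f t i) <= g i) ->
  (forall i, (fun t => f t i) @ F --> f0 i) ->
  (fun t => tsum (f t)) @ F --> tsum f0.
Proof.
move=> gM fg cv.
have f0g i : nrm (f0 i) <= g i.
  rewrite leNgt; apply/negP => lt.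
  have /cvg_nrmP/(_ (nrm (f0 i) - g i)) h := cv i.
  have d0 : 0 < nrm (f0 i) - g i by rewrite subr_gt0.
  have /filter_ex[t [h1 /(_ i) h2]] : F [set t | nrm (f t i - f0 i) < nrm (f0 i) - g i
      /\ forall i, nrm (f t i) <= g i] by apply: filterI (h d0) fg.
  have := nrm_distl (f0 i) (f t i); rewrite nrmB; lra.
have g0 i : 0 <= g i by apply: le_trans (f0g i); exact: nrm_ge0.
apply/cvg_nrmP => e e0; have e4 : 0 < e / 4 by rewrite divr_gt0.
have [J0 hJ0] := bsum_tail g0 gM e4.
have n0 : 0 < ((size J0).+1%:R : R) by rewrite ltr0n.
pose e' := e / 4 / (size J0).+1%:R.
have e'0 : 0 < e' by rewrite divr_gt0.
have nr : \forall t \near F, forall i, i \in (J0 : seq I) -> nrm (f t i - f0 i) < e'.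
  by apply: near_all => i; have /cvg_nrmP/(_ _ e'0) := cv i.
apply: filterS (filterI nr fg) => t [h1 h2].
have hf : hasSum (f t) (tsum (f t)) by apply: tsumP; apply: asummable_le gM.
have hf0 : hasSum f0 (tsum f0) by apply: tsumP; apply: asummable_le gM.
apply: (@le_lt_trans _ _ (e / 4 + 2 * (e / 4))); last by lra.
apply: hasSum_nrm_le (hasSumB hf hf0).
have b1 : bsum (fun i => if i \in J0 then nrm (f t i - f0 i) else 0) (e / 4).
  apply: bsum_leM (bsum_support J0 (fun i => nrm_ge0 _)).
  apply: (@le_trans _ _ (\sum_(i <- J0) e')).
    by rewrite big_seq [leRHS]big_seq; apply: ler_sum => i /h1/ltW.
  rewrite big_const_seq count_predT iter_addr_0 -(mulr_natr e') /e' (mulrAC (e / 4)).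
  by rewrite ler_pdivrMr// ler_wpM2l ?(ltW e4)// ler_nat leqW.
apply: bsum_le (bsumD b1 (bsumZ _ hJ0)) => // i.
case: ifP => _; first by rewrite mulr0 addr0.
have := ler_nrmB (f t i) (f0 i); have := h2 i; have := f0g i; lra.
Qed.

Lemma hasSum_cvg (I : choiceType) (f : I -> C) l :
  hasSum f l <-> partial_sum f @ totally --> l.
Proof.
have FF := @totally_filter I; split=> [h|/cvg_nrmP h].
  apply/cvg_nrmP => e /h[J0 hJ]; exists J0 => // J /= /hJ.
  by rewrite /partial_sum big_seq_fsetE.
move=> e /h[J0 _ hJ]; exists J0 => J /hJ /=.
by rewrite /partial_sum big_seq_fsetE.
Qed.

Lemma sum_hasSum (I : choiceType) (f : I -> C) l :
  hasSum f l -> summability.sum f = l.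
Proof.
have FF := @totally_filter I; move=> /hasSum_cvg; apply: cvg_lim.
exact: norm_hausdorff.
Qed.

End Sums.

(** * The exponential and the function v = y/(1-y)^2 *)

Section RealBounds.
Variable R : realType.
Implicit Types a b : R.

Lemma expR_sub1_le a : 0 <= a -> expR a - 1 <= a * expR a.
Proof.
move=> a0; have h := expR_ge1Dx (- a).
have : expR a * (1 - a) <= expR a * expR (- a) by rewrite ler_wpM2l ?expR_ge0.
rewrite -expRD subrr expR0; lra.
Qed.

Lemma norm_expR_sub1 a : `|expR a - 1| <= `|a| * expR `|a|.
Proof.
have [a0|a0] := leP 0 a.
  rewrite (ger0_norm a0) ger0_norm; first exact: expR_sub1_le.
  by rewrite subr_ge0 -expR0 ler_expR.
rewrite (ltr0_norm a0) ler0_norm; last by rewrite subr_le0 -expR0 ler_expR ltW.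
have h := expR_ge1Dx a.
have : 1 <= expR (- a) by rewrite -{1}(expR0 R) ler_expR; lra.
nra.
Qed.

Lemma norm_expR_sub2 a : `|expR a - 1 - a| <= a ^+ 2 * expR `|a|.
Proof.
have h := expR_ge1Dx a.
rewrite ger0_norm; last by lra.
have [a0|a0] := leP 0 a.
  by rewrite (ger0_norm a0); have := expR_sub1_le a0; nra.
rewrite (ltr0_norm a0).
have h1 : expR a <= 1 by rewrite -expR0 ler_expR ltW.
have h2 : 1 <= expR (- a) by rewrite -{1}(expR0 R) ler_expR; lra.
have h3 := expR_ge1Dx (- a).
have h4 : expR a * expR (- a) = 1 by rewrite -expRD subrr expR0.
have h5 := expR_gt0 a.
have h6 : expR a * (1 - a) <= 1 by nra.
have : expR a - 1 - a <= a ^+ 2 by nra.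
nra.
Qed.

Lemma sin_mvt b : exists2 c : R, True & sin b = cos c * b.
Proof.
have hd (x : R) : is_derive x (1 : R) (@sin R) (cos x) by exact: is_derive_sin.
have cs (A : set R) : {within A, continuous (@sin R)}.
  by apply: continuous_subspaceT => x; exact: continuous_sin.
have [b0|b0] := leP 0 b.
  have [c _] := MVT_segment b0 (fun x _ => hd x) (cs _).
  by rewrite sin0 !subr0 => ->; exists c.
have [c _] := MVT_segment (ltW b0) (fun x _ => hd x) (cs _).
by rewrite sin0 !sub0r mulrN => /oppr_inj ->; exists c.
Qed.

Lemma norm_sin_le b : `|sin b| <= `|b|.
Proof.
by have [c _ ->] := sin_mvt b; rewrite normrM ler_piMl// cos_max.
Qed.

Lemma cos_half b : cos b = 1 - 2 * sin (b / 2) ^+ 2.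
Proof.
have e : b = b / 2 + b / 2 by field.
rewrite {1}e cosD -!expr2 cos2sin2; set s := sin _ ^+ 2; ring.
Qed.

Lemma cos_sub1 b : `|cos b - 1| <= b ^+ 2 / 2.
Proof.
rewrite cos_half; have := norm_sin_le (b / 2).
rewrite -(ler_pXn2r (n := 2)) ?nnegrE// !real_normK ?num_real// => h.
rewrite ler0_norm; have := sqr_ge0 (sin (b / 2)); lra.
Qed.

Lemma sin_sub b : `|sin b - b| <= b ^+ 2.
Proof.
have hd (x : R) : is_derive x (1 : R) (fun x : R => sin x - x) (cos x - 1).
  by apply: is_deriveB.
have cs (A : set R) : {within A, continuous (fun x : R => sin x - x)}.
  apply: continuous_subspaceT => x.
  by apply: differentiable_continuous; apply/derivable1_diffP; case: (hd x).
have key : exists2 c : R, `|c| <= `|b| & sin b - b = (cos c - 1) * b.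
  have [b0|b0] := leP 0 b.
    have [c] := MVT_segment b0 (fun x _ => hd x) (cs _).
    rewrite in_itv/= sin0 !subr0 => /andP[c0 cb] ->; exists c => //.
    by rewrite !ger0_norm.
  have [c] := MVT_segment (ltW b0) (fun x _ => hd x) (cs _).
  rewrite in_itv/= sin0 subr0 => /andP[c0 cb] h; exists c; last by lra.
  by rewrite !ler0_norm ?lerN2// ltW.
have [c cb ->] := key; rewrite normrM.
have h1 := cos_sub1 c.
have h2 : c ^+ 2 <= b ^+ 2.
  by rewrite -(real_normK (num_real c)) -(real_normK (num_real b)) lerXn2r ?nnegrE.
have h3 : `|cos c - 1| <= 2 by have := cos_le1 c; have := cos_geN1 c; rewrite ler_norml; lra.
have h4 : `|b| ^+ 2 = b ^+ 2 by rewrite real_normK ?num_real.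
have h0 := normr_ge0 b; have h5 := normr_ge0 (cos c - 1).
have [b2|b2] := leP `|b| 2; nra.
Qed.

End RealBounds.

(** * Limits in C along a filter *)

Section ComplexLimits.
Variables (R : realType) (T : Type) (F : set_system T).
Context {FF : Filter F}.
Local Notation C := (cplx R).
Implicit Types (f g : T -> C) (a b : C).

Lemma eq_cvgC f g a : f =1 g -> f t @[t --> F] --> a -> g t @[t --> F] --> a.
Proof. by move=> /funext ->. Qed.

Lemma cvCD f g a b : f t @[t --> F] --> a -> g t @[t --> F] --> b ->
  f t + g t @[t --> F] --> a + b.
Proof. exact: cvgD. Qed.

Lemma cvCB f g a b : f t @[t --> F] --> a -> g t @[t --> F] --> b ->
  f t - g t @[t --> F] --> a - b.
Proof. exact: cvgB. Qed.

Lemma cvCM f g a b : f t @[t --> F] --> a -> g t @[t --> F] --> b ->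
  f t * g t @[t --> F] --> a * b.
Proof. exact: cvgM. Qed.

Lemma cvCV f a : a != 0 -> f t @[t --> F] --> a -> (f t)^-1 @[t --> F] --> a^-1.
Proof. exact: cvgV. Qed.

Lemma cvC_cst (a : C) : (fun _ : T => a) @ F --> a.
Proof. exact: cvg_cst. Qed.

Lemma cvCX f a n : f t @[t --> F] --> a -> f t ^+ n @[t --> F] --> a ^+ n.
Proof.
move=> h; elim: n => [|n ih]; first exact: cvC_cst.
by rewrite exprS; apply: eq_cvgC (cvCM h ih) => t; rewrite exprS.
Qed.

Lemma cvC_sum (I : Type) (r : seq I) (P : pred I) (f : I -> T -> C) (a : I -> C) :
  (forall i, P i -> f i t @[t --> F] --> a i) ->
  \sum_(i <- r | P i) f i t @[t --> F] --> \sum_(i <- r | P i) a i.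
Proof.
move=> h; elim: r => [|i r ih].
  have -> : (fun t => \sum_(i <- [::] | P i) f i t) = (fun _ => 0).
    by apply/funext => t; rewrite big_nil.
  by rewrite big_nil; exact: cvC_cst.
rewrite big_cons; case: ifP => Pi.
  by apply: eq_cvgC (cvCD (h i Pi) ih) => t; rewrite big_cons Pi.
by apply: eq_cvgC ih => t; rewrite big_cons Pi.
Qed.

Lemma near_cvgC f g a : (\forall t \near F, f t = g t) ->
  f t @[t --> F] --> a -> g t @[t --> F] --> a.
Proof.
move=> h /cvg_nrmP c; apply/cvg_nrmP => e /c hc.
by apply: filterS (filterI h hc) => t [<-].
Qed.

End ComplexLimits.
Arguments cvC_cst {R T F FF} a.
Arguments cvCX {R T F FF f a} n.

(** * The complex exponential and e(z) = exp(2 pi i z) *)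

Section Exponential.
Variable R : realType.
Local Notation C := (cplx R).
Implicit Types (x y z w : C).

Lemma cvgC_P (u : C -> C) z0 l : u w @[w --> z0] --> l <->
  forall e, 0 < e -> exists2 d : R, 0 < d & forall w, nrm (w - z0) < d -> nrm (u w - l) < e.
Proof.
split=> [/(@cvg_nrmP _ _ (nbhs z0))h e e0|h].
  by apply/nearC; exact: h.
by apply/(@cvg_nrmP _ _ (nbhs z0)) => e /h ?; apply/nearC.
Qed.

Lemma cvgC'_P (u : C -> C) z0 l : u w @[w --> z0^'] --> l <->
  forall e, 0 < e -> exists2 d : R, 0 < d &
    forall w, nrm (w - z0) < d -> w != z0 -> nrm (u w - l) < e.
Proof.
split=> [/(@cvg_nrmP _ _ (z0^'))h e e0|h].
  by apply/nearC'; exact: h.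
by apply/(@cvg_nrmP _ _ (z0^')) => e /h ?; apply/nearC'.
Qed.

Lemma re_cexp z : re (cexp z) = expR (re z) * cos (im z). Proof. by []. Qed.

Lemma im_cexp z : im (cexp z) = expR (re z) * sin (im z). Proof. by []. Qed.

Lemma cexpD x y : cexp (x + y) = cexp x * cexp y.
Proof.
apply: eq_reim; rewrite ?reM ?imM !(re_cexp, im_cexp) !reD !imD expRD ?cosD ?sinD.
  ring.
ring.
Qed.

Lemma cexp0 : cexp 0 = 1 :> C.
Proof. by apply: eq_reim; rewrite ?re_cexp ?im_cexp expR0 ?cos0 ?sin0 mul1r. Qed.

Lemma cexp_neq0 z : cexp z != 0.
Proof.
apply/eqP => h; have := cexpD z (- z).
by rewrite subrr cexp0 h mul0r => /eqP; rewrite oner_eq0.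
Qed.

Lemma cexpN z : cexp (- z) = (cexp z)^-1.
Proof.
apply: (mulfI (cexp_neq0 z)).
by rewrite -cexpD subrr cexp0 mulfV// cexp_neq0.
Qed.

Lemma nrm_cexp z : nrm (cexp z) = expR (re z).
Proof.
apply/eqP; rewrite -(eqrXn2 (n := 2)) ?nrm_ge0 ?expR_ge0//.
rewrite nrm_sqr re_cexp im_cexp !exprMn -mulrDr cos2Dsin2 mulr1//.
Qed.

Lemma cexp_sum (I : Type) (r : seq I) (P : pred I) (F : I -> C) :
  cexp (\sum_(i <- r | P i) F i) = \prod_(i <- r | P i) cexp (F i).
Proof. exact: (big_morph (@cexp R) cexpD cexp0). Qed.

(** The real and the imaginary part each split into two terms with an explicit quadratic factor; the
    four bounds add up to 7/2, rounded up to 4. The estimate gives the derivative of [ee] at 0 as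
    well as the Taylor remainders of q-series. *)
Lemma nrm_cexp_sub1 z : nrm (cexp z - 1 - z) <= 4 * nrm z ^+ 2 * expR (nrm z).
Proof.
set a := re z; set b := im z.
have ha : `|a| <= nrm z by exact: re_le_nrm.
have hb : `|b| <= nrm z by exact: im_le_nrm.
have hE : expR `|a| <= expR (nrm z) by rewrite ler_expR.
have E1 : 1 <= expR (nrm z) by rewrite -(expR0 R) ler_expR nrm_ge0.
have hea : expR a <= expR (nrm z).
  by rewrite ler_expR; apply: le_trans ha; exact: ler_norm.
have p1 := expR_gt0 a; have n0 := nrm_ge0 z; have a0 := normr_ge0 a; have b0 := normr_ge0 b.
have sa : a ^+ 2 = `|a| ^+ 2 by rewrite real_normK ?num_real.
have sb : b ^+ 2 = `|b| ^+ 2 by rewrite real_normK ?num_real.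
have Ep : 0 <= expR `|a| by exact: expR_ge0.
have a2 : `|a| ^+ 2 <= nrm z ^+ 2 by rewrite lerXn2r ?nnegrE.
have b2 : `|b| ^+ 2 <= nrm z ^+ 2 by rewrite lerXn2r ?nnegrE.
have ab : `|a| * `|b| <= nrm z ^+ 2 by rewrite expr2 ler_pM.
have n2 : 0 <= nrm z ^+ 2 by rewrite sqr_ge0.
apply: le_trans (nrm_le_reim _) _.
have -> : re (cexp z - 1 - z) = expR a * (cos b - 1) + (expR a - 1 - a).
  rewrite !(reD, reN) re_cexp -/a -/b (re_nat _ 1); ring.
have -> : im (cexp z - 1 - z) = expR a * (sin b - b) + b * (expR a - 1).
  rewrite !(imD, imN) im_cexp -/a -/b (im_nat _ 1); ring.
have h1 : `|expR a * (cos b - 1)| <= expR (nrm z) * (nrm z ^+ 2 / 2).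
  rewrite normrM ger0_norm ?expR_ge0// ler_pM ?expR_ge0//.
  by apply: le_trans (cos_sub1 b) _; rewrite sb ler_pM2r.
have h2 : `|expR a - 1 - a| <= nrm z ^+ 2 * expR (nrm z).
  by apply: le_trans (norm_expR_sub2 a) _; rewrite sa ler_pM.
have h3 : `|expR a * (sin b - b)| <= expR (nrm z) * nrm z ^+ 2.
  rewrite normrM ger0_norm ?expR_ge0// ler_pM ?expR_ge0//.
  by apply: le_trans (sin_sub b) _; rewrite sb.
have h4 : `|b * (expR a - 1)| <= nrm z ^+ 2 * expR (nrm z).
  rewrite normrM; apply: (@le_trans _ _ (`|b| * (`|a| * expR `|a|))).
    by rewrite ler_wpM2l// norm_expR_sub1.
  by rewrite mulrA ler_pM// ?mulr_ge0// mulrC.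
have := ler_normD (expR a * (cos b - 1)) (expR a - 1 - a).
have := ler_normD (expR a * (sin b - b)) (b * (expR a - 1)).
have : 0 <= nrm z ^+ 2 * expR (nrm z) by rewrite mulr_ge0 ?expR_ge0.
lra.
Qed.

(** The constant 2 pi i, locked so that it remains an atom under simplification, [ring] and
    [field]. *)
Definition tpi : C := locked (2 * cpi R * 'i).

Lemma tpi_def : tpi = 2 * cpi R * 'i. Proof. by rewrite /tpi -lock. Qed.

Lemma tpiE : tpi = ofR (2 * pi) * 'i.
Proof. by rewrite tpi_def ofRM ofRn. Qed.

Lemma tpi_neq0 : tpi != 0.
Proof.
rewrite tpiE mulf_neq0//; first by rewrite -nrm_eq0 nrm_ofR normr_eq0 mulf_neq0// gt_eqF// pi_gt0.
by rewrite -nrm_eq0 nrm_i oner_neq0.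
Qed.

Lemma cpi_sqr : cpi R ^+ 2 = - (tpi ^+ 2 / 4).
Proof.
have : (2 : C) != 0 by rewrite pnatr_eq0.
by rewrite tpi_def !exprMn sqrCi => h; field.
Qed.

Lemma nrm_tpi_gt0 : 0 < nrm tpi. Proof. by rewrite nrm_gt0 tpi_neq0. Qed.

Lemma re_tpiM z : re (tpi * z) = - (2 * pi * im z).
Proof. by rewrite tpiE !(reM, imM) re_i im_i re_ofR im_ofR; ring. Qed.

Lemma im_tpiM z : im (tpi * z) = 2 * pi * re z.
Proof. by rewrite tpiE !(reM, imM) re_i im_i re_ofR im_ofR; ring. Qed.

Lemma eeE z : ee z = cexp (tpi * z). Proof. by rewrite tpi_def. Qed.

Lemma eeD x y : ee (x + y) = ee x * ee y.
Proof. by rewrite !eeE mulrDr cexpD. Qed.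

Lemma ee0 : ee (0 : C) = 1.
Proof. by rewrite eeE mulr0 cexp0. Qed.

Lemma ee_neq0 z : ee z != 0. Proof. exact: cexp_neq0. Qed.

Lemma eeN z : ee (- z) = (ee z)^-1.
Proof. by rewrite !eeE mulrN cexpN. Qed.

Lemma eeB x y : ee (x - y) = ee x / ee y.
Proof. by rewrite eeD eeN. Qed.

Lemma nrm_ee z : nrm (ee z) = expR (- (2 * pi * im z)).
Proof. by rewrite eeE nrm_cexp re_tpiM. Qed.

Lemma ee_nat n z : ee (n%:R * z) = ee z ^+ n.
Proof.
elim: n => [|n ih]; first by rewrite mul0r ee0.
by rewrite -addn1 natrD mulrDl mul1r eeD ih addn1 exprSr.
Qed.

Lemma ee_intM (n : int) z : ee (n%:~R * z) = ee z ^ n.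
Proof.
case: n => n; first by rewrite -pmulrn ee_nat.
by rewrite NegzE mulrNz mulNr eeN -pmulrn ee_nat -exprnN.
Qed.

Lemma ee_half : ee (2^-1 : C) = -1.
Proof.
have h : tpi * 2^-1 = ofR pi * 'i.
  by rewrite tpiE ofRM ofRn; field.
rewrite eeE h; apply: eq_reim.
  by rewrite re_cexp !(reM, imM) re_i im_i re_ofR im_ofR !(mulr0, mulr1, mul0r) subr0 addr0 expR0 cospi reN (re_nat _ 1) mul1r.
by rewrite im_cexp !(reM, imM) re_i im_i re_ofR im_ofR !(mulr0, mulr1, mul0r) subr0 addr0 expR0 sinpi imN (im_nat _ 1) mul1r oppr0.
Qed.

Lemma ee1 : ee (1 : C) = 1.
Proof.
have e : (1 : C) = 2^-1 + 2^-1 by field.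
by rewrite {1}e eeD ee_half mulrNN mulr1.
Qed.

Lemma ee_int (n : int) : ee (n%:~R : C) = 1.
Proof. by rewrite -[n%:~R]mulr1 ee_intM ee1 exp1rz. Qed.

(** The modulus forces im z = 0. For the fractional part t of re z, cos(2 pi t) = 1 gives sin(pi t)
    = 0, while sin(pi t) > 0 for 0 < t < 1. *)
Lemma ee_eq1 z : ee z = 1 -> exists n : int, z = n%:~R.
Proof.
move=> h; have im0 : im z = 0.
  have : expR (- (2 * pi * im z)) = 1 by rewrite -nrm_ee h nrm1.
  have pg := pi_gt0 R; have p2 : 2 * pi != 0 :> R by rewrite gt_eqF//; lra.
  move=> h1; have /expR_inj h' : expR (- (2 * pi * im z)) = expR 0 by rewrite expR0.
  by apply: (mulfI p2); apply/eqP; rewrite mulr0 -oppr_eq0 h'.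
exists (Num.floor (re z)); set n := Num.floor _.
pose t : R := re z - n%:~R.
have t0 : 0 <= t by rewrite subr_ge0; exact: ge_floor.
have t1 : t < 1 by rewrite ltrBlDl; have := lt_succ_floor (re z); rewrite intrD.
have zE : z = n%:~R + ofR t.
  apply: eq_reim; first by rewrite reD re_int re_ofR /t addrC subrK.
  by rewrite imD im_int im_ofR im0 addr0.
have h1 : ee (ofR t) = 1 by move: h; rewrite zE eeD ee_int mul1r.
have h2 : cos (2 * pi * t) = 1.
  have := congr1 (@re R) h1; rewrite eeE re_cexp re_tpiM im_tpiM im_ofR re_ofR.
  by rewrite mulr0 oppr0 expR0 mul1r => ->; exact: (re_nat _ 1).
have h3 : sin (pi * t) = 0.
  move: h2; rewrite cos_half (_ : 2 * pi * t / 2 = pi * t); last by field.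
  move=> h2; apply/eqP; rewrite -sqrf_eq0; apply/eqP; lra.
have pg := pi_gt0 R.
have : t = 0.
  apply/eqP; rewrite eq_le t0 andbT leNgt; apply/negP => tp.
  have : 0 < sin (pi * t) by apply: sin_gt0_pi; nra.
  by rewrite h3 ltxx.
by move=> tz; rewrite zE tz ofR0 addr0.
Qed.

Lemma nrm_ee_sub1 : exists2 K, 0 < K & forall z, nrm z <= 1 -> nrm (ee z - 1) <= K * nrm z.
Proof.
exists (nrm tpi * (1 + 4 * nrm tpi * expR (nrm tpi))).
  by rewrite mulr_gt0 ?nrm_tpi_gt0// ltr_pwDl// !mulr_ge0 ?nrm_ge0 ?expR_ge0.
move=> z z1; rewrite eeE; have := nrm_cexp_sub1 (tpi * z); rewrite nrmM.
have t0 := nrm_tpi_gt0; have z0 := nrm_ge0 z.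
have e1 : expR (nrm tpi * nrm z) <= expR (nrm tpi) by rewrite ler_expR; nra.
have := ler_nrmD (cexp (tpi * z) - 1 - tpi * z) (tpi * z); rewrite subrK nrmM.
have e0 := expR_gt0 (nrm tpi * nrm z).
set a := nrm tpi in t0 e1 e0 *; set b := nrm z in z1 z0 e1 e0 *.
set E := expR (a * b) in e1 e0 *; set E' := expR a in e1 *.
have h1 : 4 * (a * b) ^+ 2 * E <= 4 * (a ^+ 2 * b) * E'.
  apply: ler_pM => //; first by rewrite mulr_ge0// sqr_ge0.
    exact: ltW.
  by rewrite ler_pM2l// exprMn ler_wpM2l ?sqr_ge0//; nra.
move=> h2 h3; lra.
Qed.

Lemma ee_cvg z0 : ee w @[w --> z0] --> ee z0.
Proof.
apply/cvgC_P => e e0.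
have [K K0 hK] := nrm_ee_sub1.
have n0 : 0 < nrm (ee z0) by rewrite nrm_gt0 ee_neq0.
exists (Num.min 1 (e / (nrm (ee z0) * K))).
  by rewrite lt_min ltr01 divr_gt0// mulr_gt0.
move=> w; rewrite lt_min => /andP[w1]; rewrite ltr_pdivlMr ?mulr_gt0 ?n0 ?K0// => w2.
have -> : ee w - ee z0 = ee z0 * (ee (w - z0) - 1).
  by rewrite mulrBr mulr1 -eeD (addrC z0) subrK.
by rewrite nrmM; apply: le_lt_trans w2; rewrite mulrCA ler_pM2l// mulrC hK// ltW.
Qed.

Lemma ee_deriv0 : (ee w - 1) / (tpi * w) @[w --> (0 : C)^'] --> (1 : C).
Proof.
apply/cvgC'_P => e e0.
have t0 := nrm_tpi_gt0.
set K := 4 * nrm tpi * expR (nrm tpi).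
have K0 : 0 < K by rewrite !mulr_gt0 ?expR_gt0.
exists (Num.min 1 (e / K)); first by rewrite lt_min ltr01 divr_gt0.
move=> w; rewrite subr0 lt_min ltr_pdivlMr// => /andP[w1 w2] wn.
have w0 : 0 < nrm w by rewrite nrm_gt0.
have -> : (ee w - 1) / (tpi * w) - 1 = (ee w - 1 - tpi * w) / (tpi * w).
  by field; rewrite wn tpi_neq0.
rewrite nrmM nrmV nrmM ltr_pdivrMr ?mulr_gt0// eeE.
apply: le_lt_trans (nrm_cexp_sub1 _) _; rewrite nrmM.
have e1 : expR (nrm tpi * nrm w) <= expR (nrm tpi).
  by rewrite ler_expR ler_piMr ?ltW.
apply: (@le_lt_trans _ _ (K * nrm w * (nrm tpi * nrm w))); last first.
  by rewrite ltr_pM2r ?mulr_gt0// mulrC.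
rewrite /K.
rewrite (_ : 4 * nrm tpi * _ * _ * _ = 4 * (nrm tpi * nrm w) ^+ 2 * expR (nrm tpi)); last by ring.
by rewrite ler_wpM2l// mulr_ge0// sqr_ge0.
Qed.

End Exponential.

(** * Comparison series and finite sets of integers *)

Section Bounds.
Variable R : realType.

Lemma min_pos (I : eqType) (s : seq I) (g : I -> R) :
  (forall i, 0 < g i) -> exists2 c, 0 < c & forall i, i \in s -> c <= g i.
Proof.
move=> g0; elim: s => [|i s [c c0 ih]]; first by exists 1.
exists (Num.min c (g i)); first by rewrite lt_min c0 g0.
by move=> j; rewrite inE ge_min => /orP[/eqP ->|/ih ->]//; rewrite lexx orbT.
Qed.

(** Beyond the threshold (2 b + a)/a, a s - b is at least (a/2)(1 + s). Only finitely many indices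
    remain, and there the positive numbers g i / (1 + s i) have a positive lower bound. *)
Lemma lower_linear (I : choiceType) (g s : I -> R) a b :
  (forall M, exists J : {fset I}, forall i, s i <= M -> i \in J) ->
  (forall i, 0 <= s i) -> (forall i, 0 < g i) ->
  0 < a -> (forall i, a * s i - b <= g i) ->
  exists2 c, 0 < c & forall i, c * (1 + s i) <= g i.
Proof.
move=> fin s0 g0 a0 h; have [J hJ] := fin ((2 * b + a) / a).
have [c c0 hc] := min_pos J (g := fun i => g i / (1 + s i))
  (fun i => divr_gt0 (g0 i) (ltr_pwDl ltr01 (s0 i))).
exists (Num.min c (a / 2)); first by rewrite lt_min c0 divr_gt0.
move=> i; have p : 0 < 1 + s i by rewrite ltr_pwDl.
have [le|lt] := leP (s i) ((2 * b + a) / a).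
  rewrite -ler_pdivlMr// ge_min; have := hc _ (hJ _ le).
  by rewrite ler_pdivlMr// ler_pdivlMr// => ->.
apply: le_trans (h i); rewrite -ler_pdivlMr// ge_min; apply/orP; right.
rewrite ler_pdivlMr//; move: lt; rewrite ltr_pdivrMr//; nra.
Qed.

Lemma bsum_telescope (g phi : nat -> R) :
  (forall k, 0 <= g k) -> (forall k, 0 <= phi k) ->
  (forall k, g k <= phi k - phi k.+1) -> bsum g (phi 0%N).
Proof.
move=> g0 p0 h J.
have [n hn] : exists n, forall k, k \in J -> (k < n)%N.
  exists (\max_(k <- J) k).+1 => k kJ; rewrite ltnS.
  by rewrite (big_rem k kJ)/= leq_maxl.
rewrite (perm_big [seq k <- iota 0 n | k \in J]); last first.
  apply: uniq_perm; rewrite ?filter_uniq ?iota_uniq ?fset_uniq// => k.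
  by rewrite mem_filter mem_iota; case: (boolP (k \in J)) => // /hn ->.
rewrite big_filter; apply: (@le_trans _ _ (\sum_(k <- iota 0 n) g k)).
  by rewrite big_mkcond; apply: ler_sum => k _; case: ifP.
have : \sum_(k <- iota 0 n) g k <= phi 0%N - phi n.
  elim: n {hn} => [|n ih]; first by rewrite big_nil subrr.
  rewrite -[in iota _ _]addn1 iotaD big_cat big_seq1 add0n /=; have := h n; lra.
have := p0 n; lra.
Qed.

Lemma bsum_int (g : nat -> R) M :
  (forall k, 0 <= g k) -> bsum g M -> bsum (fun j : int => g `|j|%N) (2 * M).
Proof.
move=> g0 gM; apply: (bsum_fiber (p := fun j : int => `|j|%N)) (bsumZ _ gM) => // k J hJ.
apply: (@le_trans _ _ (\sum_(j <- [fset k%:Z; - k%:Z]%fset) g `|j|%N)).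
  apply: fsum_le => // ; apply/fsubsetP => j /hJ.
  by rewrite !inE => h; lia.
have [->|nk] := eqVneq k 0%N.
  rewrite oppr0 fsetUid big_seq_fset1 absz0; have := g0 0%N; lra.
rewrite big_fsetU1 ?inE; last by lia.
rewrite big_seq_fset1 /= abszN absz_nat; lra.
Qed.

Definition sqd (k : nat) : R := ((1 + k%:R) ^+ 2)^-1.

Lemma sqd_ge0 k : 0 <= sqd k. Proof. by rewrite invr_ge0 sqr_ge0. Qed.

Lemma bsum_sqd : bsum sqd 2.
Proof.
have -> : (2 : R) = 2 / 0%N.+1%:R by rewrite divr1.
apply: (bsum_telescope (phi := fun k => 2 / k.+1%:R)) => k; first exact: sqd_ge0.
  by rewrite divr_ge0.
rewrite /sqd -!natr1 -subr_ge0; have k0 : 0 <= (k%:R : R) by [].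
set x : R := k%:R in k0 *.
rewrite (_ : _ - _ = x / ((1 + x) ^+ 2 * (x + 1 + 1))).
  by rewrite divr_ge0// mulr_ge0 ?sqr_ge0//; lra.
by field; rewrite !gt_eqF//; lra.
Qed.

Lemma bsum_sqd_int : bsum (fun j : int => sqd `|j|%N) 4.
Proof.
by apply: bsum_leM (bsum_int sqd_ge0 bsum_sqd); rewrite -natrM.
Qed.

Lemma int_fin M : exists J : {fset int}, forall j : int, `|j|%N%:R <= M :> R -> j \in J.
Proof.
pose n := Num.truncn M.
exists (seq_fset tt ([seq k%:Z | k <- iota 0 n.+1] ++ [seq - k%:Z | k <- iota 0 n.+1])).
move=> j jM; have : (`|j| <= n)%N.
  by rewrite truncn_ge_nat// (le_trans _ jM).
move=> jn; rewrite seq_fsetE mem_cat; case: (intP j) jn => [|k|k] /= kn.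
- by [].
- by apply/orP; left; apply/mapP; exists k.+1 => //; rewrite mem_iota.
- by apply/orP; right; apply/mapP; exists k.+1 => //; rewrite mem_iota; lia.
Qed.

Lemma int2_fin M : exists J : {fset int * int}, forall j : int * int,
  `|j.1|%N%:R + `|j.2|%N%:R <= M :> R -> j \in J.
Proof.
have [J hJ] := int_fin M; exists (J `*` J)%fset => -[a b]/= h.
have ha : a \in J by apply: hJ; apply: le_trans h; rewrite lerDl.
have hb : b \in J by apply: hJ; apply: le_trans h; rewrite lerDr.
by rewrite in_fsetM /= ha.
Qed.

Lemma pow2_small (a d : R) : 0 < d -> exists k, a / 2 ^+ k < d.
Proof.
move=> d0; exists (Num.truncn (`|a| / d)).+1.
rewrite ltr_pdivrMr ?exprn_gt0// -ltr_pdivrMl// mulrC.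
apply: (@le_lt_trans _ _ (`|a| / d)); first by rewrite ler_pM2r ?invr_gt0// ler_norm.
by apply: lt_trans (truncnS_gt _) _; rewrite -natrX ltr_nat ltn_expl.
Qed.

End Bounds.

(** * The functions u = y - 2 + 1/y and v = 1/u *)

Section UV.
Variable R : realType.
Local Notation C := (cplx R).
Local Notation tpi := (tpi R).
Implicit Types (x y z w : C).

(** In classical terms -4 sin(pi z)^2; it takes the place of the squared sine in the product and
    partial fraction expansions. *)
Definition uu z := ee z - 2 + (ee z)^-1.

(** As the inverse of 0, [vv] takes the default value 0 at the integers. Sums over all integers rely
    on this value at the index 0. *)
Definition vv z := (uu z)^-1.

Definition noint z := forall n : int, z <> n%:~R.

Lemma uuE z : uu z = (1 - ee z) ^+ 2 / ee z.
Proof. by rewrite /uu; field; exact: ee_neq0. Qed.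

Lemma vvE z : vv z = ee z / (1 - ee z) ^+ 2.
Proof. by rewrite /vv uuE invf_div. Qed.

Lemma uu0 : uu 0 = 0.
Proof. by rewrite /uu ee0 invr1; ring. Qed.

Lemma uuN z : uu (- z) = uu z.
Proof. by rewrite /uu eeN invrK; ring. Qed.

Lemma vvN z : vv (- z) = vv z. Proof. by rewrite /vv uuN. Qed.

Lemma uuZ z (n : int) : uu (z + n%:~R) = uu z.
Proof. by rewrite /uu eeD ee_int mulr1. Qed.

Lemma vvZ z (n : int) : vv (z + n%:~R) = vv z. Proof. by rewrite /vv uuZ. Qed.

Lemma uu_double z : uu (2 * z) = uu z * (uu z + 4).
Proof. by rewrite /uu ee_nat; field; exact: ee_neq0. Qed.

Lemma ee_noint z : noint z -> 1 - ee z != 0.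
Proof.
move=> nz; rewrite subr_eq0 eq_sym; apply/eqP => /ee_eq1[n zn]; exact: (nz n).
Qed.

Lemma uu_neq0 z : noint z -> uu z != 0.
Proof.
by move=> nz; rewrite uuE mulf_neq0 ?invr_eq0 ?ee_neq0// expf_neq0// ee_noint.
Qed.

Lemma ee_halves z : ee z = ee (z / 2) ^+ 2 /\ ee ((z + 1) / 2) = - ee (z / 2).
Proof.
split; first by rewrite -ee_nat; congr ee; field.
by rewrite mulrDl mul1r eeD ee_half mulrN1.
Qed.

(** With s = e(z/2) the two arguments have exponentials s and -s, and 1 - s^2 = (1 - s)(1 + s): the
    duplication formula of the squared cosecant. *)
Lemma vv_dup z : noint z -> vv (z / 2) + vv ((z + 1) / 2) = 4 * vv z.
Proof.
move=> /ee_noint; rewrite !vvE; have [-> ->] := ee_halves z.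
set s := ee (z / 2) => h; field.
rewrite (_ : 1 - s ^+ 2 = (1 - s) * (1 - (- s))) in h; last by ring.
move: (h); rewrite mulf_eq0 negb_or => /andP[-> ->].
by rewrite (_ : 1 - s ^+ 2 = (1 - s) * (1 - (- s))) ?h//; ring.
Qed.

(** With w = n tau the square of this expression is the n-th factor of the product defining A. For w
    not an integer, u(w) times it is u(w) - u(z). *)
Definition FF z w := 1 - uu z * vv w.

Lemma FFE z w : noint w ->
  FF z w = (1 - ee w * ee z) * (1 - ee w / ee z) / (1 - ee w) ^+ 2.
Proof.
by move=> /ee_noint h; rewrite /FF vvE /uu; field; rewrite h ee_neq0.
Qed.

Lemma noint_shift z (a b : int) : (0 < b)%R -> noint z -> noint ((z + a%:~R) / b%:~R).
Proof.
move=> b0 nz n h; apply: (nz (n * b - a)); rewrite intrB intrM.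
by rewrite -h divfK ?addrK// intr_eq0 gt_eqF.
Qed.

Lemma noint_half z : noint z -> noint (z / 2) /\ noint ((z + 1) / 2).
Proof.
move=> nz; split; first by rewrite -[z]addr0; exact: (noint_shift (a := 0) (b := 2)).
exact: (noint_shift (a := 1) (b := 2)).
Qed.

Lemma FF_dup z w : noint w -> FF z w = FF (z / 2) (w / 2) * FF (z / 2) ((w + 1) / 2).
Proof.
move=> nw; have [n1 n2] := noint_half nw; rewrite !FFE//.
have := ee_noint nw; have := ee_noint n1; have := ee_noint n2.
have [-> ->] := ee_halves w; have [-> _] := ee_halves z.
have := ee_neq0 (z / 2); set y := ee (z / 2); set q := ee (w / 2).
move=> h1 h2 h3 h4; field.
by rewrite h1 h2 h3 h4.
Qed.

Lemma cvg_punct (f : C -> C) (z0 l : C) : f w @[w --> z0] --> l -> f w @[w --> z0^'] --> l.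
Proof.
move=> /cvgC_P h; apply/cvgC'_P => e /h[d d0 hd]; exists d => // w wd _.
exact: hd.
Qed.

Lemma uu_cvg : uu w / (tpi * w) ^+ 2 @[w --> (0 : C)^'] --> (1 : C).
Proof.
have c2 : (ee w)^-1 @[w --> (0 : C)^'] --> (1 : C).
  have := @ee_cvg R 0; rewrite ee0 => /cvg_punct h.
  by pose proof (cvCV (oner_neq0 C) h) as h2; rewrite invr1 in h2.
pose proof (cvCM (cvCM (@ee_deriv0 R) (@ee_deriv0 R)) c2) as h; move: h; rewrite !mulr1.
apply: eq_cvgC => w.
by rewrite /= uuE -expr2 expr_div_n -(opprB 1 (ee w)) sqrrN mulrAC.
Qed.

Lemma uu_cvg0 z : uu w @[w --> z] --> uu z.
Proof.
have c1 := @ee_cvg R z.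
exact (cvCD (cvCB c1 (cvC_cst _)) (cvCV (ee_neq0 _) c1)).
Qed.

Lemma uu_small : exists c d, [/\ 0 < c, 0 < d & forall w, nrm w < d ->
  c * nrm w ^+ 2 <= nrm (uu w) /\ nrm (uu w) <= 3 * c * nrm w ^+ 2].
Proof.
have [|d d0 h] := (cvgC'_P _ _ _).1 uu_cvg (1/2); first by rewrite divr_gt0.
have t0 := nrm_tpi_gt0 R.
exists (nrm tpi ^+ 2 / 2), d; split => //; first by rewrite divr_gt0// exprn_gt0.
move=> w wd; have [->|w0] := eqVneq w 0.
  by rewrite uu0 nrm0 expr0n/= !mulr0.
have := h w; rewrite subr0 => /(_ wd w0).
have n0 : 0 < nrm w by rewrite nrm_gt0.
have e1 : nrm (uu w) = nrm (uu w / (tpi * w) ^+ 2) * (nrm tpi ^+ 2 * nrm w ^+ 2).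
  by rewrite nrmM nrmV nrmX nrmM exprMn divfK// mulf_neq0// expf_neq0// gt_eqF.
set r := uu w / _ in e1 *; move=> hr; rewrite e1.
have := nrm_distl r 1; have := nrm_distl 1 r; rewrite nrmB nrm1 => h1 h2.
have p : 0 < nrm tpi ^+ 2 * nrm w ^+ 2 by rewrite mulr_gt0 ?exprn_gt0.
split; nra.
Qed.

(** Both e(t) and e(-t) have nonnegative real part when |re t| <= 1/4, and u(t) + 4 = e(t) + e(-t) +
    2. *)
Lemma uu4_re t : `|re t| <= 1/4 -> 2 <= nrm (uu t + 4).
Proof.
move=> h; apply: le_trans (re_le_nrm _); apply: le_trans (ler_norm _).
have h4 (s : C) : `|re s| <= 1/4 -> 0 <= re (ee s).
  move=> hs; rewrite eeE re_cexp mulr_ge0 ?expR_ge0// im_tpiM cos_ge0_pihalf//.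
  by have := pi_gt0 R; move: hs; rewrite ler_norml => /andP[? ?] ?; nra.
have := h4 t h; have := h4 (- t); rewrite reN normrN => /(_ h).
rewrite eeN /uu => h1 h2.
rewrite (_ : _ + 4 = ee t + ((ee t)^-1 + 2)); last by ring.
by rewrite 2!reD re_nat; lra.
Qed.

(** By [uu_double] and [uu4_re], |u(x)| >= 2 |u(x/2)| on this rectangle. A fixed number k of
    halvings brings x into the disc where |u| is comparable to |x|^2, which leaves the constant c /
    2^k. *)
Lemma uu_strip : exists2 c, 0 < c & forall x, `|re x| <= 1/2 -> `|im x| <= 1 ->
  c * nrm x ^+ 2 <= nrm (uu x).
Proof.
have [c [d [c0 d0 h]]] := uu_small.
have half (x : C) : re (x / 2) = re x / 2 /\ im (x / 2) = im x / 2.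
  have -> : x / 2 = ofR (2^-1) * x by rewrite ofRV ofRn mulrC.
  by rewrite reM imM re_ofR im_ofR; split; ring.
have step k x : `|re x| <= 1/2 -> `|im x| <= 1 ->
    2 ^+ k * nrm (uu (x / 2 ^+ k)) <= nrm (uu x).
  elim: k x => [|k ih] x h1 h2; first by rewrite !expr0 divr1 mul1r.
  have [hr hi] := half x.
  have := ih (x / 2); rewrite hr hi !normrM normfV !normr_nat => /(_ _ _) h3.
  have {}h3 := h3 ltac:(by lra) ltac:(by lra).
  have e1 : x = 2 * (x / 2) by field.
  rewrite [in leRHS]e1 uu_double nrmM.
  have h4 : 2 <= nrm (uu (x / 2) + 4).
    by apply: uu4_re; rewrite hr normrM normfV normr_nat; lra.
  rewrite (_ : x / 2 ^+ k.+1 = x / 2 / 2 ^+ k); last first.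
    by rewrite exprS invfM mulrA.
  rewrite exprS -mulrA; have := nrm_ge0 (uu (x / 2)); nra.
have [k hk] : exists k : nat, 2 / d < 2 ^+ k.
  exists (Num.truncn (2 / d)).+1.
  apply: lt_trans (truncnS_gt _) _.
  by rewrite -natrX ltr_nat ltn_expl.
exists (c / 2 ^+ k); first by rewrite divr_gt0// exprn_gt0.
move=> x h1 h2; apply: le_trans (step k _ h1 h2).
have k0 : 0 < (2 ^+ k : R) by rewrite exprn_gt0.
have nx : nrm (x / 2 ^+ k) = nrm x / 2 ^+ k by rewrite nrmM nrmV nrmX nrm_nat.
have hd : nrm (x / 2 ^+ k) < d.
  rewrite nx ltr_pdivrMr//; move: hk; rewrite ltr_pdivrMr// mulrC.
  apply: le_lt_trans; apply: le_trans (nrm_le_reim _) _; lra.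
have [h3 _] := h _ hd; rewrite nx in h3.
rewrite -ler_pdivrMl//; apply: le_trans h3.
rewrite le_eqVlt; apply/orP; left; apply/eqP; field.
by rewrite gt_eqF.
Qed.

(** In terms of u = u(w/2), v(w) = 1/(u (u + 4)) yields g(w) = g(w/2)/4 + o(1) for g(w) = v(w) - (2
    pi i w)^-2 + 1/12. The constant 1/12 is the fixed point of k = k/4 + 1/16. Iterating the
    relation drives g to 0 once g(w/2^k)/4^k is known to become small. *)
Lemma vv_laurent : vv w - (tpi * w) ^- 2 @[w --> (0 : C)^'] --> - (12^-1 : C).
Proof.
pose g w : C := vv w - (tpi * w) ^- 2 + 12^-1.
pose ep w : C := 16^-1 - 4^-1 / (uu w + 4).
have epc : ep w @[w --> (0 : C)] --> (0 : C).
  have n4 : uu 0 + 4 != 0 by rewrite uu0 add0r pnatr_eq0.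
  pose proof (cvCB (cvC_cst 16^-1) (cvCM (cvC_cst 4^-1) (cvCV n4 (cvCD (@uu_cvg0 0) (cvC_cst 4))))) as h; move: h.
  by rewrite uu0 add0r (_ : 16^-1 - 4^-1 / 4 = 0)//; field.
have gs : exists2 d, 0 < d & forall w, nrm w < d -> w != 0 ->
    g w = 4^-1 * g (w / 2) + ep (w / 2).
  have [c [d [c0 d0 h]]] := uu_small.
  exists (Num.min d (1/4)); first by rewrite lt_min d0 divr_gt0.
  move=> w; rewrite lt_min => /andP[wd w4] w0.
  have n0 : 0 < nrm w by rewrite nrm_gt0.
  have nh : nrm (w / 2) = nrm w / 2 by rewrite nrmM nrmV nrm_nat.
  have u0 : uu (w / 2) != 0.
    rewrite -nrm_gt0; have [|h1 _] := h (w / 2); first by rewrite nh; lra.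
    by apply: lt_le_trans h1; rewrite mulr_gt0// exprn_gt0// nh divr_gt0.
  have u4 : uu (w / 2) + 4 != 0.
    rewrite -nrm_gt0; apply: lt_le_trans (uu4_re _); first by [].
    by apply: le_trans (re_le_nrm _) _; rewrite nh; lra.
  rewrite /g /ep /vv {1}(_ : w = 2 * (w / 2)); last by field.
  rewrite uu_double; field.
  by rewrite u0 u4 w0 tpi_neq0.
have [d1 d10 h1] := gs.
(* Only u(w) ~ (2 pi i w)^2 enters: it makes v(w/2^k)/4^k tend to (2 pi i w)^-2. *)
have lim0 w : w != 0 -> forall e : R, 0 < e -> exists k, nrm (g (w / 2 ^+ k)) / 4 ^+ k < e.
  move=> w0 e e0.
  have vc : (uu w / (tpi * w) ^+ 2)^-1 @[w --> (0 : C)^'] --> (1 : C).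
    by pose proof (cvCV (oner_neq0 C) uu_cvg) as h; rewrite invr1 in h.
  have t0 : 0 < nrm (tpi * w) ^+ 2.
    by rewrite exprn_gt0// nrm_gt0 mulf_neq0// tpi_neq0.
  have [|d d0 hd] := (cvgC'_P _ _ _).1 vc (e / 2 * nrm (tpi * w) ^+ 2).
    by rewrite mulr_gt0// divr_gt0.
  have [|k hk] := @pow2_small R (nrm w + 1) (Num.min d (e / 2)).
    by rewrite lt_min d0 divr_gt0.
  move: hk; rewrite lt_min => /andP[k1 k2].
  have p2 : 0 < (2 ^+ k : R) by rewrite exprn_gt0.
  have p2' : (2 : C) ^+ k != 0 by rewrite expf_neq0.
  exists k; have wk : w / 2 ^+ k != 0 by rewrite mulf_neq0 ?invr_eq0.
  have nx : nrm (w / 2 ^+ k) = nrm w / 2 ^+ k by rewrite nrmM nrmV nrmX nrm_nat.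
  have := hd (w / 2 ^+ k); rewrite subr0 nx => /(_ _ wk) h.
  have {}h := h ltac:(by apply: le_lt_trans k1; rewrite ler_pM2r ?invr_gt0// lerDl).
  rewrite (_ : (uu _ / _)^-1 - 1 = (vv (w / 2 ^+ k) / 4 ^+ k - (tpi * w) ^- 2) * (tpi * w) ^+ 2) in h; last first.
    rewrite invf_div -/(vv _) mulrBl mulVf; last by rewrite expf_neq0// mulf_neq0// tpi_neq0.
    have -> : (4 : C) ^+ k = (2 ^+ k) ^+ 2.
      by rewrite -exprM mulnC exprM; congr (_ ^+ k); ring.
    by set V := vv _; congr (_ - _); field; rewrite p2'.
  move: h; rewrite [X in X < _]nrmM [nrm (_ ^+ 2)]nrmX ltr_pM2r// => h.
  have -> : nrm (g (w / 2 ^+ k)) / 4 ^+ k = nrm (g (w / 2 ^+ k) / 4 ^+ k).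
    by rewrite nrmM nrmV nrmX nrm_nat.
  have -> : g (w / 2 ^+ k) / 4 ^+ k = vv (w / 2 ^+ k) / 4 ^+ k - (tpi * w) ^- 2 + 12^-1 / 4 ^+ k.
    rewrite /g !mulrDl mulNr; congr (_ - _ + _).
    have -> : (4 : C) ^+ k = (2 ^+ k) ^+ 2.
      by rewrite -exprM mulnC exprM; congr (_ ^+ k); ring.
    by field; rewrite p2' w0 tpi_neq0.
  apply: le_lt_trans (ler_nrmD _ _) _; rewrite nrmM !nrmV nrmX !nrm_nat.
  have : 12^-1 / 4 ^+ k <= (nrm w + 1) / 2 ^+ k.
    apply: ler_pM; rewrite ?invr_ge0 ?exprn_ge0//; first by have := nrm_ge0 w; lra.
    by rewrite lef_pV2 ?posrE ?exprn_gt0// lerXn2r ?nnegrE// ler_nat.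
  lra.
apply/cvgC'_P => e e0.
have [|d2 d20 h2] := (cvgC_P _ _ _).1 epc (e / 2); first by rewrite divr_gt0.
exists (Num.min d1 d2); first by rewrite lt_min d10.
have half w : nrm (w / 2) = nrm w / 2 by rewrite nrmM nrmV nrm_nat.
have half0 w : w != 0 -> w / 2 != 0 by move=> w0; rewrite mulf_neq0 ?invr_eq0.
(* The errors, each below e / 2, are summed with weights 4^-j, hence the total 2/3 e. *)
have key k w : nrm w < d1 -> nrm w < d2 -> w != 0 ->
    nrm (g w) <= 2 / 3 * e + nrm (g (w / 2 ^+ k)) / 4 ^+ k.
  elim: k w => [|k ih] w w1 w2 w0; first by rewrite !expr0 !divr1 lerDr; lra.
  rewrite h1//; apply: le_trans (ler_nrmD _ _) _; rewrite nrmM nrmV nrm_nat.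
  have n0 := nrm_ge0 w.
  have h3 : nrm (ep (w / 2)) < e / 2 by rewrite -[ep _]subr0 h2// subr0 half; lra.
  have := ih (w / 2); rewrite half => /(_ _ _ (half0 _ w0)) h4.
  have {}h4 := h4 ltac:(by lra) ltac:(by lra).
  rewrite (_ : w / 2 ^+ k.+1 = w / 2 / 2 ^+ k); last by rewrite exprS invfM mulrA.
  rewrite exprS invfM (mulrCA _ 4^-1); lra.
move=> w; rewrite subr0 lt_min => /andP[w1 w2] w0.
rewrite opprK -/(g w).
have [|k hk] := lim0 w w0 (e / 4); first by rewrite divr_gt0.
have := key k w w1 w2 w0; lra.
Qed.

End UV.
Arguments uu : simpl never.
Arguments vv : simpl never.

(** * Unconditional products *)

Section Products.
Variable R : realType.
Local Notation C := (cplx R).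

Let tot (I : choiceType) := @totally_filter I.

Definition hasProd (I : choiceType) (f : I -> C) (p : C) :=
  forall e : R, 0 < e -> exists J0 : {fset I}, forall J : {fset I},
    (J0 `<=` J)%fset -> nrm (\prod_(i <- J) f i - p) < e.

Lemma hasProd_cvg (I : choiceType) (f : I -> C) p :
  hasProd f p <-> (fun J : {fset I} => \prod_(i <- J) f i) @ totally --> p.
Proof.
have FF := tot I; split=> [h|/cvg_nrmP h].
  by apply/cvg_nrmP => e /h[J0 hJ]; exists J0.
by move=> e /h[J0 _ hJ]; exists J0 => J /hJ.
Qed.

Lemma hasProd_unique (I : choiceType) (f : I -> C) p p' :
  hasProd f p -> hasProd f p' -> p = p'.
Proof.
have FF := tot I; move=> /hasProd_cvg h /hasProd_cvg h'.
exact: (cvg_unique (@norm_hausdorff _ _) h h').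
Qed.

Lemma hasProdM (I : choiceType) (f g : I -> C) p q :
  hasProd f p -> hasProd g q -> hasProd (fun i => f i * g i) (p * q).
Proof.
have FF := tot I; move=> /hasProd_cvg h /hasProd_cvg h'; apply/hasProd_cvg.
by apply: eq_cvgC (cvCM h h') => J; rewrite big_split.
Qed.

Lemma hasProd1 (I : choiceType) : hasProd (fun _ : I => 1) 1.
Proof. by move=> e e0; exists fset0 => J _; rewrite big1// subrr nrm0. Qed.

Lemma eq_hasProd (I : choiceType) (f g : I -> C) p :
  f =1 g -> hasProd f p -> hasProd g p.
Proof. by move=> /funext ->. Qed.

Lemma hasProd_big (I : choiceType) (T : Type) (r : seq T) (f : T -> I -> C) (p : T -> C) :
  (forall t, hasProd (f t) (p t)) ->
  hasProd (fun i => \prod_(t <- r) f t i) (\prod_(t <- r) p t).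
Proof.
move=> h; elim: r => [|t r ih].
  by rewrite big_nil; apply: eq_hasProd (hasProd1 I) => i; rewrite big_nil.
by rewrite big_cons; apply: eq_hasProd (hasProdM (h t) ih) => i; rewrite big_cons.
Qed.

Lemma hasProd_exp (I : choiceType) (f : I -> C) l :
  hasSum f l -> hasProd (fun i => cexp (f i)) (cexp l).
Proof.
move=> h e e0.
have c1 : forall x : C, cexp x = ee ((tpi R)^-1 * x).
  by move=> x; rewrite eeE mulrA mulfV ?mul1r// tpi_neq0.
have /cvgC_P/(_ _ e0)[d d0 hd] := @ee_cvg R ((tpi R)^-1 * l).
have t0 := nrm_tpi_gt0 R.
have [J0 hJ] := h _ (mulr_gt0 d0 t0).
exists J0 => J /hJ hn; rewrite -cexp_sum !c1; apply: hd.
by rewrite -mulrBr nrmM nrmV mulrC ltr_pdivrMr.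
Qed.

Lemma hasProd_support (I : choiceType) (f : I -> C) (J : {fset I}) :
  (forall i, i \notin J -> f i = 1) -> hasProd f (\prod_(i <- J) f i).
Proof.
move=> h e e0; exists J => K JK.
rewrite -(big_fset_incl _ JK) ?subrr ?nrm0//.
by move=> i _; exact: h.
Qed.

Lemma hasProd_fin_inj (T : finType) (I : choiceType) (h : T -> I) (f : I -> C) :
  injective h -> (forall i, (forall t, h t <> i) -> f i = 1) ->
  hasProd f (\prod_t f (h t)).
Proof.
move=> hi f1; have := @hasProd_support I f [fset h x | x in T]%fset.
rewrite big_imfset/=; last by move=> ? ? _ _; exact: hi.
rewrite big_enum; apply => i iT; apply: f1 => t ht; move: iT.
by rewrite -ht in_imfset.
Qed.

Lemma hasProd_restrict (I K : choiceType) (h : K -> I) (f : I -> C) p :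
  injective h -> (forall i, (forall k, h k <> i) -> f i = 1) ->
  hasProd f p -> hasProd (f \o h) p.
Proof.
move=> hi f0 hl e e0; have [J0 hJ] := hl _ e0.
have [B hB] := fset_preim J0 hi; exists B => J BJ.
have -> : \prod_(k <- J) (f \o h) k = \prod_(i <- [fset h k | k in J]%fset) f i.
  by rewrite big_imfset//= => ? ? _ _; exact: hi.
have := hJ _ (fsubsetUl J0 [fset h k | k in J]%fset).
rewrite -(big_fset_incl _ (fsubsetUr J0 _))// => i iJ /imfsetP iL.
apply: f0 => k hk; apply: (iL); exists k => //=; apply: (fsubsetP BJ); rewrite hB.
move: iJ; rewrite inE hk => /orP[//|/imfsetP[k' /= k'J e1]].
by case: iL; exists k'.
Qed.

Lemma hasProd_bij (I K : choiceType) (h : K -> I) (f : I -> C) p :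
  bijective h -> hasProd f p -> hasProd (f \o h) p.
Proof.
move=> [g hg gh]; apply: hasProd_restrict; first exact: can_inj hg.
by move=> i /(_ (g i)); rewrite gh.
Qed.

(** One factor is exchanged at a time, every partial product being bounded by the exponential of the
    sum of the bounds. This estimate yields existence, regrouping and dominated convergence of
    products. *)
Lemma prod_lip (I : Type) (s : seq I) (x y : I -> C) (m : I -> R) :
  (forall i, nrm (x i) <= m i) -> (forall i, nrm (y i) <= m i) ->
  nrm (\prod_(i <- s) (1 + x i) - \prod_(i <- s) (1 + y i)) <=
  expR (\sum_(i <- s) m i) * \sum_(i <- s) nrm (x i - y i).
Proof.
move=> xm ym.
have m0 i : 0 <= m i by apply: le_trans (xm i); exact: nrm_ge0.
have bd (u : I -> C) t : (forall i, nrm (u i) <= m i) ->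
    nrm (\prod_(i <- t) (1 + u i)) <= expR (\sum_(i <- t) m i).
  move=> um; elim: t => [|i t ih]; first by rewrite !big_nil nrm1 expR0.
  rewrite !big_cons nrmM expRD ler_pM ?nrm_ge0//.
  apply: le_trans (ler_nrmD _ _) _; rewrite nrm1.
  by apply: le_trans (expR_ge1Dx _); rewrite lerD2l.
elim: s => [|i s ih]; first by rewrite !big_nil subrr nrm0 mulr0.
rewrite !big_cons expRD.
have := bd x s xm; move: ih.
set X := \prod_(j <- s) (1 + x j); set Y := \prod_(j <- s) (1 + y j).
set E := expR (\sum_(j <- s) _); set S := \sum_(j <- s) _ => h1 h2.
have -> : (1 + x i) * X - (1 + y i) * Y = (x i - y i) * X + (1 + y i) * (X - Y) by ring.
apply: le_trans (ler_nrmD _ _) _; rewrite !nrmM.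
have h3 : nrm (1 + y i) <= expR (m i).
  apply: le_trans (ler_nrmD _ _) _; rewrite nrm1.
  by apply: le_trans (expR_ge1Dx _); rewrite lerD2l.
have h4 : 1 <= expR (m i) by rewrite -(expR0 R) ler_expR.
have E0 : 0 <= E by exact: expR_ge0.
have S0 : 0 <= S by apply: sumr_ge0 => j _; exact: nrm_ge0.
have n0 := nrm_ge0 (x i - y i).
have a1 : nrm (x i - y i) * nrm X <= nrm (x i - y i) * (expR (m i) * E).
  by rewrite ler_wpM2l//; apply: le_trans h2 _; rewrite ler_peMl.
have a2 : nrm (1 + y i) * nrm (X - Y) <= expR (m i) * (E * S).
  by rewrite ler_pM ?nrm_ge0.
rewrite mulrDr; lra.
Qed.

(** Completeness is inherited from [R] through real and imaginary parts. *)
Lemma cauchyC (T : Type) (F : set_system T) (FF : ProperFilter F) (u : T -> C) :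
  (forall e : R, 0 < e -> exists t0, \forall t \near F, nrm (u t - u t0) < e) ->
  exists l : C, u @ F --> l.
Proof.
move=> h.
have key (p : C -> R) : (forall x y, `|p x - p y| <= nrm (x - y)) ->
    exists a : R, (fun t => p (u t)) @ F --> a.
  move=> hp; have : cauchy ((fun t => p (u t)) @ F).
    apply: cauchy_exP => e e0; have [t0 ht] := h e e0.
    exists (p (u t0)); apply: filterS ht => t ht.
    by rewrite /ball /= distrC; apply: le_lt_trans (hp _ _) ht.
  by move=> /cauchy_cvgP c; exists (lim ((fun t => p (u t)) @ F)).
have [x y|a ha] := key (@re R); first by rewrite -reN -reD re_le_nrm.
have [x y|b hb] := key (@im R); first by rewrite -imN -imD im_le_nrm.
exists (ofR a + 'i * ofR b); apply/cvg_nrmP => e e0.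
have e2 : 0 < e / 2 by rewrite divr_gt0.
move/cvgrPdist_lt : ha => /(_ _ e2) ha; move/cvgrPdist_lt : hb => /(_ _ e2) hb.
apply: filterS (filterI ha hb) => t [h1 h2].
apply: le_lt_trans (nrm_le_reim _) _.
rewrite !(reD, imD, reN, imN) !(reM, imM) re_i im_i !re_ofR !im_ofR.
have -> : a + (0 * b - 1 * 0) = a by ring.
have -> : 0 + (0 * 0 + 1 * b) = b by ring.
rewrite distrC (distrC (im _)); lra.
Qed.

Lemma hasProd_ex (I : choiceType) (x : I -> C) (m : I -> R) M :
  (forall i, nrm (x i) <= m i) -> bsum m M -> exists p, hasProd (fun i => 1 + x i) p.
Proof.
move=> xm mM; have FF := tot I.
have m0 i : 0 <= m i by apply: le_trans (xm i); exact: nrm_ge0.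
have [e e0|l hl] := @cauchyC _ totally _ (fun J : {fset I} => \prod_(i <- J) (1 + x i)); last first.
  by exists l; apply/hasProd_cvg.
have E0 := expR_gt0 M.
have [|J0 hJ0] := @bsum_tail R _ m M (e / (2 * expR M)) m0 mM.
  by rewrite divr_gt0// mulr_gt0.
exists J0; exists J0 => // J /= J0J.
(* Truncating x to [J0] turns the product over [J0] into a product over [J], so that [prod_lip]
   compares the two. *)
pose y i := if i \in J0 then x i else 0.
have ym i : nrm (y i) <= m i by rewrite /y; case: ifP => // _; rewrite nrm0.
have -> : \prod_(i <- J0) (1 + x i) = \prod_(i <- J) (1 + y i).
  rewrite -(big_fset_incl _ J0J (F := fun i => 1 + y i)).
    by rewrite big_seq [RHS]big_seq; apply: eq_bigr => i iJ; rewrite /y iJ.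
  by move=> i _ /negbTE iJ; rewrite /y iJ addr0.
apply: le_lt_trans (prod_lip J xm ym) _.
apply: (@le_lt_trans _ _ (expR M * (e / (2 * expR M)))); last first.
  by rewrite mulrA mulrC invfM mulrA mulfVK ?gt_eqF//; lra.
apply: ler_pM; rewrite ?expR_ge0 ?ler_expR//; first by apply: sumr_ge0 => *; exact: nrm_ge0.
apply: le_trans (hJ0 J); apply: ler_sum => i _; rewrite /y; case: ifP => _.
  by rewrite subrr nrm0.
by rewrite subr0.
Qed.

Lemma hasProd_lip (I : choiceType) (x y : I -> C) (m : I -> R) M D p q :
  (forall i, nrm (x i) <= m i) -> (forall i, nrm (y i) <= m i) -> bsum m M ->
  bsum (fun i => nrm (x i - y i)) D ->
  hasProd (fun i => 1 + x i) p -> hasProd (fun i => 1 + y i) q ->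
  nrm (p - q) <= expR M * D.
Proof.
move=> xm ym mM dD hp hq; apply/ler_addgt0Pr => e e0.
have e2 : 0 < e / 2 by rewrite divr_gt0.
have [J1 h1] := hp _ e2; have [J2 h2] := hq _ e2.
have {}h1 := h1 _ (fsubsetUl J1 J2); have {}h2 := h2 _ (fsubsetUr J1 J2).
have h3 := prod_lip (J1 `|` J2)%fset xm ym.
have h4 : nrm (\prod_(i <- (J1 `|` J2)%fset) (1 + x i) - \prod_(i <- (J1 `|` J2)%fset) (1 + y i)) <= expR M * D.
  apply: le_trans h3 _; apply: ler_pM; rewrite ?expR_ge0 ?ler_expR//.
  by apply: sumr_ge0 => *; exact: nrm_ge0.
move: h1 h2 h4; set X := \prod_(i <- _) _; set Y := \prod_(i <- _) _ => h1 h2 h4.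
have -> : p - q = (X - Y) - (X - p) + (Y - q) by ring.
have := ler_nrmD (X - Y - (X - p)) (Y - q); have := ler_nrmB (X - Y) (X - p); lra.
Qed.

Lemma hasProd_fiberE (I K : choiceType) (r : I -> K) (x : I -> C) (m : I -> R) M
    (g : K -> C) p :
  (forall i, nrm (x i) <= m i) -> bsum m M ->
  (forall k, hasProd (fun i => if r i == k then 1 + x i else 1) (g k)) ->
  hasProd (fun i => 1 + x i) p -> hasProd g p.
Proof.
move=> xm mM hg hp e e0.
have m0 i : 0 <= m i by apply: le_trans (xm i); exact: nrm_ge0.
have E0 := expR_gt0 M.
have [|J0 hJ0] := @bsum_tail R _ m M (e / (2 * expR M)) m0 mM.
  by rewrite divr_gt0// mulr_gt0.
exists [fset r i | i in J0]%fset => J J0J.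
pose y i := if r i \in J then x i else 0.
have ym i : nrm (y i) <= m i by rewrite /y; case: ifP => // _; rewrite nrm0.
have hy : hasProd (fun i => 1 + y i) (\prod_(k <- J) g k).
  apply: eq_hasProd (hasProd_big J hg) => i; rewrite /y.
  case: ifP => riJ.
    rewrite (big_fsetD1 (r i))//= eqxx big1_seq ?mulr1// => k /=.
    by rewrite !inE eq_sym => /andP[/negbTE ->].
  rewrite big1_seq ?addr0// => k /= kJ; case: eqP => // e1.
  by rewrite e1 kJ in riJ.
rewrite nrmB; apply: (@le_lt_trans _ _ (expR M * (e / (2 * expR M)))); last first.
  by rewrite mulrA mulrC invfM mulrA mulfVK ?gt_eqF//; lra.
apply: (hasProd_lip xm ym mM _ hp hy); apply: bsum_le hJ0 => i.
rewrite /y; case: ifP => riJ; first by rewrite subrr nrm0; case: ifP.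
rewrite subr0; case: ifP => // iJ.
by rewrite (fsubsetP J0J) in riJ; rewrite ?in_imfset.
Qed.

(** By [hasProd_lip] the distance between the products is controlled by the sum of the |x t i - x0
    i|, to which [tannery] applies. *)
Lemma hasProd_tannery (T : Type) (F : set_system T) (FF : ProperFilter F)
    (I : choiceType) (x : T -> I -> C) (x0 : I -> C) (m : I -> R) M (p : T -> C) p0 :
  bsum m M -> (\forall t \near F, forall i, nrm (x t i) <= m i) ->
  (forall i, (fun t => x t i) @ F --> x0 i) ->
  (\forall t \near F, hasProd (fun i => 1 + x t i) (p t)) ->
  hasProd (fun i => 1 + x0 i) p0 ->
  p @ F --> p0.
Proof.
move=> mM xm cv hp hp0.
have x0m i : nrm (x0 i) <= m i.
  rewrite leNgt; apply/negP => lt.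
  have d0 : 0 < nrm (x0 i) - m i by rewrite subr_gt0.
  have /cvg_nrmP/(_ _ d0) h := cv i.
  have /filter_ex[t [h1 /(_ i) h2]] : F [set t | nrm (x t i - x0 i) < nrm (x0 i) - m i
      /\ forall i, nrm (x t i) <= m i] by apply: filterI h xm.
  by have := nrm_distl (x0 i) (x t i); rewrite nrmB; lra.
have m0 i : 0 <= m i by apply: le_trans (x0m i); exact: nrm_ge0.
have E0 := expR_gt0 M.
pose d t i := ofR (nrm (x t i - x0 i)).
have dm t : (forall i, nrm (x t i) <= m i) -> forall i, nrm (d t i) <= 2 * m i.
  move=> h i; rewrite nrm_ofR ger0_norm ?nrm_ge0//.
  by have := ler_nrmB (x t i) (x0 i); have := h i; have := x0m i; lra.
have dc : (fun t => tsum (d t)) @ F --> tsum (fun i : I => (0 : C)).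
  apply: (@tannery _ _ _ _ _ _ _ (fun i => 2 * m i)); first exact: bsumZ mM.
    by apply: filterS xm => t /dm.
  move=> i; apply/cvg_nrmP => e e0; have /cvg_nrmP/(_ _ e0) := cv i.
  by apply: filterS => t; rewrite subr0 nrm_ofR ger0_norm ?nrm_ge0.
rewrite (hasSum_tsum (hasSum0 I)) in dc.
apply/cvg_nrmP => e e0; move/cvg_nrmP : dc => /(_ (e / expR M)); rewrite divr_gt0// => /(_ isT) dc.
apply: filterS (filterI (filterI dc xm) hp) => t [[h1 h2] h3].
rewrite subr0 ltr_pdivlMr// in h1; apply: le_lt_trans h1; rewrite mulrC.
have /(bsum_hasSum (fun i => nrm_ge0 _))[s [sb _ hs]] : bsum (fun i => nrm (x t i - x0 i)) (2 * M).
  by apply: bsum_le (bsumZ _ mM) => // i; have := dm t h2 i; rewrite nrm_ofR ger0_norm ?nrm_ge0.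
rewrite (hasSum_tsum hs) nrm_ofR ger0_norm; last exact: bsum_ge0 sb.
exact: hasProd_lip h2 x0m mM sb h3 hp0.
Qed.

Lemma hasProd_nat (f : nat -> C) p : hasProd f p ->
  \prod_(0 <= n < N) f n @[N --> \oo] --> p.
Proof.
move=> h; apply/cvg_nrmP => e /h[J0 hJ].
exists (\max_(k <- J0) k).+1 => // N /= hN.
have sub : (J0 `<=` seq_fset tt (iota 0 N))%fset.
  apply/fsubsetP => k kJ; rewrite seq_fsetE mem_iota add0n.
  apply: leq_trans hN; rewrite ltnS.
  by rewrite (big_rem k kJ)/= leq_maxl.
have := hJ _ sub; rewrite (perm_big (iota 0 N))/=; first by rewrite /index_iota subn0.
by apply: uniq_perm; rewrite ?sort_keys_uniq ?iota_uniq// => k; rewrite sort_keysE.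
Qed.

(* f = f_+ f_- with f_+ supported on the positive and f_- on the negative integers *)
Lemma hasProd_even (x : int -> C) (m : int -> R) M p :
  (forall j, nrm (x j) <= m j) -> bsum m M -> x 0 = 0 -> (forall j, x (- j) = x j) ->
  hasProd (fun n : nat => 1 + x n.+1%:Z) p -> hasProd (fun j => 1 + x j) (p ^+ 2).
Proof.
move=> xm mM x0 xN hp.
pose y (j : int) := if 0 < j then x j else 0.
have ym j : nrm (y j) <= m j.
  by rewrite /y; case: ifP => // _; rewrite nrm0; apply: le_trans (xm j); exact: nrm_ge0.
have [q hq] := hasProd_ex ym mM.
have qp : q = p.
  apply: hasProd_unique hp.
  have hi : injective (fun n : nat => n.+1%:Z) by move=> a b [].
  apply: eq_hasProd (hasProd_restrict hi _ hq) => [n|j h]; first by rewrite /= /y.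
  by rewrite /y; case: ifP => [j0|]; rewrite ?addr0//; case: j j0 h => [[//|n]|n]// _ /(_ n).
have hn : hasProd (fun j => 1 + y (- j)) q.
  have bij : bijective (fun j : int => - j) by exists (fun j : int => - j) => j; rewrite opprK.
  exact: hasProd_bij bij hq.
rewrite qp in hq hn; rewrite expr2; apply: eq_hasProd (hasProdM hq hn) => j.
rewrite /y oppr_gt0; case: (ltgtP j 0) => [j0|j0|->].
- by rewrite addr0 mul1r xN.
- by rewrite addr0 mulr1.
- by rewrite x0 addr0 mulr1.
Qed.

End Products.

(** * Partial fractions of v and the sine product *)

Section Rows.
Variable R : realType.
Local Notation C := (cplx R).
Local Notation tpi := (tpi R).
Implicit Types (z w a : C).

Lemma pow2_near (a d : R) : 0 <= a -> 0 < d -> \forall k \near \oo, a / 2 ^+ k.+1 < d.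
Proof.
move=> a0 d0; have [K hK] := pow2_small a d0.
exists K => // k /= kK; apply: le_lt_trans hK.
rewrite ler_wpM2l// lef_pV2 ?posrE ?exprn_gt0//.
by rewrite ler_eXn2l ?ltr1n// leqW.
Qed.

Lemma nrm_pow2 (x : C) k : nrm (x / 2 ^+ k) = nrm x / 2 ^+ k.
Proof. by rewrite nrmM nrmV nrmX nrm_nat. Qed.

Lemma div_pow2_neq0 (x : C) k : x != 0 -> x / 2 ^+ k != 0.
Proof. by move=> x0; rewrite mulf_neq0// invr_eq0 expf_neq0// pnatr_eq0. Qed.

Lemma uu_scaled a : uu (a / 2 ^+ k.+1) * 4 ^+ k.+1 @[k --> \oo] --> (tpi * a) ^+ 2.
Proof.
have [->|a0] := eqVneq a 0.
  rewrite mulr0 expr0n /=; apply: eq_cvgC (cvC_cst 0) => k.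
  by rewrite mul0r uu0 mul0r.
have ta : tpi * a != 0 by rewrite mulf_neq0// tpi_neq0.
have c1 : uu (a / 2 ^+ k.+1) / (tpi * (a / 2 ^+ k.+1)) ^+ 2 @[k --> \oo] --> (1 : C).
  apply/cvg_nrmP => e e0; have [d d0 hd] := (cvgC'_P _ _ _).1 (@uu_cvg R) _ e0.
  apply: filterS (pow2_near (nrm_ge0 a) d0) => k hk; apply: hd; last exact: div_pow2_neq0.
  by rewrite subr0 nrm_pow2.
pose proof (cvCM c1 (cvC_cst ((tpi * a) ^+ 2))) as c2.
rewrite mul1r in c2; apply: eq_cvgC c2 => k /=.
have -> : (4 : C) ^+ k.+1 = (2 ^+ k.+1) ^+ 2.
  by rewrite -exprM mulnC exprM; congr (_ ^+ k.+1); ring.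
have : (2 : C) ^+ k.+1 != 0 by rewrite expf_neq0// pnatr_eq0.
have := tpi_neq0 R; set p := 2 ^+ k.+1; set u := uu _ => h1 h2; field.
by rewrite a0 h1 h2.
Qed.

Lemma vv_scaled a : a != 0 -> vv (a / 2 ^+ k.+1) / 4 ^+ k.+1 @[k --> \oo] --> (tpi * a) ^- 2.
Proof.
move=> a0; have ta : (tpi * a) ^+ 2 != 0 by rewrite expf_neq0// mulf_neq0// tpi_neq0.
pose proof (cvCV ta (@uu_scaled a)) as h; apply: eq_cvgC h => k.
by rewrite invfM.
Qed.

Lemma noint_pow2 k w (j : int) : noint w -> noint ((w + j%:~R) / 2 ^+ k).
Proof.
move=> nw; have -> : (2 : C) ^+ k = (2 ^ k)%N%:Z%:~R by rewrite -pmulrn natrX.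
by apply: noint_shift => //; rewrite ltz_nat expn_gt0.
Qed.

Lemma split_pow2 (T : nmodType) k (f : nat -> T) :
  \sum_(i < 2 ^ k.+1) f i = \sum_(i < 2 ^ k) (f i + f (i + 2 ^ k)%N).
Proof.
rewrite big_split -(big_mkord xpredT f) -(big_mkord xpredT f).
rewrite -(big_mkord xpredT (fun i => f (i + 2 ^ k)%N)).
rewrite (big_cat_nat _ (n := 2 ^ k)) ?leq_exp2l//=; congr (_ + _).
by rewrite -{1}[(2 ^ k)%N]add0n big_addn expnS mul2n -addnn addnK.
Qed.

Lemma vv_pow2 k w : noint w ->
  \sum_(i < 2 ^ k) vv ((w + i%:R) / 2 ^+ k) = 4 ^+ k * vv w.
Proof.
move=> nw; elim: k => [|k ih].
  by rewrite big_ord_recl big_ord0 /= !addr0 expr0 divr1 mul1r.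
rewrite (split_pow2 _ (fun i => vv ((w + i%:R) / 2 ^+ k.+1))) [in RHS]exprS -mulrA -ih mulr_sumr.
apply: eq_bigr => i _; rewrite -vv_dup; last by rewrite pmulrn; exact: noint_pow2.
have p0 : (2 : C) ^+ k != 0 by rewrite expf_neq0// pnatr_eq0.
congr (vv _ + vv _); first by rewrite exprS; field; rewrite p0.
by rewrite natrD natrX exprS; field; rewrite p0.
Qed.

Lemma FF_pow2 k z w : noint w ->
  \prod_(i < 2 ^ k) FF (z / 2 ^+ k) ((w + i%:R) / 2 ^+ k) = FF z w.
Proof.
move=> nw; elim: k => [|k ih].
  by rewrite big_ord_recl big_ord0 /= !addr0 expr0 !divr1 mulr1.
have sp (f : nat -> C) : \prod_(i < 2 ^ k.+1) f i = \prod_(i < 2 ^ k) (f i * f (i + 2 ^ k)%N).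
  rewrite big_split -(big_mkord xpredT f) -(big_mkord xpredT f).
  rewrite -(big_mkord xpredT (fun i => f (i + 2 ^ k)%N)).
  rewrite (big_cat_nat _ (n := 2 ^ k)) ?leq_exp2l//=; congr (_ * _).
  by rewrite -{1}[(2 ^ k)%N]add0n big_addn expnS mul2n -addnn addnK.
rewrite (sp (fun i => FF (z / 2 ^+ k.+1) ((w + i%:R) / 2 ^+ k.+1))) -ih.
apply: eq_bigr => i _; rewrite [RHS]FF_dup; last by rewrite pmulrn; exact: noint_pow2.
have p0 : (2 : C) ^+ k != 0 by rewrite expf_neq0// pnatr_eq0.
congr (FF _ _ * FF _ _); do ?[by rewrite exprS; field; rewrite p0].
by rewrite natrD natrX exprS; field; rewrite p0.
Qed.

(** The residues modulo 2^(k+1) in symmetric position: for 0 <= re w <= 1 all points (w + j)/2^(k+1)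
    then have real part at most 1/2 in modulus, as [uu_strip] requires. *)
Definition box k (j : int) := (- (2 ^ k)%N%:Z <= j) && (j < (2 ^ k)%N%:Z).

Definition boxi k (i : 'I_(2 ^ k.+1)) : int := i%:Z - (2 ^ k)%N%:Z.

Lemma boxi_inj k : injective (@boxi k).
Proof. by move=> a b; rewrite /boxi => h; apply: val_inj => /=; lia. Qed.

Lemma boxP k j : (forall i, @boxi k i <> j) -> box k j = false.
Proof.
move=> h; apply/negbTE/negP => /andP[h1 h2].
have lt : (`|(j + (2 ^ k)%N%:Z)%R| < 2 ^ k.+1)%N by rewrite expnS; lia.
by apply: (h (Ordinal lt)); rewrite /boxi /=; lia.
Qed.

Lemma box_boxi k i : box k (@boxi k i).
Proof. by have := ltn_ord i; rewrite /box /boxi {2}expnS; lia. Qed.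

Lemma noint_addz w (n : int) : noint w -> noint (w + n%:~R).
Proof. by move=> nw; have := noint_shift (a := n) (b := 1) isT nw; rewrite divr1. Qed.

Lemma boxiE k w (i : 'I_(2 ^ k.+1)) :
  w + (boxi i)%:~R = w + (- (2 ^ k)%N%:Z)%:~R + i%:R.
Proof. by rewrite /boxi intrB mulrNz -addrA (addrC (- _)) -pmulrn. Qed.

(** The finite identity [vv_pow2], spread over all integers with zeros outside the box, so that the
    limit in k can be taken under the sum. The shift of the box by 2^k is absorbed by the period 1
    of v. *)
Lemma hasSum_box k w : noint w ->
  hasSum (fun j : int => if box k j then vv ((w + j%:~R) / 2 ^+ k.+1) / 4 ^+ k.+1 else 0) (vv w).
Proof.
move=> nw; have hs := hasSum_fin (fun i : 'I_(2 ^ k.+1) =>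
  vv ((w + (boxi i)%:~R) / 2 ^+ k.+1) / 4 ^+ k.+1).
rewrite (_ : \sum_i _ = vv w) in hs; last first.
  rewrite -mulr_suml -[in RHS](vvZ w (- (2 ^ k)%N%:Z)).
  have := vv_pow2 k.+1 (@noint_addz w (- (2 ^ k)%N%:Z) nw).
  rewrite (eq_bigr (fun i : 'I_(2 ^ k.+1) => vv ((w + (boxi i)%:~R) / 2 ^+ k.+1))); last first.
    by move=> i _; rewrite boxiE.
  move=> ->; rewrite mulrC mulKf// expf_neq0// pnatr_eq0//.
apply/(hasSum_inj (h := @boxi k)) => [|j /boxP ->//|]; first exact: boxi_inj.
by apply: eq_hasSum hs => i; rewrite /= box_boxi.
Qed.

Lemma hasProd_box k z w : noint w ->
  hasProd (fun j : int => 1 + (if box k j then - (uu (z / 2 ^+ k.+1) * vv ((w + j%:~R) / 2 ^+ k.+1)) else 0))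
    (FF z w).
Proof.
move=> nw.
pose f (j : int) : C := 1 + (if box k j then - (uu (z / 2 ^+ k.+1) * vv ((w + j%:~R) / 2 ^+ k.+1)) else 0).
have hp := @hasProd_fin_inj R _ _ (@boxi k) f (@boxi_inj k).
rewrite (_ : \prod_t _ = FF z w) in hp; last first.
  rewrite -[RHS](_ : FF z (w + (- (2 ^ k)%N%:Z)%:~R) = _); last by rewrite /FF vvZ.
  rewrite -(FF_pow2 k.+1 z (@noint_addz w (- (2 ^ k)%N%:Z) nw)).
  by apply: eq_bigr => i _; rewrite /f box_boxi /FF boxiE.
by apply: hp => j /boxP h; rewrite /f h addr0.
Qed.

Lemma noint_lower w : noint w ->
  exists2 c : R, 0 < c & forall j : int, c * (1 + `|j|%N%:R) <= nrm (w + j%:~R).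
Proof.
move=> nw; apply: (@lower_linear R int _ _ 1 (nrm w)) => //.
- exact: int_fin.
- move=> j; rewrite nrm_gt0; apply/eqP => h.
  by apply: (nw (- j)); apply/eqP; rewrite -subr_eq0 mulrNz opprK h.
move=> j; rewrite mul1r natr_absz intr_norm.
have -> : `|j%:~R : R| = nrm (j%:~R : C) by rewrite nrm_int.
by rewrite lerBlDr; apply: le_trans (ler_nrmB (w + j%:~R) w); rewrite addrC addKr.
Qed.

Lemma bsum_row w (c : R) : 0 < c -> (forall j : int, c * (1 + `|j|%N%:R) <= nrm (w + j%:~R)) ->
  bsum (fun j : int => (nrm (w + j%:~R) ^+ 2)^-1) (4 / c ^+ 2).
Proof.
move=> c0 h; have := bsumZ _ (bsum_sqd_int R) => /(_ (c ^- 2)).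
rewrite mulrC invr_ge0 sqr_ge0 => /(_ isT); apply: bsum_le => j.
have p : 0 < c * (1 + `|j|%N%:R) by rewrite mulr_gt0// ltr_pwDl.
rewrite /sqd -invfM -exprMn lef_pV2 ?posrE ?exprn_gt0//; last exact: lt_le_trans (h j).
by rewrite lerXn2r ?nnegrE ?nrm_ge0 ?(ltW p) ?h.
Qed.

(** The bound of [uu_strip] is uniform in k: after division by 4^(k+1) it becomes a constant times
    the summable |w + j|^-2. *)
Lemma box_dom w : noint w -> 0 <= re w <= 1 ->
  exists2 c : R, 0 < c & \forall k \near \oo, forall j, box k j ->
    nrm (vv ((w + j%:~R) / 2 ^+ k.+1)) <= c * 4 ^+ k.+1 * (nrm (w + j%:~R) ^+ 2)^-1.
Proof.
move=> nw /andP[w0 w1]; have [c c0 hc] := uu_strip R.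
exists c^-1; first by rewrite invr_gt0.
apply: filterS (pow2_near (normr_ge0 (im w)) ltr01) => k hk j /andP[j1 j2].
set x := (w + j%:~R) / 2 ^+ k.+1.
have xE : x = ofR (2 ^- k.+1) * (w + j%:~R) by rewrite ofRV ofRX ofRn mulrC.
have p2 : 0 < (2 ^+ k.+1 : R) by rewrite exprn_gt0.
have hr : `|re x| <= 1/2.
  rewrite xE reM re_ofR im_ofR mul0r subr0 normrM normfV (ger0_norm (ltW p2)) mulrC.
  rewrite ler_pdivrMr// exprS reD re_int.
  have a1 : - (2 ^+ k : R) <= j%:~R.
    have : (- (2 ^ k)%N%:Z)%:~R <= j%:~R :> R by rewrite ler_int.
    by rewrite mulrNz -pmulrn natrX.
  have a2 : j%:~R + 1 <= (2 ^+ k : R).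
    have : (j + 1)%:~R <= (2 ^ k)%N%:Z%:~R :> R by rewrite ler_int; lia.
    by rewrite intrD -pmulrn natrX.
  rewrite ler_norml; lra.
have hi : `|im x| <= 1.
  rewrite xE imM re_ofR im_ofR mul0r addr0 normrM normfV (ger0_norm (ltW p2)) mulrC.
  by rewrite imD im_int addr0 ltW.
have wj : w + j%:~R != 0.
  apply/eqP => h; apply: (nw (- j)); apply/eqP.
  by rewrite -subr_eq0 mulrNz opprK h.
have := hc x hr hi; rewrite {1}/x nrm_pow2 /vv nrmV => h.
have n0 : 0 < nrm (w + j%:~R) by rewrite nrm_gt0.
have p : 0 < c * (nrm (w + j%:~R) / 2 ^+ k.+1) ^+ 2 by rewrite mulr_gt0// exprn_gt0// divr_gt0.
apply: (@le_trans _ _ (c * (nrm (w + j%:~R) / 2 ^+ k.+1) ^+ 2)^-1).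
  by rewrite lef_pV2 ?posrE//; apply: lt_le_trans h.
have -> : (4 : R) ^+ k.+1 = (2 ^+ k.+1) ^+ 2.
  by rewrite -exprM mulnC exprM; congr (_ ^+ k.+1); ring.
rewrite le_eqVlt; apply/orP; left; apply/eqP; field.
by rewrite !gt_eqF.
Qed.

Lemma near_box (j : int) : \forall k \near \oo, box k j.
Proof.
exists `|j|.+1 => // k /= kj; have h : (k < 2 ^ k)%N by rewrite ltn_expl.
by rewrite /box; lia.
Qed.

Lemma red_strip w : noint w -> exists n : int, noint (w - n%:~R) /\ 0 <= re (w - n%:~R) <= 1.
Proof.
move=> nw; exists (Num.floor (re w)); split; first by rewrite -mulrNz; exact: (@noint_addz w).
rewrite reD reN re_int subr_ge0 ge_floor /=.
by have := lt_succ_floor (re w); rewrite intrD => h; lra.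
Qed.

Lemma addz_bij (n : int) : bijective (fun j : int => j + n).
Proof. by exists (fun j : int => j - n) => j; rewrite ?addrK ?subrK. Qed.

(** As k grows the terms of [hasSum_box] tend to (2 pi i (w + j))^-2 while the sum stays equal to
    v(w). The reduction to 0 <= re w <= 1 uses the period 1 on both sides. *)
Lemma hasSum_row w : noint w ->
  hasSum (fun j : int => (w + j%:~R) ^- 2) (tpi ^+ 2 * vv w).
Proof.
wlog w01 : w / 0 <= re w <= 1 => [wl nw|nw].
  have [n [nn n01]] := red_strip nw.
  have := wl _ n01 nn; rewrite -mulrNz vvZ.
  move=> /(hasSum_bij _ _ (addz_bij n)); apply: eq_hasSum => j /=.
  by rewrite intrD mulrNz; congr (_ ^- 2); ring.
have [c c0 hc] := box_dom nw w01; have [c' c'0 hc'] := noint_lower nw.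
have bs := bsumZ (ltW c0) (bsum_row c'0 hc').
have t := @tannery R nat \oo eventually_filter int _ (fun j => (tpi * (w + j%:~R)) ^- 2) _ _ bs.
have {}t := t (fun k j => if box k j then vv ((w + j%:~R) / 2 ^+ k.+1) / 4 ^+ k.+1 else 0).
have p4 k : 0 < (4 ^+ k : R) by rewrite exprn_gt0.
have wj j : w + j%:~R != 0.
  by rewrite -nrm_gt0; apply: lt_le_trans (hc' j); rewrite mulr_gt0// ltr_pwDl.
have h : tsum (fun j : int => (tpi * (w + j%:~R)) ^- 2) = vv w.
  apply: (cvg_unique (@norm_hausdorff _ _) (t _ _)).
  - apply: filterS hc => k hk j; case: ifP => bj.
      rewrite nrmM nrmV nrmX nrm_nat ler_pdivrMr//; have := hk j bj.
      by rewrite mulrAC.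
    by rewrite nrm0 divr_ge0 ?sqr_ge0 ?(ltW c0).
  - move=> j; apply: near_cvgC (vv_scaled (wj j)).
    by apply: filterS (near_box j) => k ->.
  - apply: (@near_cvgC _ _ _ _ (fun _ => vv w)); last exact: cvC_cst.
    by near=> k; rewrite (hasSum_tsum (hasSum_box k nw)).
rewrite -h -[X in hasSum X _](_ : (fun j : int => tpi ^+ 2 * (tpi * (w + j%:~R)) ^- 2) = _).
  apply: hasSumZ; apply: tsumP; apply: asummable_le (bsumZ _ (bsum_row c'0 hc')) => [j|].
    by rewrite nrmV nrmX nrmM exprMn invfM.
  by rewrite invr_ge0 sqr_ge0.
apply/funext => j; by field; rewrite wj tpi_neq0.
Unshelve. all: by end_near.
Qed.

(** The same passage to the limit in the factorisation [FF_pow2]; here the factor u(z/2^(k+1))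
    supplies the decay 4^-(k+1). *)
Lemma hasProd_row z w : noint w ->
  hasProd (fun j : int => 1 - z ^+ 2 / (w + j%:~R) ^+ 2) (FF z w).
Proof.
wlog w01 : w / 0 <= re w <= 1 => [wl nw|nw].
  have [n [nn n01]] := red_strip nw.
  have := wl _ n01 nn; rewrite -mulrNz /FF vvZ.
  move=> /(hasProd_bij (addz_bij n)); apply: eq_hasProd => j /=.
  by rewrite intrD mulrNz; congr (1 - _ / _ ^+ 2); ring.
have [c c0 hc] := box_dom nw w01; have [c' c'0 hc'] := noint_lower nw.
have [c2 [d [c20 d0 hd]]] := uu_small R.
pose K := Num.max (3 * c2 * nrm z ^+ 2 * c) (nrm z ^+ 2).
have K0 : 0 <= K by rewrite le_max sqr_ge0 orbT.
have bs := bsumZ K0 (bsum_row c'0 hc').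
have p4 k : 0 < (4 ^+ k : R) by rewrite exprn_gt0.
have wj j : w + j%:~R != 0.
  by rewrite -nrm_gt0; apply: lt_le_trans (hc' j); rewrite mulr_gt0// ltr_pwDl.
have i0 j : 0 <= (nrm (w + j%:~R) ^+ 2)^-1 by rewrite invr_ge0 sqr_ge0.
have dom0 j : nrm (- (z ^+ 2 / (w + j%:~R) ^+ 2)) <= K * (nrm (w + j%:~R) ^+ 2)^-1.
  by rewrite nrmN nrmM nrmV !nrmX ler_wpM2r// le_max lexx orbT.
have [p hp] := hasProd_ex dom0 bs.
suff -> : FF z w = p by [].
pose x k j : C := if box k j then - (uu (z / 2 ^+ k.+1) * vv ((w + j%:~R) / 2 ^+ k.+1)) else 0.
apply: (cvg_unique (@norm_hausdorff _ _) (@cvC_cst _ _ \oo _ (FF z w))).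
apply: (@hasProd_tannery R nat \oo eventually_filter int x _ _ _ (fun _ => FF z w) p bs _ _ _ hp).
- apply: filterS (filterI hc (pow2_near (nrm_ge0 z) d0)) => k [hk zk] j.
  rewrite /x; case: ifP => bj; last by rewrite nrm0 mulr_ge0.
  rewrite -nrm_pow2 in zk; have [_ h1] := hd _ zk; have h2 := hk j bj.
  rewrite nrmN nrmM; apply: (@le_trans _ _ ((3 * c2 * nrm z ^+ 2 * c) * (nrm (w + j%:~R) ^+ 2)^-1)); last first.
    by rewrite ler_wpM2r// le_max lexx.
  apply: le_trans (ler_pM (nrm_ge0 _) (nrm_ge0 _) h1 h2) _.
  rewrite nrm_pow2 (_ : (4 : R) ^+ k.+1 = (2 ^+ k.+1) ^+ 2); last first.
    by rewrite -exprM mulnC exprM; congr (_ ^+ k.+1); ring.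
  have p2 : (2 ^+ k.+1 : R) != 0 by rewrite gt_eqF// exprn_gt0.
  set i := (_ ^+ 2)^-1; rewrite le_eqVlt; apply/orP; left; apply/eqP; field.
  by rewrite p2.
- move=> j; have vs := vv_scaled (wj j).
  pose proof (cvCB (cvC_cst 0) (cvCM (@uu_scaled z) vs)) as h.
  rewrite sub0r (_ : (tpi * z) ^+ 2 * _ = z ^+ 2 / (w + j%:~R) ^+ 2) in h; last first.
    by field; rewrite wj tpi_neq0.
  apply: near_cvgC h; apply: filterS (near_box j) => k bj; rewrite /x bj sub0r.
  by congr (- _); field; rewrite expf_neq0// pnatr_eq0.
- by near=> k; exact: hasProd_box.
Unshelve. all: by end_near.
Qed.

End Rows.

(** * Lattice sums, wp and the form A *)

Section RowZero.
Variable R : realType.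
Local Notation C := (cplx R).
Local Notation tpi := (tpi R).
Implicit Types (z w : C).

Lemma cst_at (z0 a : C) : (fun _ : C => a) w @[w --> z0] --> a.
Proof. by apply/cvgC_P => e e0; exists 1 => // w _; rewrite subrr nrm0. Qed.

Lemma id_at (z0 : C) : w @[w --> z0] --> z0.
Proof. by apply/cvgC_P => e e0; exists e. Qed.

Lemma inv0sq : (0 : C) ^- 2 = 0.
Proof. by rewrite -exprVn invr0 expr0n. Qed.

(** The row through the origin is the limit w -> 0 of [hasProd_row] without its factor j = 0. That
    factor, 1 - z^2/w^2, is compensated by u(w), which behaves like (2 pi i w)^2. In the statement
    the factor at j = 0 is 1 by the convention 1/0 = 0. *)
Lemma hasProd_row0 z : z != 0 ->
  hasProd (fun j : int => 1 - z ^+ 2 / j%:~R ^+ 2) (uu z / (tpi * z) ^+ 2).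
Proof.
move=> z0.
pose x w (j : int) : C := if j == 0 then 0 else - (z ^+ 2 / (w + j%:~R) ^+ 2).
pose m (j : int) : R := 16 * nrm z ^+ 2 * sqd R `|j|%N.
have mM : bsum m (16 * nrm z ^+ 2 * 4).
  by apply: bsumZ (bsum_sqd_int R); rewrite mulr_ge0// sqr_ge0.
have xm w : nrm w < 1/2 -> forall j, nrm (x w j) <= m j.
  move=> w2 j; rewrite /x /m; case: eqP => [->|/eqP j0].
    by rewrite nrm0 mulr_ge0 ?sqd_ge0// mulr_ge0// sqr_ge0.
  have j1 : (1 : R) <= `|j|%N%:R by rewrite ler1n absz_gt0.
  have h : (1 + `|j|%N%:R) / 4 <= nrm (w + j%:~R).
    have := ler_nrmB (w + j%:~R) w; rewrite addrC addKr nrm_int -intr_norm -natr_absz.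
    lra.
  rewrite nrmN nrmM nrmV !nrmX (_ : 16 * _ * _ = nrm z ^+ 2 * (16 * sqd R `|j|%N)); last by ring.
  rewrite ler_wpM2l ?sqr_ge0//.
  rewrite /sqd -[16]invrK -invfM lef_pV2 ?posrE.
  - apply: le_trans (_ : ((1 + `|j|%N%:R) / 4) ^+ 2 <= _).
      by rewrite expr_div_n; set t := _ ^+ 2; lra.
    by rewrite lerXn2r ?nnegrE ?nrm_ge0// divr_ge0//; lra.
  - by rewrite exprn_gt0//; apply: lt_le_trans h; rewrite divr_gt0//; lra.
  by rewrite mulr_gt0// exprn_gt0//; lra.
pose p w := xget 0 [set q | hasProd (fun j => 1 + x w j) q].
have hp w : nrm w < 1/2 -> hasProd (fun j => 1 + x w j) (p w).
  move=> w2; have [q hq] := hasProd_ex (xm w w2) mM.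
  by rewrite /p (xget_unique 0 (x := q))// => q' /hasProd_unique; apply.
have sm : forall w, nrm w < 1/2 -> w != 0 -> noint w.
  move=> w w2 w0 n wn; move: w2 w0; rewrite wn nrm_int -intr_norm -natr_absz.
  have [->|n0] := eqVneq n 0; first by rewrite eqxx.
  have : (1 : R) <= `|n|%N%:R by rewrite ler1n absz_gt0.
  by move=> h1 h2 _; clear wn; lra.
(* Multiplied by u(w), [FF z w] becomes u(w) - u(z), whose limit -u(z) is known directly. *)
have id w : nrm w < 1/2 -> w != 0 ->
    uu w - uu z = uu w / (tpi * w) ^+ 2 * (tpi ^+ 2 * (w ^+ 2 - z ^+ 2)) * p w.
  move=> w2 w0; have nw := sm w w2 w0.
  pose f (j : int) : C := if j == 0 then 1 - z ^+ 2 / w ^+ 2 else 1.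
  have hf : hasProd f (1 - z ^+ 2 / w ^+ 2).
    have := @hasProd_support R int f [fset (0 : int)]%fset; rewrite big_seq_fset1 /f eqxx.
    by apply => i; rewrite inE => /negbTE ->.
  have h : FF z w = (1 - z ^+ 2 / w ^+ 2) * p w.
    apply: hasProd_unique (hasProd_row z nw) _; apply: eq_hasProd (hasProdM hf (hp w w2)) => j.
    by rewrite /f /x; case: eqP => [->|_]; rewrite ?addr0 ?mulr1 ?mul1r.
  have -> : uu w - uu z = uu w * FF z w.
    by rewrite /FF /vv mulrBr mulr1 mulrCA mulfV ?mulr1// uu_neq0.
  rewrite h; field; by rewrite w0 tpi_neq0.
have half : 0 < (1/2 : R) by lra.
have n00 : nrm (0 : C) < 1/2 by rewrite nrm0.
have near2 : \forall w \near (0 : C)^', nrm w < 1/2 /\ w != 0.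
  by apply/nearC'; exists (1/2) => // w; rewrite subr0.
have pc : p w @[w --> (0 : C)^'] --> p 0.
  apply: (@hasProd_tannery R C ((0 : C)^') _ int x (x 0) m _ p (p 0) mM).
  - by apply: filterS near2 => w [w2 _]; exact: xm.
  - move=> j; apply: cvg_punct; rewrite /x; case: eqP => [_|/eqP j0]; first exact: cst_at.
    have n0 : (0 + j%:~R : C) ^+ 2 != 0 by rewrite add0r expf_neq0// intr_eq0.
    pose proof (cvCB (cvC_cst 0) (cvCM (cvC_cst (z ^+ 2)) (cvCV n0 (cvCX 2 (cvCD (@id_at 0) (cvC_cst (j%:~R))))))) as h.
    by rewrite sub0r in h; apply: eq_cvgC h => w; rewrite sub0r.
  - by apply: filterS near2 => w [w2 _]; exact: hp.
  - exact: hp.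
have c1 : uu w - uu z @[w --> (0 : C)^'] --> - uu z.
  pose proof (cvCB (cvg_punct (@uu_cvg0 R 0)) (cvC_cst (uu z))) as h.
  by rewrite uu0 sub0r in h.
have c2 : uu w - uu z @[w --> (0 : C)^'] --> - ((tpi * z) ^+ 2 * p 0).
  have c3 : w ^+ 2 - z ^+ 2 @[w --> (0 : C)^'] --> (0 : C) ^+ 2 - z ^+ 2.
    exact: cvg_punct (cvCB (cvCX 2 (@id_at 0)) (cvC_cst (z ^+ 2))).
  pose proof (cvCM (cvCM (@uu_cvg R) (cvCM (cvC_cst (tpi ^+ 2)) c3)) pc) as h.
  have e : - ((tpi * z) ^+ 2 * p 0) = 1 * (tpi ^+ 2 * (0 ^+ 2 - z ^+ 2)) * p 0 by ring.
  rewrite e; apply: near_cvgC h; apply: filterS near2 => w [w2 w0].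
  by rewrite id.
have e1 : uu z = (tpi * z) ^+ 2 * p 0.
  by apply: oppr_inj; apply: (cvg_unique (@norm_hausdorff _ _) c1 c2).
rewrite e1 mulrC mulKf; last by rewrite expf_neq0// mulf_neq0// tpi_neq0.
apply: eq_hasProd (hp 0 n00) => j; rewrite /x add0r; case: eqP => [->|//].
by rewrite mulr0z inv0sq mulr0 subr0 addr0.
Qed.

Lemma hasSum_inv2 : exists c0 : C, hasSum (fun j : int => j%:~R ^- 2) c0.
Proof.
apply: asummable_ex; apply: (@asummable_le R int _ (fun j => 4 * sqd R `|j|%N)).
  move=> j; have [->|j0] := eqVneq j 0.
    by rewrite mulr0z inv0sq nrm0 mulr_ge0// sqd_ge0.
  have j1 : (1 : R) <= `|j|%N%:R by rewrite ler1n absz_gt0.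
  rewrite nrmV nrmX nrm_int -intr_norm -natr_absz /sqd -[4]invrK -invfM lef_pV2 ?posrE.
  - by nra.
  - by rewrite exprn_gt0//; lra.
  by rewrite mulr_gt0// exprn_gt0//; lra.
by apply: bsumZ (bsum_sqd_int R).
Qed.

End RowZero.

(** * The period lattice and the Weierstrass function *)

Section Lattice.
Variable R : realType.
Local Notation C := (cplx R).
Local Notation tpi := (tpi R).
Implicit Types (t z w : C).

Definition wlat t (ab : int * int) : C := ab.1%:~R * t + ab.2%:~R.

Definition slat (ab : int * int) : R := `|ab.1|%N%:R + `|ab.2|%N%:R.

Definition nolat t z := forall ab : int * int, z <> wlat t ab.

Lemma slat_ge0 ab : 0 <= slat ab. Proof. by rewrite addr_ge0. Qed.

(** The imaginary part of w controls |a|, and then b = w - a t controls |b|; [K] collects the two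
    constants. *)
Lemma wlat_lower t : 0 < im t -> exists2 c, 0 < c & forall ab, c * slat ab <= nrm (wlat t ab).
Proof.
move=> t0; pose K := 1 / im t + (1 + nrm t / im t).
have n0 := nrm_ge0 t.
have K0 : 0 < K.
  have i0 : 0 < (im t)^-1 by rewrite invr_gt0.
  have : 0 <= nrm t / im t by rewrite divr_ge0// ltW.
  by rewrite /K div1r; lra.
exists K^-1; first by rewrite invr_gt0.
move=> [a b]; rewrite mulrC ler_pdivrMr// /slat /wlat/=.
rewrite !natr_absz !intr_norm -!(nrm_int R) -/C.
set w := a%:~R * t + b%:~R.
have h1 : nrm (a%:~R : C) * im t <= nrm w.
  have : `|im w| <= nrm w by exact: im_le_nrm.
  by rewrite /w imD imM im_int re_int mul0r addr0 im_int addr0 normrM (gtr0_norm t0) nrm_int.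
have h2 : nrm (b%:~R : C) <= nrm w + nrm (a%:~R : C) * nrm t.
  rewrite -nrmM; have -> : b%:~R = w - a%:~R * t by rewrite /w addrC addKr.
  exact: ler_nrmB.
have h3 : nrm (a%:~R : C) <= nrm w / im t by rewrite ler_pdivlMr.
rewrite /K; have := nrm_ge0 (a%:~R : C).
have h4 : nrm (a%:~R : C) * nrm t <= nrm w / im t * nrm t by rewrite ler_wpM2r.
rewrite !mulrDr mulr1 mul1r; set u := nrm w / im t in h3 h4 *.
rewrite (_ : nrm w * (nrm t / im t) = u * nrm t); first by lra.
by rewrite /u; ring.
Qed.

Lemma wlat_lower_z t z : 0 < im t -> nolat t z ->
  exists2 c, 0 < c & forall ab, c * (1 + slat ab) <= nrm (z - wlat t ab).
Proof.
move=> t0 nz; have [c c0 hc] := wlat_lower t0.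
apply: (@lower_linear R _ _ slat c (nrm z)) => //.
- exact: int2_fin.
- exact: slat_ge0.
- by move=> ab; rewrite nrm_gt0 subr_eq0; apply/eqP.
move=> ab; rewrite lerBlDr; apply: le_trans (hc ab) _.
by have := ler_nrmB z (z - wlat t ab); rewrite opprB addrCA subrr addr0; lra.
Qed.

Lemma wlat_lower1 t : 0 < im t ->
  exists2 c, 0 < c & forall ab, ab != 0 -> c * (1 + slat ab) <= nrm (wlat t ab).
Proof.
move=> t0; have [c c0 hc] := wlat_lower t0; exists (c / 2); first by rewrite divr_gt0.
move=> [a b] ab0; apply: le_trans (hc _).
have : (1 : R) <= slat (a, b).
  rewrite /slat /= -natrD ler1n addn_gt0 !absz_gt0 -negb_and.
  by apply: contra ab0 => /andP[/eqP -> /eqP ->].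
nra.
Qed.

Definition cub (ab : int * int) : R := ((1 + slat ab) ^+ 3)^-1.

Lemma cub_ge0 ab : 0 <= cub ab.
Proof. by rewrite invr_ge0 exprn_ge0// addr_ge0// slat_ge0. Qed.

(** The sum over b telescopes against 2/(1 + |a| + k)^2, which leaves the summable 4/(1 + |a|)^2 for
    the sum over a. *)
Lemma bsum_cub : bsum cub 16.
Proof.
have -> : (16 : R) = 4 * 4 by rewrite -natrM.
apply: (bsum_pair (G := fun a : int => 4 * sqd R `|a|%N)); last first.
  by apply: bsumZ (bsum_sqd_int R).
move=> a; have A0 : 0 <= (`|a|%N%:R : R) by [].
have e : 4 * sqd R `|a|%N = 2 * (2 / (1 + `|a|%N%:R + 0%N%:R) ^+ 2) by rewrite addr0 /sqd; ring.
rewrite e; apply: (@bsum_int R (fun k => ((1 + (`|a|%N%:R + k%:R)) ^+ 3)^-1)).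
  by move=> k; rewrite invr_ge0 exprn_ge0// !addr_ge0.
apply: (bsum_telescope (phi := fun k => 2 / (1 + `|a|%N%:R + k%:R) ^+ 2)) => k.
- by rewrite invr_ge0 exprn_ge0// !addr_ge0.
- by rewrite divr_ge0// sqr_ge0.
rewrite -[k.+1%:R]natr1; have k0 : 0 <= (k%:R : R) by [].
set x := 1 + `|a|%N%:R + k%:R; rewrite (_ : 1 + (_ + k%:R) = x); last by rewrite /x addrA.
rewrite (_ : 1 + `|a|%N%:R + (k%:R + 1) = x + 1); last by rewrite /x; ring.
have x1 : 1 <= x by rewrite /x; lra.
rewrite -subr_ge0 (_ : _ - _ = (3 * x ^+ 2 - 1) / (x ^+ 3 * (x + 1) ^+ 2)).
  rewrite divr_ge0//; first by nra.
  by rewrite mulr_ge0 ?sqr_ge0// exprn_ge0//; lra.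
by field; rewrite !gt_eqF//; lra.
Qed.

Definition wterm t z (ab : int * int) : C :=
  if ab == (0, 0) then 0 else (z - wlat t ab) ^- 2 - (wlat t ab) ^- 2.

(** The difference of the two inverse squares is (2 z/w - z^2/w^2)/(z - w)^2, of order |w|^-3. *)
Lemma asummable_wterm t z : 0 < im t -> nolat t z -> asummable (wterm t z).
Proof.
move=> t0 nz; have [c1 c10 h1] := wlat_lower1 t0; have [c2 c20 h2] := wlat_lower_z t0 nz.
pose K := (2 * nrm z / c1 + nrm z ^+ 2 / c1 ^+ 2) / c2 ^+ 2.
have n0 := nrm_ge0 z.
have K0 : 0 <= K.
  by rewrite divr_ge0 ?sqr_ge0// addr_ge0// divr_ge0 ?sqr_ge0 ?mulr_ge0// ltW.
apply: (asummable_le (g := fun ab => K * cub ab)) (bsumZ K0 bsum_cub) => ab.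
rewrite /wterm; case: eqP => [_|/eqP ab0]; first by rewrite nrm0 mulr_ge0// cub_ge0.
have := h1 ab ab0; have := h2 ab; have s0 := slat_ge0 ab.
set w := wlat t ab => b2 b1; set s := 1 + slat ab in b1 b2.
have s1 : 1 <= s by rewrite /s; lra.
have wn : 0 < nrm w by apply: lt_le_trans b1; rewrite mulr_gt0//; lra.
have zn : 0 < nrm (z - w) by apply: lt_le_trans b2; rewrite mulr_gt0//; lra.
have w0 : w != 0 by rewrite -nrm_gt0.
have z0 : z - w != 0 by rewrite -nrm_gt0.
have -> : (z - w) ^- 2 - w ^- 2 = (2 * z * w^-1 - z ^+ 2 * w ^- 2) * (z - w) ^- 2.
  by field; rewrite w0 z0.
rewrite nrmM; have i1 : (nrm w)^-1 <= (c1 * s)^-1 by rewrite lef_pV2// posrE mulr_gt0//; lra.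
have i2 : (nrm (z - w))^-1 <= (c2 * s)^-1 by rewrite lef_pV2// posrE mulr_gt0//; lra.
have iv0 (a : R) : 0 < a -> 0 <= a^-1 by move=> a0; rewrite invr_ge0 ltW.
have sV : 0 < s^-1 <= 1 by rewrite invr_gt0 invf_le1; lra.
have a1 : nrm (2 * z * w^-1 - z ^+ 2 * w ^- 2) <= (2 * nrm z / c1 + nrm z ^+ 2 / c1 ^+ 2) * s^-1.
  apply: le_trans (ler_nrmB _ _) _.
  rewrite [X in X + _](_ : _ = 2 * nrm z * (nrm w)^-1); last by rewrite nrmM nrmV nrmM nrm_nat.
  rewrite [X in _ + X](_ : _ = nrm z ^+ 2 * (nrm w) ^- 2); last by rewrite nrmM nrmV !nrmX.
  rewrite [leRHS]mulrDl lerD//.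
    by rewrite -[leRHS]mulrA -invfM ler_wpM2l// mulr_ge0.
  rewrite -[leRHS]mulrA ler_wpM2l ?sqr_ge0//.
  apply: (@le_trans _ _ ((c1 * s) ^- 2)).
    by rewrite -!exprVn lerXn2r ?nnegrE ?iv0// mulr_gt0//; lra.
  rewrite exprMn invfM ler_wpM2l ?invr_ge0 ?sqr_ge0// -exprVn expr2.
  by rewrite ler_piMr//; lra.
have a2 : nrm ((z - w) ^- 2) <= (c2 * s) ^- 2.
  by rewrite nrmV nrmX -!exprVn lerXn2r ?nnegrE ?iv0// mulr_gt0//; lra.
apply: le_trans (ler_pM (nrm_ge0 _) (nrm_ge0 _) a1 a2) _.
rewrite le_eqVlt; apply/orP; left; apply/eqP.
rewrite /K /cub -/s; field; rewrite !gt_eqF//; lra.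
Qed.

Lemma wp_sum t z : 0 < im t -> nolat t z -> hasSum (wterm t z) (wp t z - (z ^+ 2)^-1).
Proof.
move=> t0 nz; have h := tsumP (asummable_wterm t0 nz).
suff -> : wp t z - (z ^+ 2)^-1 = tsum (wterm t z) by [].
rewrite /wp addrC addKr -(sum_hasSum h); congr (summability.sum _).
Qed.

Lemma noint_lat t (a : int) : 0 < im t -> a != 0 -> noint (a%:~R * t).
Proof.
move=> t0 a0 n h; have := congr1 (@im R) h; rewrite imM !im_int re_int mul0r addr0.
move=> /eqP; rewrite mulf_eq0 intr_eq0 (negbTE a0)/= => /eqP t00.
by rewrite t00 ltxx in t0.
Qed.

Lemma noint_nolat t z (a : int) : nolat t z -> noint (z - a%:~R * t).
Proof. by move=> nz n h; apply: (nz (a, n)); rewrite /wlat /= -h addrC subrK. Qed.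

Lemma opp_bij : bijective (fun j : int => - j).
Proof. by exists (fun j => - j) => j; rewrite opprK. Qed.

(** The absolutely convergent series is summed row by row; for a != 0 both halves of row a are given
    by [hasSum_row]. Row a = 0 omits the lattice point 0, which costs z^-2, and contains the sum c0
    of the b^-2; the default [vv 0] = 0 lets it take the same form as the others. *)
Lemma wp_rows t z c0 : 0 < im t -> nolat t z -> hasSum (fun j : int => j%:~R ^- 2) c0 ->
  hasSum (fun a : int => tpi ^+ 2 * (vv (z - a%:~R * t) - vv (a%:~R * t))) (wp t z + c0).
Proof.
move=> t0 nz h0.
have hrow (a : int) : hasSum (fun b : int => (z - wlat t (a, b)) ^- 2) (tpi ^+ 2 * vv (z - a%:~R * t)).
  have := hasSum_row (@noint_nolat t z a nz) => /(hasSum_bij _ _ opp_bij).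
  by apply: eq_hasSum => b; rewrite /wlat /= mulrNz opprD addrA.
have hr (a : int) : a != 0 -> hasSum (fun b : int => (wlat t (a, b)) ^- 2) (tpi ^+ 2 * vv (a%:~R * t)).
  by move=> a0; exact: hasSum_row (noint_lat t0 a0).
have h1 := hasSum_pair (g := fun a : int => tpi ^+ 2 * (vv (z - a%:~R * t) - vv (a%:~R * t)) -
    (if a == 0 then (z ^+ 2)^-1 + c0 else 0)) _ (wp_sum t0 nz).
have {}h1 := h1 _; have h2 : hasSum (fun a : int => if a == 0 then (z ^+ 2)^-1 + c0 else 0 : C) ((z ^+ 2)^-1 + c0).
  have := @hasSum_support R int (fun a => if a == 0 then (z ^+ 2)^-1 + c0 else 0) [fset (0 : int)]%fset.
  by rewrite big_seq_fset1 eqxx; apply => i; rewrite inE => /negbTE ->.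
rewrite (_ : wp t z + c0 = wp t z - (z ^+ 2)^-1 + ((z ^+ 2)^-1 + c0)); last by ring.
apply: eq_hasSum (hasSumD (h1 _) h2) => [a|a]; first by rewrite subrK.
have [->|a0] := eqVneq a 0.
  rewrite mul0r subr0 /vv uu0 invr0 subr0.
  have hz := hrow 0; rewrite mul0r subr0 in hz.
  have h3 : hasSum (fun b : int => if b == 0 then (z ^+ 2)^-1 else 0 : C) ((z ^+ 2)^-1).
    have := @hasSum_support R int (fun a => if a == 0 then (z ^+ 2)^-1 else 0) [fset (0 : int)]%fset.
    by rewrite big_seq_fset1 eqxx; apply => i; rewrite inE => /negbTE ->.
  have := hasSumB (hasSumB hz h3) h0; rewrite opprD addrA; apply: eq_hasSum => b.
  rewrite /wterm /wlat xpair_eqE eqxx /= mul0r !add0r.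
  case: eqP => [->|_]; last by rewrite subr0.
  by rewrite mulr0z inv0sq !subr0 subrr.
rewrite subr0 mulrBr; apply: eq_hasSum (hasSumB (hrow a) (hr a a0)) => b.
by rewrite /wterm xpair_eqE (negbTE a0).
Qed.

Lemma rot_bij : bijective (fun ab : int * int => (ab.2, - ab.1)).
Proof.
by exists (fun ab : int * int => (- ab.2, ab.1)) => -[a b] /=; rewrite ?opprK.
Qed.

Lemma wlat_S t ab : t != 0 -> wlat (- t^-1) ab = wlat t (ab.2, - ab.1) / t.
Proof. by move=> t0; rewrite /wlat /= mulrNz; field. Qed.

Lemma im_neq0 t : 0 < im t -> t != 0.
Proof. by move=> h; apply: contraTneq h => ->; rewrite (im_nat _ 0) ltxx. Qed.

Lemma im_S t : 0 < im t -> 0 < im (- t^-1).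
Proof.
move=> h; have t0 := im_neq0 h; have n0 : 0 < nrm t by rewrite nrm_gt0.
have e : - t^-1 = ofR (- (nrm t ^- 2)) * (ofR (re t) - 'i * ofR (im t)).
  apply: (mulfI t0); rewrite mulrN mulfV// mulrCA {2}(reim t).
  rewrite (_ : (ofR (re t) + 'i * ofR (im t)) * (ofR (re t) - 'i * ofR (im t)) = ofR (nrm t ^+ 2)).
    by rewrite -ofRM mulNr mulVf ?ofRN// expf_neq0// gt_eqF.
  rewrite nrm_sqr ofRD !ofRX [LHS](_ : _ = ofR (re t) ^+ 2 - 'i ^+ 2 * ofR (im t) ^+ 2); last by ring.
  by rewrite sqrCi; ring.
rewrite e imM re_ofR im_ofR mul0r addr0 imD im_ofR imN imM re_i im_i re_ofR im_ofR mul0r mul1r !add0r.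
by rewrite mulNr mulrN opprK mulr_gt0// invr_gt0 exprn_gt0.
Qed.

Lemma nolat_S t z : 0 < im t -> nolat t z -> nolat (- t^-1) (z / t).
Proof.
move=> t0 nz ab h; have tn := im_neq0 t0.
by apply: (nz (ab.2, - ab.1)); rewrite -[RHS](divfK tn) -wlat_S// -h divfK.
Qed.

(** The lattice of -1/t is that of t divided by t, with (a, b) sent to (b, -a). Absolute convergence
    makes the sum insensitive to this permutation, so the weight is read off termwise. *)
Lemma wp_S t z : 0 < im t -> nolat t z -> wp (- t^-1) (z / t) = t ^+ 2 * wp t z.
Proof.
move=> t0 nz; have tn := im_neq0 t0.
have h1 := wp_sum (im_S t0) (nolat_S t0 nz).
have := hasSumZ (t ^+ 2) ((hasSum_bij (wterm t z) _ rot_bij).1 (wp_sum t0 nz)) => h2.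
suff e : wp (- t^-1) (z / t) - ((z / t) ^+ 2)^-1 = t ^+ 2 * (wp t z - (z ^+ 2)^-1).
  rewrite -[LHS](subrK (((z / t) ^+ 2)^-1)) e mulrBr -addrA -[RHS]addr0; congr (_ + _).
  by rewrite expr_div_n invf_div addrC subrr.
apply: hasSum_unique h1 _; apply: eq_hasSum h2 => ab /=.
rewrite /wterm wlat_S//; have -> : ((ab.2, - ab.1) == (0, 0)) = (ab == (0, 0)).
  by case: ab => a b; rewrite !xpair_eqE oppr_eq0 andbC.
case: eqP => _; first by rewrite mulr0.
rewrite -mulrBl !expr_div_n !invf_div; ring.
Qed.

End Lattice.

(** * Geometric series for v in the upper half-plane *)

Section Geometric.
Variable R : realType.
Local Notation C := (cplx R).
Implicit Types (x z : C).

Lemma bsum_geo (r : R) : 0 <= r < 1 -> bsum (fun k : nat => r ^+ k) (1 - r)^-1.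
Proof.
move=> /andP[r0 r1]; have p : 0 < 1 - r by rewrite subr_gt0.
have e : (1 - r)^-1 = r ^+ 0 / (1 - r) by rewrite expr0 mul1r.
rewrite e; apply: (bsum_telescope (phi := fun k => r ^+ k / (1 - r))) => k.
- by rewrite exprn_ge0.
- by rewrite divr_ge0 ?exprn_ge0// ltW.
rewrite -mulrBl -{2}(mulr1 (r ^+ k)) exprSr -mulrBr mulfK// gt_eqF//.
Qed.

Lemma hasSum_succ (f : nat -> C) l :
  hasSum (fun k => f k.+1) l -> hasSum f (f 0%N + l).
Proof.
move=> h.
have h0 : hasSum (fun k => if k == 0%N then f k else 0) (f 0%N).
  have := @hasSum_support R nat (fun k => if k == 0%N then f k else 0) [fset 0%N]%fset.
  by rewrite big_seq_fset1 eqxx; apply => i; rewrite inE => /negbTE ->.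
have h1 : hasSum (fun k => if k == 0%N then 0 else f k) l.
  apply/(hasSum_inj (h := S)) => [a b []//|[|k]//= /(_ k)//|].
  exact: eq_hasSum h.
apply: eq_hasSum (hasSumD h0 h1) => k.
by case: eqP => _; rewrite ?addr0 ?add0r.
Qed.

Lemma hasSum_geo x : nrm x < 1 -> hasSum (fun k : nat => x ^+ k) (1 - x)^-1.
Proof.
move=> x1.
have as_ : asummable (fun k : nat => x ^+ k).
  apply: (asummable_le (g := fun k => nrm x ^+ k)) (bsum_geo _) => [k|].
    by rewrite nrmX.
  by rewrite nrm_ge0.
have h := tsumP as_; set s := tsum _ in h.
have h2 := hasSum_succ (f := fun k => x ^+ k) (l := x * s).
have {}h2 := h2 (eq_hasSum (fun k => esym (exprS x k)) (hasSumZ x h)).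
have e := hasSum_unique h h2; rewrite expr0 in e.
have x0 : 1 - x != 0.
  by rewrite subr_eq0; apply: contraTneq x1 => <-; rewrite nrm1 ltxx.
suff -> : (1 - x)^-1 = s by [].
by apply: (mulfI x0); rewrite mulfV// mulrBl mul1r {1}e addrK.
Qed.

Lemma nrm_ee_lt1 z : 0 < im z -> nrm (ee z) < 1.
Proof.
move=> z0; rewrite nrm_ee -(expR0 R) ltr_expR oppr_lt0 !mulr_gt0//.
exact: pi_gt0.
Qed.

Lemma im_noint z : im z != 0 -> noint z.
Proof. by move=> z0 n zn; rewrite zn im_int eqxx in z0. Qed.

Lemma hasSum_vv z : 0 < im z ->
  hasSum (fun ij : nat * nat => ee z * (ee z ^+ ij.1 * ee z ^+ ij.2)) (vv z).
Proof.
move=> z0; have n1 := nrm_ee_lt1 z0.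
rewrite vvE expr2 invfM.
by apply: hasSumZ; apply: hasSumM; exact: hasSum_geo.
Qed.

Lemma nrm_vv_le z : 0 < im z -> nrm (vv z) <= nrm (ee z) / (1 - nrm (ee z)) ^+ 2.
Proof.
move=> z0; have n1 := nrm_ee_lt1 z0; rewrite vvE nrmM nrmV nrmX.
rewrite ler_wpM2l ?nrm_ge0//.
have p : 0 < 1 - nrm (ee z) by rewrite subr_gt0.
have h : 1 - nrm (ee z) <= nrm (1 - ee z) by have := nrm_distl 1 (ee z); rewrite nrm1.
rewrite lef_pV2 ?posrE ?exprn_gt0//; last exact: lt_le_trans h.
by rewrite lerXn2r ?nnegrE ?nrm_ge0// ltW.
Qed.

Lemma bsum_vv (t : C) : 0 < im t ->
  exists M, bsum (fun a : int => nrm (vv (a%:~R * t))) M.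
Proof.
move=> t0; have n1 := nrm_ee_lt1 t0; have n0 := nrm_ge0 (ee t).
have p : 0 < 1 - nrm (ee t) by rewrite subr_gt0.
pose g (k : nat) : R := nrm (ee t) ^+ k / (1 - nrm (ee t)) ^+ 2.
have gM : bsum g ((1 - nrm (ee t)) ^- 2 * (1 - nrm (ee t))^-1).
  have h := @bsum_geo (nrm (ee t)); rewrite n0 n1 in h.
  apply: bsum_le (bsumZ _ (h isT)); last by rewrite invr_ge0 sqr_ge0.
  by move=> k; rewrite mulrC.
have g0 k : 0 <= g k by rewrite divr_ge0// exprn_ge0// ltW.
exists (2 * ((1 - nrm (ee t)) ^- 2 * (1 - nrm (ee t))^-1)).
apply: bsum_le (bsum_int g0 gM) => a.
have key (k : nat) : nrm (vv (k.+1%:R * t)) <= g k.+1.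
  have im0 : 0 < im (k.+1%:R * t) by rewrite imM im_nat re_nat mul0r addr0 mulr_gt0.
  apply: le_trans (nrm_vv_le im0) _; rewrite ee_nat nrmX /g.
  rewrite ler_wpM2l ?exprn_ge0// lef_pV2 ?posrE ?exprn_gt0//; last first.
    by rewrite subr_gt0 exprn_ilt1.
  have h : nrm (ee t) ^+ k.+1 <= nrm (ee t).
    by rewrite exprS ler_piMr// exprn_ile1// ltW.
  by rewrite lerXn2r ?nnegrE//; lra.
case: (intP a) => [|k|k].
- by rewrite mul0r /vv uu0 invr0 nrm0.
- by rewrite -pmulrn.
by rewrite mulrNz mulNr vvN abszN -pmulrn.
Qed.

End Geometric.

(** * Quasi-periods and lattice product of A *)

Section FormA.
Variable R : realType.
Local Notation C := (cplx R).
Local Notation tpi := (tpi R).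
Implicit Types (t z w : C).

Lemma FF_bound t z : 0 < im t -> exists (m : int -> R) M, bsum m M /\
  forall a : int, nrm (- (uu z * vv (a%:~R * t))) <= m a.
Proof.
move=> t0; have [M hM] := bsum_vv t0.
exists (fun a => nrm (uu z) * nrm (vv (a%:~R * t))), (nrm (uu z) * M); split.
  exact: bsumZ (nrm_ge0 _) hM.
by move=> a; rewrite nrmN nrmM.
Qed.

Lemma int_succ_inj : injective (fun n : nat => n.+1%:Z).
Proof. by move=> a b []. Qed.

Lemma formA_hasProd t z : 0 < im t -> exists p,
  hasProd (fun n : nat => FF z (n.+1%:R * t)) p /\ formA t z = uu z * p ^+ 2.
Proof.
move=> t0; have [m [M [mM xm]]] := FF_bound z t0.
have [p hp] := @hasProd_ex R nat (fun n => - (uu z * vv (n.+1%:Z%:~R * t))) _ _ (fun n => xm n.+1%:Z)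
  (bsum_inj int_succ_inj mM).
have {}hp : hasProd (fun n : nat => FF z (n.+1%:R * t)) p.
  by apply: eq_hasProd hp => n; rewrite /FF -pmulrn.
exists p; split => //; rewrite /formA -/(uu z); congr (_ * _).
apply: cvg_lim; first exact: norm_hausdorff.
apply: eq_cvgC (cvCX 2 (hasProd_nat hp)) => N.
rewrite big_add1 /= -prodrXl; apply: eq_bigr => n _.
have nt : noint (n.+1%:R * t).
  by apply: im_noint; rewrite imM im_nat re_nat mul0r addr0 mulf_neq0 ?gt_eqF.
rewrite FFE// -ee_nat !exprMn exprVn -exprM; congr (_ * _ * _).
Qed.

Lemma formA_N t z : 0 < im t -> formA t (- z) = formA t z.
Proof.
move=> t0; have [p [hp ->]] := formA_hasProd z t0; have [q [hq ->]] := formA_hasProd (- z) t0.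
rewrite uuN (hasProd_unique hp (eq_hasProd _ hq))// => n.
by rewrite /FF uuN.
Qed.

Lemma formA_D1 t z : 0 < im t -> formA t (z + 1) = formA t z.
Proof.
move=> t0; have [p [hp ->]] := formA_hasProd z t0; have [q [hq ->]] := formA_hasProd (z + 1) t0.
have e : uu (z + 1) = uu z by exact: (uuZ z 1).
rewrite e (hasProd_unique hp (eq_hasProd _ hq))// => n.
by rewrite /FF e.
Qed.

(** Passing from z to z + t moves the factors one step along the product. For finite products this
    is the identity [step], whose boundary factors involving q^N tend to 1; it is written without
    division because 1 - q y may vanish. *)
Lemma formA_Dt t z : 0 < im t -> formA t (z + t) = ee (- t - 2 * z) * formA t z.
Proof.
move=> t0; have [p [hp ->]] := formA_hasProd z t0; have [p' [hp' ->]] := formA_hasProd (z + t) t0.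
set q := ee t; set y := ee z.
have q0 : q != 0 by exact: ee_neq0.
have y0 : y != 0 by exact: ee_neq0.
have nq : nrm q < 1 by exact: nrm_ee_lt1.
pose T (x : C) N := \prod_(0 <= n < N) FF x (n.+1%:R * t).
have nt n : noint (n.+1%:R * t).
  by apply: im_noint; rewrite imM im_nat re_nat mul0r addr0 mulf_neq0 ?gt_eqF.
have step N : (1 - q * y) * (1 - q ^+ N / y) * T (z + t) N = (1 - q ^+ N.+1 * y) * (1 - y^-1) * T z N.
  elim: N => [|N ih]; first by rewrite /T !big_geq// expr0 expr1 mul1r.
  rewrite /T !big_nat_recr//= -/(T _ N) -/(T _ N) !FFE// !ee_nat -/q -/y eeD -/q -/y.
  have d0 : 1 - q ^+ N.+1 != 0 by have := ee_noint (nt N); rewrite ee_nat.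
  set u := T z N in ih *; set v := T (z + t) N in ih *.
  have -> : (1 - q * y) * (1 - q ^+ N.+1 / y) *
     (v * ((1 - q ^+ N.+1 * (y * q)) * (1 - q ^+ N.+1 / (y * q)) / (1 - q ^+ N.+1) ^+ 2)) =
     ((1 - q * y) * (1 - q ^+ N / y) * v) *
     ((1 - q ^+ N.+1 / y) * (1 - q ^+ N.+2 * y) / (1 - q ^+ N.+1) ^+ 2).
    by rewrite !exprS; rewrite !exprS in d0; field; rewrite d0 q0 y0.
  rewrite ih; field; by rewrite d0 y0.
have qc : q ^+ N @[N --> \oo] --> (0 : C).
  apply/cvg_nrmP => e e0; have := @cvg_geometric R 1 (nrm q).
  rewrite ger0_norm ?nrm_ge0// => /(_ nq) /cvgrPdist_lt/(_ _ e0).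
  apply: filterS => N /=; rewrite /geometric /= mul1r !subr0 sub0r normrN nrmX.
  by rewrite ger0_norm ?exprn_ge0 ?nrm_ge0.
have e1 : (1 - q * y) * p' = (1 - y^-1) * p.
  have qc1 : q ^+ N.+1 @[N --> \oo] --> (0 : C).
    pose proof (cvCM (cvC_cst q) qc) as h; rewrite mulr0 in h.
    by apply: eq_cvgC h => N; rewrite exprS.
  pose proof (cvCM (cvCM (cvC_cst (1 - q * y)) (cvCB (cvC_cst 1) (cvCM qc (cvC_cst y^-1))))
    (hasProd_nat hp')) as h1.
  pose proof (cvCM (cvCM (cvCB (cvC_cst 1) (cvCM qc1 (cvC_cst y))) (cvC_cst (1 - y^-1)))
    (hasProd_nat hp)) as h2.
  rewrite !mul0r !subr0 mulr1 in h1; rewrite !mul0r !subr0 mul1r in h2.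
  apply: (cvg_unique (@norm_hausdorff _ _) _ h2).
  by apply: eq_cvgC h1 => N; exact: step.
rewrite !uuE eeB eeN ee_nat eeD -/q -/y.
have -> : (1 - y * q) ^+ 2 / (y * q) * p' ^+ 2 = ((1 - q * y) * p') ^+ 2 / (y * q).
  by field; rewrite q0 y0.
rewrite e1; field; by rewrite q0 y0.
Qed.

Lemma sg_bound (X : R) : 0 <= X -> exists2 K, 0 <= K & forall x : C, nrm x <= X ->
  nrm ((1 - x) * cexp x - 1) <= K * nrm x ^+ 2.
Proof.
move=> X0; have E0 := expR_ge0 X.
exists (4 * expR X + 4 * X * expR X + 1).
  by rewrite !addr_ge0// !mulr_ge0.
move=> x xX; set e := cexp x - 1 - x.
have -> : (1 - x) * cexp x - 1 = e - x * (e + x) by rewrite /e; ring.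
have n0 := nrm_ge0 x.
have he : nrm e <= 4 * nrm x ^+ 2 * expR X.
  apply: le_trans (nrm_cexp_sub1 x) _; rewrite ler_wpM2l ?mulr_ge0 ?sqr_ge0//.
  by rewrite ler_expR.
apply: le_trans (ler_nrmB _ _) _; rewrite nrmM.
have h2 := ler_nrmD e x.
have s0 : 0 <= nrm x ^+ 2 by rewrite sqr_ge0.
have h3 : nrm x * nrm (e + x) <= nrm x * (4 * nrm x ^+ 2 * expR X + nrm x).
  by rewrite ler_wpM2l//; lra.
have h4 : nrm x * (4 * nrm x ^+ 2 * expR X) <= X * (4 * nrm x ^+ 2 * expR X).
  by rewrite ler_wpM2r// !mulr_ge0.
rewrite mulrDr -expr2 in h3; lra.
Qed.

(** The factors of the Weierstrass sigma function at w and -w, multiplied together. The exponential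
    makes the product over the lattice absolutely convergent, and at w = 0 the factor is 1 by the
    convention 1/0 = 0. *)
Definition sgm t z (ab : int * int) : C :=
  (1 - z ^+ 2 / wlat t ab ^+ 2) * cexp (z ^+ 2 / wlat t ab ^+ 2).

Lemma sgm_bound t z : 0 < im t -> exists (m : int * int -> R) M, bsum m M /\
  forall ab, nrm (sgm t z ab - 1) <= m ab.
Proof.
move=> t0; have [c c0 hc] := wlat_lower1 t0.
have X0 : 0 <= nrm z ^+ 2 / c ^+ 2 by rewrite divr_ge0 ?sqr_ge0.
have xb ab : nrm (z ^+ 2 / wlat t ab ^+ 2) <= nrm z ^+ 2 / c ^+ 2 * ((1 + slat R ab) ^- 2).
  have i0 : 0 <= (1 + slat R ab) ^- 2 by rewrite invr_ge0 sqr_ge0.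
  have [->|ab0] := eqVneq ab 0.
    by rewrite /wlat /= mul0r add0r mulr0z inv0sq mulr0 nrm0 mulr_ge0 ?X0// invr_ge0 sqr_ge0.
  have s0 : 0 < c * (1 + slat R ab) by rewrite mulr_gt0// ltr_pwDl// slat_ge0.
  rewrite nrmM nrmV !nrmX -mulrA ler_wpM2l ?sqr_ge0// -invfM -exprMn.
  rewrite lef_pV2 ?posrE ?exprn_gt0//; last exact: lt_le_trans (hc _ ab0).
  by rewrite lerXn2r ?nnegrE ?nrm_ge0 ?(ltW s0) ?hc.
have [K K0 hK] := sg_bound X0.
exists (fun ab => K * (nrm z ^+ 2 / c ^+ 2) ^+ 2 * cub R ab), (K * (nrm z ^+ 2 / c ^+ 2) ^+ 2 * 16); split.
  by apply: bsumZ (bsum_cub R); rewrite mulr_ge0// sqr_ge0.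
move=> ab; have h := xb ab; have s0 := slat_ge0 R ab.
have i1 : (1 + slat R ab) ^- 2 <= 1 by rewrite invf_le1 ?exprn_gt0 ?exprn_ege1//; lra.
have h1 : nrm (z ^+ 2 / wlat t ab ^+ 2) <= nrm z ^+ 2 / c ^+ 2.
  by apply: le_trans h _; rewrite ler_piMr.
apply: le_trans (hK _ h1) _; rewrite -mulrA ler_wpM2l//.
apply: (@le_trans _ _ ((nrm z ^+ 2 / c ^+ 2 * (1 + slat R ab) ^- 2) ^+ 2)).
  by rewrite lerXn2r ?nnegrE ?nrm_ge0// mulr_ge0// invr_ge0 sqr_ge0.
rewrite exprMn ler_wpM2l ?sqr_ge0// /cub exprVn -exprM lef_pV2 ?posrE ?exprn_gt0//; try lra.
by rewrite ler_weXn2l//; lra.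
Qed.

(** In the row-by-row product, row a != 0 contributes [FF z (a t)] and the exponential of z^2 times
    its sum of w^-2. These sums add up to k, the weight 2 Eisenstein series summed by rows. Thus A
    is a constant times sigma(z)^2 times the exponential of a multiple of z^2. *)
Lemma formA_lattice t z (P : C) : 0 < im t -> z != 0 -> hasProd (sgm t z) P ->
  forall k, hasSum (fun a : int => (if a == 0 then tsum (fun j : int => j%:~R ^- 2)
     else tpi ^+ 2 * vv (a%:~R * t))) k ->
  formA t z = (tpi * z) ^+ 2 * P * cexp (- (z ^+ 2 * k)).
Proof.
move=> t0 z0 hP k hk; have [m [M [mM hm]]] := sgm_bound z t0.
have [c0 hc0] := hasSum_inv2 R; rewrite (hasSum_tsum hc0) in hk.
pose r1 (a : int) : C := if a == 0 then uu z / (tpi * z) ^+ 2 else FF z (a%:~R * t).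
pose kk (a : int) : C := if a == 0 then c0 else tpi ^+ 2 * vv (a%:~R * t).
have hr (a : int) : hasProd (fun b : int => sgm t z (a, b)) (r1 a * cexp (z ^+ 2 * kk a)).
  rewrite /r1 /kk /sgm; case: eqP => [->|/eqP a0].
    have := hasProdM (hasProd_row0 z0) (hasProd_exp (hasSumZ (z ^+ 2) hc0)).
    by apply: eq_hasProd => b; rewrite /wlat /= mul0r add0r.
  have nt := noint_lat t0 a0.
  exact: hasProdM (hasProd_row z nt) (hasProd_exp (hasSumZ (z ^+ 2) (hasSum_row nt))).
have h1 : hasProd (fun a => r1 a * cexp (z ^+ 2 * kk a)) P.
  apply: (@hasProd_fiberE R _ _ fst (fun ab => sgm t z ab - 1) m M) => //.
    move=> a; have [||q hq] := @hasProd_ex R _ (fun ab : int * int => if ab.1 == a then sgm t z ab - 1 else 0) m M => //.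
      by move=> ab; case: ifP => // _; rewrite nrm0; apply: le_trans (hm ab); exact: nrm_ge0.
    have e : q = r1 a * cexp (z ^+ 2 * kk a).
      apply: hasProd_unique (hr a); have hi : injective (fun b : int => (a, b)) by move=> ? ? [].
      apply: eq_hasProd (hasProd_restrict hi _ hq) => [b|[a' b] h] /=.
        by rewrite eqxx addrC subrK.
      by case: eqP => [e|]; rewrite ?addr0//; case: (h b); rewrite e.
    rewrite -e; apply: eq_hasProd hq => ab; case: ifP => _; last by rewrite addr0.
    by rewrite addrC subrK.
  by apply: eq_hasProd hP => ab; rewrite addrC subrK.
have h2 : hasProd r1 (P * cexp (- (z ^+ 2 * k))).
  have := hasProdM h1 (hasProd_exp (hasSumN (hasSumZ (z ^+ 2) hk))).
  by apply: eq_hasProd => a; rewrite cexpN mulfK// cexp_neq0.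
have [p [hp ->]] := formA_hasProd z t0; have [m' [M' [mM' hm']]] := FF_bound z t0.
(* Rows a and -a give equal factors, whence the square. *)
have h3 : hasProd (fun a : int => FF z (a%:~R * t)) (p ^+ 2).
  apply: (hasProd_even hm' mM').
  - by rewrite mul0r /vv uu0 invr0 mulr0 oppr0.
  - by move=> a; rewrite mulrNz mulNr vvN.
  by apply: eq_hasProd hp => n; rewrite /FF -pmulrn.
have h4 : hasProd r1 (uu z / (tpi * z) ^+ 2 * p ^+ 2).
  have := @hasProd_support R int (fun a => if a == 0 then uu z / (tpi * z) ^+ 2 else 1) [fset (0 : int)]%fset.
  rewrite big_seq_fset1 eqxx => hs; have {}hs := hs _.
  apply: eq_hasProd (hasProdM (hs _) h3) => [a|a]; last by rewrite inE => /negbTE ->.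
  rewrite /r1; case: eqP => [->|_]; last by rewrite mul1r.
  by rewrite mul0r /FF /vv uu0 invr0 mulr0 subr0 mulr1.
by rewrite -mulrA -(hasProd_unique h4 h2); field; rewrite z0 tpi_neq0.
Qed.

End FormA.

(** * Modular behaviour of A *)

Section ModularA.
Variable R : realType.
Local Notation C := (cplx R).
Local Notation tpi := (tpi R).
Implicit Types (t z w : C).

Lemma sgm_hasProd t z : 0 < im t -> exists P, hasProd (sgm t z) P.
Proof.
move=> t0; have [m [M [mM hm]]] := sgm_bound z t0.
have [P hP] := hasProd_ex hm mM; exists P.
by apply: eq_hasProd hP => ab; rewrite addrC subrK.
Qed.

Lemma row_const t : 0 < im t ->
  exists k, hasSum (fun a : int => (if a == 0 then tsum (fun j : int => j%:~R ^- 2)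
     else tpi ^+ 2 * vv (a%:~R * t))) k.
Proof.
move=> t0; have [M hM] := bsum_vv t0; apply: asummable_ex.
set c0 := tsum _.
apply: (@asummable_le R int _ (fun a : int => (if a \in [fset (0 : int)]%fset then nrm c0 else 0) +
   nrm (tpi ^+ 2) * nrm (vv (a%:~R * t)))).
  move=> a; rewrite inE; case: eqP => [_|_]; last by rewrite add0r nrmM.
  by rewrite lerDl mulr_ge0 ?nrm_ge0.
apply: bsumD; first exact: (@bsum_support R int (fun _ => nrm c0) [fset (0 : int)]%fset (fun _ => nrm_ge0 c0)).
exact: bsumZ (nrm_ge0 _) hM.
Qed.

Lemma formA_0 t : 0 < im t -> formA t 0 = 0.
Proof. by move=> t0; have [p [_ ->]] := formA_hasProd 0 t0; rewrite uu0 mul0r. Qed.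

(** The product [P] is the same for both lattices because [sgm] depends only on the ratio z/w. The
    row-by-row constants differ, which leaves an exponential of z^2 with unknown coefficient. *)
Lemma formA_S_exp t : 0 < im t ->
  exists k, forall z, formA (- t^-1) (z / t) * t ^+ 2 = formA t z * cexp (z ^+ 2 * k).
Proof.
move=> t0; have tn := im_neq0 t0; have t0' := im_S t0.
have [k hk] := row_const t0; have [k' hk'] := row_const t0'.
exists (k - k' / t ^+ 2) => z.
have [->|z0] := eqVneq z 0; first by rewrite mul0r !formA_0// !mul0r.
have [P hP] := sgm_hasProd z t0.
have hP' : hasProd (sgm (- t^-1) (z / t)) P.
  apply: eq_hasProd (hasProd_bij rot_bij hP) => ab /=.
  rewrite /sgm wlat_S//; set w := wlat t _.
  have -> : (z / t) ^+ 2 / (w / t) ^+ 2 = z ^+ 2 / w ^+ 2; last by [].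
  by rewrite !expr_div_n invf_div mulrA divfK// expf_neq0.
have zt : z / t != 0 by rewrite mulf_neq0// invr_eq0.
rewrite (formA_lattice t0 z0 hP hk) (formA_lattice t0' zt hP' hk').
rewrite -[RHS]mulrA -cexpD.
have -> : - (z ^+ 2 * k) + z ^+ 2 * (k - k' / t ^+ 2) = - ((z / t) ^+ 2 * k').
  by field.
by set E := cexp _; field.
Qed.

(** If the product p vanished, comparing it with the constant product 1 by [hasProd_lip] would give
    1 <= exp(M) |u(z)| M, which fails for small z. *)
Lemma formA_near0 t : 0 < im t ->
  exists2 d, 0 < d & forall z, nrm z < d -> z != 0 -> formA t z != 0.
Proof.
move=> t0; have [M hM] := bsum_vv t0.
have M0 := bsum_ge0 hM; have E0 := expR_gt0 M.
have /cvgC_P hu := @uu_cvg0 R 0.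
have [|d1 d10 h1] := hu (Num.min 1 (1 / (2 * (expR M * (M + 1))))).
  by rewrite lt_min ltr01 divr_gt0// !mulr_gt0// ltr_wpDl.
have [c [d2 [c0 d20 h2]]] := uu_small R.
exists (Num.min d1 d2); first by rewrite lt_min d10.
move=> z; rewrite lt_min => /andP[z1 z2] z0.
have u0 : uu z != 0.
  rewrite -nrm_gt0; apply: lt_le_trans (h2 z z2).1.
  by rewrite mulr_gt0// exprn_gt0// nrm_gt0.
have [p [hp ->]] := formA_hasProd z t0.
have := h1 z; rewrite subr0 uu0 subr0 lt_min => /(_ z1)/andP[u1 u2].
rewrite mulf_neq0// expf_neq0//; apply/eqP => p0; rewrite p0 in hp.
have hM' := bsum_inj int_succ_inj hM.
have h3 : nrm (1 - 0 : C) <= expR M * (nrm (uu z) * M).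
  apply: (@hasProd_lip R nat (fun _ => 0) (fun n => - (uu z * vv (n.+1%:Z%:~R * t))) _ M _ 1 0 _ _ hM').
  - by move=> n; rewrite nrm0 nrm_ge0.
  - by move=> n; rewrite nrmN nrmM /= ler_piMl ?nrm_ge0// ltW.
  - apply: bsum_le (bsumZ (nrm_ge0 (uu z)) hM') => n /=.
    by rewrite sub0r opprK nrmM.
  - by apply: eq_hasProd (hasProd1 _) => n; rewrite addr0.
  by apply: eq_hasProd hp => n; rewrite /FF -pmulrn.
move: u2; rewrite ltr_pdivlMr; last by rewrite !mulr_gt0// ltr_wpDl.
rewrite subr0 nrm1 in h3; have n0 := nrm_ge0 (uu z).
have := mulr_ge0 n0 (ltW E0).
have : nrm (uu z) * (2 * (expR M * (M + 1))) =
  2 * (expR M * (nrm (uu z) * M)) + 2 * (nrm (uu z) * expR M) by ring.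
lra.
Qed.

Lemma cexp_const (k : C) (d : R) : 0 < d ->
  (forall z, nrm z < d -> z != 0 -> cexp (z * k) = 1) -> k = 0.
Proof.
move=> d0 h; apply/eqP; apply: contraT => k0.
have kn : 0 < nrm k by rewrite nrm_gt0.
have E0 := expR_gt0 (1 : R).
pose a := Num.min (d / 2) (Num.min 1 (1 / (8 * expR 1)) / nrm k).
have a0 : 0 < a.
  rewrite lt_min divr_gt0//= divr_gt0// lt_min ltr01 divr_gt0// mulr_gt0//.
have na : nrm (ofR a) = a by rewrite nrm_ofR gtr0_norm.
have ad : a < d.
  have : a <= d / 2 by rewrite /a ge_min lexx.
  lra.
have h1 := h (ofR a); rewrite na in h1; have {}h1 := h1 ad.
have {}h1 : cexp (ofR a * k) = 1 by apply: h1; rewrite -nrm_gt0 na.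
have := nrm_cexp_sub1 (ofR a * k); rewrite h1 subrr sub0r nrmN.
set x := nrm (ofR a * k).
have xE : x = a * nrm k by rewrite /x nrmM na.
have x0 : 0 < x by rewrite xE mulr_gt0.
have x1 : x <= Num.min 1 (1 / (8 * expR 1)).
  by rewrite xE -ler_pdivlMr// /a ge_min lexx orbT.
move: x1; rewrite le_min => /andP[x1 x2].
have e1 : expR x <= expR 1 by rewrite ler_expR.
move: x2; rewrite ler_pdivlMr ?mulr_gt0// => x2 x3.
have e2 : 4 * x ^+ 2 * expR x <= 4 * x ^+ 2 * expR 1.
  by rewrite ler_wpM2l// mulr_ge0// sqr_ge0.
have : 4 * x ^+ 2 * expR 1 = x * (x * (8 * expR 1)) / 2 by field.
have : x * (x * (8 * expR 1)) <= x * 1 by rewrite ler_wpM2l// ltW.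
lra.
Qed.

(** The unknown k is found by comparing z with z + 1: A has period 1 in z, whereas z/t then moves by
    a quasi-period of the lattice of -1/t. This gives exp((2 w + 1)(k - 2 pi i/t)) = 1 for all small
    w != 0, hence k = 2 pi i/t. *)
Lemma formA_S t z : 0 < im t -> formA (- t^-1) (z / t) * t ^+ 2 = ee (z ^+ 2 / t) * formA t z.
Proof.
move=> t0; have tn := im_neq0 t0; have t0' := im_S t0.
have [k hk] := formA_S_exp t0; have [d d0 hd] := formA_near0 t0.
have t2 : t ^+ 2 != 0 by rewrite expf_neq0.
have step (w : C) : nrm w < d -> w != 0 -> cexp ((2 * w + 1) * (k - tpi / t)) = 1.
  move=> wd w0; have A0 := hd w wd w0.
  have h1 := hk (w + 1); rewrite formA_D1// in h1.
  have e1 : w / t = (w + 1) / t + - t^-1 by field.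
  have h2 := hk w; rewrite e1 formA_Dt// in h2.
  move: A0 h1 h2; move: (formA t w) (formA (- t^-1) ((w + 1) / t)) => A A' A0 h1 h2.
  have h3 := congr1 (fun x => ee (- - t^-1 - 2 * ((w + 1) / t)) * x) h1.
  rewrite /= mulrA h2 mulrCA in h3; have {}h3 := mulfI A0 h3.
  rewrite eeE -cexpD in h3.
  apply: (mulIf (cexp_neq0 (w ^+ 2 * k))); rewrite mul1r {2}h3 -cexpD.
  by congr cexp; field.
have k0 : k - tpi / t = 0.
  apply: (cexp_const d0) => w wd w0.
  have h1 := step w wd w0.
  have w2 : nrm (w / 2) < d.
    by rewrite nrmM nrmV nrm_nat; have := nrm_ge0 w; lra.
  have h2 : cexp ((2 * (w / 2) + 1) * (k - tpi / t)) = 1.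
    by apply: step => //; rewrite mulf_neq0// invr_eq0 pnatr_eq0.
  (* The factors 2 w + 1 taken at w and at w/2 differ by w, which removes the summand 1. *)
  have -> : w * (k - tpi / t) = (2 * w + 1) * (k - tpi / t) - (2 * (w / 2) + 1) * (k - tpi / t).
    by field.
  by rewrite cexpD cexpN h1 h2 invr1 mulr1.
have -> : ee (z ^+ 2 / t) = cexp (z ^+ 2 * k).
  have -> : k = tpi / t by apply/eqP; rewrite -subr_eq0 k0.
  by rewrite eeE; congr cexp; ring.
by rewrite hk mulrC.
Qed.

End ModularA.

(** * The meromorphic form psi_m of weight 2 *)

Section Psi.
Variable R : realType.
Local Notation C := (cplx R).
Local Notation tpi := (tpi R).
Implicit Types (t z w : C).

Definition psim (m : nat) t z : C := (wp t z / tpi ^+ 2) ^+ m.+1 * formA t z ^+ m.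

(** Since -3/pi^2 = 12/(2 pi i)^2, B is 12 W A with W = wp/(2 pi i)^2, and the powers of 12 cancel.
    Where A vanishes both sides are 0, the left one by the convention 1/0 = 0 and the right one
    because m > 0. *)
Lemma psimE m t z : (0 < m)%N -> Defs.formB t z ^+ m.+1 / (12 ^+ m.+1 * formA t z) = psim m t z.
Proof.
move=> m0; rewrite /Defs.formB cpi_sqr.
have -> : - (3 / - (tpi ^+ 2 / 4)) * wp t z * formA t z = 12 * (wp t z / tpi ^+ 2) * formA t z.
  by field; exact: tpi_neq0.
rewrite /psim; move: (formA t z) (wp t z / tpi ^+ 2) => A W.
have t12 : (12 : C) ^+ m.+1 != 0 by rewrite expf_neq0// pnatr_eq0.
rewrite !exprMn; have [->|A0] := eqVneq A 0.
  by rewrite mulr0 invr0 mulr0 expr0n (gtn_eqF m0) mulr0.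
by rewrite (exprSr A); field; rewrite t12 A0.
Qed.

Lemma wp_N t z : 0 < im t -> nolat t z -> wp t (- z) = wp t z.
Proof.
move=> t0 nz.
have nz' : nolat t (- z).
  move=> [a b] h; apply: (nz (- a, - b)); rewrite -[z]opprK h /wlat /=.
  by rewrite !mulrNz; ring.
have bij : bijective (fun ab : int * int => (- ab.1, - ab.2)).
  by exists (fun ab : int * int => (- ab.1, - ab.2)) => -[a b] /=; rewrite !opprK.
have h1 := wp_sum t0 nz'; have h2 := (hasSum_bij (wterm t z) _ bij).1 (wp_sum t0 nz).
rewrite sqrrN in h1; apply: (addIr (- (z ^+ 2)^-1)).
apply: hasSum_unique h1 _; apply: eq_hasSum h2 => -[a b] /=.
rewrite /wterm !xpair_eqE !oppr_eq0; case: ifP => // _.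
rewrite /wlat /= !mulrNz -(sqrrN (- z - _)) -[in RHS](sqrrN (a%:~R * t + b%:~R)).
congr (_ ^- 2 - _ ^- 2); ring.
Qed.

Lemma nolat_D t z (a b : int) : nolat t z -> nolat t (z + a%:~R * t + b%:~R).
Proof.
move=> nz [a' b'] h; apply: (nz (a' - a, b' - b)); rewrite /wlat /= !intrB.
have -> : z = z + a%:~R * t + b%:~R - a%:~R * t - b%:~R by ring.
by rewrite h /wlat /=; ring.
Qed.

(** Adding the sum e of the v(a t) to the row expansion leaves the sum of the v(z - a t), in which a
    shift of z by a lattice point is a shift of the index. *)
Lemma wp_D t z (a b : int) : 0 < im t -> nolat t z ->
  wp t (z + a%:~R * t + b%:~R) = wp t z.
Proof.
move=> t0 nz; have [c0 hc0] := hasSum_inv2 R.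
have nz' := @nolat_D t z a b nz.
have [e he] : exists e : C, hasSum (fun a : int => vv (a%:~R * t)) e.
  by apply: asummable_ex; exact: bsum_vv.
have h1 := hasSumD (hasSumZ (tpi ^- 2) (wp_rows t0 nz hc0)) he.
have h2 := hasSumD (hasSumZ (tpi ^- 2) (wp_rows t0 nz' hc0)) he.
have tn := tpi_neq0 R.
have h3 := (hasSum_bij _ _ (addz_bij (- a))).1 h1.
have : tpi ^- 2 * (wp t (z + a%:~R * t + b%:~R) + c0) + e = tpi ^- 2 * (wp t z + c0) + e.
  apply: hasSum_unique h2 _; apply: eq_hasSum h3 => j /=.
  have -> : vv (z + a%:~R * t + b%:~R - j%:~R * t) = vv (z - (j - a)%:~R * t).
    rewrite -[RHS](vvZ _ b); congr vv; rewrite intrB; ring.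
  by field.
move=> /addIr/(mulfI _) h; apply: (addIr c0); apply: h.
by rewrite invr_eq0 expf_neq0.
Qed.

Lemma psim_D1 m t z : 0 < im t -> nolat t z -> psim m t (z + 1) = psim m t z.
Proof.
move=> t0 nz; rewrite /psim formA_D1//.
by have := wp_D 0 1 t0 nz; rewrite mul0r addr0 => ->.
Qed.

Lemma psim_Dt m t z : 0 < im t -> nolat t z ->
  psim m t (z + t) = ee (- (m%:R * (t + 2 * z))) * psim m t z.
Proof.
move=> t0 nz; rewrite /psim formA_Dt//.
have := wp_D 1 0 t0 nz; rewrite mul1r addr0 => ->.
rewrite -[- (m%:R * _)]mulrN ee_nat opprD; move: (formA t z) (ee _) => A E.
by rewrite [(E * A) ^+ m]exprMn mulrCA.
Qed.

Lemma psim_N m t z : 0 < im t -> nolat t z -> psim m t (- z) = psim m t z.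
Proof. by move=> t0 nz; rewrite /psim formA_N// wp_N. Qed.

(** W^(m+1) has weight 2 m + 2, and A^m has weight -2 m and index m. *)
Lemma psim_S m t z : 0 < im t -> nolat t z ->
  psim m (- t^-1) (z / t) = t ^+ 2 * ee (m%:R * z ^+ 2 / t) * psim m t z.
Proof.
move=> t0 nz; have tn := im_neq0 t0; rewrite /psim wp_S//.
have -> : formA (- t^-1) (z / t) = ee (z ^+ 2 / t) * formA t z / t ^+ 2.
  by rewrite -formA_S// mulfK// expf_neq0.
rewrite -(mulrA m%:R) ee_nat -(mulrA (t ^+ 2)).
move: (wp t z / tpi ^+ 2) (formA t z) (ee _) => W A E.
have := expf_neq0 2 tn; move: (t ^+ 2) => T T0; rewrite !exprMn exprVn exprS.
by have T1 := expf_neq0 m T0; field.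
Qed.

End Psi.

(** * Fourier coefficients and involutions *)

Section Fourier.
Variable R : realType.
Local Notation C := (cplx R).
Implicit Types (t z w : C) (c : int * int -> C) (nr : int * int).

Definition mon t z nr : C := ee (nr.1%:~R * t + nr.2%:~R * z).

Lemma mon_neq0 t z nr : mon t z nr != 0. Proof. exact: ee_neq0. Qed.

Lemma monE t z nr : ee t ^ nr.1 * ee z ^ nr.2 = mon t z nr.
Proof. by rewrite /mon eeD !ee_intM. Qed.

Lemma ee_fracX n (k : int) : (0 < n)%N -> ee (k%:~R / n%:R : C) ^+ n = 1.
Proof.
move=> n0; rewrite -ee_nat mulrC divfK ?ee_int// pnatr_eq0 -lt0n//.
Qed.

Lemma sum_ee n (k : int) : (0 < n)%N ->
  \sum_(j < n) ee (k%:~R * j%:R / n%:R : C) = if (n%:Z %| k)%Z then n%:R else 0.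
Proof.
move=> n0; have n0' : (n%:R : C) != 0 by rewrite pnatr_eq0 -lt0n.
have e (j : 'I_n) : ee (k%:~R * j%:R / n%:R : C) = ee (k%:~R / n%:R) ^+ j.
  by rewrite -ee_nat; congr ee; ring.
under eq_bigr do rewrite e.
case: ifPn => [/dvdzP[a ->]|nk].
  have -> : (a * n%:Z)%:~R / n%:R = a%:~R :> C by rewrite intrM -pmulrn mulfK.
  rewrite ee_int; under eq_bigr do rewrite expr1n.
  by rewrite sumr_const card_ord.
have x1 : ee (k%:~R / n%:R : C) != 1.
  apply: contra nk => /eqP/ee_eq1[a h]; apply/dvdzP; exists a.
  apply/eqP; rewrite -(eqr_int C) intrM -pmulrn -h divfK//.
have := subrX1 (ee (k%:~R / n%:R : C)) n; rewrite ee_fracX// subrr => /esym/eqP.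
by rewrite mulf_eq0 subr_eq0 (negbTE x1)/= => /eqP.
Qed.

Lemma mon_shift t z (a b : R) nr :
  mon (t + ofR a) (z + ofR b) nr = mon t z nr * ee (nr.1%:~R * ofR a + nr.2%:~R * ofR b).
Proof. by rewrite /mon -eeD; congr ee; ring. Qed.

(* The coefficient at (n0, r0) is isolated by averaging over the N-torsion of
   the real torus and letting N tend to infinity; no lower bound on the
   exponents is needed. *)
Lemma fourier_zero c t z :
  (forall a b : R, hasSum (fun nr => c nr * mon (t + ofR a) (z + ofR b) nr) 0) ->
  forall nr, c nr = 0.
Proof.
move=> h [n0 r0].
pose f nr := c nr * mon t z nr.
pose g N nr : C := if (N.+1%:Z %| nr.1 - n0)%Z && (N.+1%:Z %| nr.2 - r0)%Z then f nr else 0.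
have hg N : hasSum (g N) 0.
  have n1 : (N.+1%:R : C) != 0 by rewrite pnatr_eq0.
  have hs := hasSum_big (index_enum 'I_N.+1) (P := predT) (f := fun (j : 'I_N.+1) nr =>
    \sum_(k < N.+1) N.+1%:R ^- 2 * ee (- (n0%:~R * j%:R + r0%:~R * k%:R) / N.+1%:R) *
      (c nr * mon (t + ofR (j%:R / N.+1%:R)) (z + ofR (k%:R / N.+1%:R)) nr)) (l := fun=> 0).
  rewrite big1 in hs; last by [].
  apply: eq_hasSum (hs _) => [nr|j _]; last first.
    have := hasSum_big (index_enum 'I_N.+1) (P := predT) (f := fun (k : 'I_N.+1) nr =>
      N.+1%:R ^- 2 * ee (- (n0%:~R * j%:R + r0%:~R * k%:R) / N.+1%:R) *
      (c nr * mon (t + ofR (j%:R / N.+1%:R)) (z + ofR (k%:R / N.+1%:R)) nr)) (l := fun=> 0).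
    rewrite big1//; apply => k _.
    by have := hasSumZ (N.+1%:R ^- 2 * ee (- (n0%:~R * j%:R + r0%:~R * k%:R) / N.+1%:R))
      (h (j%:R / N.+1%:R) (k%:R / N.+1%:R)); rewrite mulr0.
  rewrite [LHS](_ : _ = f nr * (N.+1%:R ^- 2 *
     ((\sum_(j < N.+1) ee ((nr.1 - n0)%:~R * j%:R / N.+1%:R)) *
      (\sum_(k < N.+1) ee ((nr.2 - r0)%:~R * k%:R / N.+1%:R))))).
    rewrite !sum_ee// /g; case: (_ %| _)%Z => /=; last by rewrite mul0r !mulr0.
    case: (_ %| _)%Z; last by rewrite !mulr0.
    by rewrite -expr2 mulVf ?mulr1// expf_neq0.
  rewrite mulr_suml !mulr_sumr; apply: eq_bigr => j _.
  rewrite !mulr_sumr; apply: eq_bigr => k _; rewrite mon_shift /f.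
  rewrite !ofRM !ofRV !ofRn -eeD.
  have -> : ee ((nr.1 - n0)%:~R * j%:R / N.+1%:R + (nr.2 - r0)%:~R * k%:R / N.+1%:R) =
     ee (- (n0%:~R * j%:R + r0%:~R * k%:R) / N.+1%:R) *
     ee (nr.1%:~R * (j%:R / N.+1%:R) + nr.2%:~R * (k%:R / N.+1%:R)) :> C.
    by rewrite -eeD !intrB; move: (N.+1%:R : C) n1 => X X0; congr ee; field.
  ring.
have [M fM] : asummable f.
  have := h 0 0; rewrite !addr0; exact: hasSum_asummable.
have h1 : (fun N => tsum (g N)) @ \oo --> tsum (fun nr => if nr == (n0, r0) then f nr else 0).
  apply: (@tannery R nat \oo eventually_filter _ g _ (fun nr => nrm (f nr)) M) => //.
    by apply: nearW => N nr; rewrite /g; case: ifP => // _; rewrite nrm0 nrm_ge0.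
  move=> [n r]; apply: (near_cvgC (f := fun=> if (n, r) == (n0, r0) then f (n, r) else 0)); last exact: cvC_cst.
  exists (`|n - n0|%N + `|r - r0|%N)%N => // N /= hN; rewrite /g xpair_eqE /=.
  have e (a b : int) : (`|a - b| <= N)%N -> (N.+1%:Z %| a - b)%Z = (a == b).
    move=> ab; apply/idP/eqP => [/dvdzP[q hq]|->]; last by rewrite subrr dvdz0.
    have : (`|q| * N.+1 < N.+1)%N by rewrite -(absz_nat N.+1) -abszM -hq absz_nat ltnS.
    rewrite -{2}(mul1n N.+1) ltn_mul2r /= ltnS leqn0 absz_eq0 => /eqP q0.
    by move: hq; rewrite q0 mul0r => /eqP; rewrite subr_eq0 => /eqP.
  rewrite !e//; first by apply: leq_trans hN; exact: leq_addl.
  by apply: leq_trans hN; exact: leq_addr.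
have h2 : tsum (fun nr => if nr == (n0, r0) then f nr else 0) = f (n0, r0).
  apply: hasSum_tsum.
  have := @hasSum_support R _ (fun nr => if nr == (n0, r0) then f nr else 0) [fset (n0, r0)]%fset.
  by rewrite big_seq_fset1 eqxx; apply => i; rewrite inE => /negbTE ->.
have : f (n0, r0) = 0.
  rewrite -h2; apply: (cvg_unique (@norm_hausdorff _ _) h1).
  apply: (near_cvgC (f := fun=> 0)); last exact: cvC_cst.
  by apply: nearW => N; rewrite (hasSum_tsum (hg N)).
by move=> /eqP; rewrite mulf_eq0 (negbTE (mon_neq0 _ _ _)) orbF => /eqP.
Qed.

Lemma fourier_unique c c' t z (p : R -> R -> C) :
  (forall a b : R, hasSum (fun nr => c nr * mon (t + ofR a) (z + ofR b) nr) (p a b)) ->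
  (forall a b : R, hasSum (fun nr => c' nr * mon (t + ofR a) (z + ofR b) nr) (p a b)) ->
  c = c'.
Proof.
move=> h h'; apply/funext => nr; apply/eqP; rewrite -subr_eq0; apply/eqP; move: nr.
apply: (@fourier_zero _ t z) => a b; rewrite -(subrr (p a b)).
by apply: eq_hasSum (hasSumB (h a b) (h' a b)) => nr; rewrite mulrBl.
Qed.

Definition fseries c (phi : C -> C -> C) :=
  forall t z, 0 < im t -> hasSum (fun nr => c nr * mon t z nr) (phi t z).

(** These maps preserve 4 m n - r^2 and r modulo 2 m, and their orbits are exactly the fibres of
    this pair. It is the elliptic law expressed on coefficients. *)
Definition qperiodic (m : nat) c := forall (n r l : int),
  c (n + r * l + m%:Z * l ^+ 2, r + (2 * m)%:Z * l) = c (n, r).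

Definition bounded_below c := exists n0 : int, forall n r : int, n < n0 -> c (n, r) = 0.

Lemma im_ofRD t (a : R) : im (t + ofR a) = im t.
Proof. by rewrite imD im_ofR addr0. Qed.

Lemma fseries_unique c c' phi : fseries c phi -> fseries c' phi -> c = c'.
Proof.
move=> h h'; have i0 : 0 < im ('i : C) by rewrite im_i.
apply: (@fourier_unique _ _ ('i : C) 0 (fun a b => phi ('i + ofR a) (0 + ofR b))) => a b.
  by apply: h; rewrite im_ofRD.
by apply: h'; rewrite im_ofRD.
Qed.

Lemma fourier_expansionP phi c : fourier_expansion phi c <-> bounded_below c /\ fseries c phi.
Proof.
have e t z : (fun nr : int * int => c nr * ee t ^ nr.1 * ee z ^ nr.2) = (fun nr => c nr * mon t z nr).
  by apply/funext => nr; rewrite -mulrA monE.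
split=> [[b h]|[b h]]; split => // t z t0.
  by apply/hasSum_cvg; rewrite -e; apply: h; apply/upperP.
by rewrite e; apply/hasSum_cvg; apply: h; apply/upperP.
Qed.

Lemma fourier_coefE phi c : bounded_below c -> fseries c phi -> fourier_coef phi = c.
Proof.
move=> b h; apply: xget_unique; first by apply/fourier_expansionP.
by move=> c' /fourier_expansionP[_ h']; exact: fseries_unique h' h.
Qed.

Lemma fseries_ext c phi psi : fseries c phi -> (forall t z, 0 < im t -> phi t z = psi t z) -> fseries c psi.
Proof. by move=> h e t z t0; rewrite -e//; exact: h. Qed.

Lemma fseriesD c d phi psi (a b : C) : fseries c phi -> fseries d psi ->
  fseries (fun nr => a * c nr + b * d nr) (fun t z => a * phi t z + b * psi t z).
Proof.
move=> h k t z t0; apply: eq_hasSum (hasSumD (hasSumZ a (h t z t0)) (hasSumZ b (k t z t0))) => nr.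
ring.
Qed.

Lemma shift_bij (f : int -> int) (s : int) :
  bijective (fun nr : int * int => (nr.1 + f nr.2, nr.2 + s)).
Proof.
exists (fun nr : int * int => (nr.1 - f (nr.2 - s), nr.2 - s)) => -[n r] /=.
  by rewrite !addrK.
by rewrite !subrK.
Qed.

(* Only the translates of one point by real shifts are used here; the elliptic
   law is what makes c(n, r) depend only on 4mn - r^2 and r modulo 2m. *)
Lemma periodic_of (m : nat) c t z (l : int) (p : R -> R -> C) :
  (forall a b : R, let t' := t + ofR a in let z' := z + ofR b in
     hasSum (fun nr => c nr * mon t' z' nr) (p a b) /\
     hasSum (fun nr => c nr * mon t' (z' + l%:~R * t') nr)
       (ee (- (m%:R * (l%:~R ^+ 2 * t' + 2 * l%:~R * z'))) * p a b)) ->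
  forall n r : int, c (n + r * l + m%:Z * l ^+ 2, r + (2 * m)%:Z * l) = c (n, r).
Proof.
move=> h n r.
have e : (fun nr : int * int => c (nr.1 + (- (nr.2 * l)), nr.2 + 0)) =
         (fun nr => c (nr.1 + m%:Z * l ^+ 2, nr.2 + (2 * m)%:Z * l)).
  apply: (@fourier_unique _ _ t z (fun a b =>
    ee (- (m%:R * (l%:~R ^+ 2 * (t + ofR a) + 2 * l%:~R * (z + ofR b)))) * p a b)) => a b.
    have [_ h2] := h a b.
    have := (hasSum_bij _ _ (shift_bij (fun r => - (r * l)) 0)).1 h2.
    apply: eq_hasSum => -[n' r'] /=; rewrite addr0; congr (_ * _).
    by rewrite /mon /= intrD mulrNz intrM; congr ee; ring.
  have [h1 _] := h a b.
  have := (hasSum_bij _ _ (shift_bij (fun=> m%:Z * l ^+ 2) ((2 * m)%:Z * l))).1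
    (hasSumZ (ee (- (m%:R * (l%:~R ^+ 2 * (t + ofR a) + 2 * l%:~R * (z + ofR b))))) h1).
  apply: eq_hasSum => -[n' r'] /=; rewrite mulrCA; congr (_ * _).
  rewrite /mon /= -eeD !intrD !intrM PoszM intrM -!pmulrn; congr ee; rewrite !expr2; ring.
have := congr1 (fun f => f (n + r * l, r)) e => /= <-.
by rewrite addr0 addrK.
Qed.

Lemma fseries_periodic m c phi : elliptic_law m phi -> fseries c phi -> qperiodic m c.
Proof.
move=> he h n r l; apply: (@periodic_of m c ('i : C) 0 l (fun a b => phi ('i + ofR a) (0 + ofR b))).
move=> a b t' z'; have t0 : 0 < im t' by rewrite im_ofRD im_i.
split; first exact: h.
have := he t' z' l 0 ((upperP t').2 t0); rewrite addr0 => <-.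
exact: h.
Qed.

(** The properties preserved by involutions and linear combinations. The quantified function only
    records that the series converges for every tau and z. *)
Definition goodf m c := [/\ (0 < m)%N, bounded_below c, qperiodic m c & exists phi, fseries c phi].

Lemma nrm_mon t z nr : nrm (mon t z nr) =
  expR (- (2 * pi * (nr.1%:~R * im t + nr.2%:~R * im z))).
Proof. by rewrite /mon nrm_ee imD !imM !im_int !re_int !mul0r !addr0. Qed.

(** The modulus is monotone in im z, so one of the two edges of a horizontal strip dominates. *)
Lemma nrm_mon_le t z z1 z2 nr : im z1 <= im z <= im z2 ->
  nrm (mon t z nr) <= nrm (mon t z1 nr) + nrm (mon t z2 nr).
Proof.
move=> /andP[h1 h2]; rewrite !nrm_mon; have pg := pi_gt0 R.
set A := nr.1%:~R * im t; set r : R := nr.2%:~R.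
have [r0|r0] := leP 0 r.
  apply: (@le_trans _ _ (expR (- (2 * pi * (A + r * im z1))))); last by rewrite lerDl expR_ge0.
  by rewrite ler_expR lerN2 ler_pM2l ?mulr_gt0// lerD2l ler_wpM2l.
apply: (@le_trans _ _ (expR (- (2 * pi * (A + r * im z2))))); last by rewrite lerDr expR_ge0.
by rewrite ler_expR lerN2 ler_pM2l ?mulr_gt0// lerD2l ler_wnM2l// ltW.
Qed.

Lemma mon_cont t z0 nr : mon t w nr @[w --> z0] --> mon t z0 nr.
Proof.
pose proof (cvCM (cvC_cst (nr.2%:~R : C)) (@id_at R z0)) as h.
have h2 : ee (nr.2%:~R * w) @[w --> z0] --> ee (nr.2%:~R * z0).
  exact: (cvg_comp _ _ h (@ee_cvg R _)).
pose proof (cvCM (cvC_cst (ee (nr.1%:~R * t))) h2) as h3.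
rewrite /mon eeD; apply: eq_cvgC h3 => w; by rewrite eeD.
Qed.

Lemma fseries_cont c phi t z0 : fseries c phi -> 0 < im t -> phi t w @[w --> z0] --> phi t z0.
Proof.
move=> h t0.
have [M1 b1] := hasSum_asummable (h t (z0 - 'i) t0).
have [M2 b2] := hasSum_asummable (h t (z0 + 'i) t0).
have ht := @tannery R C (nbhs z0) (nbhs_pfilter z0) _ (fun w nr => c nr * mon t w nr) (fun nr => c nr * mon t z0 nr) _ _ (bsumD b1 b2).
rewrite -(hasSum_tsum (h t z0 t0)).
apply: (@near_cvgC R C (nbhs z0) (nbhs_filter z0) (fun w => tsum (fun nr => c nr * mon t w nr))).
  by apply: nearW => w; rewrite (hasSum_tsum (h t w t0)).
apply: ht.
  apply/nearC; exists 1 => // w hw nr; rewrite !nrmM -mulrDr ler_wpM2l ?nrm_ge0//.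
  apply: nrm_mon_le; rewrite imD imN im_i imD im_i.
  have := im_le_nrm (w - z0); rewrite imD imN ler_norml; lra.
by move=> nr; exact: (cvCM (cvC_cst (c nr)) (@mon_cont t z0 nr)).
Qed.

End Fourier.

(** * Involutions as averages over torsion points *)

Section Involutions.
Variable R : realType.
Local Notation C := (cplx R).
Implicit Types (t z w : C) (c : int * int -> C) (nr : int * int).

(** [involW] transported to families of coefficients, where the algebra of the involutions is
    carried out. *)
Definition coefW (m n : nat) c : int * int -> C := fun nr =>
  c ((((4 * m)%:Z * nr.1 - nr.2 ^+ 2 + star n (m %/ n) nr.2 ^+ 2) %/ (4 * m)%:Z)%Z,
     star n (m %/ n) nr.2).

Lemma modz_eqP (d : nat) (a b : int) :
  (a = b %[mod d%:Z])%Z <-> exists k, a = b + k * d%:Z.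
Proof.
split=> [/eqP|[k ->]]; last by rewrite -modzDm modzMl addr0 modz_mod.
rewrite eqz_mod_dvd => /dvdzP[k hk]; exists k.
by rewrite -hk addrC subrK.
Qed.

Lemma bezout_nat (n m2 : nat) : (0 < n)%N -> coprime n m2 ->
  exists u : int, exists v : int, u * m2%:Z = 1 + v * n%:Z.
Proof.
move=> n0 cop; have [u' [v' e1]] := Bezoutz n%:Z m2%:Z.
have e' : u' * n%:Z + v' * m2%:Z = 1 by rewrite e1 /gcdz /= (eqP cop).
exists v', (- u'); rewrite -e'; ring.
Qed.

Lemma inverse_mod (n m2 : nat) (r : int) : (0 < n)%N -> coprime n m2 ->
  exists l : int, (n%:Z %| r - m2%:Z * l)%Z.
Proof.
move=> n0 cop; have [u [v e]] := bezout_nat n0 cop.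
exists (u * r); apply/dvdzP; exists (- v * r).
have -> : m2%:Z * (u * r) = (u * m2%:Z) * r by ring.
by rewrite e; ring.
Qed.

(** The choice made by [star] is determined modulo 2 n m2 by the Chinese remainder theorem;
    [qperiodic] families do not see the remaining ambiguity. *)
Lemma starP (n m2 : nat) (r s : int) : coprime n m2 -> (0 < n)%N -> (0 < m2)%N ->
  (exists k, s = - r + k * (2 * n)%:Z) -> (exists k, s = r + k * (2 * m2)%:Z) ->
  exists l : int, star n m2 r = s + l * (2 * (n * m2))%:Z.
Proof.
move=> cop n0 m0 h1 h2.
pose S := [set s : int | (s = - r %[mod (2 * n)%:Z])%Z /\ (s = r %[mod (2 * m2)%:Z])%Z].
have Ss : S s by split; apply/modz_eqP.
have : S (star n m2 r) by rewrite /star; case: xgetP => [x _ //|/(_ s)].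
move=> [/modz_eqP[a ea] /modz_eqP[b eb]].
case: h1 => a' ea'; case: h2 => b' eb'.
have e : (a - a') * n%:Z = (b - b') * m2%:Z.
  have : (a - a') * n%:Z * 2 = (b - b') * m2%:Z * 2.
    have -> : (a - a') * n%:Z * 2 = star n m2 r - s by rewrite {1}ea {1}ea' PoszM; ring.
    by rewrite {1}eb {1}eb' PoszM; ring.
  by move/(@mulIf int 2 isT).
have /dvdzP[k hk] : (m2%:Z %| a - a')%Z.
  rewrite -(@Gauss_dvdzl _ _ n%:Z); first by rewrite e dvdz_mull.
  by rewrite /coprimez /gcdz /= coprime_sym in cop *; rewrite (eqP cop).
exists k; rewrite {1}ea [in RHS]ea' PoszM PoszM.
have -> : a = a' + k * m2%:Z by rewrite -hk; ring.
ring.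
Qed.

(** Writing r = q n + m2 l, the number r - 2 m2 l = -r + 2 q n satisfies both congruences required
    of [star]; keeping 4 m N - r^2 fixed then subtracts l q from N. *)
Lemma coefW_val (m n m2 : nat) c (N r l : int) : m = (n * m2)%N -> coprime n m2 ->
  (0 < m)%N -> qperiodic m c -> (n%:Z %| r - m2%:Z * l)%Z ->
  coefW m n c (N, r) = c (N - l * ((r - m2%:Z * l) %/ n%:Z)%Z, r - (2 * m2)%:Z * l).
Proof.
move=> em cop m0 per /dvdzP[q hq]; rewrite em muln_gt0 in m0; case/andP: m0 => n0 m20.
have nz : n%:Z != 0 by rewrite eqz_nat -lt0n.
rewrite hq mulzK//.
have re : r = q * n%:Z + m2%:Z * l by rewrite -hq subrK.
have [||k hk] := @starP n m2 r (r - (2 * m2)%:Z * l) cop n0 m20.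
- by exists q; rewrite re !PoszM; ring.
- by exists (- l); ring.
have em2 : (m %/ n)%N = m2 by rewrite em mulKn.
rewrite /coefW /= em2 hk -em.
set s := r - _; have -> : s + k * (2 * m)%:Z = s + (2 * m)%:Z * k by rewrite [k * _]mulrC.
rewrite -[RHS](per _ _ k); congr (c (_, _)).
have -> : (4 * m)%:Z * N - r ^+ 2 + (s + (2 * m)%:Z * k) ^+ 2 =
   (N - l * q + s * k + m%:Z * k ^+ 2) * (4 * m)%:Z.
  by rewrite /s em !PoszM re; ring.
by rewrite mulzK// eqz_nat muln_eq0 em muln_eq0 !negb_or -!lt0n n0 m20.
Qed.

Lemma periodic_coefW (m n m2 : nat) c : m = (n * m2)%N -> coprime n m2 ->
  (0 < m)%N -> qperiodic m c -> qperiodic m (coefW m n c).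
Proof.
move=> em cop m0 per N r k; have n0 : (0 < n)%N by move: m0; rewrite em muln_gt0 => /andP[].
have nz : n%:Z != 0 by rewrite eqz_nat -lt0n.
have [l hl] := inverse_mod r n0 cop.
have hl2 : (n%:Z %| r + (2 * m)%:Z * k - m2%:Z * l)%Z.
  rewrite addrAC rpredD// em PoszM PoszM.
  by rewrite (_ : _ * k = n%:Z * (2 * m2%:Z * k)); [rewrite dvdz_mulr|ring].
rewrite (coefW_val _ em cop m0 per hl) (coefW_val _ em cop m0 per hl2).
rewrite -[RHS](per _ _ k); case/dvdzP: hl => q hq.
have e1 : r + (2 * m)%:Z * k - m2%:Z * l = (q + (2 * m2)%:Z * k) * n%:Z.
  by rewrite addrAC hq em !PoszM; ring.
rewrite e1 hq !mulzK//; congr (c (_, _)); last by ring.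
have -> : r = q * n%:Z + m2%:Z * l by rewrite -hq subrK.
rewrite em !PoszM; ring.
Qed.

(** Periodicity brings r into [-m, m), where a lower bound on n becomes a lower bound on 4 m n -
    r^2. *)
Lemma bounded_disc m c : (0 < m)%N -> bounded_below c -> qperiodic m c ->
  exists D : int, forall n r : int, (4 * m)%:Z * n - r ^+ 2 < D -> c (n, r) = 0.
Proof.
move=> m0 [n0 hn] per; exists ((4 * m)%:Z * n0 - m%:Z ^+ 2) => n r lt.
pose k := ((r + m%:Z) %/ (2 * m)%:Z)%Z.
rewrite -(per n r (- k)); apply: hn.
set r' := r + (2 * m)%:Z * (- k).
have h2m : (2 * m)%:Z != 0 by rewrite eqz_nat muln_eq0 -lt0n m0.
have e1 := divz_eq (r + m%:Z) (2 * m)%:Z; rewrite -/k in e1.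
have p1 := modz_ge0 (r + m%:Z) h2m.
have p2 : ((r + m%:Z) %% (2 * m)%:Z)%Z < (2 * m)%:Z by rewrite ltz_pmod// ltz_nat muln_gt0.
have er : r' = ((r + m%:Z) %% (2 * m)%:Z)%Z - m%:Z.
  rewrite /r'; move: e1; move: (_ %% _)%Z => x e1.
  by rewrite (_ : x = r + m%:Z - k * (2 * m)%:Z); [ring | rewrite e1; ring].
have r2 : r' ^+ 2 <= m%:Z ^+ 2.
  move: p1 p2; rewrite er; set x := (_ %% _)%Z; rewrite PoszM => p1 p2; nia.
set N := n + _ + _.
have eN : (4 * m)%:Z * N - r' ^+ 2 = (4 * m)%:Z * n - r ^+ 2.
  by rewrite /N /r' !PoszM; ring.
have : (4 * m)%:Z * N < (4 * m)%:Z * n0 by rewrite -eN in lt; lia.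
by rewrite ltr_pM2l// ltz_nat muln_gt0.
Qed.

Lemma bounded_below_coefW (m n m2 : nat) c : m = (n * m2)%N -> coprime n m2 -> (0 < m)%N ->
  bounded_below c -> qperiodic m c -> bounded_below (coefW m n c).
Proof.
move=> em cop m0 b per; have [D hD] := bounded_disc m0 b per.
have n0 : (0 < n)%N by move: m0; rewrite em muln_gt0 => /andP[].
have nz : n%:Z != 0 by rewrite eqz_nat -lt0n.
exists (- `|D|) => N r lt; have [l hl] := inverse_mod r n0 cop.
rewrite (coefW_val _ em cop m0 per hl); apply: hD; case/dvdzP: hl => q hq.
rewrite hq mulzK//.
have -> : (4 * m)%:Z * (N - l * q) - (r - (2 * m2)%:Z * l) ^+ 2 = (4 * m)%:Z * N - r ^+ 2.
  have -> : r = q * n%:Z + m2%:Z * l by rewrite -hq subrK.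
  rewrite em !PoszM; ring.
have h : (4 * m)%:Z * N <= N by rewrite PoszM; nia.
have := sqr_ge0 r; lia.
Qed.

(** The translate of [phi] by the torsion point (l t + mu)/n, corrected by the automorphy factor of
    index m = n m2. *)
Definition Xt (n m2 : nat) (phi : C -> C -> C) (l mu : int) t z : C :=
  ee (m2%:R * (l%:~R ^+ 2 * t / n%:R + 2 * l%:~R * z + l%:~R * mu%:~R / n%:R)) *
  phi t (z + (l%:~R * t + mu%:~R) / n%:R).

Definition funW (n m2 : nat) (phi : C -> C -> C) t z : C :=
  n%:R^-1 * \sum_(l < n) \sum_(mu < n) Xt n m2 phi l mu t z.

Lemma sum_residue (n m2 : nat) (r : int) (T : nmodType) (a : T) : (0 < n)%N -> coprime n m2 ->
  \sum_(l < n) (if (n%:Z %| r - m2%:Z * l%:Z)%Z then a else 0) = a.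
Proof.
move=> n0 cop; have [l hl] := inverse_mod r n0 cop.
have nz : n%:Z != 0 by rewrite eqz_nat -lt0n.
have p1 := modz_ge0 l nz.
have p2 : (l %% n%:Z)%Z < n%:Z by rewrite ltz_pmod// ltz_nat.
have lt : (`|(l %% n%:Z)%Z| < n)%N by lia.
have e0 : (`|(l %% n%:Z)%Z|%N)%:Z = (l %% n%:Z)%Z by rewrite gez0_abs.
rewrite (bigD1 (Ordinal lt))//= big1 ?addr0 => [|i ni].
  rewrite ifT// e0; case/dvdzP: hl => q hq; apply/dvdzP.
  have e1 := divz_eq l n%:Z.
  exists (q + m2%:Z * (l %/ n%:Z)%Z).
  have -> : (l %% n%:Z)%Z = l - (l %/ n%:Z)%Z * n%:Z by rewrite {2}e1; ring.
  have -> : r = q * n%:Z + m2%:Z * l by rewrite -hq subrK.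
  ring.
rewrite ifF//; apply: contraNF ni => hi; apply/eqP/val_inj => /=.
have d : (n%:Z %| l - i%:Z)%Z.
  rewrite -(@Gauss_dvdzr _ m2%:Z); last by rewrite /coprimez /gcdz /= (eqP cop).
  have -> : m2%:Z * (l - i%:Z) = (r - m2%:Z * i%:Z) - (r - m2%:Z * l) by ring.
  by apply: rpredB.
have : (l = i%:Z %[mod n%:Z])%Z by apply/eqP; rewrite eqz_mod_dvd.
by move=> ->; rewrite modz_small ?absz_nat//= ltz_nat ltn_ord.
Qed.

(** The average over mu retains the exponents r congruent to m2 l modulo n, and on these the
    translation by l t/n acts as [coefW_val] prescribes. Each r belongs to exactly one class of l,
    by [sum_residue]. *)
Lemma coefW_hasSum (m n m2 : nat) c phi t z : m = (n * m2)%N -> coprime n m2 -> (0 < m)%N ->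
  qperiodic m c -> fseries c phi -> 0 < im t ->
  hasSum (fun nr => coefW m n c nr * mon t z nr) (funW n m2 phi t z).
Proof.
move=> em cop m0 per h t0; have n0 : (0 < n)%N by move: m0; rewrite em muln_gt0 => /andP[].
have n1 : (n%:R : C) != 0 by rewrite pnatr_eq0 -lt0n.
have nz : n%:Z != 0 by rewrite eqz_nat -lt0n.
pose P (l : nat) : C := ee (m2%:R * (l%:R ^+ 2 * t / n%:R + 2 * l%:R * z)).
have step (l : 'I_n) : hasSum (fun nr =>
    if (n%:Z %| nr.2 - m2%:Z * l%:Z)%Z then coefW m n c nr * mon t z nr else 0)
    (n%:R^-1 * \sum_(mu < n) Xt n m2 phi l mu t z).
  have h1 : hasSum (fun nr => \sum_(mu < n)
      n%:R^-1 * P l * ee (m2%:R * l%:R * mu%:R / n%:R) *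
      (c nr * mon t (z + (l%:R * t + mu%:R) / n%:R) nr))
      (n%:R^-1 * \sum_(mu < n) Xt n m2 phi l mu t z).
    rewrite mulr_sumr; apply: hasSum_big => mu _.
    have := hasSumZ (n%:R^-1 * P l * ee (m2%:R * l%:R * mu%:R / n%:R)) (h t (z + (l%:R * t + mu%:R) / n%:R) t0).
    rewrite /Xt -!pmulrn -!mulrA [P l * _]mulrA -eeD.
    congr (hasSum _ (_ * (ee _ * _))); ring.
  (* The index change of [coefW_val]; the integer quotient makes it a bijection of all pairs,
     including those that the average over mu discards. *)
  pose g nr : int * int := (nr.1 + (- (l%:Z * ((nr.2 - m2%:Z * l%:Z) %/ n%:Z)%Z)), nr.2 + (- ((2 * m2)%:Z * l%:Z))).
  have gb : bijective g by exact: (shift_bij (fun r => - (l%:Z * ((r - m2%:Z * l%:Z) %/ n%:Z)%Z))).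
  apply: eq_hasSum ((hasSum_bij _ _ gb).1 h1) => -[N r] /=.
  have em' (mu : 'I_n) : n%:R^-1 * P l * ee (m2%:R * l%:R * mu%:R / n%:R) *
      (c (g (N, r)) * mon t (z + (l%:R * t + mu%:R) / n%:R) (g (N, r))) =
      n%:R^-1 * P l * c (g (N, r)) * mon t (z + l%:R * t / n%:R) (g (N, r)) *
      ee ((r - m2%:Z * l%:Z)%:~R * mu%:R / n%:R).
    have -> : mon t (z + (l%:R * t + mu%:R) / n%:R) (g (N, r)) =
       mon t (z + l%:R * t / n%:R) (g (N, r)) * ee ((r - (2 * m2)%:Z * l%:Z)%:~R * mu%:R / n%:R).
      by rewrite /mon -eeD; congr ee; rewrite /g /=; move: (_%:~R) (_%:~R) => a b; field.
    have -> : ee ((r - m2%:Z * l%:Z)%:~R * mu%:R / n%:R) =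
       ee (m2%:R * l%:R * mu%:R / n%:R) * ee ((r - (2 * m2)%:Z * l%:Z)%:~R * mu%:R / n%:R) :> C.
      rewrite -eeD; congr ee; rewrite !intrB PoszM !intrM -!pmulrn; field; exact: n1.
    ring.
  under eq_bigr do rewrite em'.
  rewrite -mulr_sumr sum_ee//; case: ifPn => hd; last by rewrite mulr0.
  rewrite (coefW_val _ em cop m0 per hd) /g /=.
  set c0 := c _; case/dvdzP: hd => q hq; rewrite hq mulzK//.
  have -> : mon t z (N, r) = P l * mon t (z + l%:R * t / n%:R) (N - l%:Z * q, r - (2 * m2)%:Z * l%:Z).
    rewrite /mon /P -eeD /=; congr ee; have -> : r = q * n%:Z + m2%:Z * l%:Z by rewrite -hq subrK.
    rewrite !(intrB, intrD) PoszM !intrM -!pmulrn; field; exact: n1.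
  by rewrite mulrAC; field; exact: n1.
rewrite /funW mulr_sumr; apply: eq_hasSum (hasSum_big (index_enum 'I_n) (P := predT) (fun l _ => step l)) => nr.
by rewrite /= sum_residue.
Qed.

Lemma goodf_coefW (m n m2 : nat) c : m = (n * m2)%N -> coprime n m2 -> goodf m c -> goodf m (coefW m n c).
Proof.
move=> em cop [m0 b per [phi h]]; split => //.
- exact: bounded_below_coefW em cop m0 b per.
- exact: periodic_coefW em cop m0 per.
by exists (funW n m2 phi) => t z t0; exact: coefW_hasSum.
Qed.

Lemma goodfD m c d (a b : C) : goodf m c -> goodf m d -> goodf m (fun nr => a * c nr + b * d nr).
Proof.
move=> [m0 [n0 h0] p1 [phi h1]] [_ [n0' h0'] p2 [psi h2]]; split => //.
- exists (Num.min n0 n0') => n r; rewrite lt_min => /andP[l1 l2].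
  by rewrite h0// h0'// !mulr0 addr0.
- by move=> n r l; rewrite p1 p2.
by exists (fun t z => a * phi t z + b * psi t z); exact: fseriesD.
Qed.

Lemma involWE (m n m2 : nat) phi c t z : m = (n * m2)%N -> coprime n m2 -> goodf m c ->
  fseries c phi -> 0 < im t -> involW m n phi t z = funW n m2 phi t z.
Proof.
move=> em cop [m0 b per _] h t0.
rewrite /involW; apply: sum_hasSum; apply: eq_hasSum (coefW_hasSum z em cop m0 per h t0) => nr.
rewrite /coefW /disc_coef (fourier_coefE b h) -mulrA monE.
by congr (c (_, _) * _); rewrite addrC.
Qed.

Lemma fseries_one_plus_W (m n m2 : nat) (eps : int) phi c : m = (n * m2)%N -> coprime n m2 ->
  goodf m c -> fseries c phi ->
  fseries (fun nr => 1 * c nr + eps%:~R * coefW m n c nr) (one_plus_W m n eps phi).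
Proof.
move=> em cop gc h.
have hW : fseries (coefW m n c) (involW m n phi).
  move=> t z t0; rewrite (involWE z em cop gc h t0); case: gc => m0 _ per _.
  exact: coefW_hasSum.
by apply: fseries_ext (fseriesD 1 eps%:~R h hW) _ => t z t0; rewrite mul1r.
Qed.

End Involutions.

(** * The Fourier expansion of the standard form *)

Section Families.
Variable R : realType.
Local Notation C := (cplx R).

Lemma hasSum_natP (f : nat -> C) l : hasSum f l ->
  \sum_(0 <= n < N) f n @[N --> \oo] --> l.
Proof.
move=> h; apply/cvg_nrmP => e /h[J0 hJ].
exists (\max_(k <- J0) k).+1 => // N /= hN.
have sub : (J0 `<=` seq_fset tt (iota 0 N))%fset.
  apply/fsubsetP => k kJ; rewrite seq_fsetE mem_iota add0n.
  apply: leq_trans hN; rewrite ltnS.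
  by rewrite (big_rem k kJ)/= leq_maxl.
have := hJ _ sub; rewrite (perm_big (iota 0 N))/=; first by rewrite /index_iota subn0.
by apply: uniq_perm; rewrite ?sort_keys_uniq ?iota_uniq// => k; rewrite sort_keysE.
Qed.

Lemma hasSum_le (I : choiceType) (g : I -> R) s : (forall i, 0 <= g i) ->
  hasSum (fun i => ofR (g i)) (ofR s) -> bsum g s.
Proof.
move=> g0 h; have [M hM] := hasSum_asummable h.
have gM : bsum g M by apply: bsum_le hM => i; rewrite nrm_ofR ger0_norm.
have [s' [b _ h']] := bsum_hasSum g0 gM.
have := hasSum_unique h h' => /(congr1 (@re R)); rewrite !re_ofR => ->.
exact: b.
Qed.

Lemma bsum_fiberE (I K : choiceType) (p : I -> K) (f : I -> C) (g : K -> C) M :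
  (forall k, hasSum (fun i => if p i == k then f i else 0) (g k)) ->
  bsum (fun i => nrm (f i)) M -> bsum (fun k => nrm (g k)) M.
Proof.
move=> h b; have n0 i : 0 <= nrm (f i) by exact: nrm_ge0.
have [s [bs sM hs]] := bsum_hasSum n0 b.
apply: bsum_leM sM _.
have hG k : exists G, [/\ nrm (g k) <= G & hasSum (fun i => if p i == k then ofR (nrm (f i)) else 0) (ofR G)].
  have b1 : bsum (fun i => if p i == k then nrm (f i) else 0) s.
    by apply: bsum_le bs => i; case: ifP.
  have [|G [b2 _ h2]] := bsum_hasSum _ b1; first by move=> i; case: ifP.
  exists G; split.
    apply: hasSum_nrm_le (h k); apply: bsum_le b2 => i.
    by case: ifP => // _; rewrite nrm0.
  by apply: eq_hasSum h2 => i; case: ifP.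
have [G hG'] := choice hG.
apply: (@bsum_le _ _ _ G) => [k|]; first by case: (hG' k).
apply: hasSum_le => [k|].
  by case: (hG' k) => h1 _; apply: le_trans h1; exact: nrm_ge0.
exact: (hasSum_fiberE (p := p) (g := fun k => ofR (G k)) (fun k => (hG' k).2) hs).
Qed.

Lemma hasSum_int_split (f : int -> C) a b :
  hasSum (fun k : nat => f k.+1%:Z) a -> hasSum (fun k : nat => f (- k.+1%:Z)) b ->
  hasSum f (f 0 + (a + b)).
Proof.
move=> ha hb.
have h0 : hasSum (fun j : int => if j == 0 then f j else 0) (f 0).
  have := @hasSum_support R int (fun a => if a == 0 then f a else 0) [fset (0 : int)]%fset.
  by rewrite big_seq_fset1 eqxx; apply => i; rewrite inE => /negbTE ->.
have h1 : hasSum (fun j : int => if 0 < j then f j else 0) a.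
  apply/(@hasSum_inj R int nat (fun n => n.+1%:Z) (fun j : int => if 0 < j then f j else 0) a).
  - by move=> i j [].
  - by move=> i hi; case: (intP i) hi => // k hk; case: (hk k).
  - by apply: eq_hasSum ha => k /=.
have h2 : hasSum (fun j : int => if j < 0 then f j else 0) b.
  apply/(@hasSum_inj R int nat (fun n => - n.+1%:Z) (fun j : int => if j < 0 then f j else 0) b).
  - by move=> i j /oppr_inj[].
  - by move=> i hi; case: (intP i) hi => // k hk; case: (hk k).
  - by apply: eq_hasSum hb => k /=.
apply: eq_hasSum (hasSumD h0 (hasSumD h1 h2)) => j.
by case: (intP j) => [|k|k] //=; rewrite ?addr0 ?add0r.
Qed.

End Families.

(** * Power series in q and y on the strip |im z| < im t *)

Section QSeries.
Variable R : realType.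
Local Notation C := (cplx R).
Implicit Types (t z w : C) (nr : int * int).

Definition strip t z := `|im z| < im t.

Lemma strip_im t z : strip t z -> 0 < im t.
Proof. exact: le_lt_trans (normr_ge0 _). Qed.

(** Keeping a bound on the absolute sum as part of the datum is what allows infinite sums of such
    series. *)
Definition strip_series (f : C -> C -> C) (F : C -> C -> R) := exists2 c : int * int -> C,
  (forall n r : int, n < 0 -> c (n, r) = 0) &
  forall t z, strip t z -> bsum (fun nr => nrm (c nr * mon t z nr)) (F t z) /\
    hasSum (fun nr => c nr * mon t z nr) (f t z).

(** The coefficient of a monomial is the sum over its fibre. Its convergence does not depend on tau
    and z, so it is tested at the single point (i, 0) of the strip. *)
Lemma strip_series_of (I : choiceType) (a : I -> C) (e : I -> int * int) f F :
  (forall i, 0 <= (e i).1) ->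
  (forall t z, strip t z -> bsum (fun i => nrm (a i * mon t z (e i))) (F t z) /\
    hasSum (fun i => a i * mon t z (e i)) (f t z)) -> strip_series f F.
Proof.
move=> e0 h.
pose c k := tsum (fun i => if e i == k then a i else 0).
have hc k : hasSum (fun i => if e i == k then a i else 0) (c k).
  apply: tsumP; have [|b _] := h ('i : C) 0.
    by rewrite /strip im_i (im_nat R 0) normr0.
  have := @asummable_mask R I _ (fun i => e i == k) (ex_intro _ _ b).
  case/asummable_ex => l /(hasSumZr (mon 'i 0 k)^-1)/hasSum_asummable[M hM].
  exists M; apply: bsum_le hM => i; case: eqP => [->|_]; last by rewrite mul0r.
  by rewrite mulfK ?mon_neq0.
have hck t z k : hasSum (fun i => if e i == k then a i * mon t z (e i) else 0) (c k * mon t z k).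
  apply: eq_hasSum (hasSumZr (mon t z k) (hc k)) => i.
  by case: eqP => [->|]; rewrite ?mul0r.
exists c => [n r n0|t z s].
  apply: hasSum_tsum; apply: eq_hasSum (@hasSum0 R I) => i.
  by case: eqP => // ei; have := e0 i; rewrite ei /= leNgt n0.
have [b1 h1] := h t z s; split.
  by apply: (bsum_fiberE (p := e)) b1 => k; exact: hck.
by apply: (hasSum_fiberE (p := e)) h1 => k; exact: hck.
Qed.

Lemma strip_series_le f F G : (forall t z, strip t z -> F t z <= G t z) -> strip_series f F -> strip_series f G.
Proof.
move=> h [c c0 hc]; exists c => // t z s; have [b ?] := hc t z s; split => //.
exact: bsum_leM (h _ _ s) b.
Qed.

Lemma strip_series_ext f g F : (forall t z, strip t z -> f t z = g t z) -> strip_series f F -> strip_series g F.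
Proof. by move=> h [c c0 hc]; exists c => // t z s; rewrite -h//; exact: hc. Qed.

Lemma strip_seriesD f g F G : strip_series f F -> strip_series g G ->
  strip_series (fun t z => f t z + g t z) (fun t z => F t z + G t z).
Proof.
move=> [c c0 hc] [d d0 hd]; exists (fun nr => c nr + d nr) => [n r n0|t z s].
  by rewrite c0// d0// addr0.
have [b1 h1] := hc t z s; have [b2 h2] := hd t z s; split.
  by apply: bsum_le (bsumD b1 b2) => nr; rewrite mulrDl ler_nrmD.
by apply: eq_hasSum (hasSumD h1 h2) => nr; rewrite mulrDl.
Qed.

Lemma strip_series_mon (n r : int) (a : C) : 0 <= n ->
  strip_series (fun t z => a * mon t z (n, r)) (fun t z => nrm (a * mon t z (n, r))).
Proof.
move=> n0; apply: (@strip_series_of unit (fun=> a) (fun=> (n, r))) => // t z s; split.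
  move=> J; apply: (@le_trans _ _ (\sum_(i <- [fset tt]%fset) nrm (a * mon t z (n, r)))).
    by apply: fsum_le => [_|]; [exact: nrm_ge0 | apply/fsubsetP => -[]; rewrite inE].
  by rewrite big_seq_fset1.
have := @hasSum_support R unit (fun=> a * mon t z (n, r)) [fset tt]%fset.
by rewrite big_seq_fset1; apply => -[]; rewrite inE.
Qed.

Lemma mon00 t z : mon t z (0, 0) = 1.
Proof. by rewrite /mon !mul0r addr0 ee0. Qed.

Lemma strip_series_cst (a : C) : strip_series (fun _ _ => a) (fun _ _ => nrm a).
Proof.
have := @strip_series_mon 0 0 a (lexx _); congr strip_series.
  by apply/funext => t; apply/funext => z; rewrite mon00 mulr1.
by apply/funext => t; apply/funext => z; rewrite mon00 mulr1.
Qed.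

Lemma monM t z nr nr' : mon t z nr * mon t z nr' = mon t z (nr.1 + nr'.1, nr.2 + nr'.2).
Proof. by rewrite /mon -eeD /= !intrD; congr ee; ring. Qed.

Lemma strip_seriesM f g F G : strip_series f F -> strip_series g G ->
  strip_series (fun t z => f t z * g t z) (fun t z => G t z * F t z).
Proof.
move=> [c c0 hc] [d d0 hd].
pose c' (nr : int * int) := if 0 <= nr.1 then c nr else 0.
have cc' nr : c nr = c' nr.
  by rewrite /c'; case: nr => n r /=; case: leP => // /c0 ->.
(* Indices with a negative power of q carry coefficient 0; sending them to the power 0 makes the
   exponent condition hold for all indices. *)
pose e (x : (int * int) * (int * int)) : int * int :=
  (if (0 <= x.1.1) && (0 <= x.2.1) then x.1.1 + x.2.1 else 0, x.1.2 + x.2.2).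
have key t z x : c x.1 * d x.2 * mon t z (e x) = c x.1 * mon t z x.1 * (d x.2 * mon t z x.2).
  case: x => -[n r] [n' r'] /=; rewrite /e /=.
  have [n0|/c0 ->] := leP 0 n; last by rewrite !mul0r.
  have [n0'|/d0 ->] := leP 0 n' => /=; last by rewrite !(mulr0, mul0r).
  by rewrite -(monM t z (n, r) (n', r')); ring.
apply: (@strip_series_of _ (fun x => c x.1 * d x.2) e) => [x|t z s].
  by rewrite /e /=; case: ifP => // /andP[? ?]; rewrite addr_ge0.
have [b1 h1] := hc t z s; have [b2 h2] := hd t z s; split.
  apply: (@bsum_le _ _ _ (fun x => nrm (c x.1 * mon t z x.1) * nrm (d x.2 * mon t z x.2))).
    by move=> x; rewrite key nrmM.
  apply: (bsum_pair (G := fun nr => G t z * nrm (c nr * mon t z nr))) => [nr|].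
    by have := bsumZ (nrm_ge0 (c nr * mon t z nr)) b2; rewrite [_ * G t z]mulrC.
  by apply: bsumZ b1; exact: bsum_ge0 b2.
by apply: eq_hasSum (hasSumM h1 h2) => x; rewrite key.
Qed.

Lemma strip_series_sum (f : nat -> C -> C -> C) (F : nat -> C -> C -> R) g M :
  (forall k, strip_series (f k) (F k)) ->
  (forall t z, strip t z -> bsum (fun k => F k t z) (M t z)) ->
  (forall t z, strip t z -> hasSum (fun k => f k t z) (g t z)) -> strip_series g M.
Proof.
move=> h b hg.
have h' k : exists c : int * int -> C, (forall n r : int, n < 0 -> c (n, r) = 0) /\
    (forall t z, strip t z -> bsum (fun nr => nrm (c nr * mon t z nr)) (F k t z) /\
    hasSum (fun nr => c nr * mon t z nr) (f k t z)).
  by case: (h k) => c; exists c.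
have [c hc] := choice h'.
pose e (x : nat * (int * int)) : int * int := (if 0 <= x.2.1 then x.2.1 else 0, x.2.2).
have key t z x : c x.1 x.2 * mon t z (e x) = c x.1 x.2 * mon t z x.2.
  case: x => k [n r]; rewrite /e /=; case: leP => // n0.
  by rewrite (hc k).1// !mul0r.
apply: (@strip_series_of _ (fun x => c x.1 x.2) e) => [x|t z s].
  by rewrite /e /=; case: ifP.
have bb : bsum (fun x : nat * (int * int) => nrm (c x.1 x.2 * mon t z x.2)) (M t z).
  by apply: (bsum_pair (G := fun k => F k t z)) (b t z s) => k; exact: ((hc k).2 t z s).1.
split; first by apply: bsum_le bb => x; rewrite key.
have [l hl] := asummable_ex (ex_intro _ _ bb).
have hk k : hasSum (fun nr => c (k, nr).1 (k, nr).2 * mon t z (k, nr).2) (f k t z) by exact: ((hc k).2 t z s).2.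
have hfl : hasSum (fun k => f k t z) l.
  exact: (@hasSum_pair R nat (int * int)%type (fun x => c x.1 x.2 * mon t z x.2) (fun k => f k t z) l hk hl).
have -> : g t z = l by exact: (@hasSum_unique R nat _ _ _ (hg t z s) hfl).
have ek x : c x.1 x.2 * mon t z x.2 = c x.1 x.2 * mon t z (e x) by rewrite key.
exact: (@eq_hasSum R (nat * (int * int))%type _ _ l ek hl).
Qed.

Lemma strip_seriesZ a f F : strip_series f F -> strip_series (fun t z => a * f t z) (fun t z => F t z * nrm a).
Proof. exact: strip_seriesM (strip_series_cst a). Qed.

Lemma strip_series_uu : strip_series (fun t z => uu z) (fun t z => nrm (ee z) + 2 + (nrm (ee z))^-1).
Proof.
have h1 := strip_seriesD (strip_seriesD (strip_series_mon 1 1 (lexx 0)) (strip_series_cst (-2))) (strip_series_mon (-1) 1 (lexx 0)).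
apply: strip_series_ext (strip_series_le _ h1) => [t z _|t z _].
  rewrite /uu /mon /= !mul0r !add0r mulN1r eeN !mul1r.
  by [].
rewrite nrmN nrm_nat /mon /= !mul0r !add0r !mul1r mulN1r eeN nrmV.
by [].
Qed.

(** The double geometric series of v in x = e((k+1) t + eps z) converges on the strip because |eps|
    <= 1. The factor |q|^k split off in the bound makes it geometric in k. *)
Lemma strip_series_vv (k : nat) (eps : int) : `|eps| <= 1 -> strip_series (fun t z => vv (k.+1%:R * t + eps%:~R * z))
  (fun t z => nrm (ee t) ^+ k * (nrm (ee (t + eps%:~R * z)) / (1 - nrm (ee (t + eps%:~R * z))) ^+ 2)).
Proof.
move=> e1.
apply: (@strip_series_of _ (fun=> 1) (fun ij : nat * nat =>
  ((k.+1 * (ij.1 + ij.2).+1)%:Z, eps * (ij.1 + ij.2).+1%:Z))) => // t z s.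
have t0 := strip_im s.
have em ij : 1 * mon t z ((k.+1 * (ij.1 + ij.2).+1)%:Z, eps * (ij.1 + ij.2).+1%:Z) =
   let x := ee (k.+1%:R * t + eps%:~R * z) in x * (x ^+ ij.1 * x ^+ ij.2).
  rewrite /= mul1r -exprD -exprS -ee_nat /mon /= PoszM !intrM -!pmulrn; congr ee; ring.
have i1 : 0 < im (t + eps%:~R * z).
  rewrite imD imM im_int re_int mul0r addr0; move: s; rewrite /strip.
  have : `|eps%:~R * im z| <= `|im z|.
    rewrite normrM ler_piMl//; have := e1; rewrite -(ler_int R) => h; by rewrite -intr_norm.
  by have := ler_norm (- (eps%:~R * im z)); rewrite normrN => *; lra.
have ex : nrm (ee (k.+1%:R * t + eps%:~R * z)) = nrm (ee t) ^+ k * nrm (ee (t + eps%:~R * z)).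
  by rewrite -nrmX -nrmM -ee_nat -eeD; congr (nrm (ee _)); rewrite -addn1 natrD; ring.
have p1 := nrm_ee_lt1 t0; have p2 := nrm_ee_lt1 i1.
have q1 := nrm_ge0 (ee t); have q2 := nrm_ge0 (ee (t + eps%:~R * z)).
have le1 : nrm (ee t) ^+ k <= 1 by rewrite exprn_ile1// ltW.
have ge0 : 0 <= nrm (ee t) ^+ k by rewrite exprn_ge0.
have le2 : nrm (ee (k.+1%:R * t + eps%:~R * z)) <= nrm (ee (t + eps%:~R * z)).
  by rewrite ex ler_piMl.
have i2 : 0 < im (k.+1%:R * t + eps%:~R * z).
  rewrite (_ : _ + _ = k%:R * t + (t + eps%:~R * z)); last by rewrite -addn1 natrD; ring.
  by rewrite imD imM im_nat re_nat mul0r addr0 ltr_wpDl// mulr_ge0// ltW.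
split; last by apply: eq_hasSum (hasSum_vv i2) => ij; rewrite em.
move: le2 ex em; set x := ee (_ + eps%:~R * z); set rho := nrm (ee (t + _)) => le2 ex em.
have geo : bsum (fun n : nat => nrm x ^+ n) (1 - nrm x)^-1.
  by apply: bsum_geo; rewrite nrm_ge0 (le_lt_trans le2).
have pos : 0 < 1 - nrm x by rewrite subr_gt0 (le_lt_trans le2).
apply: (@bsum_le _ _ _ (fun ij => nrm x * (nrm x ^+ ij.1 * nrm x ^+ ij.2))).
  by move=> ij; rewrite em /= !nrmM !nrmX.
apply: (@bsum_leM _ _ _ (nrm x * ((1 - nrm x)^-1 * (1 - nrm x)^-1))).
  rewrite -invfM -expr2 {1}ex -mulrA ler_wpM2l// ler_wpM2l//.
  rewrite lef_pV2 ?posrE ?exprn_gt0//; last by rewrite subr_gt0.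
  by rewrite lerXn2r ?nnegrE//; rewrite /rho in le2 p2 *; lra.
apply: bsumZ (nrm_ge0 _) _.
apply: (bsum_pair (G := fun i => (1 - nrm x)^-1 * nrm x ^+ i)) => [i|].
  by have := bsumZ (exprn_ge0 i (nrm_ge0 x)) geo; rewrite [_ * (1 - _)^-1]mulrC.
by apply: bsumZ geo; rewrite invr_ge0 ltW.
Qed.

Lemma strip_series_nrm f F t z : strip_series f F -> strip t z -> nrm (f t z) <= F t z.
Proof. by move=> [c _ hc] s; have [b h] := hc t z s; exact: hasSum_nrm_le b h. Qed.

Lemma strip_series_tsum (f : nat -> C -> C -> C) (F : nat -> C -> C -> R) M :
  (forall k, strip_series (f k) (F k)) ->
  (forall t z, strip t z -> bsum (fun k => F k t z) (M t z)) ->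
  strip_series (fun t z => tsum (fun k => f k t z)) M /\
  forall t z, strip t z -> hasSum (fun k => f k t z) (tsum (fun k => f k t z)).
Proof.
move=> h b; have hs t z : strip t z -> hasSum (fun k => f k t z) (tsum (fun k => f k t z)).
  move=> s; apply: tsumP; apply: asummable_le (b t z s) => k; exact: strip_series_nrm.
by split => //; exact: strip_series_sum h b hs.
Qed.

Definition VV (eps : int) (k : nat) t z : R :=
  nrm (ee t) ^+ k * (nrm (ee (t + eps%:~R * z)) / (1 - nrm (ee (t + eps%:~R * z))) ^+ 2).

Lemma VV_ge0 eps k t z : 0 <= VV eps k t z.
Proof. by rewrite mulr_ge0 ?exprn_ge0 ?nrm_ge0// divr_ge0 ?nrm_ge0 ?sqr_ge0. Qed.

Lemma bsum_VV eps t z : 0 < im t ->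
  bsum (fun k => VV eps k t z) (VV eps 0 t z / (1 - nrm (ee t))).
Proof.
move=> t0; have h : bsum (fun k : nat => nrm (ee t) ^+ k) (1 - nrm (ee t))^-1.
  by apply: bsum_geo; rewrite nrm_ge0 nrm_ee_lt1.
have := bsumZ (VV_ge0 eps 0 t z) h; apply: bsum_le => k.
by rewrite /VV expr0 mul1r mulrC.
Qed.

(** For eps = 1 and -1 these are the terms of the Appell-Lerch sum with s > 0 and s < 0. For m = 0
    they are the terms of the row expansion of wp, where eps = 0 gives the v(a t). *)
Definition half_term (m : nat) (eps : int) (k : nat) t z : C :=
  mon t z ((m * k.+1 ^ 2)%:Z, eps * (2 * m * k.+1)%:Z) * vv (k.+1%:R * t + eps%:~R * z).

Definition half_sum m eps t z := tsum (fun k => half_term m eps k t z).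

Lemma strip_series_half m eps : `|eps| <= 1 -> (exists F, strip_series (half_sum m eps) F) /\
  forall t z, strip t z -> hasSum (fun k => half_term m eps k t z) (half_sum m eps t z).
Proof.
(* With K = k + 1, completing the square gives K^2 im t + 2 K eps im z >= ((K - 1)^2 - 1) im t, so
   the monomials are bounded by exp(2 pi m im t) independently of k. *)
move=> e1; pose B t : R := expR (2 * pi * (m%:R * im t)).
have h k : strip_series (half_term m eps k) (fun t z => B t * VV eps k t z).
  have := strip_seriesM (@strip_series_mon (m * k.+1 ^ 2)%:Z (eps * (2 * m * k.+1)%:Z) 1 isT) (@strip_series_vv k eps e1).
  move=> h; apply: strip_series_ext (strip_series_le _ h) => [t z _|t z s]; first by rewrite mul1r.
  rewrite mulrC ler_wpM2r ?VV_ge0// mul1r nrm_mon ler_expR -mulrN.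
  have pg := pi_gt0 R; rewrite ler_pM2l ?mulr_gt0//= PoszM !intrM !PoszM !intrM -!pmulrn.
  have : `|eps%:~R * im z| <= im t.
    apply: le_trans (ltW s); rewrite normrM ler_piMl// -intr_norm.
    by have := e1; rewrite -(ler_int R).
  have t0 := strip_im s; have m0 : 0 <= m%:R :> R by [].
  rewrite ler_norml => /andP[h1 h2]; set K : R := k.+1%:R.
  have K0 : 0 <= K by [].
  have : 0 <= m%:R * (K * (eps%:~R * im z + im t)) by rewrite !mulr_ge0//; lra.
  have := mulr_ge0 m0 (mulr_ge0 (sqr_ge0 (K - 1)) (ltW t0)).
  by rewrite expr2 => *; lra.
have [] := strip_series_tsum h (M := fun t z => B t * (VV eps 0 t z / (1 - nrm (ee t)))).
  by move=> t z s; apply: bsumZ; [exact: expR_ge0 | exact: bsum_VV (strip_im s)].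
by move=> h1 h2; split => //; exists (fun t z => B t * (VV eps 0 t z / (1 - nrm (ee t)))).
Qed.

(** Each partial product of the [FF] differs from the previous one by -u v times the latter; taking
    u out of the telescoping sum shows the infinite product to be 1 + u K with K regular on the
    strip. *)
Definition pK t z : C :=
  tsum (fun n => - vv (n.+1%:R * t) * \prod_(0 <= j < n) FF z (j.+1%:R * t)).

Lemma strip_series_pK : (exists F, strip_series pK F) /\ forall t z p, strip t z ->
  hasProd (fun n : nat => FF z (n.+1%:R * t)) p -> p = 1 + uu z * pK t z.
Proof.
pose U z : R := nrm (ee z) + 2 + (nrm (ee z))^-1.
have U0 z : 0 <= U z by rewrite !addr_ge0 ?invr_ge0 ?nrm_ge0.
have hv k : strip_series (fun t z => vv (k.+1%:R * t)) (VV 0 k).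
  by apply: strip_series_ext (@strip_series_vv k 0 isT) => t z _; rewrite mul0r addr0.
have hP n : strip_series (fun t z => \prod_(0 <= j < n) FF z (j.+1%:R * t))
    (fun t z => \prod_(0 <= j < n) (1 + U z * VV 0 j t z)).
  elim: n => [|n ih].
    apply: strip_series_ext (strip_series_le _ (strip_series_cst 1)) => t z _; by rewrite big_nil// nrm1.
  have := strip_seriesM (strip_seriesD (strip_series_cst 1) (strip_seriesZ (-1) (strip_seriesM strip_series_uu (hv n)))) ih.
  move=> h; apply: strip_series_ext (strip_series_le _ h) => t z _; rewrite big_nat_recr//= /FF.
    by rewrite mulN1r mulrC.
  by rewrite nrm1 nrmN nrm1 mulr1 [VV _ _ _ _ * _]mulrC.
have hX n : strip_series (fun t z => - vv (n.+1%:R * t) * \prod_(0 <= j < n) FF z (j.+1%:R * t))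
   (fun t z => expR (U z * (VV 0 0 t z / (1 - nrm (ee t)))) * VV 0 n t z).
  have := strip_seriesM (strip_seriesZ (-1) (hv n)) (hP n); move=> h; apply: strip_series_ext (strip_series_le _ h) => t z s.
    by rewrite mulN1r.
  rewrite nrmN nrm1 mulr1 ler_wpM2r ?VV_ge0//.
  apply: (@le_trans _ _ (\prod_(0 <= j < n) expR (U z * VV 0 j t z))).
    apply: ler_prod => j _; rewrite expR_ge1Dx andbT.
    by rewrite addr_ge0// mulr_ge0// VV_ge0.
  rewrite -expR_sum ler_expR -mulr_sumr ler_wpM2l//.
  have := bsum_VV 0 z (strip_im s) (seq_fset tt (iota 0 n)).
  rewrite (perm_big (iota 0 n))/=; first by rewrite /index_iota subn0.
  by apply: uniq_perm; rewrite ?sort_keys_uniq ?iota_uniq// => k; rewrite sort_keysE.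
have [] := strip_series_tsum hX (M := fun t z => expR (U z * (VV 0 0 t z / (1 - nrm (ee t)))) * (VV 0 0 t z / (1 - nrm (ee t)))).
  by move=> t z s; apply: bsumZ; [exact: expR_ge0 | exact: bsum_VV (strip_im s)].
move=> h1 h2; split; first by eexists; exact: h1.
move=> t z p s hp; apply: (cvg_unique (@norm_hausdorff _ _) (hasProd_nat hp)).
pose proof (cvCD (cvC_cst (1 : C)) (cvCM (cvC_cst (uu z)) (hasSum_natP (h2 t z s)))) as h3.
apply: eq_cvgC h3 => N; elim: N => [|N ih]; first by rewrite !big_nil mulr0 addr0.
rewrite !big_nat_recr//= -ih /FF; ring.
Qed.

End QSeries.

(** * Cancellation of the polar part *)

Section Expansion.
Variable R : realType.
Local Notation C := (cplx R).
Local Notation tpi := (tpi R).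
Implicit Types (t z w : C) (nr : int * int).

(** Multiplied by v = 1/u, such a function splits into the polar part v and a power series on the
    strip. *)
Definition OU (f : C -> C -> C) := exists2 K, (exists F, strip_series K F) &
  forall t z, strip t z -> nolat t z -> f t z = 1 + uu z * K t z.

Lemma OU1 : OU (fun _ _ => 1).
Proof.
exists (fun _ _ => 0) => [|t z _ _]; last by rewrite mulr0 addr0.
by eexists; exact: strip_series_cst 0.
Qed.

Lemma OUM f g : OU f -> OU g -> OU (fun t z => f t z * g t z).
Proof.
move=> [K [F hK] ef] [L [G hL] eg].
exists (fun t z => K t z + L t z + uu z * (K t z * L t z)) => [|t z s nz].
  eexists; exact: strip_seriesD (strip_seriesD hK hL) (strip_seriesM (@strip_series_uu R) (strip_seriesM hK hL)).
by rewrite ef// eg//; ring.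
Qed.

Lemma OUX f n : OU f -> OU (fun t z => f t z ^+ n).
Proof.
move=> h; elim: n => [|n ih]; first by have := OU1; congr OU.
have := OUM h ih; case=> K hK e; exists K => // t z s nz.
by rewrite exprS e.
Qed.

Definition pprod t z : C := xget 0 [set p | hasProd (fun n : nat => FF z (n.+1%:R * t)) p].

Lemma pprodP t z : 0 < im t ->
  hasProd (fun n : nat => FF z (n.+1%:R * t)) (pprod t z) /\ formA t z = uu z * pprod t z ^+ 2.
Proof.
move=> t0; have [p [h e]] := formA_hasProd z t0.
suff -> : pprod t z = p by [].
by apply: xget_unique => // p' h'; exact: hasProd_unique h' h.
Qed.

Definition regW t z : C := half_sum 0 1 t z + half_sum 0 (-1) t z + (-2) * half_sum 0 0 t z
  - tsum (fun j : int => j%:~R ^- 2 : C) / tpi ^+ 2.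

Lemma half_term0 eps k t z : half_term 0 eps k t z = vv (k.+1%:R * t + eps%:~R * z).
Proof. by rewrite /half_term mul0n !mulr0 mon00 mul1r. Qed.

Lemma W_split t z : strip t z -> nolat t z -> wp t z / tpi ^+ 2 = vv z + regW t z.
Proof.
move=> s nz; have t0 := strip_im s.
have [c0 hc0] := hasSum_inv2 R; rewrite /regW (hasSum_tsum hc0).
have h := hasSumZ (tpi ^- 2) (wp_rows t0 nz hc0).
have [_ /(_ t z s) h1] := @strip_series_half R 0 1 isT.
have [_ /(_ t z s) h2] := @strip_series_half R 0 (-1) isT.
have [_ /(_ t z s) h3] := @strip_series_half R 0 0 isT.
pose f (a : int) := vv (z - a%:~R * t) - vv (a%:~R * t).
have hf : hasSum f (tpi ^- 2 * (wp t z + c0)).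
  by apply: eq_hasSum h => a; rewrite /f mulKf// expf_neq0// tpi_neq0.
have := @hasSum_int_split R f _ _ (eq_hasSum _ (hasSumB h2 h3)) (eq_hasSum _ (hasSumB h1 h3)).
move=> hs; have := hasSum_unique hf (hs _ _).
have -> : f 0 = vv z by rewrite /f mul0r subr0 [X in _ - X](_ : _ = 0) ?subr0// /vv uu0 invr0.
move=> e; have -> : wp t z / tpi ^+ 2 = tpi ^- 2 * (wp t z + c0) - c0 / tpi ^+ 2.
  by field; exact: tpi_neq0.
rewrite e; first by ring.
- move=> k; rewrite !half_term0 /f mul0r addr0 mulN1r -pmulrn.
  by rewrite -[in RHS]vvN opprB.
- move=> k; rewrite !half_term0 /f mul0r addr0 mul1r mulrNz mulNr opprK vvN -pmulrn.
  by rewrite [_ + z]addrC.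
Qed.

Lemma strip_series_regW : exists F, strip_series regW F.
Proof.
have [[F1 h1] _] := @strip_series_half R 0 1 isT.
have [[F2 h2] _] := @strip_series_half R 0 (-1) isT.
have [[F3 h3] _] := @strip_series_half R 0 0 isT.
eexists; exact: strip_seriesD (strip_seriesD (strip_seriesD h1 h2) (strip_seriesZ (-2) h3)) (strip_series_cst _).
Qed.

(** Read additively, the s-th term is the index m translate of v by s t. The Appell-Lerch sum is
    thus an average of v over translations by Z t, and its elliptic behaviour is a shift of s. *)
Definition al (m : nat) t z (s : int) : C :=
  ee (m%:R * (s%:~R ^+ 2 * t + 2 * s%:~R * z)) * vv (z + s%:~R * t).

Lemma alE m t z s :
  ee t ^ (m%:Z * s ^+ 2 + s) * ee z ^ (2 * m%:Z * s + 1) / (1 - ee t ^ s * ee z) ^+ 2 = al m t z s.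
Proof.
rewrite /al vvE -!ee_intM -!eeD mulrA -eeD; congr (ee _ / (1 - ee _) ^+ 2); last by rewrite addrC.
rewrite !intrD !intrM -!pmulrn; ring.
Qed.

Lemma al_S m t z (s l : int) :
  al m t (z + l%:~R * t) s = ee (- (m%:R * (l%:~R ^+ 2 * t + 2 * l%:~R * z))) * al m t z (s + l).
Proof.
by rewrite /al mulrA -eeD; congr (ee _ * vv _); rewrite intrD; ring.
Qed.

Lemma al_N m t z s : al m t (- z) s = al m t z (- s).
Proof.
by rewrite /al intrN -[vv (- z + _)]vvN; congr (ee _ * vv _); ring.
Qed.

Definition regAL m t z : C := half_sum m 1 t z + half_sum m (-1) t z.

Lemma hasSum_al_strip m t z : strip t z -> hasSum (al m t z) (vv z + regAL m t z).
Proof.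
move=> s.
have [_ /(_ t z s) h1] := @strip_series_half R m 1 isT.
have [_ /(_ t z s) h2] := @strip_series_half R m (-1) isT.
have -> : vv z = al m t z 0 by rewrite /al mulr0 !mul0r !addr0 expr0n mul0r mulr0 ee0 mul1r.
apply: hasSum_int_split.
  apply: eq_hasSum h1 => k; rewrite /half_term /al /mon /= mul1r; congr (ee _ * vv _).
    by rewrite -!pmulrn !natrM; ring.
  by rewrite -?pmulrn; ring.
apply: eq_hasSum h2 => k; rewrite /half_term /al /mon /= -[in RHS]vvN; congr (ee _ * vv _).
  by rewrite mulrNz !PoszM !intrM -!pmulrn; ring.
by rewrite mulrNz -!pmulrn; ring.
Qed.

Definition apl m t z : C := tsum (al m t z).

Lemma strip_red t z : 0 < im t -> exists (l : int) w, z = w + l%:~R * t /\ strip t w.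
Proof.
move=> t0; pose l := Num.floor (im z / im t); exists l, (z - l%:~R * t); split; first by rewrite subrK.
rewrite /strip imD imN imM im_int re_int mul0r addr0.
have := Num.Theory.floor_itv (im z / im t); rewrite -/l => /andP[].
rewrite ler_pdivlMr// ltr_pdivrMr// intrD mulrDl mul1r => h1 h2.
rewrite ger0_norm; lra.
Qed.

Lemma hasSum_al m t z : 0 < im t -> hasSum (al m t z) (apl m t z).
Proof.
move=> t0; have [l [w [-> s]]] := strip_red z t0.
have h := hasSum_al_strip m s.
have := (hasSum_bij _ _ (addz_bij l)).1 (hasSumZ (ee (- (m%:R * (l%:~R ^+ 2 * t + 2 * l%:~R * w)))) h).
move=> h'; have h2 : hasSum (al m t (w + l%:~R * t)) (ee (- (m%:R * (l%:~R ^+ 2 * t + 2 * l%:~R * w))) * (vv w + regAL m t w)).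
  by apply: eq_hasSum h' => a; rewrite al_S.
by rewrite /apl (hasSum_tsum h2).
Qed.

Lemma appell_lerchE m t z : 0 < im t -> appell_lerch m t z = apl m t z.
Proof.
move=> t0; apply: sum_hasSum; apply: eq_hasSum (hasSum_al m z t0) => s.
by rewrite alE.
Qed.

Lemma apl_S m t z (l : int) : 0 < im t ->
  apl m t (z + l%:~R * t) = ee (- (m%:R * (l%:~R ^+ 2 * t + 2 * l%:~R * z))) * apl m t z.
Proof.
move=> t0; apply: hasSum_tsum.
have := (hasSum_bij _ _ (addz_bij l)).1 (hasSumZ (ee (- (m%:R * (l%:~R ^+ 2 * t + 2 * l%:~R * z)))) (hasSum_al m z t0)).
by apply: eq_hasSum => a; rewrite al_S.
Qed.

Lemma apl_N m t z : 0 < im t -> apl m t (- z) = apl m t z.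
Proof.
move=> t0; apply: hasSum_tsum.
have := (hasSum_bij _ _ opp_bij).1 (hasSum_al m z t0).
by apply: eq_hasSum => a /=; rewrite al_N.
Qed.

Definition phi0 m t z : C := psim m t z - apl m t z.

Lemma nolat_noint t z : nolat t z -> noint z.
Proof. by move=> h n e; apply: (h (0, n)); rewrite /wlat mul0r add0r. Qed.

(* Off the lattice, psi_m = W (W A)^m with W = v + S and u v = 1, so
   psi_m = (v + S) (1 + u S)^m p^(2m): the polar part v cancels the s = 0 term
   of the Appell-Lerch sum without any division by u. *)
Lemma strip_series_phi0 m : exists f F, strip_series f F /\
  forall t z, strip t z -> nolat t z -> phi0 m t z = f t z.
Proof.
have [F1 hS] := strip_series_regW.
have [[F2 h2] _] := @strip_series_half R m 1 isT.
have [[F3 h3] _] := @strip_series_half R m (-1) isT.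
have ouS : OU (fun t z => 1 + uu z * regW t z) by exists regW => //; exists F1.
have [[F4 hK] hp] := strip_series_pK R.
have oup : OU pprod.
  exists (pK (R := R)); first by exists F4.
  by move=> t z s _; apply: hp => //; case: (pprodP z (strip_im s)).
have [K [F5 h5] e5] := OUM (OUX m ouS) (OUX (2 * m) oup).
exists (fun t z => K t z + regW t z * (1 + uu z * K t z) + (-1) * regAL m t z).
eexists; split.
  exact: strip_seriesD (strip_seriesD h5 (strip_seriesM hS (strip_seriesD (strip_series_cst 1) (strip_seriesM (@strip_series_uu R) h5)))) (strip_seriesZ (-1) (strip_seriesD h2 h3)).
move=> t z s nz; have t0 := strip_im s; have u0 := uu_neq0 (nolat_noint nz).
rewrite /phi0 /apl (hasSum_tsum (hasSum_al_strip m s)) /psim W_split//.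
have [_ ->] := pprodP z t0.
rewrite exprS -mulrA -exprMn.
have -> : (vv z + regW t z) * (uu z * pprod t z ^+ 2) = (1 + uu z * regW t z) * pprod t z ^+ 2.
  by rewrite mulrA mulrDl mulrC /vv mulVf// mulrC [regW _ _ * _]mulrC.
rewrite exprMn -exprM e5//.
rewrite mulrDl mulrDr mulr1 mulrA /vv mulVf// mul1r; ring.
Qed.

Lemma psim_T m t z (l : int) : 0 < im t -> nolat t z ->
  psim m t (z + l%:~R * t) = ee (- (m%:R * (l%:~R ^+ 2 * t + 2 * l%:~R * z))) * psim m t z.
Proof.
move=> t0; have nd w (a : int) : nolat t w -> nolat t (w + a%:~R * t).
  by move=> h; have := @nolat_D R t w a 0 h; rewrite addr0.
have h n w : nolat t w -> psim m t (w + n%:R * t) = ee (- (m%:R * (n%:R ^+ 2 * t + 2 * n%:R * w))) * psim m t w.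
  elim: n w => [|n ih] w nz.
    by rewrite expr0n !mulr0 !mul0r !addr0 mulr0 oppr0 ee0 mul1r.
  have -> : w + n.+1%:R * t = w + n%:R * t + t by rewrite -addn1 natrD; ring.
  rewrite psim_Dt//; last exact: (nd _ n%:Z).
  rewrite ih// mulrA -eeD; congr (ee _ * _); rewrite -addn1 natrD; ring.
case: (intP l) => [|n|n] nz.
- by rewrite expr0n !mulr0 !mul0r !addr0 mulr0 oppr0 ee0 mul1r.
- by rewrite -!pmulrn h.
have := h n.+1 (z + (- n.+1%:Z)%:~R * t) (nd _ _ nz).
rewrite mulrNz mulNr -pmulrn subrK => ->; rewrite mulrA -eeD.
by rewrite [X in ee X](_ : _ = 0) ?ee0 ?mul1r//; ring.
Qed.

End Expansion.

(** * Global Fourier expansion of the standard form *)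

Section PhiStand.
Variable R : realType.
Local Notation C := (cplx R).
Implicit Types (t z w : C) (nr : int * int).

Lemma phi0_T m t z (l : int) : 0 < im t -> nolat t z ->
  phi0 m t (z + l%:~R * t) = ee (- (m%:R * (l%:~R ^+ 2 * t + 2 * l%:~R * z))) * phi0 m t z.
Proof. by move=> t0 nz; rewrite /phi0 psim_T// apl_S// mulrBr. Qed.

Lemma nolat_T t z (l : int) : nolat t z -> nolat t (z + l%:~R * t).
Proof. by move=> h; have := @nolat_D R t z l 0 h; rewrite addr0. Qed.

Lemma nolat_N t z : nolat t z -> nolat t (- z).
Proof.
move=> h [a b] e; apply: (h (- a, - b)).
by rewrite -[z]opprK e /wlat /= !intrN; ring.
Qed.

Lemma phi0_N m t z : 0 < im t -> nolat t z -> phi0 m t (- z) = phi0 m t z.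
Proof. by move=> t0 nz; rewrite /phi0 psim_N// apl_N. Qed.

Lemma nolat_near t z : 0 < im t -> exists2 d : R, 0 < d &
  forall w, nrm (w - z) < d -> w != z -> nolat t w.
Proof.
move=> t0; have [[ab0 e]|nz] := pselect (exists ab, z = wlat t ab).
  have [c c0 hc] := wlat_lower1 t0; exists c => // w lt /eqP ne ab ew.
  apply: ne; rewrite ew e; congr wlat; apply/eqP; apply: contraTT lt => nab.
  have h := hc (ab - ab0); rewrite subr_eq0 nab in h.
  rewrite -leNgt ew e; apply: le_trans (_ : nrm (wlat t (ab - ab0)) <= _).
    by apply: le_trans (h isT); rewrite ler_peMr ?(ltW c0)// lerDl slat_ge0.
  by rewrite (_ : wlat t ab - wlat t ab0 = wlat t (ab - ab0))// /wlat /= !intrB; ring.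
have {}nz : nolat t z by move=> ab e; apply: nz; exists ab.
have [c c0 hc] := wlat_lower_z t0 nz; exists c => // w lt _ ab ew.
have := hc ab; rewrite -ew leNgt => /negP; apply.
rewrite nrmB; apply: lt_le_trans lt _.
by rewrite ler_peMr ?(ltW c0)// lerDl slat_ge0.
Qed.

Lemma im_half_nolat t z (a : int) : 0 < im t -> a%:~R * im t < im z < (a + 1)%:~R * im t -> nolat t z.
Proof.
move=> t0 /andP[h1 h2] [b c] e; move: h1 h2; rewrite e /wlat imD imM /= !im_int !re_int !mul0r !addr0.
rewrite !ltr_pM2r// !ltr_int; lia.
Qed.

Lemma qperiodic_of1 m c : (forall n r : int, c (n + r + m%:Z, r + (2 * m)%:Z) = c (n, r) :> C) ->
  qperiodic m c.
Proof.
move=> h.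
have hn k : forall n r : int, c (n + r * k%:Z + m%:Z * k%:Z ^+ 2, r + (2 * m)%:Z * k%:Z) = c (n, r).
  elim: k => [|k ih] n r; first by rewrite expr0n !mulr0 !addr0.
  rewrite -[RHS]ih -[RHS]h; congr (c (_, _)); rewrite -addn1 !PoszD ?PoszM; ring.
move=> n r l; case: (intP l) => [|k|k]; first by rewrite expr0n !mulr0 !addr0.
  exact: hn.
rewrite -[LHS](hn k.+1); congr (c (_, _)); rewrite ?PoszM; ring.
Qed.

(** The expansion on the strip, off the lattice, determines everything. Its periodicity extends it
    to all z; its sum is continuous in z, hence equals the limit defining [phi_stand] at the lattice
    points too; its symmetry is tested on one line that is disjoint from the lattice. *)
Theorem phi_stand_expansion m : (0 < m)%N -> exists c : int * int -> C,
  [/\ fseries c (@phi_stand R m), forall n r : int, n < 0 -> c (n, r) = 0,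
      qperiodic m c, forall n r : int, c (n, - r) = c (n, r) &
      forall t z, 0 < im t -> nolat t z -> phi_stand m t z = phi0 m t z].
Proof.
move=> m0.
have [f [F [[c c0 hc] hf]]] := strip_series_phi0 R m.
have hs t z : strip t z -> nolat t z -> hasSum (fun nr => c nr * mon t z nr) (phi0 m t z).
  by move=> s nz; rewrite hf//; case: (hc t z s).
have imt (a : R) : im ('i + ofR a) = 1 by rewrite im_ofRD im_i.
have per : qperiodic m c.
  apply: qperiodic_of1 => n r.
  (* Over im t = 1 the lines im z = -1/2 and im z = 1/2 lie in the strip, avoid the lattice and
     differ by the period t. *)
  have := @periodic_of R m c 'i (- ('i / 2)) 1 (fun a b => phi0 m ('i + ofR a) (- ('i / 2) + ofR b)).
  have i2 : im ('i / 2 : C) = 1 / 2.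
    have -> : ('i / 2 : C) = ofR 2^-1 * 'i by rewrite ofRV ofRn mulrC.
    by rewrite imM im_ofR mul0r addr0 re_ofR im_i mulr1 mul1r.
  have h : forall a b : R, strip ('i + ofR a) (- ('i / 2) + ofR b) /\ nolat ('i + ofR a) (- ('i / 2) + ofR b).
    move=> a b; split; first by rewrite /strip imt imD imN i2 im_ofR addr0 normrN ger0_norm; lra.
    apply: (@im_half_nolat _ _ (-1)); rewrite imt ?imD ?imN ?i2 ?im_ofR ?addr0//.
    by rewrite mulr1 addNr mulr0z !mulr1; lra.
  have h' : forall a b : R, strip ('i + ofR a) (- ('i / 2) + ofR b + 1%:~R * ('i + ofR a)).
    move=> a b; rewrite /strip mul1r !imD imN i2 im_i !im_ofR !addr0.
    by rewrite ger0_norm; lra.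
  move=> /(_ _ n r); rewrite expr1n !mulr1; apply => a b t' z'.
  have [h1 h2] := h a b; have t0 : 0 < im t' by rewrite /t' imt.
  split; first exact: (hs t' z' h1 h2).
  have := hs t' (z' + 1%:~R * t') (h' a b) (@nolat_T t' z' 1 h2).
  by rewrite (@phi0_T m t' z' 1 t0 h2) mulr1.
(* By periodicity the series converges outside the strip as well: translating z by l t permutes its
   terms up to a common factor. *)
pose G t z := tsum (fun nr => c nr * mon t z nr).
have FSG : fseries c G.
  move=> t z t0; apply: tsumP; have [l [w [-> s]]] := strip_red z t0.
  have [_ h] := hc t w s.
  have := (hasSum_bij _ _ (shift_bij (fun r => r * l + m%:Z * l ^+ 2) ((2 * m)%:Z * l))).1 h.
  move=> /(hasSumZ (ee (- (m%:R * (l%:~R ^+ 2 * t + 2 * l%:~R * w)))))/hasSum_asummable[M hM].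
  exists M; apply: bsum_le hM => -[n r] /=; rewrite addrA per mulrCA.
  rewrite le_eqVlt; apply/orP; left; apply/eqP; congr (nrm (_ * _)).
  rewrite /mon /= -eeD !(intrD, intrM) PoszM intrM -!pmulrn; congr ee; rewrite !expr2; ring.
have Gphi t z : 0 < im t -> nolat t z -> G t z = phi0 m t z.
  move=> t0 nz; have [l [w [ez s]]] := strip_red z t0.
  have nw : nolat t w.
    by have := @nolat_T t z (- l) nz; rewrite ez mulrNz mulNr addrK.
  have [_ h] := hc t w s.
  rewrite ez phi0_T// hf//; apply: hasSum_tsum.
  have := (hasSum_bij _ _ (shift_bij (fun r => r * l + m%:Z * l ^+ 2) ((2 * m)%:Z * l))).1 h.
  move=> /(hasSumZ (ee (- (m%:R * (l%:~R ^+ 2 * t + 2 * l%:~R * w))))).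
  apply: eq_hasSum => -[n r] /=; rewrite addrA per mulrCA; congr (_ * _).
  rewrite /mon /= -eeD !(intrD, intrM) PoszM intrM -!pmulrn; congr ee; rewrite !expr2; ring.
have Gst t z : 0 < im t -> G t z = phi_stand m t z.
  move=> t0; rewrite /phi_stand; apply/esym; apply: cvg_lim; first exact: norm_hausdorff.
  have [d d0 hd] := nolat_near z t0.
  apply: (near_cvgC (f := G t)); last exact: cvg_punct (fseries_cont FSG t0).
  apply/nearC'; exists d => // w lt ne.
  by rewrite (Gphi _ _ t0 (hd w lt ne)) /phi0 appell_lerchE// psimE.
exists c; split => //; first exact: fseries_ext FSG Gst.
  2: by move=> t z t0 nz; rewrite -Gst// Gphi.
have i3 : im ('i / 2 : C) = 1 / 2.
  have -> : ('i / 2 : C) = ofR 2^-1 * 'i by rewrite ofRV ofRn mulrC.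
  by rewrite imM im_ofR mul0r addr0 re_ofR im_i mulr1 mul1r.
have e : (fun nr : int * int => c (nr.1, - nr.2)) = c.
  apply: (@fourier_unique _ _ _ ('i : C) ('i / 2) (fun a b => phi0 m ('i + ofR a) ('i / 2 + ofR b))) => a b.
    have nz : nolat ('i + ofR a) ('i / 2 + ofR b).
      have e1 : im ('i / 2 + ofR b) = 1 / 2 by rewrite imD i3 im_ofR addr0.
      by apply: (@im_half_nolat _ _ 0); rewrite imt// e1 add0r mul0r mul1r; lra.
    have s : strip ('i + ofR a) (- ('i / 2 + ofR b)).
      by rewrite /strip imt imN imD i3 im_ofR addr0 normrN ger0_norm; lra.
    have h := hs _ _ s (nolat_N nz); rewrite phi0_N ?imt// in h.
    have gb : bijective (fun nr : int * int => (nr.1, - nr.2)).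
      by exists (fun nr : int * int => (nr.1, - nr.2)) => -[? ?] /=; rewrite opprK.
    apply: eq_hasSum ((hasSum_bij _ _ gb).1 h) => -[n r] /=; congr (_ * _).
    by rewrite /mon /= intrN mulrNN.
  apply: hs; first by rewrite /strip imt imD i3 im_ofR addr0 ger0_norm; lra.
  have e1 : im ('i / 2 + ofR b) = 1 / 2 by rewrite imD i3 im_ofR addr0.
  by apply: (@im_half_nolat _ _ 0); rewrite imt// e1 add0r mul0r mul1r; lra.
by move=> n r; have := congr1 (fun g => g (n, r)) e.
Qed.

End PhiStand.

(** * Constant terms in weight two *)

Section WeightTwo.
Variable R : realType.
Local Notation C := (cplx R).
Local Notation tpi := (tpi R).
Implicit Types (t z w d : C).

Definition qseries (f : C -> C) (b : int -> C) := forall t, 0 < im t ->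
  hasSum (fun N : int => b N * ee (N%:~R * t)) (f t).

Lemma nrm_eeN (N : int) t : nrm (ee (N%:~R * t)) = expR (- (2 * pi * (N%:~R * im t))).
Proof. by rewrite nrm_ee imM im_int re_int mul0r addr0. Qed.

(** A majorant near the arc from i to the cube root of unity: heights between 5/8 and 3/2, with a
    margin 1/8, are compared with the fixed heights 1/4 and 2 according to the sign of N. The slack
    absorbs the factor 1 + |N| because pi >= 2. *)
Lemma arc_bound (N : int) (x y : R) : 5 / 8 <= x <= 3 / 2 -> 0 <= y <= 1 / 8 ->
  (1 + `|N%:~R|) * (expR (- (2 * pi * (N%:~R * x))) * expR (2 * pi * `|N%:~R| * y)) <=
  expR (- (2 * pi * (N%:~R * (1 / 4)))) + expR (- (2 * pi * (N%:~R * 2))).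
Proof.
move=> /andP[x1 x2] /andP[y0 y1]; have p2 := pi_ge2 R; rewrite -expRD.
apply: (@le_trans _ _ (expR `|N%:~R| * expR (- (2 * pi * (N%:~R * x)) + 2 * pi * `|N%:~R| * y))).
  by rewrite ler_wpM2r ?expR_ge0 ?expR_ge1Dx.
rewrite -expRD; set n : R := N%:~R.
have [n0|n0] := leP 0 n.
  apply: (@le_trans _ _ (expR (- (2 * pi * (n * (1 / 4)))))); last by rewrite lerDl expR_ge0.
  rewrite ler_expR.
  have := mulr_ge0 n0 (mulr_ge0 (ltW (pi_gt0 R)) (_ : 0 <= x - 5 / 8)) => /(_ ltac:(lra)).
  have := mulr_ge0 n0 (mulr_ge0 (ltW (pi_gt0 R)) (_ : 0 <= 1 / 8 - y)) => /(_ ltac:(lra)).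
  have := mulr_ge0 n0 (_ : 0 <= pi - 2 :> R) => /(_ ltac:(lra)).
  rewrite ger0_norm//; lra.
apply: (@le_trans _ _ (expR (- (2 * pi * (n * 2))))); last by rewrite lerDr expR_ge0.
rewrite ler_expR; have n1 : 0 <= - n by lra.
have := mulr_ge0 n1 (mulr_ge0 (ltW (pi_gt0 R)) (_ : 0 <= 3 / 2 - x)) => /(_ ltac:(lra)).
have := mulr_ge0 n1 (mulr_ge0 (ltW (pi_gt0 R)) (_ : 0 <= 1 / 8 - y)) => /(_ ltac:(lra)).
have := mulr_ge0 n1 (_ : 0 <= pi - 2 :> R) => /(_ ltac:(lra)).
rewrite ltr0_norm//; lra.
Qed.

(** Termwise integration; the term N = 0 becomes b(0) t and causes the increment b(0) under t -> t +
    1. Differentiability takes the form of a uniform quadratic remainder, in which 8 pi |N| comes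
    from [nrm_cexp_sub1] after division by 2 pi i N. *)
Lemma qseries_antiderivative f b : qseries f b -> exists (F : C -> C) (M : R),
  [/\ 0 <= M, forall t, 0 < im t -> F (t + 1) = F t + b 0,
   forall t, 5 / 8 <= im t <= 3 / 2 -> nrm (f t) <= M &
   forall t d, 5 / 8 <= im t <= 3 / 2 -> nrm d <= 1 / 8 ->
     nrm (F (t + d) - F t - f t * d) <= M * nrm d ^+ 2].
Proof.
move=> h.
pose T t (N : int) : C := if N == 0 then 0 else b N * ee (N%:~R * t) / (tpi * N%:~R).
have tp := nrm_tpi_gt0 R; have tp0 := tpi_neq0 R.
have hT t : 0 < im t -> hasSum (T t) (tsum (T t)).
  move=> t0; apply: tsumP; have [M hM] := hasSum_asummable (hasSumZ tpi^-1 (h t t0)).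
  exists M; apply: bsum_le hM => N; rewrite /T; case: eqP => [_|/eqP N0].
    by rewrite nrm0 nrm_ge0.
  rewrite (_ : b N * _ / _ = tpi^-1 * (b N * ee (N%:~R * t)) / N%:~R); last by rewrite invfM; ring.
  rewrite [X in X <= _]nrmM ler_piMr ?nrm_ge0//.
  have N1 : 1 <= nrm (N%:~R : C).
    by rewrite nrm_int -intr_norm (ler_int R 1) -absz_gt0 in N0 *; lia.
  by rewrite nrmV invf_le1// (lt_le_trans _ N1).
pose t1 : C := ofR (1 / 4) * 'i; pose t2 : C := ofR 2 * 'i.
have i1 : im t1 = 1 / 4 by rewrite imM im_ofR mul0r addr0 re_ofR im_i mulr1.
have i2 : im t2 = 2 by rewrite imM im_ofR mul0r addr0 re_ofR im_i mulr1.
have [|M1 b1] := hasSum_asummable (h t1 _); first by rewrite i1; lra.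
have [|M2 b2] := hasSum_asummable (h t2 _); first by rewrite i2; lra.
have b12 := bsumD b1 b2; set g := (fun i : int => _) in b12.
have key t y (N : int) : 5 / 8 <= im t <= 3 / 2 -> 0 <= y <= 1 / 8 ->
    nrm (b N * ee (N%:~R * t)) * ((1 + `|N%:~R|) * expR (2 * pi * `|N%:~R| * y)) <= g N.
  move=> ht hy; have le := arc_bound N ht hy; rewrite /g !nrmM !nrm_eeN i1 i2.
  rewrite -mulrDr -mulrA; rewrite ler_wpM2l ?nrm_ge0//.
  by apply: le_trans le; rewrite mulrCA.
exists (fun t => b 0 * t + tsum (T t)), ((M1 + M2) * (1 + 8 * pi)); split.
- by rewrite mulr_ge0 ?(bsum_ge0 b12)// addr_ge0// mulr_ge0// ltW ?pi_gt0.
- move=> t t0; rewrite mulrDr mulr1 addrAC; congr (_ + _ + _); congr tsum.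
  by apply/funext => N; rewrite /T mulrDr mulr1 eeD ee_int mulr1.
- move=> t ht; have t0 : 0 < im t by lra.
  apply: (@le_trans _ _ (M1 + M2)); last first.
    by rewrite ler_peMr ?(bsum_ge0 b12)// lerDl mulr_ge0// ltW ?pi_gt0.
  apply: hasSum_nrm_le (h t t0); apply: bsum_le b12 => N.
  apply: le_trans (key t 0 N ht _); last by lra.
  by rewrite mulr0 expR0 mulr1 ler_peMr ?nrm_ge0// lerDl.
move=> t d ht hd; have d0 := nrm_ge0 d.
have t0 : 0 < im t by lra.
have td0 : 0 < im (t + d) by rewrite imD; have := im_le_nrm d; rewrite ler_norml; lra.
have hz : hasSum (fun N : int => if N == 0 then b 0 * d else 0) (b 0 * d).
  have := @hasSum_support R int (fun a => if a == 0 then b 0 * d else 0) [fset (0 : int)]%fset.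
  by rewrite big_seq_fset1 eqxx; apply => i; rewrite inE => /negbTE ->.
have hs := hasSumD (hasSumB (hasSumB (hT _ td0) (hT _ t0)) (hasSumZr d (h t t0))) hz.
rewrite (_ : _ - _ - _ = tsum (T (t + d)) - tsum (T t) - f t * d + b 0 * d); last by ring.
apply: hasSum_nrm_le hs.
apply: (@bsum_leM _ _ _ (8 * pi * nrm d ^+ 2 * (M1 + M2))).
  have := mulr_ge0 (sqr_ge0 (nrm d)) (bsum_ge0 b12); lra.
have c0 : 0 <= 8 * pi * nrm d ^+ 2 by rewrite !mulr_ge0 ?sqr_ge0// ltW// pi_gt0.
apply: bsum_le (bsumZ c0 b12) => N; rewrite /T.
have g0 N' : 0 <= g N' by rewrite addr_ge0 ?nrm_ge0.
case: eqP => [->|/eqP N0].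
  by rewrite subrr mul0r ee0 mulr1 sub0r addNr nrm0 mulr_ge0.
rewrite addr0; have Nn : (N%:~R : C) != 0 by rewrite intr_eq0.
rewrite (_ : _ - _ = b N * ee (N%:~R * t) * ((cexp (tpi * (N%:~R * d)) - 1 - tpi * (N%:~R * d)) / (tpi * N%:~R))); last first.
  rewrite -eeE mulrDr eeD; field; by rewrite tp0 Nn.
rewrite nrmM; have e1 := nrm_cexp_sub1 (tpi * (N%:~R * d)).
have eN : nrm (tpi * (N%:~R * d)) = 2 * pi * `|N%:~R| * nrm d.
  by rewrite tpiE !nrmM nrm_i nrm_ofR nrm_int mulr1 ger0_norm ?mulrA// mulr_ge0// ltW// pi_gt0.
have k := key t (nrm d) N ht; rewrite d0 hd in k; have {}k := k isT.
apply: le_trans (ler_wpM2l c0 k); rewrite [X in _ <= X]mulrCA ler_wpM2l ?nrm_ge0//.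
rewrite nrmM nrmV ler_pdivrMr ?nrm_gt0 ?mulf_neq0//; apply: le_trans e1 _; rewrite eN.
have -> : nrm (tpi * N%:~R) = 2 * pi * `|N%:~R|.
  by rewrite tpiE !nrmM nrm_i nrm_ofR nrm_int mulr1 ger0_norm// mulr_ge0// ltW// pi_gt0.
set a := `|N%:~R|; set E := expR _; have E0 : 0 <= E by exact: expR_ge0.
have a0 : 0 <= a by exact: normr_ge0.
have p0 := ltW (pi_gt0 R).
have : 0 <= 16 * pi ^+ 2 * nrm d ^+ 2 * a * E by rewrite !mulr_ge0 ?sqr_ge0.
lra.
Qed.

(* If f(-1/t) = t^2 f(t) + kappa t, then F(-1/t) - F(t) - kappa log t is
   constant for an antiderivative F; compare its values at t = i and at the cube
   root of unity t = w in the upper half-plane, where -1/w = w + 1. *)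
Lemma weight_two f b (kap : C) : qseries f b ->
  (forall t, 0 < im t -> f (- t^-1) = t ^+ 2 * f t + kap * t) -> b 0 = kap * tpi / 12.
Proof.
move=> h hf; have [F [M [M0 F1 fM FM]]] := qseries_antiderivative h.
pose T (s : R) : C := ee (ofR s).
have nT s : nrm (T s) = 1 by rewrite nrm_ee im_ofR !mulr0 oppr0 expR0.
have T0 s : T s != 0 by exact: ee_neq0.
have imT s : 1 / 4 <= s <= 1 / 3 -> 5 / 8 <= im (T s) <= 3 / 2.
  move=> hs; rewrite /T eeE im_cexp re_tpiM im_tpiM im_ofR re_ofR mulr0 oppr0 expR0 mul1r.
  have -> : sin (2 * pi * s) = cos (2 * pi * s - pi / 2).
    by rewrite cosBpihalf.
  set x := _ - _; have := cos_sub1 x; have : 0 <= x <= 2 / 3.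
    have := pihalf_lt2 R; have := pi_gt0 R; rewrite /x => p0 p4.
    have := mulr_ge0 (ltW p0) (_ : 0 <= s - 1 / 4) => /(_ ltac:(lra)).
    have := mulr_ge0 (ltW p0) (_ : 0 <= 1 / 3 - s) => /(_ ltac:(lra)).
    lra.
  move=> /andP[x0 x1]; have : x ^+ 2 <= (2 / 3) ^+ 2 by rewrite lerXn2r// nnegrE; lra.
  rewrite ler_norml; lra.
have imV t : nrm t = 1 -> im (- t^-1) = im t.
  move=> n1; have t0 : t != 0 by rewrite -nrm_gt0 n1.
  have -> : - t^-1 = ofR (- re t) + 'i * ofR (im t).
    apply: (mulfI t0); rewrite mulrN divff// [X in _ = X * _](reim t).
    have := nrm_sqr t; rewrite n1 expr1n => e1.
    have -> : (-1 : C) = - ofR (re t ^+ 2 + im t ^+ 2) by rewrite -e1.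
    rewrite ofRN ofRD !ofRX; have ii : 'i ^+ 2 = -1 :> C by rewrite sqrCi.
    have -> : (ofR (re t) + 'i * ofR (im t)) * (- ofR (re t) + 'i * ofR (im t)) = - ofR (re t) ^+ 2 + 'i ^+ 2 * ofR (im t) ^+ 2 by ring.
    by rewrite ii; ring.
  by rewrite imD imM im_i !im_ofR re_ofR mulr0 add0r add0r mul1r.
(* On the unit circle t = e(s), log t is 2 pi i s, and the arc from i to the cube root of unity is
   1/4 <= s <= 1/3. *)
pose H s : C := F (- (T s)^-1) - F (T s) - kap * (tpi * ofR s).
have hH : exists K e0 : R, [/\ 0 <= K, 0 < e0 & forall s s' : R, 1 / 4 <= s <= 1 / 3 ->
    1 / 4 <= s' <= 1 / 3 -> `|s' - s| <= e0 -> nrm (H s' - H s) <= K * `|s' - s| ^+ 2].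
  have [K1 K10 hK1] := nrm_ee_sub1 R.
  exists (3 * M * K1 ^+ 2 + nrm kap * (4 * nrm tpi ^+ 2 * expR (nrm tpi))), (Num.min 1 (1 / 8 / K1)); split.
  - apply: addr_ge0; first by apply: mulr_ge0 (sqr_ge0 _); apply: mulr_ge0.
    apply: mulr_ge0 (nrm_ge0 _) _; apply: mulr_ge0 (expR_ge0 _).
    by apply: mulr_ge0 (sqr_ge0 _).
  - by rewrite lt_min ltr01 divr_gt0.
  move=> s s' hs hs'; rewrite le_min => /andP[le1 le2].
  set x : C := ofR (s' - s); have nx : nrm x = `|s' - s| by rewrite nrm_ofR.
  have eT : T s' = T s * ee x by rewrite /T /x -eeD ofRD ofRN addrC subrK.
  pose d := T s' - T s.
  have nd : nrm d <= K1 * `|s' - s|.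
    rewrite /d eT -[X in _ - X]mulr1 -mulrBr nrmM nT mul1r -nx; apply: hK1.
    by rewrite nx.
  have nd8 : nrm d <= 1 / 8 by apply: le_trans nd _; rewrite mulrC -ler_pdivlMr.
  have hd2 : - (T s')^-1 - - (T s)^-1 = d / (T s * T s') by rewrite /d; field; rewrite !T0.
  have nd2 : nrm (d / (T s * T s')) = nrm d by rewrite nrmM nrmV nrmM !nT mulr1 invr1 mulr1.
  have u1 := FM (- (T s)^-1) (d / (T s * T s')).
  rewrite imV// -hd2 [_ + (_ - _)]addrC subrK hd2 nd2 in u1.
  have {}u1 := u1 (imT s hs) nd8.
  have u2 := FM (T s) d (imT s hs) nd8; rewrite /d [_ + (_ - _)]addrC subrK -/d in u2.
  have im0 : 0 < im (T s) by have := imT s hs; lra.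
  rewrite hf// in u1.
  have u3 := nrm_cexp_sub1 (tpi * (- x)); rewrite -eeE in u3.
  have ed : d / T s' = 1 - ee (- x).
    by rewrite /d eT eeN; field; rewrite ee_neq0 T0.
  (* The first order terms cancel: d(-1/t) = dt/t^2, so f(-1/t) dt/t^2 = f(t) dt + kappa dt/t, and
     dt/t = 2 pi i ds on the arc. *)
  rewrite (_ : H s' - H s =
     (F (- (T s')^-1) - F (- (T s)^-1) - (T s ^+ 2 * f (T s) + kap * T s) * (d / (T s * T s')))
     - (F (T s') - F (T s) - f (T s) * d) - f (T s) * (d ^+ 2 / T s')
     - kap * (ee (- x) - 1 - tpi * (- x))); last first.
    have -> : (T s ^+ 2 * f (T s) + kap * T s) * (d / (T s * T s')) =
       f (T s) * d - f (T s) * (d ^+ 2 / T s') + kap * (d / T s').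
      by rewrite /d; field; rewrite !T0.
    rewrite ed /H mulrN [tpi * x](_ : _ = tpi * ofR s' - tpi * ofR s); last by rewrite /x ofRD ofRN; ring.
    ring.
  apply: le_trans (ler_nrmB _ _) _; rewrite [X in _ <= X]mulrDl; apply: lerD.
    apply: le_trans (ler_nrmB _ _) _.
    have u4 : nrm (f (T s) * (d ^+ 2 / T s')) <= M * nrm d ^+ 2.
      by rewrite nrmM [nrm (_ / _)]nrmM nrmV nT invr1 mulr1 nrmX ler_wpM2r ?sqr_ge0// fM// imT.
    have u5 := ler_nrmB (F (- (T s')^-1) - F (- (T s)^-1) - (T s ^+ 2 * f (T s) + kap * T s) * (d / (T s * T s')))
      (F (T s') - F (T s) - f (T s) * d).
    have u6 : M * nrm d ^+ 2 <= M * (K1 ^+ 2 * `|s' - s| ^+ 2).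
      rewrite ler_wpM2l// -exprMn lerXn2r ?nnegrE ?nrm_ge0// mulr_ge0// ltW//.
    clear -u1 u2 u4 u5 u6; lra.
  rewrite nrmM -mulrA ler_wpM2l ?nrm_ge0//; apply: le_trans u3 _.
  rewrite nrmM nrmN nx exprMn.
  rewrite [X in _ <= X](_ : _ = 4 * (nrm tpi ^+ 2 * `|s' - s| ^+ 2) * expR (nrm tpi)); last by ring.
  apply: ler_wpM2l; first by rewrite mulr_ge0// mulr_ge0 ?sqr_ge0.
  by rewrite ler_expR ler_piMr ?nrm_ge0.
have r3 : is_true ((1 / 4 <= 1 / 3 :> R) && (1 / 3 <= 1 / 3 :> R)) by lra.
(* A function with quadratic increments is constant: n steps of length 1/(12 n) change it by
   O(1/n). *)
have e13 : H (1 / 3) = H (1 / 4).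
  have [K [e0 [K0 e00 hK]]] := hH.
  apply/eqP; rewrite -subr_eq0 -nrm_eq0; apply/eqP/le_anti; rewrite nrm_ge0 andbT.
  apply/ler_addgt0Pl => eps eps0; rewrite addr0.
  pose n := (Num.truncn (K / eps + e0^-1)).+1; have n0 : 0 < n%:R :> R by [].
  have nge : K / eps + e0^-1 <= n%:R by apply: ltW; exact: Num.Theory.truncnS_gt.
  have h1 : 0 <= K / eps by rewrite divr_ge0// ltW.
  have h2 : 0 < e0^-1 by rewrite invr_gt0.
  pose q : R := (12 * n%:R)^-1.
  have q0 : 0 < q by rewrite invr_gt0 mulr_gt0.
  have qn : q * n%:R = 1 / 12 by rewrite /q; field; rewrite gt_eqF.
  have qe : q <= e0.
    rewrite -[e0]invrK lef_pV2 ?posrE ?mulr_gt0//; lra.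
  pose s (k : nat) : R := 1 / 4 + k%:R * q.
  have hs k : (k <= n)%N -> 1 / 4 <= s k <= 1 / 3.
    move=> kn; have : k%:R * q <= n%:R * q by rewrite ler_wpM2r ?ler_nat// ltW.
    have : 0 <= k%:R * q by rewrite mulr_ge0// ltW.
    rewrite /s [n%:R * q]mulrC qn; lra.
  have step k : (k <= n)%N -> nrm (H (s k) - H (1 / 4)) <= k%:R * (K * q ^+ 2).
    elim: k => [|k ih] kn; first by rewrite /s mul0r addr0 subrr nrm0 mul0r.
    rewrite (_ : H (s k.+1) - _ = (H (s k.+1) - H (s k)) + (H (s k) - H (1 / 4))); last by ring.
    apply: le_trans (ler_nrmD _ _) _.
    have -> : k.+1%:R * (K * q ^+ 2) = K * q ^+ 2 + k%:R * (K * q ^+ 2).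
      by rewrite -addn1 natrD mulrDl mul1r addrC.
    apply: lerD; last exact: ih (ltnW kn).
    have es : s k.+1 - s k = q by rewrite /s -addn1 natrD; ring.
    have := hK (s k) (s k.+1) (hs k (ltnW kn)) (hs _ kn).
    by rewrite es gtr0_norm//; apply.
  have := step n (leqnn n).
  have -> : s n = 1 / 3 by rewrite /s [n%:R * q]mulrC qn; field.
  move=> le; apply: le_trans le _.
  have -> : n%:R * (K * q ^+ 2) = K * q / 12 by rewrite expr2 (_ : n%:R * (K * (q * q)) = K * q * (q * n%:R)); [rewrite qn; ring|ring].
  have : K * q <= eps.
    have -> : K * q = K / (12 * n%:R) by [].
    rewrite ler_pdivrMr ?mulr_gt0//.
    have : K <= eps * n%:R.
      have -> : K = eps * (K / eps) by rewrite mulrCA divff ?mulr1// gt_eqF.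
      by rewrite ler_wpM2l ?ltW//; lra.
    have : 0 <= eps * n%:R by rewrite mulr_ge0// ltW.
    lra.
  have : 0 <= K * q by rewrite mulr_ge0// ltW.
  lra.
(* The point i is fixed by t -> -1/t, and the cube root w goes to w + 1, where F increases by b(0).
   Hence b(0) = kappa 2 pi i (1/3 - 1/4). *)
have t4 : - (T (1 / 4))^-1 = T (1 / 4).
  apply: (mulfI (T0 (1 / 4))); rewrite mulrN divff// /T -eeD -ofRD.
  have -> : ofR (1 / 4 + 1 / 4) = 2^-1 :> C by rewrite -ofRn -ofRV; congr ofR; field.
  by rewrite ee_half.
have w3 : T (1 / 3) ^+ 3 = 1.
  rewrite /T -ee_nat -ofRn -ofRM (_ : 3 * (1 / 3) = 1); last by field.
  by rewrite ee1.
have w1 : T (1 / 3) != 1.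
  apply/eqP => /ee_eq1[k] /(congr1 (@re R)); rewrite re_ofR re_int => e.
  have : (3 * k)%:~R = 1%:~R :> R by rewrite intrM -e; field.
  by move/intr_inj => ?; lia.
have t3 : - (T (1 / 3))^-1 = T (1 / 3) + 1.
  apply: (mulfI (T0 (1 / 3))); rewrite mulrN divff//.
  have : (T (1 / 3) - 1) * (T (1 / 3) ^+ 2 + T (1 / 3) + 1) = 0.
    by rewrite (_ : _ * _ = T (1 / 3) ^+ 3 - 1); [rewrite w3 subrr|ring].
  move/eqP; rewrite mulf_eq0 subr_eq0 (negbTE w1) /= => /eqP e.
  by rewrite -[RHS]subr0 -e; ring.
move: e13; rewrite /H t4 t3 F1; last by have := imT _ r3; lra.
rewrite subrr sub0r => e.
have -> : b 0 = kap * (tpi * ofR (1 / 3)) - kap * (tpi * ofR (1 / 4)).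
  transitivity (F (T (1 / 3)) + b 0 - F (T (1 / 3)) - kap * (tpi * ofR (1 / 3)) + kap * (tpi * ofR (1 / 3))); first by ring.
  by rewrite e addrC.
have -> : ofR (1 / 3) = 3^-1 :> C by rewrite mul1r ofRV ofRn.
have -> : ofR (1 / 4) = 4^-1 :> C by rewrite mul1r ofRV ofRn.
by field.
Qed.

End WeightTwo.

(** * Constant terms in q at z = 0 *)

Section Laurent.
Variable R : realType.
Local Notation C := (cplx R).
Implicit Types (t z w : C) (c : int * int -> C) (b : int -> C).

Lemma qseries_of (I : choiceType) (a : I -> C) (N : I -> int) f :
  (forall t, 0 < im t -> hasSum (fun i => a i * ee ((N i)%:~R * t)) (f t)) ->
  exists2 b, qseries f b & forall l, hasSum (fun i => if N i == 0 then a i else 0) l -> b 0 = l.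
Proof.
move=> h; exists (fun k => tsum (fun i => if N i == k then a i else 0)) => [t t0|l hl]; last first.
  exact: hasSum_tsum.
apply: (hasSum_fiberE (p := N)) (h t t0) => k.
have hk : hasSum (fun i => if N i == k then a i else 0) (tsum (fun i => if N i == k then a i else 0)).
  apply: tsumP; have i0 : 0 < im ('i : C) by rewrite im_i.
  have [M b] := hasSum_asummable (h 'i i0).
  have := @asummable_mask R I _ (fun i => N i == k) (ex_intro _ _ b).
  case/asummable_ex => l /(hasSumZr (ee (k%:~R * 'i))^-1)/hasSum_asummable[M' hM].
  exists M'; apply: bsum_le hM => i; case: eqP => [->|_]; last by rewrite mul0r.
  by rewrite mulfK ?ee_neq0.
apply: eq_hasSum (hasSumZr (ee (k%:~R * t)) hk) => i.
by case: eqP => [->|]; rewrite ?mul0r.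
Qed.

Lemma qseriesD f g b d : qseries f b -> qseries g d -> qseries (fun t => f t + g t) (fun N => b N + d N).
Proof.
move=> h k t t0; apply: eq_hasSum (hasSumD (h t t0) (k t t0)) => N.
by rewrite mulrDl.
Qed.

Lemma qseries_big (n : nat) (f : 'I_n -> C -> C) (b : 'I_n -> int -> C) :
  (forall i, qseries (f i) (b i)) -> qseries (fun t => \sum_i f i t) (fun N => \sum_i b i N).
Proof.
move=> h t t0.
have := @hasSum_big R int 'I_n (index_enum 'I_n) predT (fun i N => b i N * ee (N%:~R * t)) (fun i => f i t) (fun i _ => h i t t0).
by apply: eq_hasSum => N; rewrite mulr_suml.
Qed.

Lemma qseries_cst (k : C) : qseries (fun=> k) (fun N => if N == 0 then k else 0).
Proof.
move=> t t0; have := @hasSum_support R int (fun a => if a == 0 then k else 0) [fset (0 : int)]%fset.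
rewrite big_seq_fset1 eqxx => h; apply: eq_hasSum (h _) => [N|i].
  by case: eqP => [->|_]; rewrite ?mul0r// ee0 mulr1.
by rewrite inE => /negbTE ->.
Qed.

Lemma qseries_ext f g b : (forall t, 0 < im t -> f t = g t) -> qseries f b -> qseries g b.
Proof. by move=> e h t t0; rewrite -e//; exact: h. Qed.

Definition a0 c : C := tsum (fun r : int => c (0, r)).

Lemma a0_hasSum c phi : fseries c phi -> hasSum (fun r : int => c (0, r)) (a0 c).
Proof.
move=> h; apply: tsumP; have i0 : 0 < im ('i : C) by rewrite im_i.
have [M hM] := hasSum_asummable (h 'i 0 i0); exists M.
have inj : injective (fun r : int => (0 : int, r)) by move=> x y [].
apply: bsum_le (bsum_inj inj hM) => r /=.
by rewrite /mon /= mul0r mulr0 addr0 ee0 mulr1.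
Qed.

Lemma qseries_funW (m n m2 : nat) c phi : m = (n * m2)%N -> coprime n m2 -> (0 < m)%N ->
  qperiodic m c -> fseries c phi ->
  exists2 b, qseries (fun t => funW n m2 phi t 0) b & b 0 = a0 (coefW m n c).
Proof.
move=> em cop m0 per h.
have hW : fseries (coefW m n c) (funW n m2 phi) by move=> t z t0; exact: coefW_hasSum.
have hW0 t : 0 < im t -> hasSum (fun nr => coefW m n c nr * ee (nr.1%:~R * t)) (funW n m2 phi t 0).
  by move=> t0; apply: eq_hasSum (hW t 0 t0) => nr; rewrite /mon mulr0 addr0.
have [b hb b0] := qseries_of hW0; exists b => //; apply: b0.
apply: (proj2 (@hasSum_inj R (int * int)%type int (fun r : int => (0 : int, r)) _ _ _ _)).
- by move=> x y [].
- by move=> [N r] hr /=; case: eqP => // N0; case: (hr r); rewrite N0.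
by apply: eq_hasSum (a0_hasSum hW).
Qed.

Lemma sum_shift1 (n : nat) (g : int -> C) : (forall l, g (l + n%:Z) = g l) ->
  \sum_(l < n) g (l%:Z + 1) = \sum_(l < n) g l%:Z.
Proof.
case: n => [|n] h; first by rewrite !big_ord0.
rewrite big_ord_recr [RHS]big_ord_recl /= addrC; congr (_ + _).
  by rewrite -(h 0) add0r; congr g; rewrite -addn1.
by apply: eq_bigr => i _; congr g; rewrite /= /bump leq0n add1n -addn1.
Qed.

Lemma sum_opp (n : nat) (g : int -> C) : (forall l, g (l + n%:Z) = g l) ->
  \sum_(l < n) g (- l%:Z) = \sum_(l < n) g l%:Z.
Proof.
move=> h; rewrite -[RHS]sum_shift1// (reindex_inj rev_ord_inj)/=; apply: eq_bigr => i _.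
by rewrite -(h (- _)); congr g; rewrite -subzn//; lia.
Qed.

Lemma Xt_period (n m2 : nat) phi (l mu : int) t z : (0 < n)%N ->
  (forall a b : int, phi t (z + (a%:~R * t + b%:~R) / n%:R + 1) = phi t (z + (a%:~R * t + b%:~R) / n%:R)) ->
  Xt n m2 phi l (mu + n%:Z) t z = Xt n m2 phi l mu t z :> C.
Proof.
move=> n0 hp; have n1 : (n%:R : C) != 0 by rewrite pnatr_eq0 -lt0n.
rewrite /Xt.
have -> : z + (l%:~R * t + (mu + n%:Z)%:~R) / n%:R = z + (l%:~R * t + mu%:~R) / n%:R + 1.
  by rewrite intrD -pmulrn; field.
rewrite hp; congr (_ * _).
have -> : m2%:R * (l%:~R ^+ 2 * t / n%:R + 2 * l%:~R * z + l%:~R * (mu + n%:Z)%:~R / n%:R) =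
   m2%:R * (l%:~R ^+ 2 * t / n%:R + 2 * l%:~R * z + l%:~R * mu%:~R / n%:R) + (m2%:Z * l)%:~R :> C.
  by rewrite intrD intrM -!pmulrn; field.
by rewrite eeD ee_int mulr1.
Qed.

(** The map t -> -1/t permutes the torsion points by (l, mu) -> (mu, -l). The transformation law is
    asked only at the torsion translates of z, which covers [psim], where it holds off the
    lattice. *)
Lemma funW_S (m n m2 : nat) phi t z : (0 < n)%N -> m = (n * m2)%N -> 0 < im t ->
  (forall a b : int, let w := z + (a%:~R * t + b%:~R) / n%:R in
     phi t (w + 1) = phi t w /\
     phi (- t^-1) (w / t) = t ^+ 2 * ee (m%:R * w ^+ 2 / t) * phi t w) ->
  funW n m2 phi (- t^-1) (z / t) = t ^+ 2 * ee (m%:R * z ^+ 2 / t) * funW n m2 phi t z :> C.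
Proof.
move=> n0 em t0 h; have n1 : (n%:R : C) != 0 by rewrite pnatr_eq0 -lt0n.
have tn0 := im_neq0 t0.
have alg (e1 e2 e3 e4 p q : C) : e1 * e2 = e3 * e4 -> e1 * (p * e2 * q) = p * e3 * (e4 * q).
  by move=> e; transitivity (p * q * (e1 * e2)); [ring | rewrite e; ring].
have key (l mu : int) : Xt n m2 phi l mu (- t^-1) (z / t) =
    t ^+ 2 * ee (m%:R * z ^+ 2 / t) * Xt n m2 phi mu (- l) t z.
  have [_ h2] := h mu (- l); rewrite /= in h2.
  rewrite /Xt; set w := z + (mu%:~R * t + (- l)%:~R) / n%:R in h2 *.
  have -> : z / t + (l%:~R * - t^-1 + mu%:~R) / n%:R = w / t.
    by rewrite /w intrN; field; rewrite tn0 n1.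
  rewrite h2; apply: alg; rewrite -!eeD; congr ee.
  rewrite em natrM /w intrN; field; by rewrite tn0 n1.
rewrite /funW; under eq_bigr do under eq_bigr do rewrite key.
rewrite exchange_big /= [RHS]mulrCA; congr (_ * _); rewrite mulr_sumr; apply: eq_bigr => mu _.
rewrite -mulr_sumr; congr (_ * _).
rewrite (@sum_opp n (fun l => Xt n m2 phi mu l t z))// => l.
by apply: Xt_period => // a b; case: (h a b).
Qed.

End Laurent.

(** * Weak Jacobi forms, and v at torsion points *)

Section ConstantTerm.
Variable R : realType.
Local Notation C := (cplx R).
Local Notation tpi := (tpi R).
Implicit Types (t z w : C) (c : int * int -> C) (b : int -> C).

Lemma elliptic_Z1 m psi t z : elliptic_law m psi -> 0 < im t -> psi t (z + 1) = psi t z :> C.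
Proof.
move=> h t0; have := h t z 0 1 ((upperP t).2 t0); rewrite mul0r addr0 => ->.
by rewrite expr0n mulr0 !mul0r addr0 mulr0 oppr0 ee0 mul1r.
Qed.

Lemma modular_S m psi t z : modular_law 2 m psi -> 0 < im t ->
  psi (- t^-1) (z / t) = t ^+ 2 * ee (m%:R * z ^+ 2 / t) * psi t z :> C.
Proof.
move=> h t0; have := h 0 (-1) 1 0 t z; rewrite mul0r mulN1r opprK addr0 mul0r mul1r add0r => /(_ erefl ((upperP t).2 t0)).
by rewrite mulr1 add0r mulrN1z mulN1r.
Qed.

Lemma modular_N m psi t z : modular_law 2 m psi -> 0 < im t -> psi t (- z) = psi t z :> C.
Proof.
move=> h t0; have := h (-1) 0 0 (-1) t z; rewrite mul0r mulN1r opprK subr0 => /(_ erefl ((upperP t).2 t0)).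
rewrite mulr0 !mul0r add0r addr0 ee0 sqrrN expr1n !mul1r !mulrN1z invrN invr1 !mulrN1.
by rewrite mulNr mul1r opprK.
Qed.

Lemma weak_fseries m psi : weak_jacobi_form 2 m psi -> exists c : int * int -> C,
  [/\ goodf m c, fseries c psi & forall n r : int, c (n, - r) = c (n, r)].
Proof.
move=> [[[m0 _ he [c hc]] _] hm]; have [bd hFS] := (fourier_expansionP _ _).1 hc.
exists c; split => //; first by split => //; [exact: fseries_periodic he hFS | exists psi].
have e : (fun nr : int * int => c (nr.1, - nr.2)) = c.
  apply: (@fseries_unique R _ _ psi) => // t z t0.
  have gb : bijective (fun nr : int * int => (nr.1, - nr.2)).
    by exists (fun nr : int * int => (nr.1, - nr.2)) => -[? ?] /=; rewrite opprK.
  have := (hasSum_bij _ _ gb).1 (hFS t (- z) t0); rewrite (modular_N z hm t0).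
  by apply: eq_hasSum => -[n r] /=; rewrite /mon /= intrN mulrNN.
by move=> n r; have := congr1 (fun g => g (n, r)) e.
Qed.

(** At z = 0 the average over torsion points has weight 2 without anomaly: [weight_two] with kappa =
    0. *)
Lemma a0_weak (m n m2 : nat) psi c : m = (n * m2)%N -> coprime n m2 ->
  weak_jacobi_form 2 m psi -> fseries c psi -> a0 (coefW m n c) = 0 :> C.
Proof.
move=> em cop [[[m0 _ he _] _] hm] h; have per := fseries_periodic he h.
have n0 : (0 < n)%N by move: m0; rewrite em muln_gt0 => /andP[].
have [b hb <-] := qseries_funW em cop m0 per h.
rewrite (@weight_two R _ b 0 hb) ?mul0r// => t t0; rewrite mul0r addr0.
have := @funW_S R m n m2 psi t 0 n0 em t0; rewrite mul0r expr0n mulr0 mul0r ee0 mulr1; apply => u v w.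
by split; [exact: elliptic_Z1 he t0 | exact: modular_S].
Qed.

(** Distribution relation: the row of n z splits, according to j modulo n, into the rows of the
    points z + mu/n. *)
Lemma vv_mult n z : (0 < n)%N -> noint (n%:R * z) ->
  \sum_(mu < n) vv (z + mu%:R / n%:R) = n%:R ^+ 2 * vv (n%:R * z) :> C.
Proof.
move=> n0 nz; have n1 : (n%:R : C) != 0 by rewrite pnatr_eq0 -lt0n.
have nn : (n%:Z : int) != 0 by rewrite eqz_nat -lt0n.
have nm (mu : nat) : noint (z + mu%:R / n%:R).
  move=> k e; apply: (nz (n%:Z * k - mu%:Z)).
  rewrite intrB intrM -!pmulrn -e; field; exact: n1.
have hf (mu : 'I_n) : hasSum (fun j : int => if (n%:Z %| j - 1%:Z * mu%:Z)%Z then (n%:R * z + j%:~R) ^- 2 else 0)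
    (n%:R ^- 2 * (tpi ^+ 2 * vv (z + mu%:R / n%:R))).
  apply: (proj2 (@hasSum_inj R int int (fun k : int => mu%:Z + k * n%:Z) _ _ _ _)).
  - by move=> x y /addrI/(mulIf nn).
  - move=> j hj; case: ifP => // /dvdzP[k hk]; case: (hj k).
    by rewrite -hk mul1r addrC subrK.
  apply: eq_hasSum (hasSumZ (n%:R ^- 2) (hasSum_row (nm mu))) => k /=.
  rewrite mul1r [mu%:Z + _]addrC addrK dvdz_mull//.
  rewrite -invfM -exprMn; congr (_ ^- 2).
  rewrite intrD intrM -!pmulrn; field; exact: n1.
have := hasSum_big (index_enum 'I_n) (P := predT) (fun mu _ => hf mu).
have -> : (fun j : int => \sum_(mu < n) (if (n%:Z %| j - 1%:Z * mu%:Z)%Z then (n%:R * z + j%:~R) ^- 2 else 0)) =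
   (fun j : int => (n%:R * z + j%:~R) ^- 2).
  by apply/funext => j; rewrite sum_residue// coprimen1.
move=> /(hasSum_unique (hasSum_row nz)); rewrite -!mulr_sumr => e.
apply: (mulfI (_ : tpi ^+ 2 != 0)); first by rewrite expf_neq0 ?tpi_neq0.
apply: (mulfI (_ : (n%:R : C) ^- 2 != 0)); first by rewrite invr_eq0 expf_neq0.
rewrite -e; field; exact: n1.
Qed.

Lemma vv_cvg z0 : noint z0 -> vv w @[w --> z0] --> vv z0.
Proof. by move=> nz; exact: (cvCV (uu_neq0 nz) (@uu_cvg0 R z0)). Qed.

Lemma cvg_shift (f : C -> C) w0 (l : C) : f w @[w --> w0] --> l -> f (z + w0) @[z --> (0 : C)^'] --> l.
Proof.
move=> /cvgC_P h; apply/cvgC'_P => e /h[d d0 hd]; exists d => // z.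
by rewrite subr0 => lt _; apply: hd; rewrite addrK.
Qed.

(** The limit z -> 0 of [vv_mult] after removal of the pole at mu = 0; the constant -1/12 of
    [vv_laurent] enters once on the left and n^2 times on the right. The term mu = 0 of the
    statement is the default [vv 0] = 0. *)
Lemma vv_sum n : (0 < n)%N -> \sum_(mu < n) vv (mu%:R / n%:R) = (1 - n%:R ^+ 2) / 12 :> C.
Proof.
move=> n0; have n1 : (n%:R : C) != 0 by rewrite pnatr_eq0 -lt0n.
have nmu (mu : 'I_n) : mu != 0%N :> nat -> noint (mu%:R / n%:R : C).
  move=> m0 k e; have : (mu%:Z)%:~R = (k * n%:Z)%:~R :> C by rewrite intrM -e -!pmulrn divfK.
  move/intr_inj => ek; have := ltn_ord mu; have : (0 < mu)%N by rewrite lt0n.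
  have [k0|k0] : k <= 0 \/ 1 <= k by lia.
    nia.
  nia.
pose g (mu : 'I_n) z : C := vv (z + mu%:R / n%:R) - (if mu == 0%N :> nat then (tpi * z) ^- 2 else 0).
have hg mu : g mu z @[z --> (0 : C)^'] --> vv (mu%:R / n%:R) - (if mu == 0%N :> nat then 12^-1 else 0).
  rewrite /g; case: eqP => [->|/eqP m0].
    rewrite mul0r [vv 0](_ : _ = 0); last by rewrite /vv uu0 invr0.
    rewrite sub0r; apply: eq_cvgC (@vv_laurent R) => z; by rewrite addr0.
  rewrite subr0; apply: eq_cvgC (cvg_shift (vv_cvg (nmu mu m0))) => z.
  by rewrite subr0.
have h1 : \sum_mu g mu z @[z --> (0 : C)^'] --> \sum_(mu < n) (vv (mu%:R / n%:R) - (if mu == 0%N :> nat then 12^-1 else 0)).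
  pose proof (cvC_sum (r := index_enum 'I_n) (P := predT) (fun mu _ => hg mu)) as h; exact h.
have h2 : n%:R ^+ 2 * (vv (n%:R * z) - (tpi * (n%:R * z)) ^- 2) @[z --> (0 : C)^'] --> (n%:R ^+ 2 * - 12^-1 : C).
  have h3 : vv (n%:R * z) - (tpi * (n%:R * z)) ^- 2 @[z --> (0 : C)^'] --> (- 12^-1 : C).
    apply/cvgC'_P => e /((cvgC'_P _ _ _).1 (@vv_laurent R))[d d0 hd].
    exists (d / n%:R); first by rewrite divr_gt0// ltr0n.
    move=> z; rewrite subr0 => lt z0; apply: hd; last by rewrite mulf_neq0.
    by rewrite subr0 nrmM nrm_nat mulrC -ltr_pdivlMr ?ltr0n.
  pose proof (cvCM (cvC_cst (n%:R ^+ 2 : C)) h3) as h4; exact h4.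
have h5 : \sum_mu g mu z @[z --> (0 : C)^'] --> (n%:R ^+ 2 * - 12^-1 : C).
  apply: near_cvgC h2; apply/nearC'; exists n%:R^-1; first by rewrite invr_gt0 ltr0n.
  move=> z; rewrite subr0 => lt z0.
  have nz : noint (n%:R * z).
    move=> k e; have k0 : k != 0.
      by apply: contraNneq z0 => k0; move/eqP: e; rewrite k0 mulf_eq0 (negbTE n1).
    have : nrm (n%:R * z) < 1 by rewrite nrmM nrm_nat mulrC -ltr_pdivlMr ?ltr0n// mul1r.
    rewrite e nrm_int -intr_norm (ltr_int R _ 1); lia.
  rewrite /g sumrB vv_mult// mulrBr; congr (_ - _).
  rewrite (bigD1 (Ordinal n0))//= big1 ?addr0 => [|i /eqP ni]; last first.
    by case: eqP => // i0; case: ni; apply: val_inj.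
  field; by rewrite tpi_neq0 z0 n1.
pose proof (cvg_unique (@norm_hausdorff _ _) h1 h5) as h6; move: h6.
rewrite sumrB [X in _ - X](_ : _ = 12^-1); last first.
  rewrite (bigD1 (Ordinal n0))//= big1 ?addr0// => i /eqP ni.
  by case: eqP => // i0; case: ni; apply: val_inj.
by move=> /eqP; rewrite subr_eq => /eqP ->; field.
Qed.

Lemma strip_series_cont f F t z0 : strip_series f F -> strip t z0 -> f t w @[w --> z0] --> (f t z0 : C).
Proof.
move=> [c c0 hc] s; pose d := (im t - `|im z0|) / 2.
have d0 : 0 < d by rewrite divr_gt0// subr_gt0.
have imd (x : R) : im (z0 + ofR x * 'i) = im z0 + x by rewrite imD imM im_ofR re_ofR im_i mul0r addr0 mulr1.
have nd x : `|x| <= d -> strip t (z0 + ofR x * 'i).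
  rewrite /strip imd => hx; apply: le_lt_trans (ler_normD _ _) _.
  move: s hx d0; rewrite /d /strip; lra.
have nd1 : `|d| <= d by rewrite gtr0_norm.
have nd2 : `|- d| <= d by rewrite normrN.
have [b1 _] := hc t _ (nd _ nd2); have [b2 _] := hc t _ (nd _ nd1).
have ht := @tannery R C (nbhs z0) (nbhs_pfilter z0) _ (fun w nr => c nr * mon t w nr) (fun nr => c nr * mon t z0 nr) _ _ (bsumD b1 b2).
have [_ h0] := hc t z0 s; rewrite -(hasSum_tsum h0).
have near : forall w, nrm (w - z0) < d -> `|im w - im z0| <= d.
  by move=> w hw; have := im_le_nrm (w - z0); rewrite imD imN => h; apply: le_trans h (ltW hw).
apply: (@near_cvgC R C (nbhs z0) (nbhs_filter z0) (fun w => tsum (fun nr => c nr * mon t w nr))).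
  apply/nearC; exists d => // w /near hw.
  have sw : strip t w.
    by have := nd (im w - im z0) hw; rewrite /strip imd addrC subrK.
  by have [_ h] := hc t w sw; rewrite (hasSum_tsum h).
apply: ht.
  apply/nearC; exists d => // w /near hw nr; rewrite !nrmM -mulrDr ler_wpM2l ?nrm_ge0//.
  apply: nrm_mon_le; rewrite !imd; move: hw; rewrite ler_norml; lra.
by move=> nr; exact: (cvCM (cvC_cst (c nr)) (@mon_cont R t z0 nr)).
Qed.

Lemma regAL_strip_series m : exists F, strip_series (regAL (R := R) m) F.
Proof.
have [[F2 h2] _] := @strip_series_half R m 1 isT.
have [[F3 h3] _] := @strip_series_half R m (-1) isT.
by eexists; exact: strip_seriesD h2 h3.
Qed.

Lemma apl_strip m t z : strip t z -> apl m t z = vv z + regAL m t z :> C.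
Proof. by move=> s; rewrite /apl (hasSum_tsum (hasSum_al_strip m s)). Qed.

Lemma vv0 : vv (0 : C) = 0. Proof. by rewrite /vv uu0 invr0. Qed.

Lemma ee_lin_cvg (a s : C) : ee (a + s * z) @[z --> (0 : C)^'] --> ee a.
Proof.
apply/cvgC'_P => e /((cvgC_P _ _ _).1 (@ee_cvg R a))[d d0 hd].
exists (d / (nrm s + 1)); first by rewrite divr_gt0// ltr_wpDl ?nrm_ge0.
move=> z; rewrite subr0 ltr_pdivlMr ?ltr_wpDl ?nrm_ge0// => lt _; apply: hd.
rewrite addrAC subrr add0r nrmM mulrC; apply: le_lt_trans lt.
by rewrite ler_wpM2l ?nrm_ge0// lerDl.
Qed.

(** Only the translate by 0 has a pole. Its value at z = 0 is formed with the default [vv 0] = 0,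
    whereas v(z) minus its pole tends to -1/12; hence the correction. *)
Lemma Xt_apl_cvg (n m2 : nat) t (l mu : 'I_n) : 0 < im t ->
  Xt n m2 (apl (n * m2)) l%:Z mu%:Z t z - (if (l == 0%N :> nat) && (mu == 0%N :> nat) then (tpi * z) ^- 2 else 0)
    @[z --> (0 : C)^'] -->
  Xt n m2 (apl (n * m2)) l%:Z mu%:Z t 0 - (if (l == 0%N :> nat) && (mu == 0%N :> nat) then 12^-1 else 0).
Proof.
move=> t0; have n0 : (0 < n)%N by exact: leq_ltn_trans (ltn_ord l).
have n1 : (n%:R : C) != 0 by rewrite pnatr_eq0 -lt0n.
set m := (n * m2)%N; have [F hF] := regAL_strip_series m.
set w0 : C := (l%:R * t + mu%:R) / n%:R.
have iw0 : im w0 = l%:R / n%:R * im t.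
  rewrite /w0 -[n%:R]ofRn -ofRV imM imD imM !im_nat !re_nat im_ofR re_ofR mulr0 add0r addr0 mul0r addr0.
  by rewrite mulrC mulrA [n%:R^-1 * _]mulrC.
have s0 : strip t w0.
  rewrite /strip iw0 normrM [X in _ * X]ger0_norm ?ltW// gtr_pMl// ger0_norm ?divr_ge0//.
  by rewrite ltr_pdivrMr ?ltr0n// mul1r ltr_nat.
have hreg := cvg_shift (strip_series_cont hF s0).
have hee := @ee_lin_cvg (m2%:R * (l%:R ^+ 2 * t / n%:R + l%:R * mu%:R / n%:R)) (m2%:R * 2 * l%:R).
have snear : \forall z \near (0 : C)^', strip t (z + w0).
  apply/nearC'; exists (im t - `|im w0|); first by rewrite subr_gt0.
  move=> z; rewrite subr0 => lt _; rewrite /strip imD.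
  have h1 := im_le_nrm z; have h2 := ler_normD (im z) (im w0).
  clear -h1 h2 lt; lra.
have XE z : Xt n m2 (apl m) l%:Z mu%:Z t z =
   ee (m2%:R * (l%:R ^+ 2 * t / n%:R + l%:R * mu%:R / n%:R) + m2%:R * 2 * l%:R * z) * apl m t (z + w0).
  by rewrite /Xt -!pmulrn; congr (ee _ * _); ring.
have [/andP[/eqP l0 /eqP m0]|nz] := boolP ((l == 0%N :> nat) && (mu == 0%N :> nat)).
  have w00 : w0 = 0 by rewrite /w0 l0 m0 mul0r addr0 mul0r.
  have eX z : Xt n m2 (apl m) l%:Z mu%:Z t z = apl m t z.
    by rewrite XE w00 addr0 l0 m0 expr0n !(mul0r, mulr0, addr0) ee0 mul1r.
  rewrite eX (apl_strip m); last by rewrite -w00.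
  rewrite vv0 add0r addrC.
  pose proof (cvCD (@vv_laurent R) hreg) as h; rewrite w00 in h.
  apply: near_cvgC h; near=> z.
  rewrite eX (apl_strip m); last by rewrite -[z]addr0 -w00; near: z.
  by rewrite addr0; ring.
rewrite subr0 XE mulr0 addr0 add0r (apl_strip m s0).
have nw : noint w0.
  move=> k e; have : im w0 = 0 by rewrite e im_int.
  rewrite iw0 => /eqP; rewrite mulf_eq0 (gt_eqF t0) orbF mulf_eq0 invr_eq0 !pnatr_eq0.
  rewrite [n == 0%N]eqn0Ngt n0 orbF => /eqP l0; move: nz; rewrite l0 /= => mu0.
  have : (mu%:Z)%:~R = (k * n%:Z)%:~R :> C.
    by rewrite intrM -e -!pmulrn /w0 l0 mul0r add0r divfK.
  move/intr_inj => ek; have := ltn_ord mu; have : (0 < mu)%N by rewrite lt0n.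
  have [k0|k0] : k <= 0 \/ 1 <= k by lia.
    nia.
  nia.
pose proof (cvCM hee (cvCD (cvg_shift (vv_cvg nw)) hreg)) as h.
apply: near_cvgC h; near=> z; rewrite subr0 XE (apl_strip m)//; near: z; exact: snear.
Unshelve. all: by end_near.
Qed.

End ConstantTerm.

(** * Constant term of the Appell-Lerch part *)

Section AppellConstant.
Variable R : realType.
Local Notation C := (cplx R).
Local Notation tpi := (tpi R).
Implicit Types (t z w : C).

(** In a torsion translate of the Appell-Lerch sum the indices l and s merge into L = l + n s. *)
Definition Tt (n m2 : nat) t (L : int) (mu : nat) : C :=
  ee (m2%:R * (L%:~R ^+ 2 * t / n%:R + L%:~R * mu%:R / n%:R)) * vv ((L%:~R * t + mu%:R) / n%:R).

Lemma Xt_apl (n m2 : nat) t (l mu : nat) : (0 < n)%N -> 0 < im t ->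
  hasSum (fun s : int => Tt n m2 t (l%:Z + n%:Z * s) mu) (Xt n m2 (apl (n * m2)) l%:Z mu%:Z t 0).
Proof.
move=> n0 t0; have n1 : (n%:R : C) != 0 by rewrite pnatr_eq0 -lt0n.
apply: eq_hasSum (hasSumZ (ee (m2%:R * (l%:~R ^+ 2 * t / n%:R + 2 * l%:~R * 0 + l%:~R * mu%:~R / n%:R)))
  (hasSum_al (n * m2) (0 + (l%:~R * t + mu%:~R) / n%:R) t0)) => s.
rewrite /al /Tt mulrA -eeD -!pmulrn; congr (_ * _); last first.
  by congr vv; rewrite intrD intrM -!pmulrn; field; exact: n1.
have e2 (X : C) : ee X = ee (X + (m2%:Z * s * mu%:Z)%:~R) by rewrite eeD ee_int mulr1.
rewrite [RHS]e2; congr ee.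
rewrite intrD !intrM -!pmulrn natrM; field; exact: n1.
Qed.

Lemma Tt_sgn (n m2 : nat) t (L : int) (mu : nat) : L != 0 ->
  Tt n m2 t L mu = ee (m2%:R * (`|L|%N%:R ^+ 2 * t / n%:R + (sgz L)%:~R * `|L|%N%:R * mu%:R / n%:R)) *
    vv ((`|L|%N%:R * t + (sgz L)%:~R * mu%:R) / n%:R).
Proof.
rewrite /Tt; case: (intP L) => // k _.
  by rewrite gtr0_sgz// mul1r -!pmulrn absz_nat mul1r.
rewrite ltr0_sgz// abszN absz_nat mulrNz -pmulrn; congr (ee _ * _); first by ring.
by rewrite -vvN; congr vv; ring.
Qed.

(** Once L is replaced by |L| through the symmetry of v, the geometric series of v converges, and
    the average over mu selects the k divisible by n. All exponents |L| k/n are positive. *)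
Lemma Tt_row (n m2 : nat) t (L : int) : (0 < n)%N -> 0 < im t -> L != 0 ->
  hasSum (fun ij : nat * nat => let k := (m2 * `|L| + (ij.1 + ij.2).+1)%N in
     if (n %| k)%N then ee (((`|L| * k) %/ n)%N%:R * t) else 0)
    (n%:R^-1 * \sum_(mu < n) Tt n m2 t L mu).
Proof.
move=> n0 t0 L0; have n1 : (n%:R : C) != 0 by rewrite pnatr_eq0 -lt0n.
set a := `|L|%N; have a0 : (0 < a)%N by rewrite absz_gt0.
have imx (mu : nat) : 0 < im ((a%:R * t + (sgz L)%:~R * mu%:R) / n%:R : C).
  rewrite -[n%:R]ofRn -ofRV mulrC imM im_ofR mul0r addr0 re_ofR mulr_gt0 ?invr_gt0 ?ltr0n//.
  by rewrite imD !imM !im_nat re_nat im_int !mul0r !mulr0 !addr0 mulr_gt0 ?ltr0n.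
have hm (mu : 'I_n) := hasSumZ (n%:R^-1 * ee (m2%:R * (a%:R ^+ 2 * t / n%:R + (sgz L)%:~R * a%:R * mu%:R / n%:R)))
   (hasSum_vv (imx mu)).
have := hasSum_big (index_enum 'I_n) (P := predT) (fun mu _ => hm mu).
rewrite mulr_sumr => h; have -> : \sum_(mu < n) n%:R^-1 * Tt n m2 t L mu = \sum_(mu < n)
   n%:R^-1 * ee (m2%:R * (a%:R ^+ 2 * t / n%:R + (sgz L)%:~R * a%:R * mu%:R / n%:R)) *
     vv ((a%:R * t + (sgz L)%:~R * mu%:R) / n%:R).
  by apply: eq_bigr => mu _; rewrite Tt_sgn// mulrA.
apply: eq_hasSum h => ij; rewrite /=; set k := (m2 * a + _)%N.
transitivity (n%:R^-1 * ee ((a * k)%N%:R / n%:R * t) *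
    \sum_(mu < n) ee ((sgz L * k%:Z)%:~R * mu%:R / n%:R)).
  rewrite mulr_sumr; apply: eq_bigr => mu _.
  rewrite -!mulrA; congr (_ * _); rewrite -!ee_nat -!eeD; congr ee.
  rewrite intrM -!pmulrn /k natrM natrD natrM -addn1 natrD natrD; field; exact: n1.
rewrite sum_ee// dvdzE abszM.
have -> : (`|sgz L| * `|k%:Z|)%N = k.
  rewrite absz_nat (_ : `|sgz L|%N = 1%N) ?mul1n//.
  by case: (intP L) L0 => // i _; rewrite ?gtr0_sgz ?ltr0_sgz.
case: ifP => hd; last by rewrite mulr0.
rewrite mulrAC mulVf// mul1r; congr ee; congr (_ * _).
have hd2 : (n %| a * k)%N by rewrite dvdn_mull.
by rewrite -{1}(divnK hd2) natrM mulfK.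
Qed.

Lemma nrm_ee_natM (k : nat) t (n : nat) : (0 < n)%N -> nrm (ee ((k%:R / n%:R) * t)) = nrm (ee (t / n%:R)) ^+ k.
Proof.
by move=> n0; rewrite -nrmX -ee_nat mulrAC -mulrA.
Qed.

(** By [Tt_row] every L != 0 contributes positive powers of q only. The constant term comes from L =
    0, that is l = s = 0, where the average over mu is [vv_sum] divided by n. *)
Lemma qseries_Xt_apl (n m2 l : nat) : (0 < n)%N -> (l < n)%N ->
  exists2 b, qseries (fun t => n%:R^-1 * \sum_(mu < n) Xt n m2 (apl (n * m2)) l%:Z mu%:Z t 0) b &
    b 0 = if l == 0%N then (1 - n%:R ^+ 2) / (12 * n%:R) else 0 :> C.
Proof.
move=> n0 ln; have n1 : (n%:R : C) != 0 by rewrite pnatr_eq0 -lt0n.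
pose k0 : C := if l == 0%N then (1 - n%:R ^+ 2) / (12 * n%:R) else 0.
pose L (s : int) := l%:Z + n%:Z * s.
have L0 s : L s = 0 -> l = 0%N /\ s = 0.
  rewrite /L => e; have s0 : s = 0.
    have [h|[//|h]] : s <= -1 \/ s = 0 \/ 1 <= s by lia.
      nia.
    nia.
  by move: e; rewrite s0 mulr0 addr0 => -[].
pose kk (x : int * (nat * nat)) := (m2 * `|L x.1| + (x.2.1 + x.2.2).+1)%N.
pose ok x := (L x.1 != 0) && (n %| kk x)%N.
pose a x : C := if ok x then 1 else 0.
(* Discarded indices carry coefficient 0 and receive exponent 1, so that no index has exponent 0. *)
pose N x : int := if ok x then ((`|L x.1| * kk x) %/ n)%N%:Z else 1.
have N0 x : N x != 0.
  rewrite /N; case: ifP => // /andP[h1 h2]; rewrite eqz_nat -lt0n divn_gt0//.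
  by rewrite dvdn_leq// ?dvdn_mull// muln_gt0 absz_gt0 h1 /kk addnS.
have hs t : 0 < im t -> hasSum (fun s => if L s == 0 then 0 else n%:R^-1 * \sum_(mu < n) Tt n m2 t (L s) mu)
    (n%:R^-1 * \sum_(mu < n) Xt n m2 (apl (n * m2)) l%:Z mu%:Z t 0 - k0).
  move=> t0.
  have h1 := hasSumZ n%:R^-1 (hasSum_big (index_enum 'I_n) (P := predT) (fun (mu : 'I_n) _ => Xt_apl m2 l mu n0 t0)).
  have h2 : hasSum (fun s : int => if s == 0 then k0 else 0) k0.
    have := @hasSum_support R int (fun a => if a == 0 then k0 else 0) [fset (0 : int)]%fset.
    by rewrite big_seq_fset1 eqxx; apply => i; rewrite inE => /negbTE ->.
  apply: eq_hasSum (hasSumB h1 h2) => s; rewrite /=; case: (L s =P 0) => [e|ne].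
    have [l0 s0] := L0 s e; rewrite s0 eqxx /k0 l0 mulr0 addr0 /Tt.
    under eq_bigr do rewrite mulr0z expr2 !mul0r !add0r mulr0 ee0 mul1r.
    by rewrite vv_sum// eqxx; field; exact: n1.
  case: eqP => [s0|_]; last by rewrite subr0.
  rewrite /k0; case: eqP => [l0|_]; last by rewrite subr0.
  by case: ne; rewrite /L s0 l0 mulr0.
have hpair t : 0 < im t -> hasSum (fun x => a x * ee ((N x)%:~R * t))
    (n%:R^-1 * \sum_(mu < n) Xt n m2 (apl (n * m2)) l%:Z mu%:Z t 0 - k0).
  move=> t0.
  have row s : hasSum (fun ij => a (s, ij) * ee ((N (s, ij))%:~R * t))
     (if L s == 0 then 0 else n%:R^-1 * \sum_(mu < n) Tt n m2 t (L s) mu).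
    case: eqP => [e|/eqP ne].
      by apply: eq_hasSum (@hasSum0 R (nat * nat)%type) => ij; rewrite /a /ok e eqxx mul0r.
    apply: eq_hasSum (Tt_row m2 n0 t0 ne) => ij; rewrite /a /N /ok ne /=.
    by rewrite -/(kk (s, ij)); case: ifP => _; rewrite ?mul0r// mul1r.
  pose rho := nrm (ee (t / n%:R)).
  have r0 : 0 <= rho by exact: nrm_ge0.
  have r1 : rho < 1.
    apply: nrm_ee_lt1; rewrite -[n%:R]ofRn -ofRV mulrC imM im_ofR mul0r addr0 re_ofR.
    by rewrite mulr_gt0 ?invr_gt0 ?ltr0n.
  have geo : bsum (fun k : nat => rho ^+ k) (1 - rho)^-1 by apply: bsum_geo; rewrite r0.
  have p1 : 0 <= (1 - rho)^-1 by rewrite invr_ge0 subr_ge0 ltW.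
  have bb : bsum (fun x => nrm (a x * ee ((N x)%:~R * t))) ((1 - rho)^-1 * (1 - rho)^-1 * (2 * (1 - rho)^-1)).
    apply: (@bsum_le _ _ _ (fun x => rho ^+ `|L x.1|%N * (rho ^+ x.2.1 * rho ^+ x.2.2))) => [x|].
      rewrite /a; case: ifP => h; last by rewrite mul0r nrm0 !mulr_ge0 ?exprn_ge0.
      rewrite mul1r /N h; case/andP: h => h1 h2; rewrite -pmulrn.
      have hd2 : (n %| `|L x.1| * kk x)%N by rewrite dvdn_mull.
      have -> : ((`|L x.1| * kk x) %/ n)%N%:R = (`|L x.1| * kk x)%N%:R / n%:R :> C.
        by rewrite -{2}(divnK hd2) natrM mulfK.
      rewrite nrm_ee_natM// -/rho -!exprD; apply: ler_wiXn2l => //; first exact: ltW.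
      rewrite /kk; move: h1; rewrite -absz_gt0; move: `|L _|%N => A A0.
      by rewrite mulnDr mulnS; apply: leq_trans (leq_addl _ _); rewrite leq_add2l leq_pmull.
    apply: (bsum_pair (G := fun s => (1 - rho)^-1 * (1 - rho)^-1 * rho ^+ `|L s|%N)) => [s|].
      rewrite mulrC; apply: bsumZ; first by rewrite exprn_ge0.
      apply: (bsum_pair (G := fun i => (1 - rho)^-1 * rho ^+ i)) => [i|]; last exact: bsumZ.
      by have := bsumZ (exprn_ge0 i r0) geo; rewrite [_ * (1 - _)^-1]mulrC.
    apply: bsumZ; first by rewrite mulr_ge0.
    have inj : injective L by move=> x y /addrI/mulfI; apply; rewrite eqz_nat -lt0n.
    exact: (bsum_inj (g := fun j : int => rho ^+ `|j|%N) inj (bsum_int (fun k => exprn_ge0 k r0) geo)).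
  have [v hv] := asummable_ex (ex_intro _ _ bb).
  have hv2 := @hasSum_pair R int (nat * nat)%type (fun x => a x * ee ((N x)%:~R * t)) _ v row hv.
  by rewrite (hasSum_unique (hs t t0) hv2).
have [b hb b0] := qseries_of hpair.
have hb2 := qseriesD hb (qseries_cst k0).
exists (fun N => b N + (if N == 0 then k0 else 0)).
  by apply: qseries_ext hb2 => t t0; rewrite subrK.
rewrite eqxx (b0 0) ?add0r//; apply: eq_hasSum (@hasSum0 R _) => x.
by rewrite (negbTE (N0 x)).
Qed.

Lemma qseries_funW_apl (n m2 : nat) : (0 < n)%N ->
  exists2 b, qseries (fun t => funW n m2 (apl (n * m2)) t 0) b & b 0 = (1 - n%:R ^+ 2) / (12 * n%:R) :> C.
Proof.
move=> n0; have h (l : 'I_n) : exists b, qseries (fun t => n%:R^-1 * \sum_(mu < n) Xt n m2 (apl (n * m2)) l%:Z mu%:Z t 0) b /\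
    b 0 = if l == 0%N :> nat then (1 - n%:R ^+ 2) / (12 * n%:R) else 0 :> C.
  by have [b h1 h2] := qseries_Xt_apl m2 n0 (ltn_ord l); exists b.
have [b hb] := choice h; exists (fun N => \sum_l b l N).
  by apply: qseries_ext (qseries_big (fun l => (hb l).1)) => t t0; rewrite /funW mulr_sumr.
under eq_bigr do rewrite (hb _).2.
rewrite (bigD1 (Ordinal n0))//= big1 ?addr0// => i /eqP ni.
by case: eqP => // i0; case: ni; apply: val_inj.
Qed.

End AppellConstant.

(** * Constant term of the standard form *)

Section StandardConstant.
Variable R : realType.
Local Notation C := (cplx R).
Local Notation tpi := (tpi R).
Implicit Types (t z w : C) (c : int * int -> C).

(** If z + (a t + b)/n is a lattice point then so is n z; a single punctured disc therefore serves
    all torsion points. *)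
Lemma nolat_frac (n : nat) t : (0 < n)%N -> 0 < im t -> exists2 d : R, 0 < d &
  forall z, nrm z < d -> z != 0 -> forall a b : int, nolat t (z + (a%:~R * t + b%:~R) / n%:R).
Proof.
move=> n0 t0; have n1 : (n%:R : C) != 0 by rewrite pnatr_eq0 -lt0n.
have [c c0 hc] := wlat_lower1 t0; exists (c / n%:R); first by rewrite divr_gt0// ltr0n.
move=> z lt z0 a b [a' b'] e.
pose ab : int * int := (n%:Z * a' - a, n%:Z * b' - b).
have ez : n%:R * z = wlat t ab.
  rewrite /wlat /= !intrB !intrM -!pmulrn.
  have -> : n%:R * z = n%:R * (z + (a%:~R * t + b%:~R) / n%:R) - (a%:~R * t + b%:~R) by field.
  by rewrite e /wlat /=; ring.
have [ab0|nab] := eqVneq ab 0.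
  move/eqP: ez; rewrite ab0 /wlat /= !mul0r add0r mulf_eq0 (negbTE n1) /= => /eqP z00.
  by rewrite z00 eqxx in z0.
have := hc ab nab; rewrite -ez leNgt nrmM nrm_nat => /negP; apply.
apply: (@lt_le_trans _ _ c); first by rewrite mulrC -ltr_pdivlMr ?ltr0n.
by rewrite ler_peMr ?(ltW c0)// lerDl slat_ge0.
Qed.

Lemma funW_ext (n m2 : nat) phi psi t z :
  (forall a b : int, phi t (z + (a%:~R * t + b%:~R) / n%:R) = psi t (z + (a%:~R * t + b%:~R) / n%:R)) ->
  funW n m2 phi t z = funW n m2 psi t z :> C.
Proof.
move=> h; rewrite /funW; congr (_ * _); apply: eq_bigr => l _; apply: eq_bigr => mu _.
by rewrite /Xt h.
Qed.

Lemma WfD (n m2 : nat) phi psi t z :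
  funW n m2 (fun t z => phi t z + psi t z) t z = funW n m2 phi t z + funW n m2 psi t z :> C.
Proof.
rewrite /funW -mulrDr -big_split /=; congr (_ * _); apply: eq_bigr => l _.
by rewrite -big_split /=; apply: eq_bigr => mu _; rewrite /Xt mulrDr.
Qed.

Lemma funW_apl_cvg (n m2 : nat) t : (0 < n)%N -> 0 < im t ->
  funW n m2 (apl (n * m2)) t z - (n%:R * (tpi * z) ^+ 2)^-1 @[z --> (0 : C)^'] -->
  (funW n m2 (apl (n * m2)) t 0 - (12 * n%:R)^-1 : C).
Proof.
move=> n0 t0; have n1 : (n%:R : C) != 0 by rewrite pnatr_eq0 -lt0n.
have delta (k : C) : \sum_(l < n) \sum_(mu < n) (if (l == 0%N :> nat) && (mu == 0%N :> nat) then k else 0) = k.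
  rewrite (bigD1 (Ordinal n0))//= [X in _ + X]big1 ?addr0 => [|i /eqP ni]; last first.
    apply: big1 => j _; case: eqP => // i0; case: ni; exact: val_inj.
  rewrite (bigD1 (Ordinal n0))//= big1 ?addr0// => i /eqP ni.
  by case: eqP => // i0; case: ni; apply: val_inj.
pose proof (cvC_sum (r := index_enum 'I_n) (P := predT) (fun l _ =>
  cvC_sum (r := index_enum 'I_n) (P := predT) (fun mu _ => @Xt_apl_cvg R n m2 t l mu t0))) as h.
pose proof (cvCM (cvC_cst (n%:R^-1 : C)) h) as h2; move: h2.
have e (f : 'I_n -> 'I_n -> C) k : n%:R^-1 * \sum_(l < n) \sum_(mu < n) (f l mu - (if (l == 0%N :> nat) && (mu == 0%N :> nat) then k else 0)) =
    n%:R^-1 * (\sum_(l < n) \sum_(mu < n) f l mu) - n%:R^-1 * k.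
  rewrite -mulrBr -[in RHS](delta k) -sumrB; congr (_ * _).
  by apply: eq_bigr => l _; rewrite sumrB.
rewrite e [_^-1 * 12^-1]mulrC -invfM => h2.
apply: eq_cvgC h2 => z; apply: etrans (e (fun l mu => Xt n m2 (apl (n * m2)) l%:Z mu%:Z t z) _) _.
by rewrite /funW; congr (_ - _); rewrite [RHS]invfM.
Qed.

Lemma cvgC'_comp (f : C -> C) (l s : C) : s != 0 -> f w @[w --> (0 : C)^'] --> l ->
  f (s * z) @[z --> (0 : C)^'] --> l.
Proof.
move=> s0 /cvgC'_P h; apply/cvgC'_P => e /h[d d0 hd].
have ns : 0 < nrm s by rewrite nrm_gt0.
exists (d / nrm s); first by rewrite divr_gt0.
move=> z; rewrite subr0 ltr_pdivlMr// => lt z0; apply: hd; last by rewrite mulf_neq0.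
by rewrite subr0 nrmM mulrC.
Qed.

Lemma ee_sqr_cvg (s : C) : (ee (s * z ^+ 2) - 1) / z ^+ 2 @[z --> (0 : C)^'] --> tpi * s.
Proof.
have [->|s0] := eqVneq s 0.
  rewrite mulr0; pose proof (@cvC_cst R C ((0 : C)^') _ (0 : C)) as h.
  apply: eq_cvgC h => z; by rewrite mul0r ee0 subrr mul0r.
have h : (ee (s * z ^+ 2) - 1) / (tpi * (s * z ^+ 2)) @[z --> (0 : C)^'] --> (1 : C).
  have h0 := @ee_deriv0 R; have h1 := cvgC'_comp s0 h0.
  apply/cvgC'_P => e /((cvgC'_P _ _ _).1 h1)[d d0 hd].
  exists (Num.min d 1); first by rewrite lt_min d0 ltr01.
  move=> z; rewrite subr0 lt_min => /andP[l1 l2] z0; apply: hd; last by rewrite expf_neq0.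
  rewrite subr0 nrmX expr2; apply: le_lt_trans l1.
  by rewrite ler_piMr ?nrm_ge0// ltW.
pose proof (cvCM (cvC_cst (tpi * s)) h) as h2; rewrite mulr1 in h2.
apply: near_cvgC h2; apply/nearC'; exists 1 => // z _ z0; field.
by rewrite s0 z0 tpi_neq0.
Qed.

Lemma a0_stand (m n m2 : nat) c : m = (n * m2)%N -> coprime n m2 -> (0 < m)%N ->
  fseries c (phi_stand m) -> qperiodic m c ->
  (forall t z, 0 < im t -> nolat t z -> phi_stand m t z = phi0 m t z) ->
  a0 (coefW m n c) = (n%:R + m2%:R) / 12 :> C.
Proof.
move=> em cop m0 h per hphi.
have /andP[n0 m20] : (0 < n)%N && (0 < m2)%N by rewrite -muln_gt0 -em.
have n1 : (n%:R : C) != 0 by rewrite pnatr_eq0 -lt0n.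
have [b1 hb1 e1] := qseries_funW em cop m0 per h.
have [b2 hb2 e2] := qseries_funW_apl R m2 n0; rewrite -em in hb2.
(* The z^0 Laurent coefficient of the image of [psim]; the last summand is the constant -1/12 of v
   divided by n. *)
pose f t : C := funW n m2 (phi_stand m) t 0 + funW n m2 (apl m) t 0 + - (12 * n%:R)^-1.
have hf := qseriesD (qseriesD hb1 hb2) (qseries_cst (- (12 * n%:R)^-1)).
have hW : fseries (coefW m n c) (funW n m2 (phi_stand m)) by move=> t z t0; exact: coefW_hasSum.
have lim t : 0 < im t -> funW n m2 (psim m) t z - (n%:R * (tpi * z) ^+ 2)^-1 @[z --> (0 : C)^'] --> f t.
  move=> t0; have [d d0 hd] := nolat_frac n0 t0.
  have := @funW_apl_cvg n m2 t n0 t0; rewrite -em => ha.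
  pose proof (cvCD (cvg_punct (fseries_cont hW t0)) ha) as h3; rewrite /f -addrA.
  apply: near_cvgC h3; apply/nearC'; exists d => // z; rewrite subr0 => lt z0.
  rewrite addrA -WfD; congr (_ - _); apply: funW_ext => u v.
  by rewrite hphi//; [rewrite /phi0 subrK | exact: hd].
(* Both sides of [funW_S] are expanded at z = 0: the pole 1/(n (2 pi i z)^2), multiplied by t^2 (e(m
   z^2/t) - 1), tends to m t/(2 pi i n). *)
have key t : 0 < im t -> f (- t^-1) = t ^+ 2 * f t + m%:R / (n%:R * tpi) * t.
  move=> t0; have tn0 := im_neq0 t0.
  have l1 := cvgC'_comp (_ : t^-1 != 0) (lim _ (im_S t0)).
  have {}l1 := l1 _; rewrite invr_eq0 tn0 in l1; have {}l1 := l1 isT.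
  have l2 := @ee_sqr_cvg (m%:R / t).
  have l3 : ee (m%:R / t * z ^+ 2) @[z --> (0 : C)^'] --> (1 : C).
    have e0 := @ee_lin_cvg R 0 (m%:R / t); rewrite ee0 in e0.
    apply/cvgC'_P => e /((cvgC'_P _ _ _).1 e0)[d d0 hd].
    exists (Num.min d 1); first by rewrite lt_min d0 ltr01.
    move=> z; rewrite subr0 lt_min => /andP[a1 a2] z0.
    have := hd (z ^+ 2); rewrite add0r; apply; last by rewrite expf_neq0.
    rewrite subr0 nrmX expr2; apply: le_lt_trans a1.
    by rewrite ler_piMr ?nrm_ge0// ltW.
  pose proof (cvCD (cvCM (cvCM (cvC_cst (t ^+ 2)) l3) (lim t t0)) (cvCM (cvC_cst (t ^+ 2 / (n%:R * tpi ^+ 2))) l2)) as l4.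
  have l5 : funW n m2 (psim m) (- t^-1) (t^-1 * z) - (n%:R * (tpi * (t^-1 * z)) ^+ 2)^-1 @[z --> (0 : C)^'] -->
     (t ^+ 2 * 1 * f t + t ^+ 2 / (n%:R * tpi ^+ 2) * (tpi * (m%:R / t)) : C).
    apply: near_cvgC l4; have [d d0 hd] := nolat_frac n0 t0.
    apply/nearC'; exists d => // z; rewrite subr0 => lt z0.
    have hS := @funW_S R m n m2 (psim m) t z n0 em t0.
    rewrite [t^-1 * z]mulrC hS; last first.
      move=> u' v' /=; have nl := hd z lt z0 u' v'.
      by split; [exact: psim_D1 | exact: psim_S].
    have -> : m%:R * z ^+ 2 / t = m%:R / t * z ^+ 2 by rewrite mulrAC.
    field; by rewrite n1 tn0 z0 tpi_neq0.
  pose proof (cvg_unique (@norm_hausdorff _ _) l1 l5) as u; rewrite u.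
  rewrite mulr1; congr (_ + _); field; by rewrite n1 tpi_neq0 tn0.
(* The constant term of [f] is m/(12 n) = m2/12; removing the constants of its other two summands
   leaves (n + m2)/12. *)
have := weight_two hf key; rewrite eqxx e1 e2 => e.
have -> : a0 (coefW m n c) = m%:R / (n%:R * tpi) * tpi / 12 - ((1 - n%:R ^+ 2) / (12 * n%:R) - (12 * n%:R)^-1).
  by rewrite -e; ring.
rewrite em natrM; field; by rewrite n1 tpi_neq0.
Qed.

End StandardConstant.

(** * Products of involutions *)

Section InvolutionAlgebra.
Variable R : realType.
Local Notation C := (cplx R).
Implicit Types (t z w : C) (c : int * int -> C) (nr : int * int).

Lemma coefW_char (m n m2 : nat) c (N r N' s : int) : m = (n * m2)%N -> coprime n m2 ->
  (0 < m)%N -> qperiodic m c ->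
  (exists k, s = - r + k * (2 * n)%:Z) -> (exists k, s = r + k * (2 * m2)%:Z) ->
  (4 * m)%:Z * N' - s ^+ 2 = (4 * m)%:Z * N - r ^+ 2 ->
  coefW m n c (N, r) = c (N', s).
Proof.
move=> em cop m0 per h1 h2 hd; have /andP[n0 m20] : (0 < n)%N && (0 < m2)%N by rewrite -muln_gt0 -em.
have em2 : (m %/ n)%N = m2 by rewrite em mulKn.
have [k hk] := starP cop n0 m20 h1 h2.
rewrite /coefW /= em2 hk -em.
have -> : s + k * (2 * m)%:Z = s + (2 * m)%:Z * k by rewrite [k * _]mulrC.
rewrite -[RHS](per _ _ k); congr (c (_, _)).
have -> : (4 * m)%:Z * N - r ^+ 2 + (s + (2 * m)%:Z * k) ^+ 2 =
   (N' + s * k + m%:Z * k ^+ 2) * (4 * m)%:Z.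
  by rewrite -hd !PoszM; ring.
by rewrite mulzK// eqz_nat muln_eq0 /= -lt0n.
Qed.

Lemma coefW_ex (m n m2 : nat) (N r : int) : m = (n * m2)%N -> coprime n m2 -> (0 < m)%N ->
  exists N' q l : int, let s := r - (2 * m2)%:Z * l in
  [/\ s = - r + (2 * n)%:Z * q, (4 * m)%:Z * N' - s ^+ 2 = (4 * m)%:Z * N - r ^+ 2 &
   forall c, qperiodic m c -> coefW m n c (N, r) = c (N', s)].
Proof.
move=> em cop m0; have n0 : (0 < n)%N by move: m0; rewrite em muln_gt0 => /andP[].
have [l hl] := inverse_mod r n0 cop; case/dvdzP: (hl) => q hq.
have re : r = q * n%:Z + m2%:Z * l by rewrite -hq subrK.
exists (N - l * q), q, l => /=; split.
- by rewrite re !PoszM; ring.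
- by rewrite re em !PoszM; ring.
move=> c per; rewrite (coefW_val _ em cop m0 per hl) hq mulzK// eqz_nat -lt0n//.
Qed.

Lemma Wc1 m c : (0 < m)%N -> qperiodic m c -> coefW m 1 c = c.
Proof.
move=> m0 per; apply/funext => -[N r].
apply: (@coefW_char m 1 m) => //; rewrite ?mul1n ?coprime1n//; last by exists 0; rewrite mul0r addr0.
by exists r; ring.
Qed.

Lemma coefW_comp (m n1 n2 m3 : nat) c : m = (n1 * n2 * m3)%N -> coprime n1 n2 ->
  coprime n1 m3 -> coprime n2 m3 -> (0 < m)%N -> qperiodic m c ->
  coefW m n1 (coefW m n2 c) = coefW m (n1 * n2) c.
Proof.
move=> em c12 c13 c23 m0 per; apply/funext => -[N r].
have em1 : m = (n1 * (n2 * m3))%N by rewrite mulnA.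
have em2 : m = (n2 * (n1 * m3))%N by rewrite mulnCA mulnA.
have k1 : coprime n1 (n2 * m3) by rewrite coprimeMr c12.
have k2 : coprime n2 (n1 * m3) by rewrite coprimeMr coprime_sym c12.
have [N1 [q1 [l1 [a1 b1 h1]]]] := coefW_ex N r em1 k1 m0.
rewrite h1; last exact: periodic_coefW em2 k2 m0 per.
set s1 := r - _ in a1 b1 h1 *.
have [N2 [q2 [l2 [a2 b2 h2]]]] := coefW_ex N1 s1 em2 k2 m0.
rewrite h2//; set s2 := s1 - _ in a2 b2 h2 *; apply/esym.
have n20 : (n2%:Z : int) != 0.
  by rewrite eqz_nat; move: m0; rewrite em -lt0n !muln_gt0 => /andP[/andP[]].
apply: (coefW_char em _ m0 per); rewrite ?coprimeMl ?c13//; last by rewrite b2.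
  have e : n1%:Z * (q1 - m3%:Z * l2) = n2%:Z * (m3%:Z * l1 + q2).
    apply: (@mulIf int 2) => //.
    transitivity (s2 + r).
      by rewrite /s2 {1}a1 !PoszM; ring.
    by rewrite a2 /s1 !PoszM; ring.
  have /dvdzP[k hk] : (n2%:Z %| q1 - m3%:Z * l2)%Z.
    rewrite -(@Gauss_dvdzr _ n1%:Z); first by rewrite e dvdz_mulr.
    by rewrite /coprimez /gcdz /= -/(coprime n2 n1) coprime_sym in c12 *; rewrite (eqP c12).
  exists k; rewrite /s2 a1.
  have -> : q1 = k * n2%:Z + m3%:Z * l2 by rewrite -hk subrK.
  by rewrite !PoszM; ring.
by exists (- (n2%:Z * l1 + n1%:Z * l2)); rewrite /s2 /s1 !PoszM; ring.
Qed.

Lemma coefW_invol (m n m2 : nat) c : m = (n * m2)%N -> coprime n m2 -> (0 < m)%N ->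
  qperiodic m c -> coefW m n (coefW m n c) = c.
Proof.
move=> em cop m0 per; apply/funext => -[N r].
have [N' [q [l [h1 h2 h3]]]] := coefW_ex N r em cop m0.
rewrite h3; last exact: periodic_coefW em cop m0 per.
apply: (coefW_char em cop m0 per) => //.
  by exists q; rewrite [in RHS]h1; ring.
by exists l; ring.
Qed.

Lemma coefW_even (m n m2 : nat) c : m = (n * m2)%N -> coprime n m2 -> (0 < m)%N ->
  qperiodic m c -> (forall N r : int, c (N, - r) = c (N, r)) ->
  forall N r : int, coefW m n c (N, - r) = coefW m n c (N, r).
Proof.
move=> em cop m0 per ev N r; have [N' [q [l [h1 h2 h3]]]] := coefW_ex N r em cop m0.
rewrite h3// -ev; apply: (coefW_char em cop m0 per).
- by exists (- q); rewrite [in LHS]h1; ring.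
- by exists l; ring.
by rewrite !sqrrN.
Qed.

Lemma coefW_vanish (P : int -> Prop) (m n m2 : nat) c : m = (n * m2)%N -> coprime n m2 -> (0 < m)%N ->
  qperiodic m c -> (forall N r : int, P ((4 * m)%:Z * N - r ^+ 2) -> c (N, r) = 0) ->
  forall N r : int, P ((4 * m)%:Z * N - r ^+ 2) -> coefW m n c (N, r) = 0.
Proof.
move=> em cop m0 per h N r hP; have [N' [q [l [h1 h2 h3]]]] := coefW_ex N r em cop m0.
by rewrite h3// h// h2.
Qed.

(** The coefficients of phi(tau, d z), whose index is d^2 times that of phi. *)
Definition coefU (d : nat) c : int * int -> C := fun nr =>
  if (d%:Z %| nr.2)%Z then c (nr.1, (nr.2 %/ d%:Z)%Z) else 0.

Lemma fseries_coefU d c phi : (0 < d)%N -> fseries c phi -> fseries (coefU d c) (fun t z => phi t (d%:R * z)).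
Proof.
move=> d0 h t z t0; have dz : (d%:Z : int) != 0 by rewrite eqz_nat -lt0n.
apply: (proj2 (@hasSum_inj R (int * int)%type (int * int)%type (fun nr => (nr.1, d%:Z * nr.2)) _ _ _ _)).
- by move=> [n r] [n' r'] [-> /(mulfI dz) ->].
- move=> [n r] hr; rewrite /coefU /=; case: ifP => [/dvdzP[k hk]|_]; last by rewrite mul0r.
  by case: (hr (n, k)); rewrite /= hk mulrC.
apply: eq_hasSum (h t (d%:R * z) t0) => -[n r].
rewrite /coefU /= dvdz_mulr// mulKz//; congr (_ * _).
by rewrite /mon /= intrM -pmulrn; congr ee; ring.
Qed.

Lemma coefU_qperiodic d m1 m c : (0 < d)%N -> m = (m1 * d ^ 2)%N -> qperiodic m1 c -> qperiodic m (coefU d c).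
Proof.
move=> d0 em per n r l; have dz : (d%:Z : int) != 0 by rewrite eqz_nat -lt0n.
rewrite /coefU /= em.
have -> : (2 * (m1 * d ^ 2))%:Z * l = d%:Z * ((2 * m1)%:Z * (d%:Z * l)).
  by rewrite expnS expn1 !PoszM; ring.
rewrite rpredDr ?dvdz_mulr//; case: ifP => // /dvdzP[k ->].
rewrite mulzK// [k * _]mulrC -mulrDr mulKz// -[RHS](per n k (d%:Z * l)).
by congr (c (_, _)); rewrite expnS expn1 !PoszM; ring.
Qed.

Lemma coefU_even d c : (forall N r : int, c (N, - r) = c (N, r)) ->
  forall N r : int, coefU d c (N, - r) = coefU d c (N, r).
Proof.
move=> ev N r; rewrite /coefU /= rpredN; case: ifP => // /dvdzP[k ->].
have [->|d0] := eqVneq (d%:Z : int) 0; first by rewrite mulr0 oppr0.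
by rewrite -mulNr !mulzK.
Qed.

(** Rescaling z by d = d1 d2 is compatible with the involutions, d1^2 being removed from n and d2^2
    from its cofactor. When d does not divide r, it does not divide the residue exchanged with r
    either, so the coefficient vanishes. *)
Lemma coefW_Uc0 (d n1 n2 m1 : nat) (d1 d2 : nat) c (r : int) :
  let n := (n1 * d1 ^ 2)%N in let m2 := (n2 * d2 ^ 2)%N in let m := (n * m2)%N in
  d = (d1 * d2)%N -> m1 = (n1 * n2)%N -> coprime n m2 -> (0 < m)%N -> qperiodic m1 c ->
  coefW m n (coefU d c) (0, r) = if (d%:Z %| r)%Z then coefW m1 n1 c (0, (r %/ d%:Z)%Z) else 0.
Proof.
move=> n m2 m ed em1 cop m0 per.
have /andP[n0 m20] : (0 < n)%N && (0 < m2)%N by rewrite -muln_gt0.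
have /andP[n10 d10] : (0 < n1)%N && (0 < d1)%N by move: n0; rewrite muln_gt0 expn_gt0 orbF.
have /andP[n20 d20] : (0 < n2)%N && (0 < d2)%N by move: m20; rewrite muln_gt0 expn_gt0 orbF.
have nz : (n%:Z : int) != 0 by rewrite eqz_nat -lt0n.
have n1z : (n1%:Z : int) != 0 by rewrite eqz_nat -lt0n.
have dz : (d%:Z : int) != 0 by rewrite eqz_nat -lt0n ed muln_gt0 d10.
have D1 : (d1 %| n)%N by rewrite dvdn_mull// dvdn_exp.
have D2 : (d2 %| m2)%N by rewrite dvdn_mull// dvdn_exp.
have em : m = (m1 * d ^ 2)%N by rewrite em1 ed expnMn /m /n /m2 mulnACA.
have perU : qperiodic m (coefU d c) by apply: coefU_qperiodic em per; rewrite ed muln_gt0 d10.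
have cop1 : coprime n1 n2.
  by apply: coprime_dvdl (coprime_dvdr _ cop); rewrite ?dvdn_mulr.
have m10 : (0 < m1)%N by rewrite em1 muln_gt0 n10.
case: ifP => [/dvdzP[r' er]|nd].
  have cop' : coprime (n1 * d1) (n2 * d2).
    have E1 : (n1 * d1 %| n)%N by rewrite /n dvdn_pmul2l// dvdn_exp.
    have E2 : (n2 * d2 %| m2)%N by rewrite /m2 dvdn_pmul2l// dvdn_exp.
    exact: coprime_dvdl E1 (coprime_dvdr E2 cop).
  have [|l hl] := @inverse_mod (n1 * d1) (n2 * d2) r' _ cop'; first by rewrite muln_gt0 n10.
  case/dvdzP: hl => q hq.
  have h1 : r' - n2%:Z * (d2%:Z * l) = q * d1%:Z * n1%:Z by move: hq; rewrite !PoszM => hq; rewrite mulrA hq; ring.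
  have h2 : r - m2%:Z * (d1%:Z * l) = q * d2%:Z * n%:Z.
    rewrite er ed /m2 /n !PoszM.
    transitivity (d1%:Z * d2%:Z * (r' - n2%:Z * (d2%:Z * l))); first by ring.
    by rewrite h1; ring.
  have v1 : (n1%:Z %| r' - n2%:Z * (d2%:Z * l))%Z by rewrite h1 dvdz_mull.
  have v2 : (n%:Z %| r - m2%:Z * (d1%:Z * l))%Z by rewrite h2 dvdz_mull.
  rewrite {2}er mulzK// (coefW_val 0 em1 cop1 m10 per v1) (coefW_val 0 (erefl m) cop m0 perU v2).
  rewrite h1 h2 !mulzK// /coefU /=.
  have -> : r - (2 * m2)%:Z * (d1%:Z * l) = (r' - (2 * n2)%:Z * (d2%:Z * l)) * d%:Z.
    by rewrite er ed /m2 !PoszM; ring.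
  by rewrite dvdz_mull// mulzK//; congr (c (_, _)); ring.
have [l hl] := inverse_mod r n0 cop.
rewrite (coefW_val 0 (erefl m) cop m0 perU hl); case/dvdzP: hl => q hq.
rewrite /coefU /= ifF//; apply: contraFF nd => hd.
have er : r = q * n%:Z + m2%:Z * l by rewrite -hq subrK.
(* Since d1 is prime to m2 and d2 is prime to n, this divisibility gives d1 | l and d2 | q, whence d
   | r. *)
have hd' : (d%:Z %| q * n%:Z - m2%:Z * l)%Z.
  by move: hd; rewrite {1}er PoszM; congr (_ %| _)%Z; ring.
have dd1 : (d1%:Z %| d%:Z)%Z by rewrite ed PoszM dvdz_mulr.
have dd2 : (d2%:Z %| d%:Z)%Z by rewrite ed PoszM dvdz_mull.
have D1z : (d1%:Z %| n%:Z)%Z by rewrite dvdzE.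
have D2z : (d2%:Z %| m2%:Z)%Z by rewrite dvdzE.
have h1 : (d1%:Z %| l)%Z.
  rewrite -(@Gauss_dvdzr _ m2%:Z); last by have c1 := coprime_dvdl D1 cop; rewrite /coprimez /gcdz /= (eqP c1).
  have := dvdz_trans dd1 hd'; rewrite rpredBl//; exact: dvdz_mull.
have h2 : (d2%:Z %| q)%Z.
  rewrite -(@Gauss_dvdzl _ _ n%:Z); last by have c1 := coprime_dvdr D2 cop; rewrite coprime_sym in c1; rewrite /coprimez /gcdz /= (eqP c1).
  have := dvdz_trans dd2 hd'; rewrite rpredBr//; exact: dvdz_mulr.
rewrite er ed PoszM rpredD//.
  by rewrite [d1%:Z * _]mulrC dvdz_mul.
by rewrite [d1%:Z * _]mulrC dvdz_mul.
Qed.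

Lemma a0_coefU (n1 n2 d1 d2 : nat) c phi :
  let n := (n1 * d1 ^ 2)%N in let m2 := (n2 * d2 ^ 2)%N in let m := (n * m2)%N in
  coprime n m2 -> (0 < m)%N -> qperiodic (n1 * n2) c -> fseries c phi ->
  a0 (coefW m n (coefU (d1 * d2) c)) = a0 (coefW (n1 * n2) n1 c).
Proof.
move=> n m2 m cop m0 per h.
have /andP[n0 m20] : (0 < n)%N && (0 < m2)%N by rewrite -muln_gt0.
have /andP[n10 d10] : (0 < n1)%N && (0 < d1)%N by move: n0; rewrite muln_gt0 expn_gt0 orbF.
have /andP[n20 d20] : (0 < n2)%N && (0 < d2)%N by move: m20; rewrite muln_gt0 expn_gt0 orbF.
have cop1 : coprime n1 n2.
  by apply: coprime_dvdl (coprime_dvdr _ cop); rewrite ?dvdn_mulr.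
have m10 : (0 < n1 * n2)%N by rewrite muln_gt0 n10.
have hW : fseries (coefW (n1 * n2) n1 c) (funW n1 n2 phi) by move=> t z t0; exact: coefW_hasSum.
have dz : ((d1 * d2)%N%:Z : int) != 0 by rewrite eqz_nat -lt0n muln_gt0 d10.
apply: hasSum_tsum.
apply: (proj2 (@hasSum_inj R int int (fun r => (d1 * d2)%N%:Z * r) _ _ _ _)).
- by move=> x y /(mulfI dz).
- move=> r hr; rewrite (@coefW_Uc0 (d1 * d2) n1 n2 (n1 * n2) d1 d2)//.
  by case: ifP => // /dvdzP[k hk]; case: (hr k); rewrite hk mulrC.
apply: eq_hasSum (a0_hasSum hW) => r /=.
by rewrite (@coefW_Uc0 (d1 * d2) n1 n2 (n1 * n2) d1 d2)// dvdz_mulr// mulKz.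
Qed.

End InvolutionAlgebra.

(** * Products of the operators 1 + eps W *)

Section Operators.
Variable R : realType.
Local Notation C := (cplx R).
Implicit Types (t z w : C) (c : int * int -> C) (nr : int * int) (l : seq (nat * int)).

Definition exact_div (m n : nat) := (n %| m)%N && coprime n (m %/ n).

Lemma exact_divP m n : exact_div m n -> exists2 m2, m = (n * m2)%N & coprime n m2.
Proof. by move=> /andP[/divnK e c]; exists (m %/ n)%N; rewrite // mulnC e. Qed.

Lemma exact_divI m n m2 : (0 < m)%N -> m = (n * m2)%N -> coprime n m2 -> exact_div m n.
Proof.
move=> m0 e c; rewrite /exact_div e dvdn_mulr// mulKn//.
by move: m0; rewrite e muln_gt0 => /andP[].
Qed.

Lemma exact_div2 m a b : (0 < m)%N -> exact_div m a -> exact_div m b -> coprime a b ->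
  exists m3, [/\ m = (a * b * m3)%N, coprime a m3 & coprime b m3].
Proof.
move=> m0 /exact_divP[u eu cu] /exact_divP[v ev cv] cab.
have /dvdnP[m3 e3] : (b %| u)%N by rewrite -(@Gauss_dvdr _ a) 1?coprime_sym// -eu ev dvdn_mulr.
have a0 : (0 < a)%N by move: m0; rewrite eu muln_gt0 => /andP[].
have b0 : (0 < b)%N by move: m0; rewrite ev muln_gt0 => /andP[].
exists m3; split; first by rewrite eu e3 mulnC -mulnA mulnC [(b * a)%N]mulnC.
  by move: cu; rewrite e3 coprimeMr => /andP[].
have e4 : v = (a * m3)%N.
  by apply/eqP; rewrite -(eqn_pmul2l b0) -ev eu e3; apply/eqP; ring.
by move: cv; rewrite e4 coprimeMr => /andP[].
Qed.

Lemma exact_divM m a b : (0 < m)%N -> exact_div m a -> exact_div m b -> coprime a b -> exact_div m (a * b).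
Proof.
move=> m0 ha hb cab; have [m3 [e c1 c2]] := exact_div2 m0 ha hb cab.
by apply: exact_divI e _ => //; rewrite coprimeMl c1.
Qed.

(** The explicit factor 1 keeps the shape of the linear combinations in [goodfD] and [a0_lin]. *)
Definition coef_one_plus_W m (x : nat * int) c : int * int -> C :=
  fun nr => 1 * c nr + x.2%:~R * coefW m x.1 c nr.

Definition coef_opW m l c := foldl (fun c x => coef_one_plus_W m x c) c l.

Lemma coef_one_plus_W_goodf m x c : exact_div m x.1 -> goodf m c -> goodf m (coef_one_plus_W m x c).
Proof.
by move=> /exact_divP[m2 e cop] g; apply: goodfD => //; exact: goodf_coefW e cop g.
Qed.

Lemma coef_opW_fseries m l c phi : all (fun x => exact_div m x.1) l -> goodf m c -> fseries c phi ->
  goodf m (coef_opW m l c) /\ fseries (coef_opW m l c) (foldl (fun f x => one_plus_W m x.1 x.2 f) phi l).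
Proof.
elim: l c phi => [|x l ih] c phi //= /andP[hx hl] g h; apply: ih => //.
  exact: coef_one_plus_W_goodf.
by have [m2 e cop] := exact_divP hx; exact: fseries_one_plus_W e cop g h.
Qed.

Lemma coef_opW_ind m l (P : (int * int -> C) -> Prop) c : all (fun x => exact_div m x.1) l -> goodf m c ->
  (forall x c, exact_div m x.1 -> goodf m c -> P c -> P (coef_one_plus_W m x c)) -> P c -> P (coef_opW m l c).
Proof.
move=> hl g hP; elim: l c hl g => [|x l ih] c //= /andP[hx hl] g pc.
by apply: ih => //; [exact: coef_one_plus_W_goodf | exact: hP].
Qed.

Lemma coef_opW_even m l c : all (fun x => exact_div m x.1) l -> goodf m c ->
  (forall N r : int, c (N, - r) = c (N, r)) -> forall N r : int, coef_opW m l c (N, - r) = coef_opW m l c (N, r).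
Proof.
move=> hl g; apply: (coef_opW_ind (P := fun c => forall N r : int, c (N, - r) = c (N, r)) hl g).
move=> x d /exact_divP[m2 e cop] [m0 _ per _] ev N r.
by rewrite /coef_one_plus_W ev (coefW_even e cop m0 per).
Qed.

Lemma coef_opW_vanish (P : int -> Prop) m l c : all (fun x => exact_div m x.1) l -> goodf m c ->
  (forall N r : int, P ((4 * m)%:Z * N - r ^+ 2) -> c (N, r) = 0) ->
  forall N r : int, P ((4 * m)%:Z * N - r ^+ 2) -> coef_opW m l c (N, r) = 0.
Proof.
move=> hl g; apply: (coef_opW_ind (P := fun c => forall N r : int, P ((4 * m)%:Z * N - r ^+ 2) -> c (N, r) = 0) hl g).
move=> x d /exact_divP[m2 e cop] [m0 _ per _] hd N r hP.
by rewrite /coef_one_plus_W hd// (coefW_vanish e cop m0 per hd)// !mulr0 addr0.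
Qed.

Lemma a0_lin m c d (a b : C) : goodf m c -> goodf m d ->
  a0 (fun nr => a * c nr + b * d nr) = a * a0 c + b * a0 d.
Proof.
move=> [_ _ _ [phi h]] [_ _ _ [psi k]]; apply: hasSum_tsum.
exact: (hasSumD (hasSumZ a (a0_hasSum h)) (hasSumZ b (a0_hasSum k))).
Qed.

(** The numbers n for which W_n occurs when the product of the 1 + eps W is expanded. *)
Fixpoint subprods (l : seq nat) : seq nat :=
  if l is p :: l' then subprods l' ++ [seq (p * n)%N | n <- subprods l'] else [:: 1%N].

Lemma subprodsP m (l : seq nat) n : (0 < m)%N -> all (exact_div m) l -> pairwise coprime l -> n \in subprods l ->
  exact_div m n /\ forall p, all (coprime p) l -> coprime p n.
Proof.
move=> m0; elim: l n => [|q l ih] n /=.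
  move=> _ _; rewrite inE => /eqP ->; split => [|p _]; last exact: coprimen1.
  by rewrite /exact_div dvd1n coprime1n.
move=> /andP[hq hl] /andP[cq cl]; rewrite mem_cat => /orP[hn|/mapP[n' hn' ->]].
  have [h1 h2] := ih n hl cl hn; split => // p /andP[_]; exact: h2.
have [h1 h2] := ih n' hl cl hn'; split; first exact: exact_divM (h2 q cq).
by move=> p /andP[hp hpl]; rewrite coprimeMr hp h2.
Qed.

Lemma coefW_coef_one_plus_W m n (x : nat * int) c : (0 < m)%N -> exact_div m n -> exact_div m x.1 -> coprime n x.1 ->
  qperiodic m c -> coefW m n (coef_one_plus_W m x c) = fun nr => 1 * coefW m n c nr + x.2%:~R * coefW m (n * x.1) c nr.
Proof.
move=> m0 hn hx cop per; have [m3 [e c1 c2]] := exact_div2 m0 hn hx cop.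
by rewrite -(coefW_comp e cop c1 c2 m0 per).
Qed.

(** Expansion into Euler products. The list [js] indexes several multiplicative functions at once,
    with weights [k]; in the induction the first factor 1 + eps f_j(p) is moved into the weight. *)
Lemma a0_coef_opW (J : Type) (js : seq J) (k : J -> C) (f : J -> nat -> C) m l c :
  (forall j, f j 1%N = 1) ->
  (forall j a b, coprime a b -> f j (a * b)%N = f j a * f j b) ->
  all (exact_div m) (map fst l) -> pairwise coprime (map fst l) -> goodf m c ->
  (forall n, n \in subprods (map fst l) -> a0 (coefW m n c) = \sum_(j <- js) k j * f j n) ->
  a0 (coef_opW m l c) = \sum_(j <- js) k j * \prod_(x <- l) (1 + x.2%:~R * f j x.1).
Proof.
move=> f1 fM; elim: l c k => [|x l ih] c k /=.
  move=> _ _ [m0 _ per _] h; have := h 1%N; rewrite inE eqxx Wc1// => /(_ isT) ->.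
  by apply: eq_bigr => j _; rewrite f1 big_nil.
move=> /andP[hx hl] /andP[cx cl] g h; have m0 : (0 < m)%N by case: g.
rewrite (ih _ (fun j => k j * (1 + x.2%:~R * f j x.1))) //; last 2 first.
- exact: coef_one_plus_W_goodf.
- move=> n hn; have [xn /(_ _ cx) cn] := subprodsP m0 hl cl hn.
  have per : qperiodic m c by case: g.
  rewrite (coefW_coef_one_plus_W m0 xn hx _ per); last by rewrite coprime_sym.
  have [m2 e cop] := exact_divP xn.
  have cn' : coprime n x.1 by rewrite coprime_sym.
  have [m2' e' cop'] := exact_divP (exact_divM m0 xn hx cn').
  rewrite (a0_lin _ _ (goodf_coefW e cop g) (goodf_coefW e' cop' g)).
  rewrite h ?mem_cat ?hn// [(n * _)%N]mulnC h; last first.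
    by rewrite mem_cat; apply/orP; right; apply/mapP; exists n.
  rewrite mul1r mulr_sumr -big_split /=; apply: eq_bigr => j _.
  by rewrite fM//; ring.
by apply: eq_bigr => j _; rewrite big_cons mulrA.
Qed.

Lemma coefW_coef_opW_comm m n l c : exact_div m n -> all (fun x => exact_div m x.1) l -> goodf m c ->
  all (fun x => (n == x.1) || coprime n x.1) l -> coefW m n (coef_opW m l c) = coef_opW m l (coefW m n c).
Proof.
move=> hn; elim: l c => [|x l ih] c //= /andP[hx hl] g /andP[cx cl].
rewrite ih//; last exact: coef_one_plus_W_goodf.
congr (coef_opW m l _); have [m0 _ per _] := g.
have [/eqP ->|cop] := orP cx; first by [].
rewrite coefW_coef_one_plus_W// /coef_one_plus_W; apply/funext => nr; congr (_ + _ * _).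
have cop' : coprime x.1 n by rewrite coprime_sym.
have [m3 [e c1 c2]] := exact_div2 m0 hx hn cop'.
by rewrite (coefW_comp e cop' c1 c2 m0 per) mulnC.
Qed.

Lemma opcZ m l c (a : C) : coef_opW m l (fun nr => a * c nr) = fun nr => a * coef_opW m l c nr.
Proof.
elim: l c => [|x l ih] c //=; rewrite -ih; congr (coef_opW m l _); apply/funext => nr.
rewrite /coef_one_plus_W /coefW; ring.
Qed.

(** W (1 + eps W) = eps (1 + eps W), since W is an involution and eps^2 = 1; the other factors
    commute with W. *)
Lemma coefW_coef_opW m l c x : all (fun x => exact_div m x.1) l -> pairwise coprime (map fst l) ->
  goodf m c -> x \in l -> x.2 = 1 \/ x.2 = -1 ->
  coefW m x.1 (coef_opW m l c) = fun nr => x.2%:~R * coef_opW m l c nr.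
Proof.
elim: l c => [|y l ih] c //= /andP[hy hl] /andP[cy cl] g; rewrite inE => /orP[/eqP ->|xl] hx; last first.
  by apply: ih => //; exact: coef_one_plus_W_goodf.
have [m0 _ per _] := g.
rewrite coefW_coef_opW_comm//; [|exact: coef_one_plus_W_goodf|]; last first.
  apply/allP => z zl; apply/orP; right; apply: (allP cy); exact: map_f.
rewrite -opcZ; congr (coef_opW m l _); apply/funext => nr.
have [m2 e cop] := exact_divP hy; rewrite /coef_one_plus_W.
have -> : coefW m y.1 (fun nr => 1 * c nr + y.2%:~R * coefW m y.1 c nr) nr =
   1 * coefW m y.1 c nr + y.2%:~R * coefW m y.1 (coefW m y.1 c) nr by [].
rewrite (coefW_invol e cop m0 per).
have y2 : (y.2%:~R : C) * y.2%:~R = 1 by case: hx => ->; rewrite ?mulrN1z ?mulr1z ?mulrNN ?mulr1.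
by rewrite mulrDr [_ * (y.2%:~R * _)]mulrA y2; ring.
Qed.

(** Residues -1 are flipped to 1 one exact divisor at a time, each flip costing the eigenvalue. The
    last clause, that moduli prime to the list are left alone, lets the residue at the head survive
    the treatment of the tail. *)
Lemma coef_opW_sign m l (F : int * int -> C) : (0 < m)%N -> qperiodic m F ->
  all (fun x => exact_div m x.1) l -> pairwise coprime (map fst l) -> 
  (forall x, x \in l -> coefW m x.1 F = fun nr => x.2%:~R * F nr) ->
  (forall x, x \in l -> x.2 = 1 \/ x.2 = -1) -> forall N r : int,
  (forall x, x \in l -> (r = 1 %[mod (2 * x.1)%:Z])%Z \/ (r = -1 %[mod (2 * x.1)%:Z])%Z) ->
  exists N' r' : int, [/\ (4 * m)%:Z * N' - r' ^+ 2 = (4 * m)%:Z * N - r ^+ 2,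
    F (N, r) = (\prod_(x <- l | (r == -1 %[mod (2 * x.1)%:Z])%Z) x.2)%:~R * F (N', r'),
    forall x, x \in l -> (r' = 1 %[mod (2 * x.1)%:Z])%Z &
    forall y, (y %| m)%N -> all (coprime y) (map fst l) -> (r' = r %[mod (2 * y)%:Z])%Z].
Proof.
move=> m0 per; elim: l => [|x l ih] /= => [_ _ _ _ N r _|/andP[hx hl] /andP[cx cl] hW heps N r hr].
  by exists N, r; split => //; rewrite big_nil mul1r.
have hWl y : y \in l -> coefW m y.1 F = fun nr => y.2%:~R * F nr.
  by move=> yl; apply: hW; rewrite inE yl orbT.
have hel y : y \in l -> y.2 = 1 \/ y.2 = -1 by move=> yl; apply: heps; rewrite inE yl orbT.
have [m2 e cop] := exact_divP hx.
have div2 y : (y %| m)%N -> coprime y x.1 -> (y %| m2)%N by move=> ym cyx; rewrite -(Gauss_dvdr _ cyx) -e.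
have modw (a b : int) (d d' : nat) : (d %| d')%N -> (a = b %[mod (2 * d')%:Z])%Z -> (a = b %[mod (2 * d)%:Z])%Z.
  move=> /dvdnP[q ->] /modz_eqP[k ->]; apply/modz_eqP; exists (k * q%:Z).
  by rewrite !PoszM; ring.
have dx : (x.1 %| m)%N by case/andP: hx.
have [hm1|hm1] := boolP (r == -1 %[mod (2 * x.1)%:Z])%Z; last first.
  have hr1 : (r = 1 %[mod (2 * x.1)%:Z])%Z.
    by case: (hr x); rewrite ?inE ?eqxx// => h; rewrite h eqxx in hm1.
  have hrl y : y \in l -> (r = 1 %[mod (2 * y.1)%:Z])%Z \/ (r = -1 %[mod (2 * y.1)%:Z])%Z.
    by move=> yl; apply: hr; rewrite inE yl orbT.
  have [N' [r' [h1 h2 h3 h4]]] := ih hl cl hWl hel N r hrl.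
  exists N', r'; split => //; first by rewrite big_cons (negbTE hm1).
    by move=> y; rewrite inE => /orP[/eqP ->|/h3//]; rewrite -hr1; exact: h4.
  by move=> y ym /= /andP[_]; exact: h4.
have [N1 [q [k [a1 b1 h1]]]] := coefW_ex R N r e cop m0; set s := r - _ in a1 b1 h1.
have sm2 : (s = r %[mod (2 * m2)%:Z])%Z by apply/modz_eqP; exists (- k); rewrite /s; ring.
have sx : (s = 1 %[mod (2 * x.1)%:Z])%Z.
  move/eqP/modz_eqP: hm1 => [k' ek']; apply/modz_eqP; exists (q - k').
  by rewrite a1 ek'; ring.
have sy y : (y %| m)%N -> coprime y x.1 -> (s = r %[mod (2 * y)%:Z])%Z.
  by move=> ym cyx; apply: modw sm2; exact: div2.
have syl y : y \in l -> (s = r %[mod (2 * y.1)%:Z])%Z.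
  move=> yl; apply: sy; first by have /andP[] := allP hl y yl.
  by rewrite coprime_sym; apply: (allP cx); exact: map_f.
have hsl y : y \in l -> (s = 1 %[mod (2 * y.1)%:Z])%Z \/ (s = -1 %[mod (2 * y.1)%:Z])%Z.
  by move=> yl; rewrite syl//; apply: hr; rewrite inE yl orbT.
have [N' [r' [g1 g2 g3 g4]]] := ih hl cl hWl hel N1 s hsl.
have x2 : (x.2%:~R : C) * x.2%:~R = 1.
  by case: (heps x) => [||->]; rewrite ?inE ?eqxx//; [move=> -> |]; rewrite ?mulrN1z ?mulr1z ?mulrNN ?mulr1.
exists N', r'; split; first by rewrite g1 b1.
- rewrite big_cons hm1 intrM -mulrA.
  rewrite (_ : \prod_(j <- l | _) j.2 = \prod_(j <- l | (s == -1 %[mod (2 * j.1)%:Z])%Z) j.2); last first.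
    by rewrite big_seq_cond [RHS]big_seq_cond; apply: eq_bigl => y; case yl: (y \in l); rewrite //= syl.
  rewrite -g2 -h1// hW ?inE ?eqxx// mulrA x2 mul1r//.
- by move=> y; rewrite inE => /orP[/eqP ->|/g3//]; rewrite -sx; exact: g4.
by move=> y ym /= /andP[cyx cyl]; rewrite (g4 y ym cyl) sy.
Qed.

End Operators.

(** * Sums over divisors and the coefficient formula *)

Section Arithmetic.

Lemma gcdn_coprimeM a b d : coprime a b -> gcdn (a * b) d = (gcdn a d * gcdn b d)%N.
Proof.
move=> cop; apply/eqP; rewrite eqn_dvd; apply/andP; split; last first.
  rewrite dvdn_gcd dvdn_mul ?dvdn_gcdl//= Gauss_dvd ?dvdn_gcdr//.
  by apply: coprime_dvdl (dvdn_gcdl _ _) (coprime_dvdr (dvdn_gcdl _ _) cop).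
have [u hu] := dvdnP (dvdn_gcdr (a * b) d).
set g := gcdn (a * b) d.
have e : g = (gcdn g a * gcdn g b)%N.
  have gab : (g %| a * b)%N := dvdn_gcdl _ _.
  apply/eqP; rewrite eqn_dvd; apply/andP; split; last first.
    rewrite Gauss_dvd ?dvdn_gcdl//.
    by apply: coprime_dvdl (dvdn_gcdr _ _) (coprime_dvdr (dvdn_gcdr _ _) cop).
  rewrite muln_gcdr dvdn_gcd dvdn_mull//= muln_gcdl dvdn_gcd dvdn_mulr//=.
rewrite e dvdn_mul// dvdn_gcd.
  by rewrite dvdn_gcdr (dvdn_trans (dvdn_gcdl _ _))// dvdn_gcdr.
by rewrite dvdn_gcdr (dvdn_trans (dvdn_gcdl _ _))// dvdn_gcdr.
Qed.

Lemma gcd_sqr_dvd n m2 d : coprime n m2 -> (d ^ 2 %| n * m2)%N -> (gcdn n d ^ 2 %| n)%N.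
Proof.
move=> cop h; rewrite -(@Gauss_dvdl _ _ m2).
  by apply: dvdn_trans h; rewrite dvdn_exp2r ?dvdn_gcdr.
by rewrite coprimeXl// (coprime_dvdl (dvdn_gcdl _ _)).
Qed.

(** With r = 1 + 2 u, m divides u (u + 1), and p divides at most one of two consecutive integers.
    Cancelling the factor 4 first makes p = 2 behave like the odd primes. *)
Lemma r2_pm1 (m P p nu : nat) (r : int) : prime p -> P = (p ^ nu)%N -> (P %| m)%N ->
  (r ^+ 2 = 1 %[mod (4 * m)%:Z])%Z ->
  (r = 1 %[mod (2 * P)%:Z])%Z \/ (r = -1 %[mod (2 * P)%:Z])%Z.
Proof.
move=> pp eP Pm /modz_eqP[k hk].
have [u hu] : exists u : int, r = 1 + 2 * u.
  have [q [hq|hq]] : exists q : int, r = 2 * q \/ r = 2 * q + 1.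
    exists (r %/ 2)%Z; have := divz_eq r 2; have := @modz_ge0 r 2 isT; have := @ltz_pmod r 2 isT.
    set y := (r %% 2)%Z; set x := (r %/ 2)%Z; clearbody x y; lia.
    exfalso; have : 2 * (q * q * 2 - k * (2 * m)%:Z) = 1 :> int.
      transitivity (r ^+ 2 - k * (4 * m)%:Z); last by rewrite hk addrK.
      by rewrite hq !PoszM; ring.
    by set x := _ - _; clearbody x; lia.
  by exists q; rewrite hq addrC.
have e : u * (u + 1) = k * m%:Z.
  have : 4 * (u * (u + 1)) = 4 * (k * m%:Z).
    have e1 : 4 * (u * (u + 1)) + 1 = 4 * (k * m%:Z) + 1.
      transitivity (r ^+ 2); first by rewrite hu; ring.
      by rewrite hk PoszM; ring.
    exact: addIr e1.
  by move/(@mulfI int 4 isT).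
have dP : (P%:Z %| u * (u + 1))%Z by rewrite e dvdz_mull.
have ppn : (p%:Z %| u)%Z = false \/ (p%:Z %| u + 1)%Z = false.
  have [h1|?] := boolP (p%:Z %| u)%Z; last by left; exact/negbTE.
  right; apply/negP; rewrite rpredDl// => h2.
  by move: h2; rewrite dvdzE /= dvdn1 => /eqP p1; rewrite p1 in pp.
have cop (v : int) : (p%:Z %| v)%Z = false -> coprimez P%:Z v.
  by move=> h; rewrite coprimezE absz_nat eP coprimeXl// prime_coprime// -[p]absz_nat -dvdzE h.
case: ppn => /cop h; [right|left]; apply/modz_eqP.
  have /dvdzP[q hq] : (P%:Z %| u + 1)%Z by rewrite -(Gauss_dvdzr _ h).
  by exists q; rewrite hu PoszM (_ : u = q * P%:Z - 1); [ring | rewrite -hq addrK].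
have /dvdzP[q hq] : (P%:Z %| u)%Z by rewrite -(Gauss_dvdzl _ h).
by exists q; rewrite hu PoszM hq; ring.
Qed.

Lemma pairwise_dvd (l : seq nat) (u : int) : pairwise coprime l ->
  (forall x, x \in l -> (x%:Z %| u)%Z) -> ((\prod_(x <- l) x)%N%:Z %| u)%Z.
Proof.
elim: l => [|x l ih] /=; first by rewrite big_nil dvd1z.
move=> /andP[cx cl] h; rewrite big_cons PoszM Gauss_dvdz.
  by rewrite h ?inE ?eqxx// ih// => y yl; apply: h; rewrite inE yl orbT.
rewrite coprimezE !absz_nat; elim: l cx {ih cl h} => [|y l ih] /=; first by rewrite big_nil coprimen1.
by move=> /andP[cxy cl]; rewrite big_cons coprimeMr cxy ih.
Qed.

Lemma logn_prodX (I : finType) (p : I -> nat) (e : I -> nat) (q : nat) (A : pred I) :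
  (forall i, prime (p i)) -> logn q (\prod_(i | A i) p i ^ e i) = (\sum_(i | A i) e i * (q == p i))%N.
Proof.
move=> pp; suff [] : (0 < \prod_(i | A i) p i ^ e i)%N /\
  logn q (\prod_(i | A i) p i ^ e i) = (\sum_(i | A i) e i * (q == p i))%N by [].
elim/big_rec2: _ => [|i x y _ [y0 hy]]; first by rewrite logn1.
by rewrite muln_gt0 expn_gt0 prime_gt0// y0 lognM// ?expn_gt0 ?prime_gt0// hy lognX logn_prime.
Qed.

(* d |-> mu(d) is supported on the products of distinct p_i; the condition
   d^2 | m selects those with nu_i >= 2 *)
Lemma mobius_sum (K : comNzRingType) (s : nat) (p nu : 'I_s -> nat) (m : nat) (a b : 'I_s -> K) :
  (forall i, prime (p i)) -> injective p -> (forall i, (1 <= nu i)%N) ->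
  m = (\prod_i p i ^ nu i)%N ->
  \sum_(d <- [seq d <- index_iota 1 m.+1 | (d ^ 2 %| m)%N])
     (mobius d)%:~R * \prod_i (if gcdn (p i ^ nu i) d == 1%N then a i else b i) =
  \prod_i (if nu i == 1%N then a i else a i - b i).
Proof.
move=> pp inj nu1 em.
have m0 : (0 < m)%N by rewrite em prodn_gt0// => i; rewrite expn_gt0 prime_gt0.
pose V : {set 'I_s} := [set i | nu i != 1%N]%SET.
(* The exponent 1 gives the product the shape of [logn_prodX]. *)
pose dd (J : {set 'I_s}) := (\prod_(i in J) p i ^ 1)%N.
have dd0 J : (0 < dd J)%N by rewrite prodn_gt0// => i; rewrite expn_gt0 prime_gt0.
have logd J i : logn (p i) (dd J) = (i \in J).
  rewrite logn_prodX//; have [iJ|iJ] := boolP (i \in J).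
    rewrite (bigD1 i)//= eqxx big1// => j /andP[_ ji]; rewrite (inj_eq inj) eq_sym (negbTE ji)//.
  by rewrite big1// => j jJ; rewrite (inj_eq inj); case: eqP => // ij; rewrite ij jJ in iJ.
have logm i : logn (p i) m = nu i.
  rewrite em logn_prodX// (bigD1 i)//= eqxx muln1 big1 ?addn0// => j ji.
  by rewrite (inj_eq inj) eq_sym (negbTE ji) muln0.
have logd0 J q : (forall i, q != p i) -> logn q (dd J) = 0%N.
  by move=> hq; rewrite logn_prodX// big1// => i _; rewrite (negbTE (hq i)).
have pm q : prime q -> (q %| m)%N -> exists i, q = p i.
  move=> pq qm; case: (boolP [exists i, q == p i]) => [/existsP[i /eqP ->]|]; first by exists i.
  move=> /existsPn h; have : (0 < logn q m)%N by rewrite logn_gt0 mem_primes pq m0.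
  by rewrite em logn_prodX// big1// => i _; rewrite (negbTE (h i)) muln0.
have mudd J : mobius (dd J) = (-1) ^+ #|J|.
  have hpr : primes (dd J) =i [seq p i | i <- enum J].
    move=> q; rewrite -logn_gt0; case: (boolP [exists i, q == p i]) => [/existsP[i /eqP ->]|/existsPn h].
      by rewrite logd mem_map// mem_enum lt0b.
    rewrite logd0//; apply/esym/negbTE/mapP => -[i _ e]; by have := h i; rewrite e eqxx.
  rewrite /mobius ifT; last first.
    apply/allP => q; rewrite hpr => hq.
    have [i iJ ->] := mapP hq; by rewrite logd -mem_enum iJ.
  congr (_ ^+ _); rewrite cardE -(size_map p); apply: perm_size.
  by apply: uniq_perm => //; rewrite ?primes_uniq// map_inj_uniq ?enum_uniq.
have ddin J : (dd J \in [seq d <- index_iota 1 m.+1 | (d ^ 2 %| m)%N]) = (J \subset V).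
  rewrite mem_filter mem_index_iota ltnS dd0 /=; apply/andP/fintype.subsetP => [[h _] i iJ|h].
    rewrite inE; apply/eqP => n1; have := dvdn_leq_log (p i) m0 h.
    by rewrite lognX logd iJ logm n1.
  have h2 : (dd J ^ 2 %| m)%N.
    apply/dvdn_partP => [|q]; first by rewrite expn_gt0 dd0.
    rewrite mem_primes => /and3P[pq _ quo_gcd2].
    have qdd : (q %| dd J)%N by move: quo_gcd2; rewrite Euclid_dvdX// andbT.
    have [i ei] : exists i, q = p i.
      case: (boolP [exists i, q == p i]) => [/existsP[i /eqP ->]|/existsPn hq]; first by exists i.
      have : (0 < logn q (dd J))%N by rewrite logn_gt0 mem_primes pq dd0.
      by rewrite logd0.
    rewrite p_part pfactor_dvdn// ei lognX logd logm.
    have : (0 < logn q (dd J))%N by rewrite logn_gt0 mem_primes pq dd0.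
    rewrite ei logd; case: (i \in J) (h i) => // /(_ isT); rewrite inE => n1 _.
    by have := nu1 i; move: (nu i) n1 => [|[|n]].
  by split => //; apply: dvdn_leq (dvdn_trans _ h2); rewrite ?dvdn_exp.
have ddinj : injective dd.
  move=> J J' e; apply/setP => i; have := logd J i; rewrite e logd.
  by case: (i \in J'); case: (i \in J).
have gcdd J i : (gcdn (p i ^ nu i) (dd J) == 1%N) = (i \notin J).
  rewrite -/(coprime _ _) coprime_pexpl//.
  by rewrite prime_coprime// -[in RHS](lt0b (i \in J)) -logd logn_gt0 mem_primes pp dd0.
have -> : \sum_(d <- [seq d <- index_iota 1 m.+1 | (d ^ 2 %| m)%N])
     (mobius d)%:~R * \prod_i (if gcdn (p i ^ nu i) d == 1%N then a i else b i) =
  \sum_(d <- [seq dd J | J <- enum (powerset V)])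
     (mobius d)%:~R * \prod_i (if gcdn (p i ^ nu i) d == 1%N then a i else b i) :> K.
  rewrite (bigID (fun d => mobius d != 0)) /= [X in _ + X]big1 ?addr0 => [|d]; last first.
    by rewrite negbK => /eqP ->; rewrite mul0r.
  rewrite -big_filter; apply: perm_big; apply: uniq_perm.
  - by rewrite !filter_uniq// iota_uniq.
  - by rewrite map_inj_uniq ?enum_uniq.
  move=> d; rewrite mem_filter; apply/andP/mapP => [[mud hd]|[J]]; last first.
    by rewrite mem_enum powersetE => JV ->; rewrite ddin JV mudd signr_eq0.
  pose J : {set 'I_s} := [set i | (p i %| d)%N]%SET.
  have d0 : (0 < d)%N by move: hd; rewrite mem_filter mem_index_iota => /and3P[_ ? _].
  have sq : all (fun q => logn q d == 1%N) (primes d).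
    by move: mud; rewrite /mobius; case: ifP.
  have dm : (d %| m)%N.
    move: hd; rewrite mem_filter => /andP[h _]; apply: dvdn_trans h; exact: dvdn_exp.
  suff e : d = dd J by exists J => //; rewrite mem_enum powersetE -ddin -e.
  apply: eqn_from_log => // q.
  have [quo_gcd2|quo_gcd2] := boolP (q \in primes d).
    have /eqP -> := allP sq q quo_gcd2; move: quo_gcd2; rewrite mem_primes => /and3P[pq _ quo_gcd2].
    have [i ei] := pm q pq (dvdn_trans quo_gcd2 dm).
    by rewrite ei logd inE -ei quo_gcd2.
  have -> : logn q d = 0%N by apply/eqP; rewrite -leqn0 leqNgt logn_gt0.
  case: (boolP [exists i, q == p i]) => [/existsP[i /eqP ei]|/existsPn h]; last by rewrite logd0.
  rewrite ei logd inE; move: quo_gcd2; rewrite mem_primes ei pp d0 /=; by case: (_ %| _)%N.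
rewrite big_map big_enum /= .
transitivity (\sum_(J in powerset V) \prod_i (if i \in J then - b i else a i)).
  apply: eq_bigr => J _; rewrite mudd.
  transitivity ((-1) ^+ #|J| * \prod_i (if i \in J then b i else a i)).
    by rewrite rmorphXn /= mulrN1z; congr (_ * _); apply: eq_bigr => i _; rewrite gcdd; case: (i \in J).
  rewrite -prodr_const big_mkcond -big_split /=; apply: eq_bigr => i _.
  by case: (i \in J); rewrite ?mulN1r ?mul1r.
(* Subsets not contained in [V] receive the value 0, so that the sum runs over all subsets and is
   the expansion of a product. *)
transitivity (\sum_(J : {set 'I_s}) \prod_i (if i \in J then (if i \in V then - b i else 0) else a i)).
  rewrite big_mkcond; apply: eq_bigr => J _; rewrite powersetE; case: ifPn => [JV|].
    by apply: eq_bigr => i _; case: ifP => // iJ; rewrite (fintype.subsetP JV).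
  by move=> /fintype.subsetPn[i iJ iV]; rewrite (bigD1 i)//= iJ (negbTE iV) mul0r.
rewrite -bigA_distr; apply: eq_bigr => i _; rewrite inE.
by rewrite /=; case: eqP => _ /=; rewrite ?add0r// addrC.
Qed.

(** A nonzero mu(d) leaves only the valuations 0 and 1 of d at p. *)
Lemma gcd_squarefree p nu d : prime p -> (0 < d)%N -> mobius d != 0 ->
  gcdn (p ^ nu) d != 1%N -> gcdn (p ^ nu) d = p.
Proof.
move=> pp d0 mud; have /(dvdn_pfactor _ _ pp)[k _ e] := dvdn_gcdl (p ^ nu) d.
rewrite e; have kd : (p ^ k %| d)%N by rewrite -e dvdn_gcdr.
have : (k <= 1)%N.
  rewrite pfactor_dvdn// in kd; apply: leq_trans kd _.
  have [pd|pd] := boolP (p \in primes d); last by rewrite leqNgt -(logn_gt0 p d) in pd *; lia.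
  by move: mud; rewrite /mobius; case: ifP => // /allP/(_ p pd)/eqP ->.
by case: k {e kd} => [|[|k]] //.
Qed.

End Arithmetic.

(** * Constant terms of the class and of its image F *)

Section Assembly.
Variable R : realType.
Local Notation C := (cplx R).
Implicit Types (t z : C) (c : int * int -> C) (nr : int * int) (l : seq (nat * int)).

Definition coef_stand (k : nat) : int * int -> C := fourier_coef (@phi_stand R k).

Lemma coef_stand_props k : (0 < k)%N -> [/\ fseries (coef_stand k) (@phi_stand R k),
  forall n r : int, n < 0 -> coef_stand k (n, r) = 0, qperiodic k (coef_stand k),
  forall n r : int, coef_stand k (n, - r) = coef_stand k (n, r) &
  forall n m2, k = (n * m2)%N -> coprime n m2 -> a0 (coefW k n (coef_stand k)) = (n%:R + m2%:R) / 12].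
Proof.
move=> k0; have [c [h1 h2 h3 h4 h5]] := @phi_stand_expansion R k k0.
have -> : coef_stand k = c by apply: fourier_coefE h1; exists 0.
by split => // n m2 e cop; exact: a0_stand e cop k0 h1 h3 h5.
Qed.

(** The exact divisor that replaces n after the reduction to index m/d^2, written as a quotient in
    [C] so that it is multiplicative without divisibility conditions. *)
Definition quo_gcd2 (d n : nat) : C := n%:R / (gcdn n d)%:R ^+ 2.

Lemma qd_neq0 d n : (0 < n)%N -> quo_gcd2 d n != 0.
Proof. by move=> n0; rewrite mulf_neq0 ?invr_eq0 ?expf_neq0 ?pnatr_eq0 -?lt0n ?gcdn_gt0 ?n0. Qed.

Lemma qdM d a b : coprime a b -> quo_gcd2 d (a * b)%N = quo_gcd2 d a * quo_gcd2 d b.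
Proof. by move=> cop; rewrite /quo_gcd2 gcdn_coprimeM// !natrM exprMn invfM mulrACA. Qed.

Lemma qd1 d : quo_gcd2 d 1%N = 1. Proof. by rewrite /quo_gcd2 gcd1n expr1n divr1. Qed.

Lemma coprime_prod x (s : seq nat) : all (coprime x) s -> coprime x (\prod_(y <- s) y).
Proof.
elim: s => [|y s ih] /=; first by rewrite big_nil coprimen1.
by move=> /andP[cxy cl]; rewrite big_cons coprimeMr cxy ih.
Qed.

Lemma qd_prod d (s : seq nat) : pairwise coprime s -> quo_gcd2 d (\prod_(x <- s) x) = \prod_(x <- s) quo_gcd2 d x.
Proof.
elim: s => [|x s ih] /=; first by rewrite !big_nil qd1.
by move=> /andP[cx cs]; rewrite !big_cons qdM ?ih//; exact: coprime_prod.
Qed.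

(** The list [r] and the weights [wt] cover both classes of the theorem: all d with weight mu(d), or
    d = 1 alone with weight 1. *)
Definition coef_class (m : nat) (r : seq nat) (wt : nat -> C) (cpsi : int * int -> C) : int * int -> C :=
  fun nr => \sum_(d <- r | (d ^ 2 %| m)%N) wt d * coefU d (coef_stand (m %/ d ^ 2)) nr + cpsi nr.

Lemma sqr_dvd_gt0 m d : (0 < m)%N -> (d ^ 2 %| m)%N -> (0 < d)%N && (0 < m %/ d ^ 2)%N.
Proof.
move=> m0 h; have d0 : (0 < d)%N by case: d h => //; rewrite dvd0n => /eqP m00; rewrite m00 in m0.
by rewrite d0 divn_gt0 ?expn_gt0 ?d0// dvdn_leq.
Qed.

Lemma coef_class_props m r wt cpsi psi Phi : goodf m cpsi -> fseries cpsi psi ->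
  (forall n r : int, cpsi (n, - r) = cpsi (n, r)) ->
  (forall t z, 0 < im t -> Phi t z = \sum_(d <- r | (d ^ 2 %| m)%N) wt d * phi_stand (m %/ d ^ 2) t (d%:R * z) + psi t z) ->
  [/\ goodf m (coef_class m r wt cpsi), fseries (coef_class m r wt cpsi) Phi &
      forall n r' : int, coef_class m r wt cpsi (n, - r') = coef_class m r wt cpsi (n, r')].
Proof.
move=> [m0 [n0 hn] per _] hpsi ev hPhi.
have hF : fseries (coef_class m r wt cpsi) Phi.
  move=> t z t0; rewrite hPhi//; have hb := hasSum_big r (P := fun d => (d ^ 2 %| m)%N)
    (f := fun d nr => wt d * (coefU d (coef_stand (m %/ d ^ 2)) nr * mon t z nr))
    (l := fun d => wt d * phi_stand (m %/ d ^ 2) t (d%:R * z)) _.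
  apply: eq_hasSum (hasSumD (hb _) (hpsi t z t0)) => [nr|d hd].
    by rewrite /coef_class mulrDl mulr_suml; congr (_ + _); apply: eq_bigr => d _; rewrite mulrA.
  have /andP[d0 k0] := sqr_dvd_gt0 m0 hd; have [h1 _ _ _ _] := coef_stand_props k0.
  exact: hasSumZ (fseries_coefU d0 h1 z t0).
split => //; last first.
  move=> n r'; rewrite /coef_class ev; congr (_ + _); apply: eq_bigr => d hd.
  have /andP[d0 k0] := sqr_dvd_gt0 m0 hd; have [_ _ _ h4 _] := coef_stand_props k0.
  by rewrite (@coefU_even R d _ h4).
split => //; last by exists Phi.
- exists (Num.min 0 n0) => n r'; rewrite lt_min => /andP[lt0 ltn].
  rewrite /coef_class hn// addr0 big1// => d hd.
  have /andP[d0 k0] := sqr_dvd_gt0 m0 hd; have [_ h2 _ _ _] := coef_stand_props k0.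
  by rewrite /coefU /=; case: ifP; rewrite ?h2// mulr0.
move=> n r' k; rewrite /coef_class per; congr (_ + _); apply: eq_bigr => d hd.
have /andP[d0 k0] := sqr_dvd_gt0 m0 hd; have [_ _ h3 _ _] := coef_stand_props k0.
by rewrite (coefU_qperiodic d0 _ h3)// divnK.
Qed.

(** As d^2 divides n m2 with n and m2 coprime, d factors as (n, d)(m2, d), and [a0_coefU] reduces to
    index m/d^2. *)
Lemma a0_coefU_stand m n m2 d : (0 < m)%N -> m = (n * m2)%N -> coprime n m2 -> (d ^ 2 %| m)%N ->
  a0 (coefW m n (coefU d (coef_stand (m %/ d ^ 2)))) = (quo_gcd2 d n + (m %/ d ^ 2)%:R / quo_gcd2 d n) / 12.
Proof.
move=> m0 em cop hd; have /andP[d0 k0] := sqr_dvd_gt0 m0 hd.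
have hd' : (d ^ 2 %| m2 * n)%N by rewrite mulnC -em.
rewrite em in hd; have cop' : coprime m2 n by rewrite coprime_sym.
have /dvdnP[n1 e1] := gcd_sqr_dvd cop hd; have /dvdnP[n2 e2] := gcd_sqr_dvd cop' hd'.
have ed : d = (gcdn n d * gcdn m2 d)%N.
  rewrite -gcdn_coprimeM//; apply/esym/gcdn_idPr; apply: dvdn_trans hd; exact: dvdn_exp.
have d1p : (0 < gcdn n d)%N by rewrite gcdn_gt0 d0 orbT.
have d2p : (0 < gcdn m2 d)%N by rewrite gcdn_gt0 d0 orbT.
have ek : (m %/ d ^ 2)%N = (n1 * n2)%N.
  have -> : m = (n1 * n2 * d ^ 2)%N by rewrite em {1}e1 {1}e2 mulnACA -expnMn -ed.
  by rewrite mulnK// expn_gt0 d0.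
have q1 : quo_gcd2 d n = n1%:R.
  by rewrite /quo_gcd2 {1}e1 natrM natrX mulfK// expf_neq0// pnatr_eq0 -lt0n.
have [h1 _ h3 _ h5] := coef_stand_props k0; rewrite ek in h1 h3 h5 k0 *.
have /andP[n10 n20] : (0 < n1)%N && (0 < n2)%N by rewrite -muln_gt0.
have h0 := @a0_coefU R n1 n2 (gcdn n d) (gcdn m2 d) (coef_stand (n1 * n2)) (@phi_stand R (n1 * n2)).
move: h0; rewrite /= -e1 -e2 -em -ed => ->//.
have cop1 : coprime n1 n2.
  by apply: coprime_dvdl (coprime_dvdr _ cop); rewrite ?[in (_ %| n)%N]e1 ?[in (_ %| m2)%N]e2 dvdn_mulr.
rewrite (h5 n1 n2)// q1 natrM; congr (_ / _); congr (_ + _).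
by rewrite mulrAC mulfV ?mul1r// pnatr_eq0 -lt0n.
Qed.

Lemma a0_coef_class m n m2 r wt cpsi psi : (0 < m)%N -> m = (n * m2)%N -> coprime n m2 ->
  weak_jacobi_form 2 m psi -> fseries cpsi psi ->
  a0 (coefW m n (coef_class m r wt cpsi)) =
  \sum_(d <- r | (d ^ 2 %| m)%N) wt d * ((quo_gcd2 d n + (m %/ d ^ 2)%:R / quo_gcd2 d n) / 12).
Proof.
move=> m0 em cop hpsi h.
have [[[_ _ hel _] _] _] := hpsi.
have per := fseries_periodic hel h.
have hWpsi : fseries (coefW m n cpsi) (funW n m2 psi) by move=> t z t0; exact: coefW_hasSum.
have hz := a0_hasSum hWpsi; rewrite (a0_weak em cop hpsi h) in hz.
have hb := @hasSum_big R int nat r (fun d => (d ^ 2 %| m)%N) (fun d r0 => wt d * coefW m n (coefU d (coef_stand (m %/ d ^ 2))) (0, r0))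
  (fun d => wt d * ((quo_gcd2 d n + (m %/ d ^ 2)%:R / quo_gcd2 d n) / 12)) _.
apply: hasSum_tsum; rewrite -[X in hasSum _ X]addr0.
apply: (@eq_hasSum R int _ _ _ _ (hasSumD (hb _) hz)) => [r0|d hd]; first by rewrite /coefW.
have /andP[d0 k0] := sqr_dvd_gt0 m0 hd; have [h1 _ h3 _ _] := coef_stand_props k0.
rewrite -(a0_coefU_stand m0 em cop hd).
have perU : qperiodic m (coefU d (coef_stand (m %/ d ^ 2))) by apply: coefU_qperiodic d0 _ h3; rewrite divnK.
have hWU : fseries (coefW m n (coefU d (coef_stand (m %/ d ^ 2)))) (funW n m2 (fun t z => phi_stand (m %/ d ^ 2) t (d%:R * z))).
  by move=> t z t0; exact: (coefW_hasSum z em cop m0 perU (fseries_coefU d0 h1) t0).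
exact: (@hasSumZ R int _ _ (wt d) (a0_hasSum hWU)).
Qed.

(** The boolean separates the two multiplicative functions q and 1/q of n in [a0_coefU_stand], with
    q = [quo_gcd2]. Their Euler products agree: 1 + eps q = eps (eps + q) where the eps multiply to
    1, while m/d^2 is the product of the q and q (1 + eps/q) = eps + q. Hence 2/12 = 1/6. *)
Lemma a0_coef_opW_class m r wt cpsi psi l : weak_jacobi_form 2 m psi -> goodf m cpsi -> fseries cpsi psi ->
  goodf m (coef_class m r wt cpsi) -> 
  all (exact_div m) (map fst l) -> pairwise coprime (map fst l) ->
  m = (\prod_(x <- l) x.1)%N -> \prod_(x <- l) x.2 = 1 ->
  (forall x, x \in l -> x.2 = 1 \/ x.2 = -1) ->
  a0 (coef_opW m l (coef_class m r wt cpsi)) =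
  6^-1 * \sum_(d <- r | (d ^ 2 %| m)%N) wt d * \prod_(x <- l) (x.2%:~R + quo_gcd2 d x.1).
Proof.
move=> hpsi gpsi hF gc hx hcop em heps heps1; have m0 : (0 < m)%N by case: gpsi.
pose r' := [seq d <- r | (d ^ 2 %| m)%N].
pose f (j : nat * bool) n : C := if j.2 then quo_gcd2 j.1 n else (quo_gcd2 j.1 n)^-1.
pose k (j : nat * bool) : C := wt j.1 / 12 * (if j.2 then 1 else (m %/ j.1 ^ 2)%:R).
have sum_js (G : nat * bool -> C) : \sum_(j <- [seq (d, true) | d <- r'] ++ [seq (d, false) | d <- r']) G j =
    \sum_(d <- r | (d ^ 2 %| m)%N) (G (d, true) + G (d, false)).
  by rewrite [RHS]big_split big_cat !big_map !big_filter.
rewrite (@a0_coef_opW R _ ([seq (d, true) | d <- r'] ++ [seq (d, false) | d <- r']) k f)//; first last.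
- move=> n hn; have [/exact_divP[m2 e cop] _] := subprodsP m0 hx hcop hn.
  rewrite (a0_coef_class _ _ m0 e cop hpsi hF) sum_js.
  by apply: eq_bigr => d _; rewrite /k /f /=; field; rewrite qd_neq0//; move: m0; rewrite e muln_gt0 => /andP[].
- by move=> [d b] a a' cop; rewrite /f /=; case: b; rewrite qdM// invfM.
- by move=> [d b]; rewrite /f /=; case: b; rewrite qd1// invr1.
rewrite sum_js mulr_sumr; apply: eq_bigr => d hd.
have /andP[d0 k0] := sqr_dvd_gt0 m0 hd.
have x0 x : x \in l -> (0 < x.1)%N.
  move=> xl; have /andP[dx _] := allP hx x.1 (map_f fst xl).
  by apply: dvdn_gt0 dx.
have eps2 x : x \in l -> (x.2%:~R : C) * x.2%:~R = 1.
  by move=> /heps1 [->|->]; rewrite ?mulrN1z ?mulr1z ?mulrNN ?mulr1.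
have p1 : \prod_(x <- l) (1 + x.2%:~R * f (d, true) x.1) = \prod_(x <- l) (x.2%:~R + quo_gcd2 d x.1).
  transitivity ((\prod_(x <- l) x.2)%:~R * \prod_(x <- l) (x.2%:~R + quo_gcd2 d x.1) : C); last by rewrite heps mul1r.
  rewrite rmorph_prod -big_split /=.
  rewrite big_seq [RHS]big_seq; apply: eq_bigr => x xl; rewrite /f /= mulrDr eps2//.
have p2 : (m %/ d ^ 2)%:R * \prod_(x <- l) (1 + x.2%:~R * f (d, false) x.1) = \prod_(x <- l) (x.2%:~R + quo_gcd2 d x.1).
  have -> : (m %/ d ^ 2)%:R = \prod_(x <- l) quo_gcd2 d x.1.
    rewrite -(big_map fst predT (quo_gcd2 d)) -qd_prod// big_map -em /quo_gcd2.
    have -> : gcdn m d = d by apply/gcdn_idPr; apply: dvdn_trans hd; exact: dvdn_exp.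
    by rewrite -{2}(divnK hd) natrM natrX mulfK// expf_neq0// pnatr_eq0 -lt0n.
  rewrite -big_split /= big_seq [RHS]big_seq; apply: eq_bigr => x xl.
  by rewrite /f /=; field; exact: qd_neq0 (x0 x xl).
rewrite /k /= p1 mulr1 -[wt d / 12 * _ * _]mulrA p2; by field.
Qed.

(** At n = 0 the discriminant is -r^2, so only r = 0, 1, -1 survive. *)
Lemma a0_coef m (F : int * int -> C) phi : (0 < m)%N -> fseries F phi -> (forall N r : int, F (N, - r) = F (N, r)) ->
  (forall N r : int, (4 * m)%:Z * N - r ^+ 2 < -1 -> F (N, r) = 0) ->
  a0 F = F (0, 0) + 2 * F (0, 1).
Proof.
move=> m0 h ev og; apply: hasSum_tsum.
have := @hasSum_support R int (fun r => F (0, r)) [fset (0 : int); 1; -1]%fset.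
rewrite (perm_big [:: 0; 1; -1]) /=; last first.
  apply: uniq_perm => [||x]; rewrite ?fset_uniq// !inE; by rewrite orbA.
rewrite !big_cons big_nil addr0 ev mulr_natl mulr2n; apply => r.
rewrite !inE !negb_or => /andP[/andP[r0 r1] r2]; apply: og.
rewrite mulr0 sub0r; have : 4 <= r ^+ 2 by nia.
lia.
Qed.

End Assembly.

(** * Coefficients of discriminant -1 *)

Section Final.
Variable R : realType.
Local Notation C := (cplx R).
Implicit Types (t z : C) (c : int * int -> C) (l : seq (nat * int)).

(** After the flips of [coef_opW_sign] the residue is 1 modulo 2 P for every P in the list, hence
    modulo 2 m, and the index lies in the orbit of (0, 1). *)
Lemma eigen_coef_sign m l (F : int * int -> C) (r : int) : (0 < m)%N -> qperiodic m F ->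
  all (exact_div m) (map fst l) -> pairwise coprime (map fst l) -> m = (\prod_(x <- l) x.1)%N ->
  (forall x, x \in l -> exists p nu, prime p /\ x.1 = (p ^ nu)%N) ->
  (forall x, x \in l -> coefW m x.1 F = fun nr => x.2%:~R * F nr) ->
  (forall x, x \in l -> x.2 = 1 \/ x.2 = -1) ->
  (r ^+ 2 = 1 %[mod (4 * m)%:Z])%Z ->
  F (((-1 + r ^+ 2) %/ (4 * m)%:Z)%Z, r) =
  (\prod_(x <- l | (r == -1 %[mod (2 * x.1)%:Z])%Z) x.2)%:~R * F (0, 1).
Proof.
move=> m0 per hx hcop em hpp hW heps hr.
have m4 : ((4 * m)%:Z : int) != 0 by rewrite eqz_nat muln_eq0 -lt0n.
have mz : (m%:Z : int) != 0 by rewrite eqz_nat -lt0n.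
have [k hk] : exists k, r ^+ 2 = 1 + k * (4 * m)%:Z by apply/modz_eqP.
rewrite {1}hk addKr mulzK//.
have hx' : all (fun x => exact_div m x.1) l by rewrite -(all_map fst).
have [|N' [r' [h1 h2 h3 _]]] := coef_opW_sign m0 per hx' hcop hW heps k (r := r).
  move=> x xl; have [p [nu [pp e]]] := hpp x xl.
  apply: r2_pm1 pp e _ hr; by have /andP[] := allP hx' x xl.
rewrite h2; congr (_ * _).
have /dvdzP[v hv] : ((\prod_(x <- map fst l) x)%N%:Z %| (r' - 1) %/ 2)%Z.
  apply: pairwise_dvd => // y /mapP[x xl ->]; have /modz_eqP[q hq] := h3 x xl.
  by apply/dvdzP; exists q; rewrite hq PoszM (_ : _ - 1 = q * x.1%:Z * 2); [rewrite mulzK | ring].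
rewrite big_map -em in hv.
have hr' : r' = 1 + 2 * m%:Z * v.
  have [e he] : exists e, r' = 1 + 2 * e.
    have /orP[/eqP e0|/eqP e1] : (r' %% 2 == 0)%Z || (r' %% 2 == 1)%Z by lia.
      exfalso; have er : r' = 2 * (r' %/ 2)%Z by lia.
      by move: h1; rewrite er hk !PoszM; lia.
    by exists (r' %/ 2)%Z; lia.
  move: hv; rewrite he addrC addKr mulrC mulzK// => ->; ring.
have eN : N' = v + m%:Z * v ^+ 2.
  have : (4 * m)%:Z * N' = (4 * m)%:Z * (v + m%:Z * v ^+ 2) by move: h1; rewrite hr' hk PoszM; lia.
  exact: mulfI.
have := per 0 1 v; rewrite add0r mul1r -eN -hr' => <-; congr F; congr pair; lia.
Qed.

End Final.

(** * The coefficient formula *)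

Section MainProof.
Variable R : realType.
Local Notation C := (cplx R).

Lemma foldl_map (T U V : Type) (f : V -> U -> V) (g : T -> U) v (s : seq T) :
  foldl f v (map g s) = foldl (fun a x => f a (g x)) v s.
Proof. by elim: s v => //=. Qed.

(** Everything that the two halves of the theorem share, before any growth condition is imposed. *)
Lemma prod_one_plus_W_coef m r (wt : nat -> C) psi l (Phi : C -> C -> C) : weak_jacobi_form 2 m psi ->
  (forall t z, 0 < im t -> Phi t z = \sum_(d <- r | (d ^ 2 %| m)%N) wt d * phi_stand (m %/ d ^ 2) t (d%:R * z) + psi t z) ->
  all (exact_div m) (map fst l) -> pairwise coprime (map fst l) ->
  m = (\prod_(x <- l) x.1)%N -> \prod_(x <- l) x.2 = 1 ->
  (forall x, x \in l -> exists p nu, prime p /\ x.1 = (p ^ nu)%N) ->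
  (forall x, x \in l -> x.2 = 1 \/ x.2 = -1) ->
  exists c F : int * int -> C, [/\ bounded_below c /\ fseries c Phi, F = coef_opW m l c,
    [/\ goodf m c, goodf m F & fseries F (foldl (fun f x => one_plus_W m x.1 x.2 f) Phi l)],
    forall x, x \in l -> coefW m x.1 F = (fun nr => x.2%:~R * F nr) &
    [/\ (forall N r : int, F (N, - r) = F (N, r)),
        a0 F = 6^-1 * \sum_(d <- r | (d ^ 2 %| m)%N) wt d * \prod_(x <- l) (x.2%:~R + quo_gcd2 R d x.1) &
        (forall r0 : int, (r0 ^+ 2 = 1 %[mod (4 * m)%:Z])%Z ->
           F (((-1 + r0 ^+ 2) %/ (4 * m)%:Z)%Z, r0) =
           (\prod_(x <- l | (r0 == -1 %[mod (2 * x.1)%:Z])%Z) x.2)%:~R * F (0, 1))]].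
Proof.
move=> hpsi hPhi hx hcop em heps hpp heps1.
have [cpsi [gpsi hF ev]] := weak_fseries hpsi; have m0 : (0 < m)%N by case: gpsi.
have [gc hc evc] := @coef_class_props R m r wt cpsi psi Phi gpsi hF ev hPhi.
have hx' : all (fun x => exact_div m x.1) l by rewrite -(all_map fst).
have [gF hFS] := coef_opW_fseries hx' gc hc.
have hW x : x \in l -> coefW m x.1 (coef_opW m l (coef_class m r wt cpsi)) = (fun nr => x.2%:~R * coef_opW m l (coef_class m r wt cpsi) nr).
  by move=> xl; apply: coefW_coef_opW => //; exact: heps1.
exists (coef_class m r wt cpsi), (coef_opW m l (coef_class m r wt cpsi)); split => //.
  by split => //; case: gc.
split.
- exact: coef_opW_even.
- exact: a0_coef_opW_class hpsi gpsi hF gc hx hcop em heps heps1.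
by move=> r0 hr; apply: eigen_coef_sign => //; case: gF.
Qed.

Lemma pairwise_coprime_primes (s : seq nat) : uniq s -> all prime s -> pairwise coprime s.
Proof.
rewrite uniq_pairwise => hu ha; apply: (sub_in_pairwise (P := prime)) hu => // p q pp pq /=.
by rewrite prime_coprime// dvdn_prime2.
Qed.

Lemma disc_coefE m (Phi : C -> C -> C) c (D r N : int) : (0 < m)%N -> bounded_below c -> fseries c Phi ->
  (4 * m)%:Z * N = D + r ^+ 2 -> disc_coef m Phi D r = c (N, r).
Proof.
move=> m0 b h e; rewrite /disc_coef (fourier_coefE b h) -e mulrC mulzK//.
by rewrite eqz_nat muln_eq0 -lt0n.
Qed.

Lemma admissibleE m (N r : int) : admissible m ((4 * m)%:Z * N - r ^+ 2) r.
Proof. by apply/modz_eqP; exists N; rewrite addrC mulrC. Qed.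

Lemma disc_coef_prod_one_plus_W (s : nat) (p nu : 'I_s -> nat) (m : nat) (Phi : C -> C -> C) (eps : 'I_s -> int) (r : int) :
  (forall i, prime (p i)) -> injective p -> (forall i, (1 <= nu i)%N) ->
  m = (\prod_(i < s) p i ^ nu i)%N -> classC m Phi -> optimal_growth m Phi ->
  (forall r0 : int, admissible m 0 r0 -> disc_coef m Phi 0 r0 = 0) ->
  (forall i, eps i = 1 \/ eps i = -1) -> \prod_(i < s) eps i = 1 ->
  (r ^+ 2 = 1 %[mod (4 * m)%:Z])%Z ->
  disc_coef m (prod_one_plus_W m (fun i => (p i ^ nu i)%N) eps Phi) (-1) r =
  (\prod_(i < s | (r == -1 %[mod (2 * p i ^ nu i)%:Z])%Z) eps i)%:~R / 12 *
  \prod_(i < s) (if nu i == 1%N then (p i)%:R + (eps i)%:~R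
        else (p i)%:R ^+ nu i - (p i)%:R ^+ (nu i - 2)).
Proof.
move=> pp inj nu1 em [psi [hpsi hPhi]] og h0 heps epsprod hr.
have m0 : (0 < m)%N by case: hpsi => [[[]]].
pose l := [seq ((p i ^ nu i)%N, eps i) | i <- enum 'I_s].
have bigl (T : Type) (idx : T) (op : Monoid.com_law idx) (G : nat * int -> T) (P : pred (nat * int)) :
    \big[op/idx]_(x <- l | P x) G x = \big[op/idx]_(i < s | P ((p i ^ nu i)%N, eps i)) G ((p i ^ nu i)%N, eps i).
  by rewrite big_map big_enum_cond.
have P0 i : (0 < p i ^ nu i)%N by rewrite expn_gt0 prime_gt0.
have cop i j : i != j -> coprime (p i ^ nu i) (p j ^ nu j).
  by move=> ij; rewrite coprimeXl// coprimeXr// prime_coprime// dvdn_prime2// (inj_eq inj).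
have hcop : pairwise coprime (map fst l).
  rewrite -map_comp pairwise_map; have := enum_uniq 'I_s; rewrite uniq_pairwise.
  by apply: sub_pairwise => i j /=; exact: cop.
have hx : all (exact_div m) (map fst l).
  apply/allP => _ /mapP[_ /mapP[i _ ->] ->] /=.
  apply: (@exact_divI m _ (\prod_(j < s | j != i) p j ^ nu j)) => //.
    by rewrite em (bigD1 i).
  by apply: (big_ind (fun y => coprime (p i ^ nu i) y)); [exact: coprimen1 | move=> a b ha hb; rewrite coprimeMr ha | move=> j ji; apply: cop; rewrite eq_sym].
have hl1 : m = (\prod_(x <- l) x.1)%N by rewrite bigl.
have hl2 : \prod_(x <- l) x.2 = 1 by rewrite bigl.
have hpp x : x \in l -> exists p nu, prime p /\ x.1 = (p ^ nu)%N.
  by move=> /mapP[i _ ->]; exists (p i), (nu i).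
have hl3 x : x \in l -> x.2 = 1 \/ x.2 = -1 by move=> /mapP[i _ ->]; exact: heps.
have hPhi' t z : 0 < im t -> Phi t z = \sum_(d <- index_iota 1 m.+1 | (d ^ 2 %| m)%N)
    (mobius d)%:~R * phi_stand (m %/ d ^ 2) t (d%:R * z) + psi t z by move=> /upperP/hPhi.
have [c [F [[bc hc] eF [gc [_ bF perF _] hF] hW [ev ha hsgn]]]] :=
  prod_one_plus_W_coef hpsi hPhi' hx hcop hl1 hl2 hpp hl3.
have hx' : all (fun x => exact_div m x.1) l by rewrite -(all_map fst).
have vanc (N r' : int) : (4 * m)%:Z * N - r' ^+ 2 < -1 -> c (N, r') = 0.
  move=> lt; rewrite -(og _ r' (admissibleE m N r') lt).
  by rewrite (disc_coefE (N := N) m0 bc hc)// subrK.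
have vanF := coef_opW_vanish (P := fun D => D < -1) hx' gc vanc; rewrite -eF in vanF.
have van0c (N r' : int) : (4 * m)%:Z * N - r' ^+ 2 = 0 -> c (N, r') = 0.
  move=> e0; have := admissibleE m N r'; rewrite e0 => /h0 <-.
  rewrite (disc_coefE (N := N) m0 bc hc)//; move/eqP: e0; rewrite subr_eq0 => /eqP ->.
  by rewrite add0r.
have van0F := coef_opW_vanish (P := fun D => D = 0) hx' gc van0c; rewrite -eF in van0F.
(* F(0, 0) has discriminant 0 and vanishes, so a0(F) is 2 F(0, 1). *)
have a0F := a0_coef m0 hF ev vanF.
rewrite van0F ?mulr0 ?expr0n ?subrr// add0r ha in a0F.
have eprod : prod_one_plus_W m (fun i => (p i ^ nu i)%N) eps Phi =
    foldl (fun f x => one_plus_W m x.1 x.2 f) Phi l by rewrite foldl_map.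
rewrite /disc_coef eprod (fourier_coefE bF hF) hsgn// bigl -mulrA; congr (_ * _).
have -> : F (0, 1) = 12^-1 * (\sum_(d <- index_iota 1 m.+1 | (d ^ 2 %| m)%N)
     (mobius d)%:~R * \prod_(x <- l) (x.2%:~R + quo_gcd2 R d x.1)).
  apply: (mulfI (_ : (2 : C) != 0)); first by rewrite pnatr_eq0.
  by rewrite -a0F; field.
congr (_ * _); rewrite -big_filter.
(* Only squarefree d count, and for these gcd(P, d) is 1 or p; this gives the two possible values of
   each factor. *)
have := @mobius_sum C s p nu m (fun i => (eps i)%:~R + (p i)%:R ^+ nu i)
  (fun i => (eps i)%:~R + (p i)%:R ^+ nu i / (p i)%:R ^+ 2) pp inj nu1 em.
have -> : \prod_i (if nu i == 1%N then (eps i)%:~R + (p i)%:R ^+ nu i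
     else (eps i)%:~R + (p i)%:R ^+ nu i - ((eps i)%:~R + (p i)%:R ^+ nu i / (p i)%:R ^+ 2)) =
   \prod_(i < s) (if nu i == 1%N then (p i)%:R + (eps i)%:~R
        else (p i)%:R ^+ nu i - (p i)%:R ^+ (nu i - 2)) :> C.
  apply: eq_bigr => i _; have [->|n1] := eqVneq (nu i) 1%N; first by rewrite expr1 addrC.
  have p0 : ((p i)%:R : C) != 0 by rewrite pnatr_eq0 -lt0n prime_gt0.
  have n2 : (2 <= nu i)%N by have := nu1 i; move: (nu i) n1 => [|[|n]].
  rewrite opprD addrACA subrr add0r; congr (_ - _).
  by rewrite -{1}(subnK n2) exprD mulfK// expf_neq0.
move=> <-; rewrite big_seq [RHS]big_seq; apply: eq_bigr => d; rewrite mem_filter mem_index_iota.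
move=> /and3P[_ d0 _]; have [->|mud] := eqVneq (mobius d) 0; first by rewrite !mul0r.
congr (_ * _); rewrite bigl; apply: eq_bigr => i _; rewrite /quo_gcd2 /=.
case: eqP => [->|/eqP g1]; first by rewrite expr1n divr1 natrX.
by rewrite (gcd_squarefree (pp i) d0 mud g1) natrX.
Qed.

End MainProof.

(** A prime p of M divides (r + 1)/2 exactly when r = -1 modulo 2 p, so the primes counted on the
    left are those of the squarefree gcd. *)
Lemma mobius_gcd_sign M (r : int) : (0 < M)%N -> (forall p, p \in primes M -> logn p M = 1%N) ->
  (r ^+ 2 = 1 %[mod (4 * M)%:Z])%Z ->
  \prod_(p <- primes M | (r == -1 %[mod (2 * p)%:Z])%Z) (-1) = mobius (gcdn `|((r + 1) %/ 2)%Z| M).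
Proof.
move=> M0 hM /modz_eqP[k hk].
have [e he] : exists e, r = 2 * e - 1.
  exists ((r + 1) %/ 2)%Z; have /orP[/eqP e0|/eqP e1] : (r %% 2 == 0)%Z || (r %% 2 == 1)%Z by lia.
    exfalso; have er : r = 2 * (r %/ 2)%Z by lia.
    by move: hk; rewrite er !PoszM; lia.
  lia.
have -> : ((r + 1) %/ 2)%Z = e by lia.
set g := gcdn `|e| M; have g0 : (0 < g)%N by rewrite gcdn_gt0 M0 orbT.
have gM : (g %| M)%N by exact: dvdn_gcdr.
have hdiv p : (r == -1 %[mod (2 * p)%:Z])%Z = (p %| `|e|)%N.
  apply/idP/idP => [/eqP/modz_eqP[q hq]|h].
    have -> : e = q * p%:Z by move: hq; rewrite he PoszM; lia.
    by rewrite abszM /= dvdn_mull.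
  apply/eqP/modz_eqP; have /dvdzP[q eq] : (p%:Z %| e)%Z by rewrite dvdzE.
  by exists q; rewrite he eq PoszM; ring.
have pg : perm_eq (primes g) [seq p <- primes M | (p %| `|e|)%N].
  apply: uniq_perm; rewrite ?filter_uniq ?primes_uniq// => p.
  rewrite mem_filter !mem_primes g0 M0 /= dvdn_gcd andbCA; by case: prime.
rewrite big_const_seq /mobius.
have -> : all (fun p => logn p g == 1%N) (primes g).
  apply/allP => p pg'; rewrite eqn_leq.
  have pM : p \in primes M by move: pg'; rewrite (perm_mem pg) mem_filter => /andP[].
  by rewrite -{1}(hM p pM) dvdn_leq_log //= logn_gt0.
rewrite (perm_size pg) size_filter -(eq_count hdiv).
by elim: (count _ _) => [|n ih] //=; rewrite exprS ih.
Qed.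

(** * The forms Q_M *)

Section QProof.
Variable R : realType.
Local Notation C := (cplx R).

(** Here r = 2 e with M dividing e^2, hence every prime of M divides e. *)
Lemma sqr_dvd_squarefree M (r k : int) : (0 < M)%N -> M = (\prod_(p <- primes M) p)%N ->
  r ^+ 2 = (4 * M)%:Z * k -> exists v, r = 2 * M%:Z * v.
Proof.
move=> M0 eM hk.
have [e he] : exists e, r = 2 * e.
  exists (r %/ 2)%Z; have /orP[/eqP e0|/eqP e1] : (r %% 2 == 0)%Z || (r %% 2 == 1)%Z by lia.
    lia.
  exfalso; have er : r = 2 * (r %/ 2)%Z + 1 by lia.
  by move: hk; rewrite er !PoszM; lia.
have he2 : e ^+ 2 = M%:Z * k by move: hk; rewrite he PoszM; lia.
have /dvdzP[v hv] : ((\prod_(p <- primes M) p)%N%:Z %| e)%Z.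
  apply: pairwise_dvd; first by apply: pairwise_coprime_primes; [exact: primes_uniq | apply/allP => p; rewrite mem_primes => /andP[]].
  move=> p; rewrite mem_primes => /and3P[pp _ pM].
  have : (p%:Z %| e ^+ 2)%Z by rewrite he2 dvdz_mulr.
  by rewrite !dvdzE /= abszX Euclid_dvdX// => /andP[].
by exists v; rewrite he hv -eM; ring.
Qed.

(** mu(M) = 1 means that M is squarefree with an even number of primes, so the signs -1 multiply to
    1 as the constant term formula requires. Growth is imposed on Q itself and is carried over to F
    = 2 Q. *)
Lemma disc_coef_formQ (M : nat) (Phi : C -> C -> C) : (1 < M)%N -> mobius M = 1 -> class_stand M Phi ->
  optimal_growth M (formQ M Phi) ->
  (forall r : int, admissible M 0 r -> disc_coef M (formQ M Phi) 0 r = 0) /\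
  (forall r : int, (r ^+ 2 = 1 %[mod (4 * M)%:Z])%Z ->
     disc_coef M (formQ M Phi) (-1) r =
     (mobius (gcdn `|((r + 1) %/ 2)%Z| M))%:~R * ((totient M)%:R / 24)).
Proof.
move=> M1 muM [psi [hpsi hPhi]] og; have M0 : (0 < M)%N by exact: ltnW.
have [hlog hsize] : (forall p, p \in primes M -> logn p M = 1%N) /\ (-1) ^+ size (primes M) = 1 :> int.
  by move: muM; rewrite /mobius; case: allP => // h e; split => // p /h/eqP.
have eM : M = (\prod_(p <- primes M) p)%N.
  rewrite {1}(prod_prime_decomp M0) prime_decompE big_map big_seq [RHS]big_seq.
  by apply: eq_bigr => p pM; rewrite hlog// expn1.
have prM p : p \in primes M -> prime p by rewrite mem_primes => /andP[].
pose l := [seq (p, -1 : int) | p <- primes M].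
have el : map fst l = primes M by rewrite -map_comp map_id.
have hx : all (exact_div M) (map fst l).
  rewrite el; apply/allP => p pM; apply/andP; have pd : (p %| M)%N by move: pM; rewrite mem_primes => /and3P[].
  split => //; rewrite prime_coprime ?prM//; apply/negP => h.
  have : (p ^ 2 %| M)%N by rewrite -(divnK pd) expnS expn1 dvdn_mul.
  by rewrite pfactor_dvdn ?prM// hlog.
have hcop : pairwise coprime (map fst l).
  by rewrite el; apply: pairwise_coprime_primes; [exact: primes_uniq | apply/allP].
have hl1 : M = (\prod_(x <- l) x.1)%N by rewrite big_map.
have hl2 : \prod_(x <- l) x.2 = 1 :> int.
  by rewrite big_map big_const_seq count_predT -hsize; elim: (size _) => //= n ->; rewrite exprS.
have hpp x : x \in l -> exists p nu, prime p /\ x.1 = (p ^ nu)%N.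
  by move=> /mapP[p pM ->]; exists p, 1%N; rewrite expn1; split => //; exact: prM.
have hl3 x : x \in l -> x.2 = 1 \/ x.2 = -1 by move=> /mapP[p _ ->]; right.
have hPhi' t z : 0 < im t -> Phi t z = \sum_(d <- [:: 1%N] | (d ^ 2 %| M)%N)
    (fun=> 1) d * phi_stand (M %/ d ^ 2) t (d%:R * z) + psi t z.
  by move=> /upperP/hPhi ->; rewrite big_cons big_nil exp1n dvd1n divn1 addr0 !mul1r.
have [c [F [_ _ [_ [_ bF perF _] hF] hW [ev ha hsgn]]]] :=
  prod_one_plus_W_coef hpsi hPhi' hx hcop hl1 hl2 hpp hl3.
have bQ : bounded_below (fun nr => 2^-1 * F nr).
  by have [n0 h] := bF; exists n0 => n r lt; rewrite h// mulr0.
have hQ : fseries (fun nr => 2^-1 * F nr) (formQ M Phi).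
  move=> t z t0; rewrite /formQ.
  have := hF t z t0; rewrite foldl_map => h.
  by apply: eq_hasSum (hasSumZ 2^-1 h) => // nr; rewrite mulrA.
have half0 (x : C) : 2^-1 * x = 0 -> x = 0.
  by move=> /eqP; rewrite mulf_eq0 invr_eq0 pnatr_eq0 => /eqP.
have vanF (N r : int) : (4 * M)%:Z * N - r ^+ 2 < -1 -> F (N, r) = 0.
  move=> lt; apply: half0; rewrite -(og _ r (admissibleE M N r) lt).
  by rewrite (disc_coefE (N := N) M0 bQ hQ)// subrK.
(* The index (0, 0) is fixed by W_p, whose eigenvalue is -1, hence F(0, 0) = -F(0, 0); M > 1
   provides such a prime. *)
have F00 : F (0, 0) = 0.
  have [p pM] : exists p, p \in primes M.
    by exists (pdiv M); rewrite mem_primes pdiv_prime// M0 pdiv_dvd.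
  have /exact_divP[m2 e cop] : exact_div M p by apply: (allP hx); rewrite el.
  have := hW (p, -1) (map_f _ pM); move/(congr1 (fun f => f (0, 0))) => /=.
  rewrite (coefW_char (N' := 0) (s := 0) e cop M0 perF)//; first last.
  - by exists 0; rewrite mul0r addr0.
  - by exists 0; rewrite mul0r addr0 oppr0.
  by rewrite mulN1r => /eqP; rewrite -addr_eq0 -mulr2n mulrn_eq0 => /eqP.
have a0F := a0_coef M0 hF ev vanF; rewrite F00 add0r ha big_cons big_nil exp1n dvd1n addr0 mul1r in a0F.
(* The product of the -1 + p is phi(M), so 2 F(0, 1) = phi(M)/6; the factor 1/2 of Q then gives
   24. *)
have eF1 : 2^-1 * F (0, 1) = (totient M)%:R / 24.
  have -> : (totient M)%:R = \prod_(x <- l) (x.2%:~R + quo_gcd2 R 1 x.1) :> C.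
    rewrite big_map totientE// natr_prod big_seq [RHS]big_seq; apply: eq_bigr => p pM.
    rewrite hlog// muln1 /quo_gcd2 gcdn1 expr1n divr1 /= addrC.
    by rewrite -{2}(prednK (prime_gt0 (prM p pM))) -natr1 addrK.
  have -> : F (0, 1) = 2^-1 * (2 * F (0, 1)) by field.
  by rewrite -a0F; field.
split => r.
  (* For M squarefree, 4 M dividing r^2 puts (k, r) into the orbit of (0, 0). *)
  move=> /modz_eqP[k hk]; have hk' : r ^+ 2 = (4 * M)%:Z * k by lia.
  have [v hv] := sqr_dvd_squarefree M0 eM hk'.
  rewrite (disc_coefE (N := k) M0 bQ hQ) ?add0r//.
  have := perF 0 0 v; rewrite mul0r !add0r F00.
  have -> : M%:Z * v ^+ 2 = k.
    have M4 : ((4 * M)%:Z : int) != 0 by rewrite eqz_nat muln_eq0 -lt0n.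
    by apply: (mulfI M4); rewrite -hk' hv PoszM; ring.
  have -> : (2 * M)%:Z * v = r by rewrite hv PoszM.
  by move=> ->; rewrite mulr0.
move=> hr; rewrite -(mobius_gcd_sign M0 hlog hr).
by rewrite /disc_coef (fourier_coefE bQ hQ) hsgn// big_map mulrCA eF1.
Qed.

End QProof.

Local Close Scope classical_set_scope.

Theorem mainTheorem10 (R : realType) :
  (forall (s : nat) (p nu : 'I_s -> nat) (m : nat)
      (Phi : cplx R -> cplx R -> cplx R) (eps : 'I_s -> int) (r : int),
    (forall i, prime (p i)) ->
    injective p ->
    (forall i, (1 <= nu i)%N) ->
    m = (\prod_(i < s) p i ^ nu i)%N ->
    classC m Phi ->
    optimal_growth m Phi ->
    (forall r0 : int, admissible m 0 r0 -> disc_coef m Phi 0 r0 = 0) ->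
    (forall i, eps i = 1 \/ eps i = -1) ->
    \prod_(i < s) eps i = 1 ->
    (r ^+ 2 = 1 %[mod (4 * m)%:Z])%Z ->
    disc_coef m (prod_one_plus_W m (fun i => (p i ^ nu i)%N) eps Phi) (-1) r =
    (\prod_(i < s | (r == -1 %[mod (2 * p i ^ nu i)%:Z])%Z) eps i)%:~R / 12 *
    \prod_(i < s)
       (if nu i == 1%N then (p i)%:R + (eps i)%:~R
        else (p i)%:R ^+ nu i - (p i)%:R ^+ (nu i - 2)))
  /\
  (forall (M : nat) (Phi : cplx R -> cplx R -> cplx R),
    (1 < M)%N ->
    mobius M = 1 ->
    class_stand M Phi ->
    optimal_growth M (formQ M Phi) ->
    (forall r : int, admissible M 0 r -> disc_coef M (formQ M Phi) 0 r = 0) /\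
    (forall r : int, (r ^+ 2 = 1 %[mod (4 * M)%:Z])%Z ->
       disc_coef M (formQ M Phi) (-1) r =
       (mobius (gcdn `|((r + 1) %/ 2)%Z| M))%:~R * ((totient M)%:R / 24))).
Proof. by split; [exact: disc_coef_prod_one_plus_W | exact: disc_coef_formQ]. Qed.
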